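(* Let $\Omega\subset\mathbb{R}^N$, $N\ge 2$, be a bounded domain with $\partial\Omega$ of class $\mathcal{C}^{0,1}$, let $c_+,c_-,h\in L^q(\Omega)$ for some $q>N/2$, let $\mu>0$ be a constant, and assume $c_+\gneqq 0$, $c_-\ge 0$ and $c_+(x)c_-(x)=0$ for a.e. $x\in\Omega$. For $\lambda\in\mathbb{R}$ put $c_\lambda:=\lambda c_+-c_-$ and consider $$(P_\lambda)\qquad -\Delta u=c_\lambda(x)u+\mu|\nabla u|^2+h(x),\qquad u\in H_0^1(\Omega)\cap L^\infty(\Omega).$$ Suppose that $(P_0)$ has a solution. Then there exists $\Lambda>0$ such that, for all $0<\lambda<\Lambda$, $(P_\lambda)$ has at least two solutions.
   Context: $c_+\gneqq 0$ means $c_+\ge0$ a.e. in $\Omega$ and $c_+>0$ on a set of positive measure. $(P_0)$ is $(P_\lambda)$ with $\lambda=0$, i.e. with $c_0=-c_-$. A solution is a function $u\in H_0^1(\Omega)\cap L^\infty(\Omega)$ satisfying the equation in the weak sense, tested against all $\varphi\in H_0^1(\Omega)\cap L^\infty(\Omega)$. *)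

(* Defs.v *)
From HB Require Import structures.
From mathcomp Require Import all_boot all_order all_algebra.
From mathcomp Require Import all_classical all_reals all_analysis.
From mathcomp Require Import measurable_realfun.

Set Implicit Arguments.
Unset Strict Implicit.
Unset Printing Implicit Defensive.

Import Order.TTheory GRing.Theory Num.Theory.
Import numFieldNormedType.Exports.

Local Open Scope classical_set_scope.
Local Open Scope ring_scope.

(* MathComp-Analysis has no Lebesgue measure on R^n.  The space R^n is 'rV[R]_n,
   with the sigma-algebra generated by the coordinates (the Borel sets, see
   open_measurable_rV), and the measure is the n-fold product of
   lebesgue_measure, built by recursion along R^(n+1) = R x R^n. *)

Definition rV_display : measure_display.
Proof. exact: default_measure_display. Qed.

Section measurable_rV.
Context {R : realType} (n : nat).

Let coor : 'I_n -> 'rV[R]_n -> R := fun i x => x 0 i.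

Let rV_set0 : g_sigma_preimage coor set0.
Proof. exact: sigma_algebra0. Qed.

Let rV_setC A : g_sigma_preimage coor A -> g_sigma_preimage coor (~` A).
Proof. exact: sigma_algebraC. Qed.

Let rV_bigcup (F : _^nat) : (forall i, g_sigma_preimage coor (F i)) ->
  g_sigma_preimage coor (\bigcup_i (F i)).
Proof. exact: sigma_algebra_bigcup. Qed.

HB.instance Definition _ := @isMeasurable.Build rV_display
  'rV[R]_n (g_sigma_preimage coor) rV_set0 rV_setC rV_bigcup.

Lemma measurable_coord (i : 'I_n) :
  measurable_fun [set: 'rV[R]_n] (fun x : 'rV[R]_n => x 0 i).
Proof.
move=> _ Y mY; rewrite setTI; apply: sub_sigma_algebra => /=.
rewrite -bigcup_seq/=; exists i => /=; first by rewrite mem_index_enum.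
by exists Y => //; rewrite setTI.
Qed.

Lemma measurable_fun_rVP d (T : measurableType d) (f : T -> 'rV[R]_n) :
  (forall i, measurable_fun [set: T] (fun t => f t 0 i)) ->
  measurable_fun [set: T] f.
Proof.
move=> mf.
suff : g_sigma_preimage (fun i => coor i \o f) `<=` measurable.
  by rewrite g_sigma_preimage_comp => pre _ A mA; apply: pre; exists A.
apply: smallest_sub; first exact: sigma_algebra_measurable.
rewrite -bigcup_seq/=; apply: bigcup_sub => i _ A [B mB <-].
exact: mf.
Qed.

End measurable_rV.

Lemma open_measurable_rV (R : realType) (n : nat) (A : set 'rV[R]_n) :
  open A -> measurable A.
Proof.
move=> oA.
pose box (c : 'rV[rat]_n * rat) : set 'rV[R]_n :=
  \bigcap_(i in [set: 'I_n])
    [set x | `|x 0 i - ratr (c.1 0 i)| < ratr c.2].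
have mbox c : measurable (box c).
  apply: fin_bigcap_measurable => // i _.
  rewrite -[X in measurable X]setTI.
  have mf : measurable_fun [set: 'rV[R]_n]
      (fun x : 'rV[R]_n => `|x 0 i - ratr (c.1 0 i)|).
    apply: measurableT_comp => //; apply: measurable_funB => //.
    exact: measurable_coord.
  have := mf measurableT `]-oo, (ratr c.2 : R)[%classic (measurable_itv _).
  by congr (measurable _); apply/seteqP; split => x /=; rewrite in_itv.
have -> : A = \bigcup_c [set x | box c x /\ box c `<=` A].
  apply/seteqP; split => [x Ax|x [c _ /= [cx cA]]]; last exact: cA.
  have /nbhs_ballP[e /= e0 xeA] : nbhs x A by exact: open_nbhs_nbhs.
  have [r0] := @rat_in_itvoo R 0 (e / 2) (divr_gt0 e0 (ltr0Sn _ 1)).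
  rewrite in_itv => /andP[r0_gt0 r0e].
  have /choice[q qP] : forall i, exists q : rat, `|x 0 i - ratr q| < ratr r0.
    move=> i; have [|q] := @rat_in_itvoo R (x 0 i - ratr r0) (x 0 i + ratr r0).
      by rewrite ltrBlDr -addrA ltrDl addr_gt0.
    by rewrite in_itv/= => qx; exists q; rewrite distrC ltr_distl.
  exists (\row_i q i, r0) => //=; split; first by move=> i _ /=; rewrite mxE.
  move=> y /= yb; apply: xeA; split=> // i j; rewrite ord1 /ball /= [e]splitr.
  apply: le_lt_trans (ler_distD (ratr (q j)) _ _) _; apply: ltrD.
    exact: lt_trans r0e.
  by have := yb j I; rewrite /= mxE distrC => /lt_trans; exact.
apply: countable_bigcupT_measurable => // c.
have [cA|cA] := pselect (box c `<=` A).
  rewrite (_ : mkset _ = box c)//.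
  by apply/seteqP; split => [x []//|x].
rewrite (_ : mkset _ = set0)//.
by apply/seteqP; split => [x []//|x].
Qed.

Lemma sigma_finite_product d1 d2 (T1 : measurableType d1)
    (T2 : measurableType d2) (R : realType)
    (m1 : {sigma_finite_measure set T1 -> \bar R})
    (m2 : {sigma_finite_measure set T2 -> \bar R}) :
  sigma_finite setT (m1 \x m2)%E.
Proof.
have /sigma_finiteP[F [TF ndF Foo]] := sigma_finiteT m1.
have /sigma_finiteP[G [TG ndG Goo]] := sigma_finiteT m2.
exists (fun k => F k `*` G k).
  rewrite -setXTT TF TG predeqE => -[x y]; split.
    move=> [/= [k _ Fkx] [l _ Gly]]; exists (maxn k l) => //; split.
    - by move: x Fkx; exact/subsetPset/ndF/leq_maxl.
    - by move: y Gly; exact/subsetPset/ndG/leq_maxr.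
  by move=> [k _ []/= ? ?]; split; exists k.
move=> k; have [? ?] := Foo k; have [? ?] := Goo k.
split; first exact: measurableX.
by rewrite product_measure1E// lte_mul_pinfty// ge0_fin_numE.
Qed.

Section lebesgue_rV.
Context {R : realType}.

Definition cons_rV (n : nat) (p : R * 'rV[R]_n) : 'rV[R]_n.+1 :=
  \row_i if unlift ord0 i is Some j then p.2 0 j else p.1.

Definition uncons_rV (n : nat) (x : 'rV[R]_n.+1) : R * 'rV[R]_n :=
  (x 0 ord0, \row_j x 0 (lift ord0 j)).

Lemma cons_rV0 n (p : R * 'rV[R]_n) : cons_rV p 0 ord0 = p.1.
Proof. by rewrite mxE unlift_none. Qed.

Lemma cons_rVS n (p : R * 'rV[R]_n) j : cons_rV p 0 (lift ord0 j) = p.2 0 j.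
Proof. by rewrite mxE liftK. Qed.

Lemma cons_rVK n : cancel (@cons_rV n) (@uncons_rV n).
Proof.
move=> p; rewrite [RHS]surjective_pairing /uncons_rV cons_rV0; congr pair.
by apply/rowP => j; rewrite mxE cons_rVS.
Qed.

Lemma measurable_cons_rV n : measurable_fun setT (@cons_rV n).
Proof.
apply: measurable_fun_rVP => i; have [j ->|->] := unliftP ord0 i.
  under eq_fun do rewrite cons_rVS.
  exact: (measurableT_comp (measurable_coord j)).
under eq_fun do rewrite cons_rV0.
exact: measurable_fst.
Qed.

Lemma measurable_uncons_rV n : measurable_fun setT (@uncons_rV n).
Proof.
apply: measurable_fun_pair; first exact: measurable_coord.
apply: measurable_fun_rVP => i; under eq_fun do rewrite mxE.
exact: measurable_coord.
Qed.

Section cons.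
Variables (n : nat) (m : {sigma_finite_measure set 'rV[R]_n -> \bar R}).

Definition cons_measure : set 'rV[R]_n.+1 -> \bar R :=
  pushforward (lebesgue_measure \x m)%E (@cons_rV n).

Let cons_measure0 : cons_measure set0 = 0%E.
Proof. by rewrite /cons_measure /pushforward preimage_set0 measure0. Qed.

Let cons_measure_ge0 A : (0 <= cons_measure A)%E.
Proof. by rewrite /cons_measure /pushforward measure_ge0. Qed.

Let cons_measure_sigma_additive : semi_sigma_additive cons_measure.
Proof.
move=> F mF tF mUF; rewrite /cons_measure /pushforward preimage_bigcup.
apply: measure_semi_sigma_additive.
- move=> k; rewrite -[X in measurable X]setTI; exact: measurable_cons_rV.
- apply/trivIsetP => /= i j _ _ ij; rewrite -preimage_setI.
  by move/trivIsetP : tF => /(_ _ _ _ _ ij) ->//; rewrite preimage_set0.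
- rewrite -preimage_bigcup -[X in measurable X]setTI.
  exact: measurable_cons_rV.
Qed.

HB.instance Definition _ := isMeasure.Build _ _ _ cons_measure
  cons_measure0 cons_measure_ge0 cons_measure_sigma_additive.

Let cons_measure_sigma_finite : sigma_finite setT cons_measure.
Proof.
have [F TF Foo] := sigma_finite_product lebesgue_measure m.
exists (fun k => @uncons_rV n @^-1` F k).
  by rewrite -preimage_bigcup -TF preimage_setT.
move=> k; have [mF Fk] := Foo k; split.
  by rewrite -[X in measurable X]setTI; exact: measurable_uncons_rV.
rewrite /cons_measure /pushforward -comp_preimage.
by rewrite (_ : _ \o _ = id)//; apply/funext => x /=; rewrite cons_rVK.
Qed.

HB.instance Definition _ := Measure_isSigmaFinite.Build _ _ _ cons_measure
  cons_measure_sigma_finite.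

End cons.

Fixpoint lebesgue_rV (n : nat) : {sigma_finite_measure set 'rV[R]_n -> \bar R} :=
  match n with
  | 0 => \d_(0 : 'rV[R]_0)
  | n'.+1 => cons_measure (lebesgue_rV n')
  end.

Lemma lebesgue_rV_box (n : nat) (A : 'I_n -> set R) :
  (forall i, measurable (A i)) ->
  lebesgue_rV n [set x | forall i, A i (x 0 i)] =
  (\prod_(i < n) lebesgue_measure (A i))%E.
Proof.
elim: n A => [|n ih] A mA.
  rewrite big_ord0/= diracE mem_set//=; by case.
rewrite big_ord_recl/= /cons_measure /pushforward -ih//.
rewrite -product_measure1E//.
  congr (_ _); apply/seteqP; split => [p /= Ap|p /= [Ap0 ApS] i].
    split=> [|j]; first by have := Ap ord0; rewrite cons_rV0.
    by have := Ap (lift ord0 j); rewrite cons_rVS.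
  by have [j ->|->] := unliftP ord0 i; rewrite ?cons_rV0 ?cons_rVS.
  exact: mA.
rewrite (_ : (fun _ => _) = \bigcap_(i in [set: 'I_n])
    ((fun x : 'rV[R]_n => x 0 i) @^-1` A (lift ord0 i))); last first.
  by apply/seteqP; split => x /= Ax i => [_|]; [exact: Ax|exact: (Ax i I)].
apply: fin_bigcap_measurable => // i _.
by rewrite -[X in measurable X]setTI; exact: measurable_coord.
Qed.

End lebesgue_rV.

Section domains.
Context {R : realType} (n : nat).
Implicit Type Om : set 'rV[R]_n.

Definition bounded_domain Om :=
  [/\ open Om, connected Om, Om !=set0 & bounded_set Om].

(* boundary of class C^{0,1}: near each boundary point, after an orthogonal
   change Q of coordinates, Om is the strict epigraph, in the direction of the
   k-th coordinate, of a Lipschitz function of the n-1 other coordinates *)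
Definition lipschitz_boundary Om :=
  forall x0, (closure Om `\` interior Om) x0 ->
  exists (Q : 'M[R]_n) (k : 'I_n) (gamma : 'rV[R]_n.-1 -> R) (L : R),
    [/\ Q *m Q^T = 1%:M, L.-lipschitz gamma &
        \forall x \near x0,
          Om x <-> gamma (col' k (x *m Q)) < (x *m Q) 0 k].

End domains.

Section sobolev.
Context {R : realType} (n : nat).
Implicit Types (Om : set 'rV[R]_n) (u v phi : 'rV[R]_n -> R)
  (Du Dv : 'rV[R]_n -> 'rV[R]_n) (p : \bar R).

(* Functions on Om are represented by functions on R^n whose values outside Om
   are irrelevant, and classes modulo equality a.e. in Om by Borel
   representatives. *)
Definition Lp Om p u := u \_ Om \in Lfun (lebesgue_rV n) p.

Definition partial (i : 'I_n) u : 'rV[R]_n -> R :=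
  fun x => 'D_(delta_mx 0 i) u x.

Definition smooth u := forall s : seq 'I_n,
  continuous (foldr partial u s) /\
  forall i x, derivable (foldr partial u s) x (delta_mx 0 i).

Definition test_function Om phi :=
  [/\ smooth phi, compact (closure [set x | phi x != 0]) &
      closure [set x | phi x != 0] `<=` Om].

Definition weak_gradient Om u Du := forall phi i, test_function Om phi ->
  \int[lebesgue_rV n]_(x in Om) (u x * partial i phi x) =
  - \int[lebesgue_rV n]_(x in Om) (Du x 0 i * phi x).

(* u belongs to H^1(Om) and Du is its (a.e. unique) weak gradient *)
Definition H1 Om u Du :=
  [/\ Lp Om 2%:E u, forall i, Lp Om 2%:E (fun x => Du x 0 i) &
      weak_gradient Om u Du].

(* H^1_0(Om) is the closure in H^1(Om) of the space of test functions *)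
Definition H10 Om u Du :=
  H1 Om u Du /\
  forall e : R, 0 < e -> exists2 phi, test_function Om phi &
    (\int[lebesgue_rV n]_(x in Om)
       ((u x - phi x) ^+ 2 +
        \sum_(i < n) (Du x 0 i - partial i phi x) ^+ 2)%:E < (e ^+ 2)%:E)%E.

Definition dot (a b : 'rV[R]_n) : R := \sum_(i < n) a 0 i * b 0 i.

(* weak solutions in H^1_0(Om) and L^oo(Om) of
   - Laplacian u = c u + mu |grad u|^2 + h *)
Definition solution Om (c : 'rV[R]_n -> R) (mu : R) (h : 'rV[R]_n -> R) u :=
  exists Du, [/\ H10 Om u Du, Lp Om +oo%E u &
    forall v Dv, H10 Om v Dv -> Lp Om +oo%E v ->
      \int[lebesgue_rV n]_(x in Om) dot (Du x) (Dv x) =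
      \int[lebesgue_rV n]_(x in Om)
        ((c x * u x + mu * dot (Du x) (Du x) + h x) * v x)].

End sobolev.

(* Main.v *)
(* Let [u0] solve (P_0) and put [U0 = mu u0], [a = exp (2 U0)].  The substitution
   [u = u0 + ln (1 + v) / mu] turns (P_lambda) into
     - div (a grad v) = a [lambda c+ (G v + U0 (1 + v)) - c- G v],  G v = (1 + v) ln (1 + v),
   which, once [1 + v] is cut off at [1/e], is the Euler equation of a functional J on
   H^1_0.  For small lambda, J has a mountain pass geometry.  Iterating a descent map
   gives two Cerami sequences: one in the unit ball, starting from 0, and one outside,
   starting from the boundary of the set of points of a ray whose descent orbits go down.
   They are bounded because the nonlinearity is superlinear only by a logarithm.  The
   weight c (1 + |v|)^d, c in L^q, satisfies a Morrey condition, and dyadic averages bound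
   its quadratic form by the Dirichlet integral; this gives both the compactness of
   Cerami sequences and, by De Giorgi iteration, v bounded above and, for small lambda,
   v >= - 1/2.  Hence the cut-off is inactive and u is a bounded solution of (P_lambda). *)
Require Import Defs.
From HB Require Import structures.
From mathcomp Require Import all_boot all_order all_algebra.
From mathcomp Require Import all_classical all_reals all_analysis.
From mathcomp Require Import measurable_realfun ess_sup_inf ring lra.

Set Implicit Arguments.
Unset Strict Implicit.
Unset Printing Implicit Defensive.

Import Order.TTheory GRing.Theory Num.Theory.
Import numFieldNormedType.Exports.

Local Open Scope classical_set_scope.
Local Open Scope ring_scope.

(** * Integrals of real functions *)

(** The substitution is a Hopf-Cole change of unknown relative to the given solution. With w0 = exp
    U0, exp (mu u) equals w0 (1 + v), and passing to the quotient by w0 leaves the conductivity w0^2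
    = exp (2 U0). Subtracting the equation of u0 removes h and the term c- U0, so that v = 0 fails
    to solve the new equation only by lambda a c+ U0, which is small with lambda. This smallness
    gives the barrier of height 1/4 around the unit sphere. A logarithm is too weak for an
    Ambrosetti-Rabinowitz condition, so boundedness needs the factor 1 + N v of Cerami sequences; a
    discrete Gronwall argument along descent orbits produces exactly this factor. The cut at 1/e
    sits at the minimum of y ln y: it makes G monotone and its primitive F convex and nonnegative,
    so the c- term always has the favourable sign and the adverse bounds are proportional to lambda.
    All difficult terms have the shape c (1 + |v|)^d z^2. One estimate of this form, with an
    arbitrarily small multiple of the Dirichlet integral plus an L2 term, serves differentiability,
    compactness and pointwise bounds. *)

Lemma le_of_eq d (T : porderType d) (x y : T) : x = y -> (x <= y)%O.
Proof. by move=> ->. Qed.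

Section integrals.
Context d (T : measurableType d) (R : realType).
Variables (mu : {measure set T -> \bar R}) (D : set T).
Hypothesis mD : measurable D.
Implicit Types (f g h u v w : T -> R).

Definition ig f := mu.-integrable D (EFin \o f).
Local Notation "'It' f" := (Rintegral mu D f) (at level 10, f at level 8).
Definition aeD (P : T -> Prop) := {ae mu, forall x, D x -> P x}.

Lemma aeDE (P : T -> Prop) : aeD P -> \forall x \ae mu, D x -> P x.
Proof. by []. Qed.

Lemma aeDW (P : T -> Prop) : (forall x, D x -> P x) -> aeD P.
Proof. by move=> h; apply: aeW. Qed.

Lemma aeD1 (P Q : T -> Prop) : (forall x, D x -> P x -> Q x) -> aeD P -> aeD Q.
Proof. by move=> h; rewrite /aeD; apply: filterS => x Px Dx; exact: h (Px Dx). Qed.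

Lemma aeD2 (P Q S : T -> Prop) :
  (forall x, D x -> P x -> Q x -> S x) -> aeD P -> aeD Q -> aeD S.
Proof. by move=> h; rewrite /aeD; apply: filterS2 => x Px Qx Dx; exact: h (Px Dx) (Qx Dx). Qed.

Lemma aeD_forall (P : nat -> T -> Prop) :
  (forall n, aeD (P n)) -> aeD (fun x => forall n, P n x).
Proof.
move=> h; have : \forall x \ae mu, forall n, D x -> P n x.
  exact: ae_foralln.
by apply: filterS => x Px Dx n; exact: Px.
Qed.

Lemma ig_meas f : ig f -> measurable_fun D f.
Proof. by move=> /measurable_int/measurable_EFinP. Qed.

Lemma ig_le f g : measurable_fun D f -> ig g -> aeD (fun x => `|f x| <= g x) ->
  ig f.
Proof.
move=> mf gi fg; have mg := ig_meas gi.
apply/integrableP; split; first exact/measurable_EFinP.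
have /integrableP[_] := gi; apply: le_lt_trans.
apply: ae_ge0_le_integral => //.
- by apply: measurableT_comp => //; exact/measurable_EFinP.
- by apply: measurableT_comp => //; exact/measurable_EFinP.
- apply: filterS (aeDE fg) => x h Dx /=; rewrite lee_fin.
  exact: le_trans (h Dx) (ler_norm _).
Qed.

Lemma ig_ae f g : measurable_fun D g -> ig f -> aeD (fun x => f x = g x) -> ig g.
Proof.
move=> mg fi fg; apply: (@ig_le _ (fun x => `|f x|)) => //.
  exact: integrable_norm.
by apply: aeD1 fg => x _ ->.
Qed.

Lemma igD f g : ig f -> ig g -> ig (fun x => f x + g x).
Proof. by move=> fi gi; have := integrableD mD fi gi. Qed.
Lemma igN f : ig f -> ig (fun x => - f x).
Proof. by move=> fi; have := integrableN fi. Qed.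
Lemma igB f g : ig f -> ig g -> ig (fun x => f x - g x).
Proof. by move=> fi gi; exact: igD fi (igN gi). Qed.
Lemma igZ k f : ig f -> ig (fun x => k * f x).
Proof. by move=> fi; have := integrableZl mD k fi. Qed.
Lemma ig_norm f : ig f -> ig (fun x => `|f x|).
Proof. exact: integrable_norm. Qed.
Lemma ig0 : ig (fun=> 0).
Proof. exact: integrable0. Qed.
Lemma ig_sum (I : Type) (s : seq I) (P : pred I) (f : I -> T -> R) :
  (forall i, P i -> ig (f i)) -> ig (fun x => \sum_(i <- s | P i) f i x).
Proof.
move=> fi; elim: s => [|i s ih].
  by under [X in ig X]eq_fun do rewrite big_nil; exact: ig0.
under [X in ig X]eq_fun do rewrite big_cons.
by case: (boolP (P i)) => // Pi; apply: igD => //; exact: fi.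
Qed.

Lemma ItD f g : ig f -> ig g -> It (fun x => f x + g x) = It f + It g.
Proof. exact: RintegralD. Qed.
Lemma ItB f g : ig f -> ig g -> It (fun x => f x - g x) = It f - It g.
Proof. exact: RintegralB. Qed.
Lemma ItZ k f : ig f -> It (fun x => k * f x) = k * It f.
Proof. by move=> ?; exact: RintegralZl. Qed.
Lemma ItN f : ig f -> It (fun x => - f x) = - It f.
Proof.
move=> fi; rewrite -mulN1r -ItZ//; congr Rintegral.
by apply/funext => x; rewrite mulN1r.
Qed.
Lemma It0 : It (fun=> 0) = 0.
Proof. by rewrite /Rintegral integral0. Qed.
Lemma It_sum (I : Type) (s : seq I) (P : pred I) (f : I -> T -> R) :
  (forall i, P i -> ig (f i)) ->
  It (fun x => \sum_(i <- s | P i) f i x) = \sum_(i <- s | P i) It (f i).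
Proof.
move=> fi; elim: s => [|i s ih].
  by under [X in It X]eq_fun do rewrite big_nil; rewrite It0 big_nil.
under [X in It X]eq_fun do rewrite big_cons.
rewrite big_cons; case: (boolP (P i)) => // Pi.
by rewrite ItD ?ih//; [exact: fi|exact: ig_sum].
Qed.

Lemma ItE f : ig f -> (\int[mu]_(x in D) (f x)%:E)%E = (It f)%:E.
Proof. by move=> fi; rewrite /Rintegral fineK//; exact: integrable_fin_num. Qed.

Lemma It_eq f g : ig f -> measurable_fun D g -> aeD (fun x => f x = g x) ->
  It f = It g.
Proof.
move=> fi mg fg; congr fine; apply: ae_eq_integral => //.
- exact/measurable_EFinP/ig_meas.
- exact/measurable_EFinP.
- by apply: filterS (aeDE fg) => x h Dx; rewrite h.
Qed.

Lemma eq_It f g : (forall x, D x -> f x = g x) -> It f = It g.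
Proof. by move=> fg; apply: eq_Rintegral => x /set_mem; exact: fg. Qed.

Lemma It_ge0 f : measurable_fun D f -> aeD (fun x => 0 <= f x) -> 0 <= It f.
Proof.
move=> mf f0; suff -> : It f = It (fun x => `|f x|) by apply: Rintegral_ge0.
congr fine; apply: ae_eq_integral => //.
- exact/measurable_EFinP.
- by apply/measurable_EFinP/measurableT_comp.
- by apply: filterS (aeDE f0) => x h Dx; rewrite ger0_norm// h.
Qed.

Lemma It_sqr_ge0 f : 0 <= It (fun x => f x ^+ 2).
Proof. by apply: Rintegral_ge0 => x _; exact: sqr_ge0. Qed.

Lemma It_le f g : ig f -> ig g -> aeD (fun x => f x <= g x) -> It f <= It g.
Proof.
move=> fi gi fg; rewrite -subr_ge0 -ItB//; apply: It_ge0.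
  by apply: ig_meas; exact: igB.
by apply: aeD1 fg => x _; rewrite subr_ge0.
Qed.

Lemma It_abs f : ig f -> `|It f| <= It (fun x => `|f x|).
Proof. exact: le_normr_Rintegral. Qed.

Lemma It_abs_le f g : ig f -> ig g -> aeD (fun x => `|f x| <= g x) -> `|It f| <= It g.
Proof.
move=> fi gi fg; apply: le_trans (It_abs fi) _; apply: It_le => //; exact: ig_norm.
Qed.

Lemma ge0_ig f (M : R) : measurable_fun D f -> aeD (fun x => 0 <= f x) ->
  (\int[mu]_(x in D) (f x)%:E <= M%:E)%E -> ig f /\ It f <= M.
Proof.
move=> mf f0 fM; have fi : ig f.
  apply/integrableP; split; first exact/measurable_EFinP.
  rewrite (_ : integral _ _ _ = \int[mu]_(x in D) (f x)%:E)%E.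
    by rewrite (le_lt_trans fM)// ltry.
  apply: ae_eq_integral => //.
  - by apply: measurableT_comp => //; exact/measurable_EFinP.
  - exact/measurable_EFinP.
  - by apply: filterS (aeDE f0) => x h Dx /=; rewrite ger0_norm// h.
by split=> //; move: fM; rewrite ItE.
Qed.

Lemma It_eq0 f : ig f -> aeD (fun x => 0 <= f x) -> It f = 0 ->
  aeD (fun x => f x = 0).
Proof.
move=> fi f0 If; have mf := ig_meas fi.
have h : (\int[mu]_(x in D) `|(EFin \o f) x| = 0)%E.
  transitivity (\int[mu]_(x in D) (f x)%:E)%E; last by rewrite ItE ?If.
  apply: ae_eq_integral => //.
  - by apply: measurableT_comp => //; exact/measurable_EFinP.
  - exact/measurable_EFinP.
  - by apply: filterS (aeDE f0) => x h Dx /=; rewrite ger0_norm// h.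
move/ae_eq_integral_abs : h => /(_ mD) h.
have /h : measurable_fun D (EFin \o f) by exact/measurable_EFinP.
by apply: filterS => x /[apply] -[].
Qed.

Lemma It_DCT (f_ : nat -> T -> R) f g : (forall n, measurable_fun D (f_ n)) ->
  measurable_fun D f -> aeD (fun x => f_ ^~ x @ \oo --> f x) -> ig g ->
  (forall n, aeD (fun x => `|f_ n x| <= g x)) ->
  ig f /\ (fun n => It (f_ n)) @ \oo --> It f.
Proof.
move=> mf_ mf ff gi fg.
have [fi _ h] := @dominated_convergence _ _ _ mu D mD (fun n => EFin \o f_ n)
   (EFin \o f) (EFin \o g) (fun n => ltac:(exact/measurable_EFinP))
   (ltac:(exact/measurable_EFinP))
   (ltac:(by apply: filterS (aeDE ff) => x h Dx; apply: cvg_EFin; [exact: filterE|exact: h]))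
   gi (ltac:(by apply: filterS (aeDE (aeD_forall fg)) => x h n Dx /=; rewrite lee_fin; exact: h)).
have fni n : ig (f_ n) by apply: ig_le gi _.
split=> //; apply: fine_cvg; rewrite -ItE//.
Qed.

(** Integrability of the limit is part of the conclusion and the bound is only asked for eventually:
    in this form bounds on approximating functions are transported to limits. *)
Lemma It_fatou (f_ : nat -> T -> R) f (M : R) : (forall n, ig (f_ n)) ->
  (forall n, aeD (fun x => 0 <= f_ n x)) -> measurable_fun D f ->
  aeD (fun x => f_ ^~ x @ \oo --> f x) ->
  (\forall n \near \oo, It (f_ n) <= M) -> ig f /\ It f <= M.
Proof.
move=> fi_ f0_ mf ff fM.
have f0 : aeD (fun x => 0 <= f x).
  apply: aeD2 ff (aeD_forall f0_) => x _ h h0.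
  by rewrite -(cvg_lim _ h)//; apply: limr_ge; [apply: cvgP h|exact: filterE].
apply: ge0_ig => //.
have mf_ n : measurable_fun D (f_ n) by exact: ig_meas.
have := @fatou _ _ _ mu D mD (fun n x => `|f_ n x|%:E)
  (fun n => ltac:(by apply/measurable_EFinP/measurableT_comp)) (fun n x _ => ltac:(by rewrite lee_fin)).
rewrite (_ : integral _ _ _ = \int[mu]_(x in D) (f x)%:E)%E; last first.
  apply: ae_eq_integral => //.
  - rewrite /limn_einf; apply: measurableT_comp => //.
    apply: (@measurable_fun_limn_esup _ _ _ _ (fun n x => (- `|f_ n x|%:E)%E)) => n.
    by apply: measurableT_comp => //; apply/measurable_EFinP/measurableT_comp.
  - exact/measurable_EFinP.
  - apply: filterS2 (aeDE ff) (aeDE (aeD_forall f0_)) => x h h0 Dx.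
    apply: (fst (cvg_limn_einf_sup _)).
    apply: cvg_EFin; first exact: filterE.
    apply: cvg_trans (h Dx); apply: near_eq_cvg; apply: filterE => n /=.
    by rewrite ger0_norm// h0.
move/le_trans; apply.
have eqI n : (\int[mu]_(x in D) `|f_ n x|%:E = (It (f_ n))%:E)%E.
  rewrite -ItE//; apply: ae_eq_integral => //.
  - by apply/measurable_EFinP/measurableT_comp.
  - exact/measurable_EFinP.
  - by apply: filterS (aeDE (f0_ n)) => x h Dx; rewrite ger0_norm// h.
under [X in limn_einf X]eq_fun do rewrite eqI.
rewrite limn_einf_lim; apply: lime_le; first exact: is_cvg_einfs.
near=> n; apply: ge_ereal_inf; exists (It (f_ n))%:E.
  by exists n => //=.
by rewrite lee_fin; near: n.
Unshelve. all: by end_near. Qed.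

(** The sum of the [f_ n] has a finite integral, hence is finite almost everywhere, and the terms of
    a convergent series tend to 0. *)
Lemma ae_cvg0 (f_ : nat -> T -> R) : (forall n, ig (f_ n)) ->
  (forall n x, D x -> 0 <= f_ n x) -> (forall n, It (f_ n) <= 2 ^- n) ->
  aeD (fun x => f_ ^~ x @ \oo --> 0).
Proof.
move=> fi f0 fle.
have S : (\int[mu]_(x in D) (\sum_(0 <= n <oo) (f_ n x)%:E) < +oo)%E.
  have mE n : measurable_fun D (fun x => (f_ n x)%:E) by exact/measurable_EFinP/ig_meas.
  rewrite integral_nneseries//.
  apply: (@le_lt_trans _ _ (\sum_(0 <= n <oo) (2 ^- n)%:E)%E).
    apply: lee_nneseries => n _ //; first by rewrite ItE// lee_fin Rintegral_ge0// => x; exact: f0.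
    by rewrite ItE// lee_fin.
  have h := @cvg_geometric_series R 1 2^-1 (ltac:(by rewrite ger0_norm ?invr_ge0// invf_lt1// ltr1n)).
  rewrite (_ : (\sum_(_ <= _ <oo) _)%E = (1 / (1 - 2^-1) : R)%:E) ?ltry//.
  have h' : (fun n => (series (geometric 1 2^-1) n)%:E) @ \oo --> (1 / (1 - 2^-1) : R)%:E.
    by apply: cvg_EFin => //; exact: nearW.
  apply/cvg_lim => //; rewrite [X in X @ _ --> _](_ : _ = (fun n => (series (geometric 1 2^-1) n)%:E))//.
  apply/funext => n /=; rewrite /series/= sumEFin; congr (_%:E); apply: eq_bigr => i _.
  by rewrite mul1r exprVn.
have mS : measurable_fun D (fun x => \sum_(0 <= n <oo) (f_ n x)%:E)%E.
  apply: ge0_emeasurable_sum => // n; last by move=> _; exact/measurable_EFinP/ig_meas.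
  by move=> x Dx _; rewrite lee_fin f0.
have Si : mu.-integrable D (fun x => \sum_(0 <= n <oo) (f_ n x)%:E)%E.
  apply/integrableP; split => //.
  under eq_integral => x /set_mem Dx.
    rewrite gee0_abs; last by apply: nneseries_ge0 => n _ _; rewrite lee_fin f0.
    over.
  exact: S.
have := integrable_ae mD Si; rewrite /aeD; apply: filterS => x h' Dx; have h := h' Dx.
apply: cvg_series_cvg_0; apply: nondecreasing_is_cvgn.
  apply/nondecreasing_seqP => n; rewrite /series/= big_nat_recr//= lerDl; exact: f0.
exists (fine (\sum_(0 <= n <oo) (f_ n x)%:E)%E) => _ [n _ <-].
rewrite -lee_fin fineK// /series/= -sumEFin.
by apply: nneseries_lim_ge => k _ _; rewrite lee_fin f0.
Qed.

End integrals.

(** * Square-integrable functions: Cauchy-Schwarz and completeness *)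

Section L2.
Context d (T : measurableType d) (R : realType).
Variables (mu : {measure set T -> \bar R}) (D : set T).
Hypothesis mD : measurable D.
Implicit Types (f g h u v w : T -> R).
Local Notation "'It' f" := (Rintegral mu D f) (at level 10, f at level 8).
Local Notation ig := (ig mu D).
Local Notation aeD := (aeD mu D).

Lemma discr_le (a b c : R) : 0 <= a -> (forall t, 0 <= a * t ^+ 2 + 2 * b * t + c) ->
  b ^+ 2 <= a * c.
Proof.
rewrite le_eqVlt => /predU1P[<-|a0] h.
  have [->|b0] := eqVneq b 0; first by rewrite expr0n mul0r.
  (* For [a = 0] the quadratic is affine in [t]; this value of [t] makes it equal to -1. *)
  have := h (- (c + 1) / (2 * b)); rewrite mul0r add0r.
  rewrite (_ : _ + c = -1); last by field.
  by rewrite lerNr oppr0 ler10.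
have := h (- b / a).
rewrite (_ : _ + c = (a * c - b ^+ 2) / a); last by field; rewrite gt_eqF.
by rewrite pmulr_lge0 ?invr_gt0// subr_ge0.
Qed.

(** The integral of [w (t f + g)^2] is a nonnegative quadratic in [t], and [discr_le] bounds its
    discriminant. The product is integrable because [|f g| <= f^2 + g^2]. *)
Lemma CSw w f g : measurable_fun D w -> measurable_fun D f -> measurable_fun D g ->
  aeD (fun x => 0 <= w x) ->
  ig (fun x => w x * f x ^+ 2) -> ig (fun x => w x * g x ^+ 2) ->
  ig (fun x => w x * (f x * g x)) /\
  (It (fun x => w x * (f x * g x))) ^+ 2 <=
    It (fun x => w x * f x ^+ 2) * It (fun x => w x * g x ^+ 2).
Proof.
move=> mw mf mg w0 fi gi.
have fgi : ig (fun x => w x * (f x * g x)).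
  apply: (ig_le mD _ (igD mD fi gi)).
    by do 2 apply: measurable_funM => //.
  apply: aeD1 w0 => x _ w0; rewrite -mulrDr normrM ger0_norm//.
  apply: ler_wpM2l => //; rewrite ler_norml; apply/andP; split; nra.
split => //; apply: discr_le => [|t].
  apply: (It_ge0 mD); first exact: ig_meas fi.
  by apply: aeD1 w0 => x _ w0; rewrite mulr_ge0// sqr_ge0.
rewrite [leRHS](_ : _ = It (fun x => w x * (f x * t + g x) ^+ 2)); last first.
  transitivity (It (fun x => (t ^+ 2 * (w x * f x ^+ 2) + (2 * t) * (w x * (f x * g x))) + w x * g x ^+ 2)).
    rewrite !(ItD mD, ItZ mD)//; first ring.
    - exact: igZ.
    - exact: igZ.
    - by apply: igD => //; exact: igZ.
  by apply: eq_It => x _; ring.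
apply: (It_ge0 mD) => //.
  apply: measurable_funM => //; apply: measurable_funX; apply: measurable_funD => //.
  by apply: measurable_funM => //; exact: measurable_cst.
by apply: aeD1 w0 => x _ w0; rewrite mulr_ge0// sqr_ge0.
Qed.

Definition L2 u := measurable_fun D u /\ ig (fun x => u x ^+ 2).

Lemma L2_meas u : L2 u -> measurable_fun D u. Proof. by case. Qed.
Lemma L2_ig u : L2 u -> ig (fun x => u x ^+ 2). Proof. by case. Qed.

Lemma L2_le u g : measurable_fun D u -> ig g -> aeD (fun x => u x ^+ 2 <= g x) -> L2 u.
Proof.
move=> mu_ gi h; split=> //; apply: (ig_le mD _ gi); first exact: measurable_funX.
by apply: aeD1 h => x _; rewrite ger0_norm ?sqr_ge0.
Qed.

Lemma L2D u v : L2 u -> L2 v -> L2 (fun x => u x + v x).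
Proof.
move=> [mu_ u2] [mv v2]; apply: (@L2_le _ (fun x => 2 * u x ^+ 2 + 2 * v x ^+ 2)).
- exact: measurable_funD.
- by apply: igD => //; exact: igZ.
- by apply: aeDW => x _; have := sqr_ge0 (u x - v x); nra.
Qed.

Lemma L2Z k u : L2 u -> L2 (fun x => k * u x).
Proof.
move=> [mu_ u2]; apply: (@L2_le _ (fun x => k ^+ 2 * u x ^+ 2)).
- by apply: measurable_funM => //; exact: measurable_cst.
- exact: igZ.
- by apply: aeDW => x _; rewrite exprMn.
Qed.

Lemma L2N u : L2 u -> L2 (fun x => - u x).
Proof. by move=> /(L2Z (-1)); under [X in L2 X -> _]eq_fun do rewrite mulN1r. Qed.

Lemma L2B u v : L2 u -> L2 v -> L2 (fun x => u x - v x).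
Proof. by move=> ul /L2N; exact: L2D. Qed.

Lemma L2M u v : L2 u -> L2 v -> ig (fun x => u x * v x).
Proof.
move=> [mu_ u2] [mv v2]; apply: (@ig_le _ _ _ _ _ mD _ (fun x => u x ^+ 2 + v x ^+ 2)).
- exact: measurable_funM.
- exact: igD.
- by apply: aeDW => x _; rewrite ler_norml; apply/andP; split; nra.
Qed.

Lemma L2CS u v : L2 u -> L2 v ->
  (It (fun x => u x * v x)) ^+ 2 <= It (fun x => u x ^+ 2) * It (fun x => v x ^+ 2).
Proof.
move=> [mu_ u2] [mv v2].
have e f : (fun x => 1 * f x) = f by apply/funext => x; rewrite mul1r.
have := CSw (measurable_cst (1:R)) mu_ mv (@aeDW _ _ _ mu D _ (fun _ _ => ler01)).
rewrite (e (fun x => u x ^+ 2)) (e (fun x => v x ^+ 2)) (e (fun x => u x * v x)).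
by move=> /(_ u2 v2)[].
Qed.

Lemma ItD2 u v : L2 u -> L2 v ->
  It (fun x => (u x + v x) ^+ 2) <= 2 * It (fun x => u x ^+ 2) + 2 * It (fun x => v x ^+ 2).
Proof.
move=> ul vl; rewrite -!(ItZ mD) ?L2_ig// -(ItD mD) ?igZ ?L2_ig//.
apply: (It_le mD).
- by apply: L2_ig; exact: L2D.
- by apply: igD => //; apply: igZ => //; exact: L2_ig.
- by apply: aeDW => x _; have := sqr_ge0 (u x - v x); nra.
Qed.

Lemma ltr_sqr_norm (a e : R) : 0 < e -> `|a| ^+ 2 < e ^+ 2 -> `|a| < e.
Proof. by move=> e0; rewrite ltr_pXn2r// ?nnegrE ltW. Qed.

Lemma L2_fast_ae (u_ : nat -> T -> R) u : (forall n, L2 (u_ n)) -> L2 u ->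
  (forall n, It (fun x => (u_ n x - u x) ^+ 2) <= 2 ^- n) ->
  aeD (fun x => u_ ^~ x @ \oo --> u x).
Proof.
move=> uL ul h.
have := @ae_cvg0 _ _ _ _ _ mD (fun n x => (u_ n x - u x) ^+ 2)
  (fun n => L2_ig (L2B (uL n) ul)) (fun n x _ => sqr_ge0 _) h.
apply: aeD1 => x _ hx.
apply/cvgrPdist_lt => e e0; move/cvgrPdist_lt : hx => /(_ (e ^+ 2)).
rewrite exprn_gt0// => /(_ isT); apply: filterS => n.
rewrite sub0r normrN ger0_norm ?sqr_ge0// -[(_ - _) ^+ 2]real_normK ?num_real//.
by rewrite distrC; exact: ltr_sqr_norm.
Qed.

Lemma cvg_geom (v : nat -> R) : (\forall n \near \oo, `|v n.+1 - v n| <= 2 ^- n) -> cvgn v.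
Proof.
case=> N _ hN.
have h n k : (N <= n)%N -> `|v (n + k)%N - v n| <= 2 * 2 ^- n - 2 * 2 ^- (n + k).
  move=> Nn; elim: k => [|k ih]; first by rewrite addn0 subrr normr0 subrr.
  rewrite addnS; have := hN (n + k)%N (leq_trans Nn (leq_addr _ _)) => /= hk.
  apply: (le_trans (ler_distD (v (n + k)%N) _ _)).
  apply: le_trans (lerD hk ih) _; rewrite exprS.
  apply: le_of_eq; field.
  by rewrite !expf_neq0.
apply: cauchy_cvg; apply: cauchy_exP => e e0.
have /cvgrPdist_lt/(_ (e / 2)) : (fun n => (2^-1 : R) ^+ n) @ \oo --> 0.
  by apply: cvg_expr; rewrite ger0_norm ?invr_ge0// invf_lt1// ltr1n.
rewrite divr_gt0// => /(_ isT)[M _ hM].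
exists (v (maxn N M)); exists (maxn N M) => // n /= Kn.
have := hM (maxn N M) (leq_maxr _ _); have := h (maxn N M) (n - maxn N M)%N (leq_maxl _ _).
rewrite subnKC// => h1; rewrite /= sub0r normrN ger0_norm ?exprn_ge0 ?invr_ge0// exprVn => h2.
rewrite /ball/= distrC; apply: le_lt_trans h1 _.
have : 0 <= 2 ^- n :> R by rewrite invr_ge0 exprn_ge0.
by move: h2; move: (2 ^- _) (2 ^- _) => a b; lra.
Qed.

(** Riesz-Fischer: a fast subsequence converges almost everywhere, and Fatou's lemma in one index of
    the Cauchy condition gives convergence in mean square of the whole sequence. *)
Lemma L2_complete (u_ : nat -> T -> R) : (forall n, L2 (u_ n)) ->
  (forall e, 0 < e -> exists N, forall m n, (N <= m)%N -> (N <= n)%N ->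
     It (fun x => (u_ m x - u_ n x) ^+ 2) <= e) ->
  exists2 u, L2 u & (fun n => It (fun x => (u_ n x - u x) ^+ 2)) @ \oo --> 0.
Proof.
move=> uL uC.
(* With the rate [8 ^- k], the squared increments times [4 ^+ k] still have integrals at most
   [2 ^- k]; almost everywhere the increments are therefore eventually below [2 ^- k]. *)
have /choice[N hN] : forall k, exists N, forall m n, (N <= m)%N -> (N <= n)%N ->
     It (fun x => (u_ m x - u_ n x) ^+ 2) <= 8 ^- k.
  by move=> k; apply: uC; rewrite invr_gt0 exprn_gt0.
pose M := fix M k := if k is k'.+1 then maxn (M k').+1 (N k) else N 0%N.
have NM k : (N k <= M k)%N by case: k => //= k; exact: leq_maxr.
have MS k : (M k < M k.+1)%N by exact: leq_maxl.
have Mk k : (k <= M k)%N by elim: k => // k ih; exact: leq_ltn_trans ih (MS k).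
pose v k := u_ (M k).
have vL k : L2 (v k) by exact: uL.
have cv : aeD (fun x => cvgn (v ^~ x)).
  have f0 n x : D x -> 0 <= 4 ^+ n * (v n.+1 x - v n x) ^+ 2.
    by move=> _; apply: mulr_ge0; [exact: exprn_ge0|exact: sqr_ge0].
  have := @ae_cvg0 _ _ _ _ _ mD (fun n x => 4 ^+ n * (v n.+1 x - v n x) ^+ 2)
    (fun n => igZ mD _ (L2_ig (L2B (vL _) (vL _)))) f0.
  have h n : It (fun x => 4 ^+ n * (v n.+1 x - v n x) ^+ 2) <= 2 ^- n.
    rewrite (ItZ mD); last by apply: L2_ig; exact: L2B.
    rewrite (_ : 2 ^- n = 4 ^+ n * 8 ^- n); last first.
      by rewrite -!exprVn -exprMn; congr (_ ^+ _); field.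
    by apply: ler_wpM2l; [exact: exprn_ge0|apply: hN => //; exact: leq_trans (NM _) (ltnW (MS _))].
  move=> /(_ h); apply: aeD1 => x _ hx; apply: cvg_geom.
  move/cvgrPdist_lt : hx => /(_ 1 ltr01); apply: filterS => n.
  rewrite sub0r normrN ger0_norm; last by apply: mulr_ge0; [exact: exprn_ge0|exact: sqr_ge0].
  rewrite (_ : 4 ^+ n = (2 ^+ n) ^+ 2); last by rewrite -exprM mulnC exprM expr2 -natrM.
  rewrite -exprMn -[(_ * _) ^+ 2]real_normK ?num_real// -[X in _ < X](expr1n _ 2).
  move=> /(ltr_sqr_norm ltr01); rewrite normrM [`|2 ^+ n|]ger0_norm ?exprn_ge0// => /ltW.
  by rewrite mulrC -ler_pdivlMr ?exprn_gt0// div1r.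
pose u := fun x => limn (v ^~ x).
have mv k : measurable_fun D (v k) by exact: L2_meas.
(* A limit superior is measurable on all of [D], including the null set where the subsequence
   diverges. *)
pose g x := fine (limn_esup (fun k => (v k x)%:E)).
have mg : measurable_fun D g.
  apply: measurableT_comp => //; apply: (@measurable_fun_limn_esup _ _ _ _ (fun k x => (v k x)%:E)) => k.
  exact/measurable_EFinP.
have vg : aeD (fun x => v ^~ x @ \oo --> g x).
  apply: aeD1 cv => x _ /cvg_ex[l vl].
  suff -> : g x = l by [].
  have h : (fun k => (v k x)%:E) @ \oo --> l%:E by apply: cvg_EFin => //; exact: filterE.
  by rewrite /g (snd (cvg_limn_einf_sup h)).
have key n e : 0 < e -> (exists K, forall m, (K <= m)%N -> It (fun x => (u_ n x - u_ m x) ^+ 2) <= e) ->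
    ig (fun x => (u_ n x - g x) ^+ 2) /\ It (fun x => (u_ n x - g x) ^+ 2) <= e.
  move=> e0 [K hK]; apply: (@It_fatou _ _ _ mu D mD (fun k x => (u_ n x - v k x) ^+ 2)).
  - by move=> k; apply: L2_ig; exact: L2B.
  - by move=> k; apply: aeDW => x _; exact: sqr_ge0.
  - by apply: measurable_funX; apply: measurable_funB => //; exact: L2_meas.
  - apply: aeD1 vg => x _ vg; apply: cvgM; apply: cvgB => //; exact: cvg_cst.
  - exists K => // k /= Kk; apply: hK; exact: leq_trans Kk _.
have gL : L2 g.
  have [K hK] := uC 1 ltr01.
  have [h _] := key K 1 ltr01 (ex_intro _ K (fun m Km => hK K m (leqnn _) Km)).
  have : L2 (fun x => u_ K x - (u_ K x - g x)).
    apply: L2B => //; split => //; apply: measurable_funB => //; exact: L2_meas.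
  by under [X in L2 X -> _]eq_fun do rewrite opprB addrC subrK.
exists g => //; apply/cvgrPdist_le => e e0; have [K hK] := uC e e0.
exists K => // n /= Kn.
rewrite sub0r normrN ger0_norm; last by exact: It_sqr_ge0.
by have [_] := key n e e0 (ex_intro _ K (fun m Km => hK n m Kn Km)).
Qed.

End L2.

(** * Descent in a complete semi-Hilbert space *)

Section semi_hilbert.
Context (R : realType) (V : lmodType R).
Variable B : V -> V -> R.
Hypothesis Bsym : forall u v, B u v = B v u.
Hypothesis Blin : forall a u v w, B (a *: u + v) w = a * B u w + B v w.
Hypothesis Bpos : forall u, 0 <= B u u.
Implicit Types (u v w : V).

Lemma B0l w : B 0 w = 0.
Proof. by have := Blin (-1) 0 0 w; rewrite scaler0 addr0; lra. Qed.
Lemma BDl u v w : B (u + v) w = B u w + B v w.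
Proof. by have := Blin 1 u v w; rewrite scale1r mul1r. Qed.
Lemma BZl a u w : B (a *: u) w = a * B u w.
Proof. by have := Blin a u 0 w; rewrite addr0 B0l addr0. Qed.
Lemma BNl u w : B (- u) w = - B u w.
Proof. by rewrite -scaleN1r BZl mulN1r. Qed.
Lemma BBl u v w : B (u - v) w = B u w - B v w.
Proof. by rewrite BDl BNl. Qed.
Lemma BDr u v w : B w (u + v) = B w u + B w v.
Proof. by rewrite Bsym BDl !(Bsym w). Qed.
Lemma BZr a u w : B w (a *: u) = a * B w u.
Proof. by rewrite Bsym BZl (Bsym w). Qed.
Lemma BNr u w : B w (- u) = - B w u.
Proof. by rewrite Bsym BNl (Bsym w). Qed.
Lemma BBr u v w : B w (u - v) = B w u - B w v.
Proof. by rewrite BDr BNr. Qed.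

(** Only a seminorm: the vectors will be representatives of functions, so [nrm v = 0] will mean
    vanishing almost everywhere and not [v = 0]. Limits and continuity are therefore expressed by
    [nrm] of differences. *)
Definition nrm v := Num.sqrt (B v v).

Lemma nrm_ge0 v : 0 <= nrm v. Proof. exact: sqrtr_ge0. Qed.
Lemma sqr_nrm v : nrm v ^+ 2 = B v v. Proof. exact/sqr_sqrtr/Bpos. Qed.
Lemma nrm0 : nrm 0 = 0. Proof. by rewrite /nrm B0l sqrtr0. Qed.
Lemma nrmZ a v : nrm (a *: v) = `|a| * nrm v.
Proof. by rewrite /nrm BZl BZr mulrA -expr2 sqrtrM ?sqr_ge0// sqrtr_sqr. Qed.
Lemma nrmN v : nrm (- v) = nrm v.
Proof. by rewrite -scaleN1r nrmZ normrN1 mul1r. Qed.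
Lemma nrmBC u v : nrm (u - v) = nrm (v - u).
Proof. by rewrite -nrmN opprB. Qed.

Lemma B_sq u v : (B u v) ^+ 2 <= B u u * B v v.
Proof.
have [u0|u0] := eqVneq (B u u) 0.
  rewrite u0 mul0r; have [->|b0] := eqVneq (B u v) 0; first by rewrite expr0n.
  have := Bpos ((- (B v v + 1) / (2 * B u v)) *: u + v).
  rewrite Blin BDr !BZr BDr BZr u0 (Bsym v u).
  set c := _ / _; rewrite (_ : _ + _ = 2 * B u v * c + B v v); last by ring.
  rewrite /c mulrCA divff ?mulr1; last by rewrite mulf_neq0.
  by lra.
have a0 : 0 < B u u by rewrite lt_neqAle eq_sym u0 Bpos.
have := Bpos ((- B u v / B u u) *: u + v).
rewrite Blin BDr !BZr BDr BZr (Bsym v u).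
rewrite (_ : _ + _ = (B u u * B v v - B u v ^+ 2) / B u u); last by field.
by rewrite pmulr_lge0 ?invr_gt0// subr_ge0.
Qed.

Lemma B_CS u v : `|B u v| <= nrm u * nrm v.
Proof.
have h := B_sq u v; rewrite -!sqr_nrm -exprMn in h.
rewrite -(ler_pXn2r (ltn0Sn 1)) ?nnegrE ?mulr_ge0 ?nrm_ge0//.
by rewrite real_normK ?num_real.
Qed.

Lemma B_le u v : B u v <= nrm u * nrm v.
Proof. exact: le_trans (ler_norm _) (B_CS u v). Qed.

Lemma nrmD u v : nrm (u + v) <= nrm u + nrm v.
Proof.
rewrite -(ler_pXn2r (ltn0Sn 1)) ?nnegrE ?addr_ge0 ?nrm_ge0//.
rewrite sqrrD !sqr_nrm BDl !BDr (Bsym v u).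
by have := B_le u v; lra.
Qed.

Lemma nrmB u v : nrm (u - v) <= nrm u + nrm v.
Proof. by apply: le_trans (nrmD _ _) _; rewrite nrmN. Qed.

Lemma nrm_dist u v w : nrm (u - w) <= nrm (u - v) + nrm (v - w).
Proof. by apply: le_trans (nrmD _ _); rewrite addrA subrK. Qed.

Lemma nrm_absB u v : `|nrm u - nrm v| <= nrm (u - v).
Proof.
have h1 := nrm_dist u v 0; have h2 := nrm_dist v u 0.
rewrite !subr0 (nrmBC v u) in h1 h2.
by rewrite ler_norml; apply/andP; split; lra.
Qed.

Definition ncomplete := forall x : nat -> V,
  (forall e, 0 < e -> exists N, forall m n, (N <= m)%N -> (N <= n)%N -> nrm (x m - x n) <= e) ->
  exists l, (fun n => nrm (x n - l)) @ \oo --> 0.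

(** The functional [2^-1 B v v - l v] is bounded below, the parallelogram identity makes its
    minimizing sequences Cauchy, and the first-order condition at a limit says that [g] represents
    [l]. *)
Lemma riesz (l : V -> R) (C : R) : ncomplete ->
  (forall a u v, l (a *: u + v) = a * l u + l v) ->
  (forall v, `|l v| <= C * nrm v) ->
  exists g, forall v, l v = B g v.
Proof.
move=> cV lin lC.
have l0 : l 0 = 0 by have := lin (-1) 0 0; rewrite scaler0 addr0; lra.
have lZ a u : l (a *: u) = a * l u by have := lin a u 0; rewrite addr0 l0 addr0.
have lD u v : l (u + v) = l u + l v by have := lin 1 u v; rewrite scale1r mul1r.
pose E v := 2^-1 * B v v - l v.
have Elb v : - (C ^+ 2) / 2 <= E v.
  have := lC v; rewrite /E -sqr_nrm ler_norml => /andP[_ h].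
  by have := sqr_ge0 (nrm v - C); nra.
pose m := inf (range E).
have hE : has_inf (range E).
  by split; [exists (E 0); exists 0|exists (- (C ^+ 2) / 2) => _ [v _ <-]].
have mE v : m <= E v by apply: ge_inf; [exact: hE.2|exists v].
have /choice[x hx] : forall k : nat, exists v, E v <= m + 2 ^- k.
  move=> k; have [|_ [v _ <-] h] := @inf_adherent _ (range E) (2 ^- k) _ hE.
    by rewrite invr_gt0 exprn_gt0.
  by exists v; exact: ltW.
have ED u v : E (u + v) = E u + (B u v - l v) + 2^-1 * B v v.
  by rewrite /E BDl !BDr lD (Bsym v u); lra.
have par u v : B (u - v) (u - v) = 4 * (E u + E v - 2 * E (2^-1 *: (u + v))).
  rewrite /E BZl BZr lZ lD BBl !BBr BDl !BDr (Bsym v u).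
  by field.
have xC k j : B (x k - x j) (x k - x j) <= 4 * (2 ^- k + 2 ^- j).
  by rewrite par; have := hx k; have := hx j; have := mE (2^-1 *: (x k + x j)); lra.
have p2 : (fun n => (2 ^- n : R)) @ \oo --> (0:R).
  under eq_fun do rewrite -exprVn.
  by apply: cvg_expr; rewrite ger0_norm ?invr_ge0// invf_lt1// ltr1n.
have [e e0|g hg] := cV x.
  have e8 : 0 < e ^+ 2 / 8 by rewrite divr_gt0// exprn_gt0.
  have /cvgrPdist_lt/(_ _ e8)[N _ hN] := p2.
  exists N => k j Nk Nj; rewrite -(ler_pXn2r (ltn0Sn 1)) ?nnegrE ?nrm_ge0 ?(ltW e0)//.
  rewrite sqr_nrm; apply: le_trans (xC _ _) _.
  have := hN k Nk; have := hN j Nj.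
  rewrite /= !sub0r !normrN !ger0_norm ?invr_ge0 ?exprn_ge0//.
  by move: (2 ^- k) (2 ^- j) => a b; lra.
have Eg : E g <= m.
  have Ex k : E g <= m + 2 ^- k + (nrm (x 0%N) + nrm (x k - x 0%N) + C) * nrm (x k - g) + 2^-1 * nrm (x k - g) ^+ 2.
    have -> : E g = E (x k + (g - x k)) by rewrite addrC subrK.
    rewrite ED (nrmBC (x k) g).
    have h1 := B_le (x k) (g - x k).
    have h2 : nrm (x k) <= nrm (x 0%N) + nrm (x k - x 0%N) by apply: le_trans (nrmD _ _); rewrite addrC subrK.
    have := lC (g - x k); rewrite ler_norml => /andP[h3 _].
    have h4 := hx k; rewrite -/(nrm _).
    have := sqr_nrm (g - x k); have := nrm_ge0 (g - x k); nra.
  have bx k : nrm (x k - x 0%N) <= 3.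
    rewrite -(ler_pXn2r (ltn0Sn 1)) ?nnegrE ?nrm_ge0// sqr_nrm.
    apply: le_trans (xC k 0%N) _.
    have : 2 ^- k <= 1 :> R by rewrite invf_le1 ?exprn_gt0// exprn_ege1// ler1n.
    by rewrite expr0 invr1; lra.
  have : (fun k => m + 2 ^- k + (nrm (x 0%N) + 3 + C) * nrm (x k - g) + 2^-1 * nrm (x k - g) ^+ 2) @ \oo --> m + 0 + (nrm (x 0%N) + 3 + C) * 0 + 2^-1 * (0 * 0).
    apply: cvgD; [apply: cvgD; [apply: cvgD => //; exact: cvg_cst|]|].
      by apply: cvgM => //; exact: cvg_cst.
    by apply: cvgM; [exact: cvg_cst|exact: cvgM].
  rewrite !mulr0 !addr0 => h; rewrite -(cvg_lim _ h)//; apply: limr_ge; first exact: cvgP h.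
  apply: nearW => k; apply: le_trans (Ex k) _; rewrite lerD2r lerD2l.
  by apply: ler_wpM2r; [exact: nrm_ge0|rewrite lerD2r lerD2l].
exists g => v; apply/eqP; rewrite eq_sym -subr_eq0 -sqrf_eq0 -[_ ^+ 2 == 0]negbK.
apply/negP => ne0.
have q0 t : 0 <= t * (B g v - l v) + 2^-1 * t ^+ 2 * B v v.
  have := mE (g + t *: v); rewrite ED !BZr BZl lZ; nra.
set b := B g v - l v in ne0 q0.
have b2 : 0 < b ^+ 2 by rewrite lt_neqAle sqr_ge0 eq_sym ne0.
(* The denominator is [B v v + 1] rather than [B v v] to include the null vectors of the form. *)
have Bv := Bpos v; have := q0 (- b / (B v v + 1)).
rewrite (_ : _ + _ = - (b ^+ 2 * (2^-1 * B v v + 1)) / (B v v + 1) ^+ 2); last first.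
  by field; rewrite gt_eqF//; lra.
rewrite mulNr oppr_ge0 leNgt divr_gt0 ?exprn_gt0//; last by lra.
by rewrite mulr_gt0//; lra.
Qed.

(** * The descent map and its orbits *)

Section descent.
Variables (J : V -> R) (g : V -> V) (C : R) (k : nat).
Local Notation rho v := (1 + nrm v).
Hypothesis C1 : 1 <= C.
Hypothesis gL : forall v w, nrm (g v - g w) <= C * (rho v + rho w) ^+ k * nrm (v - w).
Hypothesis JT : forall v w,
  `|J (v + w) - J v - B (g v) w| <= C * (rho v + rho w) ^+ k * nrm w ^+ 2.

(** The first two terms bound [nrm (g v)] by a multiple of [rho v ^+ k.+1], through [gL] between [v]
    and 0. The last one keeps the second-order error of a step below half of the gain; the 3 is
    there because [rho v] plus [1 +] the step length is at most [3 rho v]. *)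
Let M : R := nrm (g 0) + C * 2 ^+ k + 2 * C * 3 ^+ k.

(** An explicit step size, continuous in [v], takes the place of a deformation flow. One step moves
    by at most 1, so it cannot jump over the ring between the spheres of radius 1 and 2. *)
Definition step v : R := (M * rho v ^+ k.+1)^-1.
Definition Tmap v := v - step v *: g v.

Let C0 : 0 < C. Proof. exact: lt_le_trans C1. Qed.
Lemma rho_ge1 v : 1 <= rho v. Proof. by rewrite lerDl nrm_ge0. Qed.
Let rho_gt0 v : 0 < rho v. Proof. exact: lt_le_trans (rho_ge1 v). Qed.
Let M1 : 1 <= M.
Proof.
have h1 : 1 <= C * 2 ^+ k by rewrite mulr_ege1// exprn_ege1// ler1n.
have h2 : 0 <= 2 * C * 3 ^+ k by rewrite !mulr_ge0 ?exprn_ge0// ltW.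
by have := nrm_ge0 (g 0); rewrite /M; lra.
Qed.
Let M0 : 0 < M. Proof. exact: lt_le_trans M1. Qed.
Let Mrho v : 0 < M * rho v ^+ k.+1. Proof. by rewrite mulr_gt0// exprn_gt0. Qed.

Lemma step_gt0 v : 0 < step v. Proof. by rewrite invr_gt0. Qed.
Lemma step_le1 v : step v <= 1.
Proof. by rewrite invf_le1// mulr_ege1// exprn_ege1// rho_ge1. Qed.

Lemma g_le v : step v * nrm (g v) <= 1.
Proof.
rewrite /step mulrC ler_pdivrMr// mul1r.
have h : nrm (g v) <= nrm (g 0) + C * (2 * rho v) ^+ k * nrm v.
  have := nrm_dist (g v) (g 0) 0; rewrite !subr0 => /le_trans; apply.
  rewrite addrC lerD2l; apply: le_trans (gL _ _) _; rewrite nrm0 subr0.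
  apply: ler_wpM2r; first exact: nrm_ge0.
  apply: ler_wpM2l; first exact: ltW.
  have := rho_ge1 v; have := rho_ge1 0; rewrite nrm0 => _ h.
  by apply: lerXn2r; rewrite ?nnegrE; lra.
apply: le_trans h _; rewrite exprMn exprS mulrA /M.
have r1 : 1 <= rho v ^+ k by rewrite exprn_ege1// rho_ge1.
have p3 : 0 <= 2 * C * 3 ^+ k by rewrite !mulr_ge0 ?exprn_ge0// ltW.
have p2 : 0 <= C * 2 ^+ k by rewrite mulr_ge0 ?exprn_ge0// ltW.
have g0 := nrm_ge0 (g 0); have n0 := nrm_ge0 v.
move: (nrm (g 0)) (nrm v) (rho v ^+ k) (2 * C * 3 ^+ k) (C * 2 ^+ k) g0 n0 r1 p3 p2.
move=> a n r p q a0 n0 r1 p0 q0.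
rewrite -subr_ge0 (_ : _ - _ = a * ((1 + n) * r - 1) + q * r + p * (1 + n) * r); last by ring.
have r0 : 0 <= r by lra.
have : 1 <= (1 + n) * r by nra.
move=> h; rewrite !addr_ge0// !mulr_ge0//; lra.
Qed.

Lemma T_near v : nrm (Tmap v - v) = step v * nrm (g v).
Proof. by rewrite /Tmap addrC addKr nrmN nrmZ gtr0_norm ?step_gt0. Qed.

(** In [JT] with [w = - step v *: g v] the error is at most [C (3 rho v)^k step v] times the
    first-order gain [step v |g v|^2], and the choice of [M] makes that factor at most 1/2. *)
Lemma T_descent v : J (Tmap v) <= J v - 2^-1 * step v * nrm (g v) ^+ 2.
Proof.
have := JT v (- (step v *: g v)).
rewrite -/(Tmap v) BNr BZr opprK nrmN nrmZ (gtr0_norm (step_gt0 v)) -sqr_nrm.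
rewrite ler_norml => /andP[_].
have r3 : (rho v + (1 + step v * nrm (g v))) ^+ k <= (3 * rho v) ^+ k.
  have := g_le v; have := rho_ge1 v; have h := mulr_ge0 (ltW (step_gt0 v)) (nrm_ge0 (g v)) => h1 h2.
  by apply: lerXn2r; rewrite ?nnegrE; lra.
have h : C * (rho v + (1 + step v * nrm (g v))) ^+ k * step v <= 2^-1.
  apply: (@le_trans _ _ (C * (3 * rho v) ^+ k * step v)).
    apply: ler_wpM2r; first exact/ltW/step_gt0.
    by apply: ler_wpM2l => //; exact: ltW.
  rewrite /step ler_pdivrMr// exprMn exprS.
  have r1 : 1 <= rho v ^+ k by rewrite exprn_ege1// rho_ge1.
  have p3 : 0 <= C * 3 ^+ k by rewrite !mulr_ge0 ?exprn_ge0// ltW.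
  have p2 : 0 <= C * 2 ^+ k by rewrite mulr_ge0 ?exprn_ge0// ltW.
  have g0 := nrm_ge0 (g 0); have n0 := nrm_ge0 v; rewrite /M -!(mulrA 2) (mulrA C).
  move: (nrm (g 0)) (nrm v) (rho v ^+ k) (C * 3 ^+ k) (C * 2 ^+ k) g0 n0 r1 p3 p2.
  move=> a n r p q a0 n0 r1 p0 q0.
  rewrite -subr_ge0 (_ : _ - _ = 2^-1 * ((a + q) * (1 + n) * r) + p * r * n).
    by rewrite addr_ge0 ?mulr_ge0//; lra.
  by field.
have := ler_wpM2r (sqr_ge0 (nrm (g v))) (ler_wpM2r (ltW (step_gt0 v)) h).
rewrite [(step v * _) ^+ 2]exprMn.
set P := C * (1 + nrm v + (1 + step v * nrm (g v))) ^+ k.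
by move: P (step v) (nrm (g v) ^+ 2) => x y z; lra.
Qed.

Lemma T_descent0 v : J (Tmap v) <= J v.
Proof.
apply: le_trans (T_descent v) _; rewrite gerBl; apply: mulr_ge0; last exact: sqr_ge0.
by apply: mulr_ge0 => //; exact/ltW/step_gt0.
Qed.

Lemma orbit_noninc v m n : (m <= n)%N -> J (iter n Tmap v) <= J (iter m Tmap v).
Proof.
move=> /subnK <-; elim: (n - m)%N => // i ih; rewrite addSn iterS.
exact: le_trans (T_descent0 _) ih.
Qed.

(* If J is bounded below along an orbit of the descent map, then the total
   descent is finite, which prevents (1 + |v|) |g v| from staying away from 0. *)
Lemma orbit_cerami v b d : (forall n, b <= J (iter n Tmap v)) -> 0 < d ->
  exists n, rho (iter n Tmap v) * nrm (g (iter n Tmap v)) < d.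
Proof.
move=> Jb d0; apply: contrapT => /forallNP h.
have {}h n : d <= rho (iter n Tmap v) * nrm (g (iter n Tmap v)) by rewrite leNgt; exact/negP.
pose y n := iter n Tmap v; pose r n := rho (y n); pose G n := nrm (g (y n)); pose s n := step (y n).
have hs n : 2^-1 * (s n * G n ^+ 2) <= J (y n) - J (y n.+1).
  by have := T_descent (y n); rewrite -/(y n.+1) -/(s n) -/(G n); lra.
(* Discrete Gronwall: as [r G >= d], a step of length [s G] is at most [r s G^2 / d], and [s G^2] is
   at most twice the loss of [J]. Finite total descent thus bounds the norms along the orbit. *)
have rle n : r n <= r 0%N * expR (2 * (J (y 0%N) - J (y n)) / d).
  elim: n => [|n ih]; first by rewrite subrr mulr0 mul0r expR0 mulr1.
  have h1 : r n.+1 <= r n + s n * G n.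
    by have := nrm_dist (y n.+1) (y n) 0; rewrite !subr0 T_near /r /G /s -/(y n); lra.
  have h2 : s n * G n <= r n * (s n * G n ^+ 2 / d).
    rewrite mulrA ler_pdivlMr//; have := h n; rewrite -/(y n) -/(r n) -/(G n).
    have : 0 <= s n * G n by rewrite mulr_ge0 ?nrm_ge0//; exact/ltW/step_gt0.
    by move=> a b'; have := ler_wpM2l a b'; nra.
  have h3 : r n.+1 <= r n * (1 + 2 * (J (y n) - J (y n.+1)) / d).
    apply: le_trans h1 _; rewrite mulrDr mulr1 lerD2l; apply: le_trans h2 _.
    apply: ler_wpM2l; first exact/ltW/rho_gt0.
    by rewrite ler_pM2r ?invr_gt0//; have := hs n; lra.
  apply: le_trans h3 _; apply: (@le_trans _ _ (r n * expR (2 * (J (y n) - J (y n.+1)) / d))).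
    by apply: ler_wpM2l; [exact/ltW/rho_gt0|exact: expR_ge1Dx].
  apply: le_trans (ler_wpM2r (expR_ge0 _) ih) _.
  by rewrite -[X in X <= _]mulrA -expRD; apply: le_of_eq; congr (_ * expR _); field; rewrite gt_eqF.
pose Rm := r 0%N * expR (2 * (J (y 0%N) - b) / d).
have rRm n : r n <= Rm.
  apply: le_trans (rle n) _; apply: ler_wpM2l; first exact/ltW/rho_gt0.
  by rewrite ler_expR ler_pM2r ?invr_gt0//; have := Jb n; rewrite -/(y n); lra.
have Rm0 : 0 < Rm by exact: lt_le_trans (rho_gt0 _) (rRm 0%N).
(* With norms bounded by [Rm], step sizes and gradients are bounded below, so each step lowers [J]
   by at least the fixed amount [ka], against the lower bound [b]. *)
pose ka := 2^-1 * ((M * Rm ^+ k.+1)^-1 * (d / Rm) ^+ 2).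
have ka0 : 0 < ka.
  apply: mulr_gt0 => //; apply: mulr_gt0; last by rewrite exprn_gt0// divr_gt0.
  by rewrite invr_gt0 mulr_gt0// exprn_gt0.
have hk n : ka <= J (y n) - J (y n.+1).
  apply: le_trans (hs n); apply: ler_wpM2l => //; apply: ler_pM.
  - by rewrite invr_ge0 mulr_ge0 ?exprn_ge0 ?ltW.
  - exact: sqr_ge0.
  - rewrite /s /step lef_pV2 ?posrE ?mulr_gt0 ?exprn_gt0//.
    by rewrite ler_pM2l//; apply: lerXn2r; rewrite ?nnegrE; [exact: ltW|exact: ltW|exact: rRm].
  - apply: lerXn2r; rewrite ?nnegrE ?nrm_ge0 ?divr_ge0 ?(ltW d0) ?(ltW Rm0)//.
    rewrite ler_pdivrMr//; apply: le_trans (h n) _; rewrite mulrC.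
    by apply: ler_wpM2l; [exact: nrm_ge0|exact: rRm].
have hn n : n%:R * ka <= J (y 0%N) - J (y n).
  elim: n => [|n ih]; first by rewrite mul0r subrr.
  by rewrite -natr1 mulrDl mul1r; have := hk n; lra.
have := hn (Num.truncn ((J (y 0%N) - b) / ka)).+1.
rewrite leNgt => /negP; apply.
have := truncnS_gt ((J (y 0%N) - b) / ka); rewrite ltr_pdivrMr//.
by have := Jb (Num.truncn ((J (y 0%N) - b) / ka)).+1; rewrite -/(y _); lra.
Qed.

Lemma cvg_expn {I : Type} (F : set_system I) {FF : Filter F} (f : I -> R) (a : R) n :
  f i @[i --> F] --> a -> f i ^+ n @[i --> F] --> a ^+ n.
Proof.
move=> h; elim: n => [|n ih]; first by under eq_fun do rewrite expr0; exact: cvg_cst.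
by under eq_fun do rewrite exprS; rewrite exprS; exact: cvgM.
Qed.

Section continuity.
Context {I : Type} (F : set_system I) {FF : ProperFilter F}.
Implicit Types x y : I -> V.

Definition nrm_cvg x l := nrm (x i - l) @[i --> F] --> 0.

Lemma cvgN_nrm x l : nrm_cvg x l -> nrm (x i) @[i --> F] --> nrm l.
Proof.
move=> h; apply/cvgrPdist_le => e e0; move/cvgrPdist_le : h => /(_ e e0).
apply: filterS => i; rewrite sub0r normrN ger0_norm ?nrm_ge0// => h.
by rewrite distrC; exact: le_trans (nrm_absB _ _) h.
Qed.

Lemma cvgN_le x l (h : I -> R) : (forall i, nrm (x i - l) <= h i) ->
  h i @[i --> F] --> 0 -> nrm_cvg x l.
Proof.
move=> xh h0; apply: (@squeeze_cvgr _ _ _ _ (fun=> 0) h) => //; last exact: cvg_cst.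
by apply: nearW => i; rewrite nrm_ge0 xh.
Qed.

Let cvgk x l : nrm_cvg x l ->
  C * (rho (x i) + rho l) ^+ k * nrm (x i - l) @[i --> F] --> 0.
Proof.
move=> h; rewrite [X in _ --> X](_ : _ = C * (rho l + rho l) ^+ k * 0); last by rewrite mulr0.
apply: cvgM => //; apply: cvgM; first exact: cvg_cst.
apply: cvg_expn.
by apply: cvgD; [apply: cvgD; [exact: cvg_cst|exact: cvgN_nrm]|exact: cvg_cst].
Qed.

Lemma cvgN_g x l : nrm_cvg x l -> nrm_cvg (g \o x) (g l).
Proof. by move=> h; apply: cvgN_le (cvgk h) => i; exact: gL. Qed.

Lemma cvgN_J x l : nrm_cvg x l -> J (x i) @[i --> F] --> J l.
Proof.
move=> h.
have h1 : nrm (g l) * nrm (x i - l) + C * (rho l + rho (x i - l)) ^+ k * nrm (x i - l) ^+ 2 @[i --> F] --> 0.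
  rewrite [X in _ --> X](_ : _ = nrm (g l) * 0 + C * (rho l + (1 + 0)) ^+ k * 0 ^+ 2); last by rewrite expr0n/= !mulr0 addr0.
  apply: cvgD; apply: cvgM; rewrite ?expr2; try (exact: cvg_cst); try (exact: cvgM); rewrite -?expr2 //.
    apply: cvgM; first exact: cvg_cst.
    by apply: cvg_expn; apply: cvgD; [exact: cvg_cst|apply: cvgD => //; exact: cvg_cst].
apply/cvgrPdist_le => e e0; move/cvgrPdist_le : h1 => /(_ e e0).
apply: filterS => i; rewrite sub0r normrN => he; apply: le_trans he.
apply: le_trans (ler_norm _).
have := JT l (x i - l); rewrite (addrC l) subrK => hJ.
rewrite distrC; have -> : J (x i) - J l = B (g l) (x i - l) + (J (x i) - J l - B (g l) (x i - l)) by ring.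
by apply: le_trans (ler_normD _ _) _; apply: lerD => //; exact: B_CS.
Qed.

Lemma cvgN_T x l : nrm_cvg x l -> nrm_cvg (Tmap \o x) (Tmap l).
Proof.
move=> h.
have hs : step (x i) @[i --> F] --> step l.
  apply: cvgV; first by rewrite gt_eqF.
  apply: cvgM; first exact: cvg_cst.
  apply: cvg_expn.
  by apply: cvgD; [exact: cvg_cst|exact: cvgN_nrm].
apply: (@cvgN_le _ _ (fun i => nrm (x i - l) + nrm (g (x i) - g l) + `|step (x i) - step l| * nrm (g l))).
  move=> i; rewrite /Tmap/=.
  rewrite (_ : _ - _ = (x i - l) - step (x i) *: (g (x i) - g l) - (step (x i) - step l) *: g l); last first.
    rewrite scalerBr scalerBl -[RHS]addrA -opprD addrA subrK.
    by rewrite !opprD !opprK addrACA.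
  apply: le_trans (nrmB _ _) _; rewrite nrmZ lerD2r; apply: le_trans (nrmB _ _) _.
  rewrite lerD2l nrmZ gtr0_norm ?step_gt0//; apply: ler_piMl; [exact: nrm_ge0|exact: step_le1].
rewrite [X in _ --> X](_ : _ = 0 + 0 + `|step l - step l| * nrm (g l)); last first.
  by rewrite subrr normr0 mul0r !addr0.
apply: cvgD; first by apply: cvgD => //; exact: cvgN_g.
apply: cvgM; last exact: cvg_cst.
by apply: cvg_norm; apply: cvgB => //; exact: cvg_cst.
Qed.

Lemma cvgN_iter x l n : nrm_cvg x l -> nrm_cvg (fun i => iter n Tmap (x i)) (iter n Tmap l).
Proof. by move=> h; elim: n => // n ih; exact: cvgN_T ih. Qed.

End continuity.

(** * Cerami points on both sides of an energy barrier *)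

Section two_points.
Variables (beta b : R) (e : V).
Hypotheses (beta_gt0 : 0 < beta) (J0 : J 0 = 0)
  (Jring : forall v, 1 <= nrm v <= 2 -> beta <= J v)
  (Jball : forall v, nrm v < 1 -> - b <= J v)
  (Je : J e < - b).
Local Notation inA v := (nrm v < 1 /\ J v < beta).

(** A step has length at most 1, so leaving the unit ball would lead into the ring, where [J] is at
    least [beta]; but [J] does not increase along a step. *)
Lemma inA_T v : inA v -> inA (Tmap v).
Proof.
move=> [v1 Jv]; have JT' := T_descent0 v; split; last exact: le_lt_trans JT' Jv.
rewrite ltNge; apply/negP => T1.
have : beta <= J (Tmap v).
  apply: Jring; rewrite T1/=; have := nrm_dist (Tmap v) v 0; rewrite !subr0 T_near.
  by have := g_le v; lra.
by rewrite leNgt (le_lt_trans JT' Jv).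
Qed.

Lemma inA_iter v n : inA v -> inA (iter n Tmap v).
Proof. by move=> h; elim: n => // n; exact: inA_T. Qed.

Lemma inA_J v n : inA v -> - b <= J (iter n Tmap v).
Proof. by move=> h; apply: Jball; have [] := inA_iter n h. Qed.

Lemma inA0 : inA 0. Proof. by rewrite nrm0 J0. Qed.

Lemma inner_cerami d : 0 < d ->
  exists v, [/\ inA v, J v <= 0 & (1 + nrm v) * nrm (g v) < d].
Proof.
move=> d0; have [n hn] := @orbit_cerami 0 (- b) d (fun n => inA_J n inA0) d0.
exists (iter n Tmap 0); split => //; first exact: inA_iter inA0.
by have := orbit_noninc 0 (leq0n n); rewrite /= J0.
Qed.

(* The boundary of the set of starting points whose descent orbit drops below
   -b consists of points whose orbit stays outside the well around 0. *)
Lemma outer_cerami : exists Jm, forall d, 0 < d ->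
  exists v, [/\ ~ inA v, - b <= J v <= Jm & (1 + nrm v) * nrm (g v) < d].
Proof.
pose S := [set t : R | 0 <= t /\ exists n, J (iter n Tmap (t *: e)) < - b].
have S1 : S 1 by split=> //; exists 0%N; rewrite /= scale1r.
have hS : has_inf S by split; [exists 1|exists 0 => t []].
pose ts := inf S.
have ts0 : 0 <= ts by apply: lb_le_inf; [exists 1|move=> t []].
have cN (t : R) : nrm_cvg (nbhs t) (fun s : R => s *: e) (t *: e).
  rewrite /nrm_cvg.
  rewrite [X in _ --> X](_ : _ = `|t - t| * nrm e); last by rewrite subrr normr0 mul0r.
  under eq_fun do rewrite -scalerBl nrmZ.
  by apply: cvgM; [apply: cvg_norm; apply: cvgB => //; exact: cvg_cst|exact: cvg_cst].
(* Each iterate depends continuously on [t], so a positive infimum belonging to [S] could be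
   lowered; 0 is not in [S] because its orbit stays in the well. *)
have notS : ~ S ts.
  move=> [_ [n hn]].
  have : 0 < ts.
    rewrite lt_neqAle ts0 andbT; apply/eqP => t0.
    by move: hn; rewrite -t0 scale0r ltNge (inA_J n inA0).
  move=> tp.
  have /cvgrPdist_lt h1 : J (iter n Tmap (s *: e)) @[s --> ts] --> J (iter n Tmap (ts *: e)).
    exact: cvgN_J (cvgN_iter n (cN ts)).
  have := h1 (- b - J (iter n Tmap (ts *: e))).
  rewrite subr_gt0 => /(_ hn) [r /= r0 hr].
  pose t := ts - Num.min (r / 2) ts.
  have m0 : 0 < Num.min (r / 2) ts by rewrite lt_min tp divr_gt0.
  have m1 : Num.min (r / 2) ts <= ts by rewrite ge_min lexx orbT.
  have m2 : Num.min (r / 2) ts <= r / 2 by rewrite ge_min lexx.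
  have : ts <= t.
    apply: ge_inf; first exact: hS.2.
    split; first by rewrite /t; lra.
    have tr : `|ts - t| < r by rewrite /t opprB addrC subrK ger0_norm; lra.
    by exists n; have := hr t tr; rewrite /= ltr_norml => /andP[h2 h3]; lra.
  by rewrite /t; lra.
pose y n := iter n Tmap (ts *: e).
have Jy n : - b <= J (y n) by rewrite leNgt; apply/negP => h; apply: notS; split => //; exists n.
(* If an iterate of the limit orbit were in the well, so would be the same iterate for parameters of
   [S] close to [ts]. Such an orbit stays above [- b] from then on, and earlier its energy was at
   least as large, so the parameter is not in [S]. *)
have yA n : ~ inA (y n).
  move=> [n1 J1].
  have /cvgrPdist_lt h1 : nrm (iter n Tmap (s *: e)) @[s --> ts] --> nrm (iter n Tmap (ts *: e)).
    exact: cvgN_nrm (cvgN_iter n (cN ts)).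
  have := h1 (1 - nrm (y n)).
  rewrite subr_gt0 => /(_ n1) [r1 /= r10 hr1].
  have /cvgrPdist_lt h1' : J (iter n Tmap (s *: e)) @[s --> ts] --> J (iter n Tmap (ts *: e)).
    exact: cvgN_J (cvgN_iter n (cN ts)).
  have := h1' (beta - J (y n)).
  rewrite subr_gt0 => /(_ J1) [r2 /= r20 hr2].
  pose r := Num.min r1 r2; have r0 : 0 < r by rewrite lt_min r10.
  have [t [t0 [m hm]] tlt] := @inf_adherent _ S r r0 hS.
  have tts : `|ts - t| < r.
    rewrite distrC ger0_norm; first by rewrite ltrBlDr addrC.
    by rewrite subr_ge0; apply: ge_inf; [exact: hS.2|split=> //; exists m].
  have At : inA (iter n Tmap (t *: e)).
    have t1 : `|ts - t| < r1 by rewrite (lt_le_trans tts)// ge_min lexx.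
    have t2 : `|ts - t| < r2 by rewrite (lt_le_trans tts)// ge_min lexx orbT.
    have := hr1 t t1; have := hr2 t t2; rewrite /= !ltr_norml -/(y n).
    by move=> /andP[h3 h4] /andP[h5 h6]; split; lra.
  move: hm; rewrite ltNge => /negP; apply.
  have [mn|nm] := leqP m n.
    by apply: le_trans (orbit_noninc (t *: e) mn); apply: Jball; have [] := At.
  by rewrite -(subnK (ltnW nm)) iterD; exact: inA_J.
exists (J (y 0%N)) => d d0; have [n hn] := orbit_cerami Jy d0.
by exists (y n); split => //; rewrite Jy (orbit_noninc _ (leq0n n)).
Qed.

End two_points.
End descent.
End semi_hilbert.

(** * Smooth and test functions *)

Section line_derivative.
Context (R : realType) (V : normedModType R).
Implicit Types (F : V -> R) (x v : V).

Let lineE F x v (t : R) :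
  (fun h : R => h^-1 *: (((fun s : R => F (s *: v + x)) \o shift t) (h *: (1:R)) - F (t *: v + x))) =
  (fun h : R => h^-1 *: ((F \o shift (t *: v + x)) (h *: v) - F (t *: v + x))).
Proof.
apply/funext => h; congr (_ *: (_ - _)) => /=.
by congr F; rewrite scalerDl addrA /GRing.scale/= mulr1.
Qed.

Lemma is_derive_line F x v (t d : R) :
  is_derive (t *: v + x) v F d <-> is_derive t 1 (fun s : R => F (s *: v + x)) d.
Proof.
by split => -[h1 h2]; split; move: h1 h2; rewrite /derivable /derive lineE.
Qed.

Lemma is_derive_line0 F x v (d : R) :
  is_derive x v F d <-> is_derive (0:R) 1 (fun s : R => F (s *: v + x)) d.
Proof. by rewrite -is_derive_line scale0r add0r. Qed.

End line_derivative.

Section smooth_functions.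
Context {R : realType} {n : nat}.
Local Notation X := 'rV[R]_n.
Implicit Types (u v phi : X -> R) (i : 'I_n).
Local Notation "'e_ i" := (delta_mx 0 i : X) (at level 8, i at level 2).

Definition C1part u := continuous u /\ forall i x, derivable u x ('e_ i).

(** [smooth] quantifies over all words of partial derivatives, and a class stable under each partial
    derivative is stable under words. *)
Lemma smooth_ind (P : (X -> R) -> Prop) :
  (forall u, P u -> C1part u) -> (forall u i, P u -> P (partial i u)) ->
  forall u, P u -> smooth u.
Proof.
move=> h1 h2 u Pu s; suff : P (foldr (@partial R n) u s) by move=> /h1.
by elim: s => //= i s ih; exact: h2.
Qed.

Lemma smooth_C1 u : smooth u -> C1part u. Proof. by move=> /(_ [::]). Qed.
Lemma smooth_partial u i : smooth u -> smooth (partial i u).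
Proof. by move=> h s; have := h (rcons s i); rewrite foldr_rcons. Qed.
Lemma smooth_cont u : smooth u -> continuous u. Proof. by move=> /smooth_C1[]. Qed.

(** The algebra generated by the smooth functions. The Leibniz rule makes it stable under partial
    derivatives, so [smooth_ind] settles sums and products together; products alone are not a stable
    class. *)
Inductive salg : (X -> R) -> Prop :=
| salg_s u of smooth u : salg u
| salg_c (c : R) : salg (fun=> c)
| salg_D u v of salg u & salg v : salg (fun x => u x + v x)
| salg_M u v of salg u & salg v : salg (fun x => u x * v x).

Lemma partialE u i x (d : R) : is_derive x ('e_ i) u d -> partial i u x = d.
Proof. by move=> h; rewrite /partial derive_val. Qed.

Lemma partialD u v i : C1part u -> C1part v ->
  partial i (fun x => u x + v x) = (fun x => partial i u x + partial i v x).
Proof.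
move=> [_ du] [_ dv]; apply/funext => x; apply: partialE.
by apply: is_deriveD; apply: DeriveDef.
Qed.
Lemma partialM u v i : C1part u -> C1part v ->
  partial i (fun x => u x * v x) = (fun x => u x * partial i v x + v x * partial i u x).
Proof.
move=> [_ du] [_ dv]; apply/funext => x; apply: partialE.
by apply: is_deriveM; apply: DeriveDef.
Qed.
Lemma partial_cst (c : R) i : partial i (fun=> c) = fun=> 0.
Proof. by apply/funext => x; apply: partialE; exact: is_derive_cst. Qed.
Lemma C1part_cst (c : R) : C1part (fun=> c).
Proof. by split => [|i x]; [exact: cst_continuous|exact: derivable_cst]. Qed.
Lemma C1partD u v : C1part u -> C1part v -> C1part (fun x => u x + v x).
Proof.
by move=> [cu du] [cv dv]; split => [x|i x]; [exact: cvgD (cu x) (cv x)|exact: derivableD].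
Qed.
Lemma C1partM u v : C1part u -> C1part v -> C1part (fun x => u x * v x).
Proof.
by move=> [cu du] [cv dv]; split => [x|i x]; [exact: cvgM (cu x) (cv x)|exact: derivableM].
Qed.

Lemma salg_C1 u : salg u -> C1part u.
Proof.
by elim=> {u} [u /smooth_C1//|c|u v _ + _|u v _ + _]; [exact: C1part_cst|exact: C1partD|exact: C1partM].
Qed.

Lemma salg_smooth u : salg u -> smooth u.
Proof.
apply: smooth_ind => {}u; first exact: salg_C1.
move=> i; elim=> {u} [u su|c|u v su hu sv hv|u v su hu sv hv].
- by apply: salg_s; exact: smooth_partial.
- by rewrite partial_cst; exact: salg_c.
- by rewrite partialD; [exact: salg_D|exact: salg_C1|exact: salg_C1].
- by rewrite partialM; [apply: salg_D; exact: salg_M|exact: salg_C1|exact: salg_C1].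
Qed.

Lemma smooth_cst (c : R) : smooth (fun _ : X => c).
Proof. exact/salg_smooth/salg_c. Qed.
Lemma smoothD u v : smooth u -> smooth v -> smooth (fun x => u x + v x).
Proof. by move=> su sv; apply: salg_smooth; apply: salg_D; exact: salg_s. Qed.
Lemma smoothM u v : smooth u -> smooth v -> smooth (fun x => u x * v x).
Proof. by move=> su sv; apply: salg_smooth; apply: salg_M; exact: salg_s. Qed.
Lemma smoothZ (c : R) u : smooth u -> smooth (fun x => c * u x).
Proof. exact/smoothM/smooth_cst. Qed.
Lemma smooth_prod (I : Type) (s : seq I) (f : I -> X -> R) :
  (forall j : I, smooth (f j)) -> smooth (fun x => \prod_(i <- s) f i x).
Proof.
move=> sf; elim: s => [|i s ih].
  by under eq_fun do rewrite big_nil; exact: smooth_cst.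
under eq_fun do rewrite big_cons.
exact: smoothM (sf i) ih.
Qed.

Lemma smooth_horner (p : {poly R}) u : smooth u -> smooth (fun x => p.[u x]).
Proof.
move=> su; elim/poly_ind: p => [|p c ih].
  by under eq_fun do rewrite horner0; exact: smooth_cst.
by under eq_fun do rewrite hornerMXaddC; apply: smoothD (smooth_cst c); exact: smoothM.
Qed.

Lemma partial_horner (p : {poly R}) u i x : smooth u ->
  partial i (fun x => p.[u x]) x = (p^`()).[u x] * partial i u x.
Proof.
move=> su; elim/poly_ind: p => [|p c ih].
  under eq_fun do rewrite horner0; rewrite partial_cst deriv0 horner0 mul0r//.
have h : C1part (fun x => p.[u x]) by apply/smooth_C1/smooth_horner.
under eq_fun do rewrite hornerMXaddC.
have h1 := partialD i (C1partM h (smooth_C1 su)) (C1part_cst c).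
have h2 := partialM i h (smooth_C1 su).
rewrite h1 h2 partial_cst ih derivMXaddC hornerD hornerMX; ring.
Qed.

(** [F] lists a function of one variable and its successive derivatives; the multiples of the
    functions [F k (a x_i + c)] form a class stable under partial derivatives. *)
Lemma smooth_coord (F : nat -> R -> R) (a c : R) i :
  (forall k (t : R), is_derive t 1 (F k) (F k.+1 t)) ->
  smooth (fun x : X => F 0%N (a * x 0 i + c)).
Proof.
move=> hF; pose P u := exists (k : nat) (b : R), u = (fun x : X => b * F k (a * x 0 i + c)).
have der k x j : is_derive x ('e_ j) (fun x : X => F k (a * x 0 i + c))
    (F k.+1 (a * x 0 i + c) * (a * ((j == i)%:R))).
  apply/is_derive_line0.
  rewrite (_ : (fun s : R => _) = F k \o (fun s : R => a * (s * (j == i)%:R + x 0 i) + c)); last first.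
    by apply/funext => s /=; rewrite !mxE eqxx/= eq_sym.
  have := @is_derive1_comp _ (F k) (fun s : R => a * (s * (j == i)%:R + x 0 i) + c) 0
    (F k.+1 (a * x 0 i + c)) (a * (j == i)%:R).
  apply; first by rewrite mul0r add0r.
  apply: is_derive_eq; rewrite !(scaler0, scaler1, addr0, add0r).
  by [].
have cF k : continuous (F k).
  by move=> t; apply: differentiable_continuous; apply/derivable1_diffP; have [] := hF k t.
apply: (@smooth_ind P) => [_ [k [b ->]]|_ j [k [b ->]]|]; last first.
- by exists 0%N, 1; apply/funext => x; rewrite mul1r.
- exists k.+1, (b * (a * (j == i)%:R)); apply/funext => x; apply: partialE.
  apply: (is_derive_eq (is_deriveZ b (der k x j))).
  by rewrite /GRing.scale/=; ring.
split=> [x|j x].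
  have h : F k (a * (y : X) 0 i + c) @[y --> x] --> F k (a * x 0 i + c).
    have hc : a * (y : X) 0 i + c @[y --> x] --> a * x 0 i + c.
      have hi : (y : X) 0 i @[y --> x] --> x 0 i by exact: coord_continuous.
      exact: cvgD (cvgM (cvg_cst a) hi) (cvg_cst c).
    exact: (@continuous_comp X R R (fun y : X => a * y 0 i + c) (F k) x hc (cF k _)).
  exact: cvgM (cvg_cst b) h.
by apply: derivableM; [exact: derivable_cst|have [] := der k x j].
Qed.

End smooth_functions.

(** * A smooth function that is positive exactly on a half-line *)

Section bump.
Context {R : realType}.
Implicit Types (p : {poly R}) (t : R).

(** The polynomial factor makes the family stable under differentiation: the derivative replaces p
    by X^2 (p - p'). One statement then covers all derivatives of the bump. *)
Definition bumpp p t : R := if 0 < t then p.[t^-1] * expR (- t^-1) else 0.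

Lemma horner_bound p : exists (k : nat) (C : R), forall s, 1 <= s -> `|p.[s]| <= C * s ^+ k.
Proof.
elim/poly_ind: p => [|p c [k [C h]]].
  by exists 0%N, 0 => s _; rewrite horner0 normr0 mul0r.
exists k.+1, (C + `|c|) => s s1; rewrite hornerMXaddC.
apply: le_trans (ler_normD _ _) _; rewrite normrM (ger0_norm (le_trans ler01 s1)) mulrDl.
apply: lerD; first by rewrite exprSr mulrA ler_wpM2r// ?(le_trans ler01 s1)//; exact: h.
by apply: ler_peMr => //; exact: exprn_ege1.
Qed.

(** This is the [k]-th power of [x <= expR x] at [x = s / k.+1], with the exponent [k s / k.+1] then
    enlarged to [s]. *)
Lemma pow_exp_le (k : nat) (s : R) : 0 <= s -> s ^+ k <= (k.+1)%:R ^+ k * expR s.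
Proof.
move=> s0; have k0 : 0 < k.+1%:R :> R by rewrite ltr0n.
have h : (s / k.+1%:R) <= expR (s / k.+1%:R).
  by apply: le_trans (expR_ge1Dx _); rewrite lerDr.
have {}h : (s / k.+1%:R) ^+ k <= expR (s / k.+1%:R) ^+ k.
  by apply: lerXn2r; rewrite ?nnegrE ?divr_ge0 ?expR_ge0.
rewrite -[X in X ^+ _ <= _](divfK (lt0r_neq0 k0)) exprMn mulrC.
apply: ler_wpM2l; first exact/exprn_ge0/ltW.
apply: le_trans h _; rewrite -expRM_natl ler_expR mulrA ler_pdivrMr// mulrC.
by apply: ler_wpM2l => //; rewrite ler_nat.
Qed.

Lemma is_derive_bumpp p t : is_derive t 1 (bumpp p) (bumpp ('X^2 * (p - p^`())) t).
Proof.
have [t0|t0|->] := ltgtP t 0.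
- have e : \forall s \near t, (fun _ : R => 0 : R) s = bumpp p s.
    near=> s; have s0 : s < 0 by near: s; exact: lt_nbhsl.
    by rewrite /bumpp ltNge (ltW s0).
  rewrite {2}/bumpp ltNge (ltW t0)/=.
  exact: near_eq_is_derive e (is_derive_cst _ _ _).
- have e : \forall s \near t, (fun s : R => p.[s^-1] * expR (- s^-1)) s = bumpp p s.
    near=> s; have s0 : 0 < s by near: s; exact: lt_nbhsr.
    by rewrite /bumpp s0.
  rewrite {2}/bumpp t0; apply: near_eq_is_derive e _.
  have tn : t != 0 by rewrite gt_eqF.
  have d1 : is_derive t 1 (fun s : R => s^-1) (- t ^- 2 *: 1) by exact: is_deriveV.
  have d2 : is_derive t 1 (horner p \o (fun s : R => s^-1)) ((p^`()).[t^-1] * (- t ^- 2 *: 1)).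
    by apply: is_derive1_comp.
  have d3 : is_derive t 1 (expR \o (fun s : R => - s^-1)) (expR (- t^-1) * - (- t ^- 2 *: 1)).
    by apply: is_derive1_comp.
  apply: (is_derive_eq (is_deriveM d2 d3)).
  rewrite hornerM hornerXn hornerD hornerN /GRing.scale/= exprVn; ring.
rewrite {2}/bumpp ltxx.
have [k [C hC]] := horner_bound p.
pose K := Num.max C 0 * k.+3%:R ^+ k.+2.
(* At the origin the exponential beats every power of [h^-1]; a quadratic bound is enough for the
   difference quotient to tend to 0. *)
have hb (h : R) : 0 < h < 1 -> `|bumpp p h| <= K * h ^+ 2.
  move=> /andP[h0 h1]; rewrite /bumpp h0 normrM (ger0_norm (expR_ge0 _)).
  have s1 : 1 <= h^-1 by rewrite invf_ge1// ltW.
  have s0 : 0 <= h^-1 by exact: le_trans s1.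
  have := hC _ s1; have := pow_exp_le k.+2 s0.
  rewrite expRN => h2 h3.
  have C0 : 0 <= Num.max C 0 by rewrite le_max lexx orbT.
  have h4 : `|p.[h^-1]| <= Num.max C 0 * h^-1 ^+ k.
    by apply: le_trans h3 _; apply: ler_wpM2r; [exact: exprn_ge0|rewrite le_max lexx].
  rewrite ler_pdivrMr ?expR_gt0//; apply: le_trans h4 _.
  rewrite (_ : K * h ^+ 2 * _ = Num.max C 0 * (h ^+ 2 * (k.+3%:R ^+ k.+2 * expR h^-1))); last first.
    by rewrite /K; move: (k.+3%:R ^+ k.+2) => q; ring.
  apply: ler_wpM2l => //; apply: le_trans (ler_wpM2l (sqr_ge0 h) h2).
  rewrite [h^-1 ^+ k.+2]exprS [h^-1 ^+ k.+1]exprS; set q := h^-1 ^+ k.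
  by apply: le_of_eq; field; rewrite gt_eqF.
have K0 : 0 <= K by rewrite mulr_ge0 ?exprn_ge0// le_max lexx orbT.
have D0 : (fun h : R => h^-1 *: ((bumpp p \o shift 0) (h *: (1:R)) - bumpp p 0)) @ 0^' --> (0 : R).
  apply/cvgrPdist_le => e e0.
  exists (Num.min 1 (e / (K + 1))) => /=; first by rewrite lt_min ltr01 divr_gt0//; lra.
  move=> h /=; rewrite sub0r normrN lt_min => /andP[h1 he] hn0.
  rewrite sub0r normrN /shift/= {2}/bumpp ltxx subr0 addr0 normrM /GRing.scale/= mulr1.
  have [hpos|hneg] := ltP 0 h; last by rewrite /bumpp ltNge hneg/= normr0 mulr0 ltW.
  rewrite (gtr0_norm hpos) in h1 he.
  rewrite ger0_norm ?invr_ge0 ?(ltW hpos)// mulrC ler_pdivrMr//.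
  apply: le_trans (hb h _) _; first by rewrite hpos.
  rewrite expr2 mulrA; apply: ler_wpM2r; first exact: ltW.
  by move: he; rewrite ltr_pdivlMr; lra.
apply: DeriveDef; first by apply/cvg_ex; exists 0.
exact: (cvg_lim (@norm_hausdorff _ _) D0).
Unshelve. all: by end_near.
Qed.

Definition bump := bumpp 1.

Lemma bump_family : exists F : nat -> R -> R,
  F 0%N = bump /\ forall k (t : R), is_derive t 1 (F k) (F k.+1 t).
Proof.
exists (fun k => bumpp (iter k (fun p => 'X^2 * (p - p^`())) 1)); split => // k t.
exact: is_derive_bumpp.
Qed.

Lemma bump_gt0 t : (0 < bump t) = (0 < t).
Proof. by rewrite /bump /bumpp; case: ifP => // _; rewrite ?ltxx// hornerC mul1r expR_gt0. Qed.
Lemma bump_ge0 t : 0 <= bump t.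
Proof. by rewrite /bump /bumpp; case: ifP => // _; rewrite hornerC mul1r expR_ge0. Qed.
Lemma bump_le1 t : bump t <= 1.
Proof.
rewrite /bump /bumpp; case: ifP => // t0; rewrite hornerC mul1r -[leRHS]expR0 ler_expR.
by rewrite oppr_le0 invr_ge0 ltW.
Qed.

End bump.

(** * Stability properties of test functions *)

Section test_functions.
Context {R : realType} {n : nat}.
Local Notation X := 'rV[R]_n.
Variable Om : set X.
Implicit Types (u v phi : X -> R) (i : 'I_n).

Let supp u := closure [set x | u x != 0].

Lemma test_smooth phi : test_function Om phi -> smooth phi. Proof. by case. Qed.

Lemma test_sub phi u : test_function Om phi -> smooth u ->
  (forall x, phi x = 0 -> u x = 0) -> test_function Om u.
Proof.
move=> [_ ck kOm] su h.
have sub : supp u `<=` supp phi.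
  apply: closure_subset => x /=; apply: contra => /eqP/h ->//.
split => //; last exact: subset_trans kOm.
exact: subclosed_compact (@closed_closure _ _) ck sub.
Qed.

Lemma testM phi u : test_function Om phi -> smooth u -> test_function Om (fun x => phi x * u x).
Proof.
move=> tp su; apply: (test_sub tp); first by apply: smoothM => //; exact: test_smooth.
by move=> x ->; rewrite mul0r.
Qed.

Lemma testZ (c : R) phi : test_function Om phi -> test_function Om (fun x => c * phi x).
Proof.
move=> tp; under eq_fun do rewrite mulrC.
by apply: testM => //; exact: smooth_cst.
Qed.

Lemma testD phi psi : test_function Om phi -> test_function Om psi ->
  test_function Om (fun x => phi x + psi x).
Proof.
move=> [sp cp pO] [sq cq qO].
have sub : supp (fun x => phi x + psi x) `<=` supp phi `|` supp psi.
  rewrite -closureU; apply: closure_subset => x /=.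
  by have [->|h _] := eqVneq (phi x) 0; [rewrite add0r; right|left].
split; first exact: smoothD.
- apply: (subclosed_compact (@closed_closure _ _) _ sub); exact: compactU.
- by apply: subset_trans sub _ => x [/pO|/qO].
Qed.

Lemma test0 : test_function Om (fun=> 0).
Proof.
have e : [set x : X | (0:R) != 0] = set0 by apply/seteqP; split => x //=; rewrite eqxx.
split; first exact: smooth_cst.
- by rewrite e closure0; exact: compact0.
- by rewrite e closure0.
Qed.

Lemma test_horner (p : {poly R}) phi : p.[0] = 0 -> test_function Om phi ->
  test_function Om (fun x => p.[phi x]).
Proof.
move=> p0 tp; apply: (test_sub tp); first exact/smooth_horner/test_smooth.
by move=> x ->.
Qed.

Lemma partial_supp phi i x : ~ supp phi x -> partial i phi x = 0.
Proof.
move=> nx; have : \forall y \near x, (fun=> 0) y = phi y.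
  have : (~` supp phi) x by [].
  have oC : open (~` supp phi) by exact/closed_openC/closed_closure.
  move=> h; apply: filterS (open_nbhs_nbhs (conj oC h)) => y ny.
  by apply/esym/eqP; apply: contra_notT ny => /= ny; exact: subset_closure.
by move=> e; rewrite /partial -(near_eq_derive _ e) derive_cst.
Qed.

Lemma test_partial phi i : test_function Om phi -> test_function Om (partial i phi).
Proof.
move=> tp; have [sp cp pO] := tp; have sub : supp (partial i phi) `<=` supp phi.
  rewrite (_ : supp phi = closure (supp phi)); last exact/closure_id/closed_closure.
  apply: closure_subset => x /=; apply: contraNP; move=> h; apply/eqP.
  exact: partial_supp.
split; first exact: smooth_partial.
  exact: (subclosed_compact (@closed_closure _ _) cp sub).
exact: subset_trans pO.
Qed.

Lemma test_out phi x : test_function Om phi -> ~ Om x -> phi x = 0.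
Proof.
move=> [_ _ pO] nx; apply/eqP; apply: contra_notT nx => h.
by apply: pO; exact: subset_closure.
Qed.

Lemma test_bounded phi : test_function Om phi -> exists2 M, 0 <= M & forall x, `|phi x| <= M.
Proof.
move=> [sp cp _]; have [M [Mr hM]] : bounded_set (phi @` supp phi).
  apply: compact_bounded; apply: continuous_compact => //.
  by apply: continuous_subspaceT; exact: smooth_cont.
exists (Num.max M 0 + 1) => [|x].
  by rewrite addr_ge0// le_max lexx orbT.
have M1 : M < Num.max M 0 + 1 by rewrite (@le_lt_trans _ _ (Num.max M 0)) ?le_max ?lexx// ltrDl.
have [->|h] := eqVneq (phi x) 0.
  by rewrite normr0 addr_ge0// le_max lexx orbT.
by apply: hM M1 _ _; exists x => //; exact: subset_closure.
Qed.

End test_functions.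

(** * Product integration and the Poincare inequality on cubes *)

Section ge0_integrals.
Context d (T : measurableType d) (R : realType) (mu : {measure set T -> \bar R}).
Local Open Scope ereal_scope.

(* No measurability is needed: the integral of a nonnegative function is a
   supremum over the simple functions below it. *)
Lemma ge0_int_le (D : set T) (f g : T -> \bar R) :
  (forall x, D x -> 0 <= f x) -> (forall x, D x -> f x <= g x) ->
  \int[mu]_(x in D) f x <= \int[mu]_(x in D) g x.
Proof.
move=> f0 fg; have g0 x : D x -> 0 <= g x by move=> Dx; exact: le_trans (f0 x Dx) (fg x Dx).
rewrite !ge0_integralE//; apply: ereal_sup_le => _ /= [h hf <-].
exists h => // x; apply: le_trans (hf x) _.
by rewrite !patchE; case: ifPn => // /set_mem; exact: fg.
Qed.

Lemma ge0_int_lin (D : set T) (f g : T -> \bar R) (a b : R) : measurable D ->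
  (0 <= a)%R -> (0 <= b)%R -> measurable_fun D f -> measurable_fun D g ->
  (forall x, D x -> 0 <= f x) -> (forall x, D x -> 0 <= g x) ->
  \int[mu]_(x in D) (a%:E * f x + b%:E * g x) =
  a%:E * \int[mu]_(x in D) f x + b%:E * \int[mu]_(x in D) g x.
Proof.
move=> mD a0 b0 mf mg f0 g0; rewrite ge0_integralD//.
- by rewrite !ge0_integralZl.
- by move=> x Dx; rewrite mule_ge0 ?f0.
- exact: measurable_funeM.
- by move=> x Dx; rewrite mule_ge0 ?g0.
- exact: measurable_funeM.
Qed.
End ge0_integrals.

(** * Slices of functions on R^(n+1) and iterated integrals *)

Section slices.
Context {R : realType}.
Local Notation X n := 'rV[R]_n.
Local Notation leb := (@lebesgue_rV R).

Lemma cons_rVD n (t s : R) (x y : X n) :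
  cons_rV (t + s, x + y) = cons_rV (t, x) + cons_rV (s, y).
Proof.
apply/rowP => i; rewrite !mxE; case: unliftP => [j|] _ //=; by rewrite !mxE.
Qed.

Lemma cons_rVZ n (h t : R) (x : X n) : cons_rV (h * t, h *: x) = h *: cons_rV (t, x).
Proof. by apply/rowP => i; rewrite !mxE; case: unliftP => [j|] _ //=; rewrite !mxE. Qed.

Lemma cons_rV_lift n (j : 'I_n) : cons_rV (0 : R, delta_mx 0 j : X n) = delta_mx 0 (lift ord0 j).
Proof.
apply/rowP => i; rewrite !mxE; case: unliftP => [k ->|->] //=; rewrite ?mxE//=.
Qed.

Lemma cons_rV_e0 n : cons_rV (1 : R, 0 : X n) = delta_mx 0 ord0.
Proof. by apply/rowP => i; rewrite !mxE; case: unliftP => [k ->|->] //=; rewrite ?mxE. Qed.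

Lemma cons_rV_ball n (p q : R * X n) e : ball p e q -> ball (cons_rV p) e (cons_rV q).
Proof.
move=> [b1 b2]; split; first by case: b2.
by move=> i j; rewrite !mxE; case: unliftP => [k _|_] //; case: b2 => _ /(_ 0 k).
Qed.

Lemma cont_cons n : continuous (@cons_rV R n).
Proof.
move=> p; apply/cvg_ballP => e e0.
exists (ball p.1 e, ball p.2 e); first by split; exact: nbhsx_ballx.
by move=> q [q1 q2]; apply: cons_rV_ball; split.
Qed.

Definition slice n (phi : X n.+1 -> R) (t : R) (x : X n) := phi (cons_rV (t, x)).

Lemma cont_slice n (phi : X n.+1 -> R) t : continuous phi -> continuous (slice phi t).
Proof.
move=> cp x; apply: (@continuous_comp _ _ _ (fun y : X n => cons_rV (t, y)) phi); last exact: cp.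
apply: (@continuous_comp _ _ _ (fun y : X n => (t, y)) (@cons_rV R n)); last exact: cont_cons.
exact: (cvg_pair (cvg_cst t) (@cvg_id _ (nbhs x))).
Qed.

Lemma cont_slice0 n (phi : X n.+1 -> R) x : continuous phi -> continuous (fun t => slice phi t x).
Proof.
move=> cp t; apply: (@continuous_comp _ _ _ (fun s : R => cons_rV (s, x)) phi); last exact: cp.
apply: (@continuous_comp _ _ _ (fun s : R => (s, x)) (@cons_rV R n)); last exact: cont_cons.
exact: (cvg_pair (@cvg_id _ (nbhs t)) (cvg_cst x)).
Qed.

Lemma is_derive_slice n (phi : X n.+1 -> R) t x (j : 'I_n) (d : R) :
  is_derive (cons_rV (t, x)) (delta_mx 0 (lift ord0 j)) phi d ->
  is_derive x (delta_mx 0 j) (slice phi t) d.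
Proof.
move=> /is_derive_line0 h; apply/is_derive_line0; move: h.
congr (is_derive _ _ _ _); apply/funext => s; rewrite /slice; congr phi.
by rewrite -cons_rV_lift -cons_rVZ -cons_rVD mulr0 add0r.
Qed.

Lemma is_derive_slice0 n (phi : X n.+1 -> R) (t : R) x (d : R) :
  is_derive (cons_rV (t, x)) (delta_mx 0 ord0) phi d ->
  is_derive t 1 (fun s => slice phi s x) d.
Proof.
have e s : cons_rV (s, x) = s *: delta_mx 0 ord0 + cons_rV (0, x).
  by rewrite -cons_rV_e0 -cons_rVZ -cons_rVD mulr1 scaler0 add0r addr0.
rewrite e => /is_derive_line; congr (is_derive _ _ _ _).
by apply/funext => s; rewrite /slice e.
Qed.

Definition C1 n (phi : X n -> R) := C1part phi /\ forall i, continuous (partial i phi).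

Lemma C1_der n (phi : X n -> R) i x : C1 phi -> is_derive x (delta_mx 0 i) phi (partial i phi x).
Proof. by move=> [[_ h] _]; exact: DeriveDef. Qed.

Lemma partial_slice n (phi : X n.+1 -> R) t (j : 'I_n) : C1 phi ->
  partial j (slice phi t) = slice (partial (lift ord0 j) phi) t.
Proof.
move=> cp; apply/funext => x; apply: partialE; apply: is_derive_slice; exact: C1_der.
Qed.

Lemma C1_slice n (phi : X n.+1 -> R) t : C1 phi -> C1 (slice phi t).
Proof.
move=> cp; split; first split.
- by apply: cont_slice; case: cp => -[].
- by move=> j x; have [] := is_derive_slice (C1_der (lift ord0 j) (cons_rV (t, x)) cp).
- by move=> j; rewrite partial_slice//; apply: cont_slice; case: cp.
Qed.

Lemma cont_measurable n (f : X n -> R) : continuous f -> measurable_fun setT f.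
Proof.
move=> /continuousP cf; apply: (measurability _ (RGenOpens.measurableE R)) => //.
move=> _ [_ [a [b ->]] <-]; rewrite setTI; apply: open_measurable_rV; apply: cf.
exact: interval_open.
Qed.

Let prodm n : {measure set (measurableTypeR R * X n) -> \bar R} :=
  (@lebesgue_measure R \x leb n)%E.
Let consm n : measurableTypeR R * X n -> X n.+1 := @cons_rV R n.
Let mcons n : measurable_fun setT (@consm n).
Proof. exact: measurable_cons_rV. Qed.

Lemma tonelli_cons n (f : X n.+1 -> \bar R) : measurable_fun setT f -> (forall x, 0 <= f x)%E ->
  (\int[leb n.+1]_x f x = \int[lebesgue_measure]_t \int[leb n]_x f (cons_rV (t, x)))%E.
Proof.
move=> mf f0.
transitivity (\int[prodm n]_p f (@consm n p))%E.
  exact: (ge0_integral_pushforward (mcons (n := n)) (prodm n) measurableT mf (fun x _ => f0 x)).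
apply: (fubini_tonelli1 (m1 := @lebesgue_measure R) (m2 := leb n) (f \o @consm n)) => //.
  by apply: measurableT_comp => //; exact: mcons.
by move=> x; exact: f0.
Qed.

Lemma fubini_cons n (f : X n.+1 -> R) : (leb n.+1).-integrable setT (EFin \o f) ->
  measurable_fun setT f ->
  (\int[leb n.+1]_x (f x)%:E = \int[lebesgue_measure]_t \int[leb n]_x (f (cons_rV (t, x)))%:E)%E /\
  (\int[leb n.+1]_x (f x)%:E = \int[leb n]_x \int[lebesgue_measure]_t (f (cons_rV (t, x)))%:E)%E.
Proof.
move=> fi mf.
have mf' : measurable_fun setT (EFin \o f \o @consm n).
  by apply: measurableT_comp; [exact/measurable_EFinP|exact: mcons].
have fi' : (prodm n).-integrable setT (EFin \o f \o @consm n).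
  apply/(integrable12ltyP (@lebesgue_measure R) (leb n) mf').
  have /integrableP[_] := fi.
  by rewrite tonelli_cons//; apply: measurableT_comp => //; exact/measurable_EFinP.
have -> : (\int[leb n.+1]_x (f x)%:E = \int[prodm n]_p (f (@consm n p))%:E)%E.
  apply: (integral_pushforward (mcons (n := n)) (mu := prodm n) (f := EFin \o f)) => //.
  exact/measurable_EFinP.
by split; symmetry; [exact: (integral12_prod_meas1 fi')|exact: (integral21_prod_meas1 fi')].
Qed.

End slices.

(** * Double integrals of squared differences on products *)

Section product_variance.
Context d1 d2 (T1 : measurableType d1) (T2 : measurableType d2) (R : realType).
Variables (m1 : {sigma_finite_measure set T1 -> \bar R}) (m2 : {sigma_finite_measure set T2 -> \bar R}).
Variables (A : set T1) (B : set T2).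
Hypotheses (mA : measurable A) (mB : measurable B).
Local Open Scope ereal_scope.

Lemma measurable_int2 (H : T1 * T2 -> \bar R) : measurable_fun setT H -> (forall p, 0 <= H p) ->
  measurable_fun setT (fun x => \int[m2]_(y in B) H (x, y)).
Proof.
move=> mH H0.
have mH' : measurable_fun setT (H \_ (setT `*` B)).
  apply/(measurable_restrictT _ (measurableX measurableT mB)).
  exact: measurable_funS mH.
have := measurable_fun_fubini_tonelli_F (m2 := m2) _ mH'.
rewrite (_ : fubini_F _ _ = (fun x => \int[m2]_(y in B) H (x, y))).
  apply => p; rewrite patchE; by case: ifP.
apply/funext => x; rewrite /fubini_F [RHS]integral_mkcond; apply: eq_integral => y _.
by rewrite !patchE; congr (if _ then _ else _); apply/idP/idP; rewrite !inE => //= -[].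
Qed.

Lemma integral_swap (H : T1 * T2 -> \bar R) : measurable_fun setT H -> (forall p, 0 <= H p) ->
  \int[m1]_(x in A) \int[m2]_(y in B) H (x, y) = \int[m2]_(y in B) \int[m1]_(x in A) H (x, y).
Proof.
move=> mH H0.
have mH' : measurable_fun setT (H \_ (A `*` B)).
  apply/(measurable_restrictT _ (measurableX mA mB)).
  exact: measurable_funS mH.
have := fubini_tonelli (m1 := m1) (m2 := m2) _ mH' (fun p => ltac:(by rewrite patchE; case: ifP)).
have e1 : (fun x => \int[m2]_y (H \_ (A `*` B)) (x, y)) = (fun x => \int[m2]_(y in B) H (x, y)) \_ A.
  apply/funext => x; rewrite [RHS]patchE; case: ifPn => xA.
    rewrite [RHS]integral_mkcond; apply: eq_integral => y _.
    rewrite !patchE; congr (if _ then _ else _); apply/idP/idP; rewrite !inE => //= yB.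
      by case: yB.
    by split => //; exact/set_mem.
  rewrite integral0_eq// => y _; rewrite patchE ifF//; apply/negP; rewrite inE => -[/= xA' _].
  by move/negP : xA; apply; exact/mem_set.
have e2 : (fun y => \int[m1]_x (H \_ (A `*` B)) (x, y)) = (fun y => \int[m1]_(x in A) H (x, y)) \_ B.
  apply/funext => y; rewrite [RHS]patchE; case: ifPn => xA.
    rewrite [RHS]integral_mkcond; apply: eq_integral => x _.
    rewrite !patchE; congr (if _ then _ else _); apply/idP/idP; rewrite !inE => //= yB.
      by case: yB.
    by split => //; exact/set_mem.
  rewrite integral0_eq// => x _; rewrite patchE ifF//; apply/negP; rewrite inE => -[/= _ xA'].
  by move/negP : xA; apply; exact/mem_set.
by rewrite e1 e2 -!integral_mkcond.
Qed.
End product_variance.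

Section product_variance2.
Context d1 d2 (T1 : measurableType d1) (T2 : measurableType d2) (R : realType).
Variables (m1 : {sigma_finite_measure set T1 -> \bar R}) (m2 : {sigma_finite_measure set T2 -> \bar R}).
Variables (A : set T1) (B : set T2).
Hypotheses (mA : measurable A) (mB : measurable B).
Local Open Scope ereal_scope.

(** The difference passes through the intermediate point [(s, x)], with
    [(a + b)^2 <= 2 a^2 + 2 b^2]. Each square varies in one factor only, so the other factor
    contributes its measure. [E1] and [E2] stay abstract so that the lemma can be iterated over the
    dimension. *)
Lemma product_variance (f : T1 * T2 -> R) (E1 E2 : T1 * T2 -> \bar R) (a1 a2 : R) :
  measurable_fun setT f -> measurable_fun setT E1 -> measurable_fun setT E2 ->
  (forall p, 0 <= E1 p) -> (forall p, 0 <= E2 p) ->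
  m1 A = a1%:E -> m2 B = a2%:E ->
  (forall x, \int[m1]_(t in A) \int[m1]_(s in A) ((f (t, x) - f (s, x)) ^+ 2)%:E <= \int[m1]_(t in A) E1 (t, x)) ->
  (forall t, \int[m2]_(x in B) \int[m2]_(y in B) ((f (t, x) - f (t, y)) ^+ 2)%:E <= \int[m2]_(x in B) E2 (t, x)) ->
  \int[m1]_(t in A) \int[m2]_(x in B) \int[m1]_(s in A) \int[m2]_(y in B) ((f (t, x) - f (s, y)) ^+ 2)%:E <=
  (2 * a2)%:E * \int[m1]_(t in A) \int[m2]_(x in B) E1 (t, x) +
  (2 * a1)%:E * \int[m1]_(t in A) \int[m2]_(x in B) E2 (t, x).
Proof.
move=> mf mE1 mE2 E10 E20 a1E a2E h1 h2.
have a10 : (0 <= a1)%R by rewrite -lee_fin -a1E.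
have a20 : (0 <= a2)%R by rewrite -lee_fin -a2E.
have sq0 (r : R) : 0 <= (r ^+ 2)%:E by rewrite lee_fin sqr_ge0.
pose U (p : T1 * T2) := \int[m1]_(s in A) ((f p - f (s, p.2)) ^+ 2)%:E.
pose V (p : T1 * T2) := \int[m2]_(y in B) ((f p - f (p.1, y)) ^+ 2)%:E.
have U0 p : 0 <= U p by exact: integral_ge0.
have V0 p : 0 <= V p by exact: integral_ge0.
have msq d (T : measurableType d) (u v : T -> T1 * T2) : measurable_fun setT u -> measurable_fun setT v ->
    measurable_fun setT (fun q => ((f (u q) - f (v q)) ^+ 2)%:E).
  move=> mu_ mv; apply/measurable_EFinP; apply: measurable_funX.
  by apply: measurable_funB; exact: measurableT_comp.
have mU : measurable_fun setT U.
  apply: (@measurable_int2 _ _ (T1 * T2)%type T1 R m1 A mA (fun q => ((f q.1 - f (q.2, q.1.2)) ^+ 2)%:E)) => //.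
  apply: msq => //; apply: measurable_fun_pair => //; exact: (measurableT_comp measurable_snd measurable_fst).
have mV : measurable_fun setT V.
  apply: (@measurable_int2 _ _ (T1 * T2)%type T2 R m2 B mB (fun q => ((f q.1 - f (q.1.1, q.2)) ^+ 2)%:E)) => //.
  apply: msq => //; apply: measurable_fun_pair => //; exact: (measurableT_comp measurable_fst measurable_fst).
have mS1 d (T : measurableType d) (F : T -> \bar R) (D : set T) : measurable_fun setT F -> measurable_fun D F.
  by move=> ?; exact: measurable_funTS.
pose W x := \int[m1]_(s in A) V (s, x).
have W0 x : 0 <= W x by exact: integral_ge0.
have mW : measurable_fun setT W.
  apply: (@measurable_int2 _ _ T2 T1 R m1 A mA (fun q => V (q.2, q.1))) => //.
  by apply: (measurableT_comp mV); apply: measurable_fun_pair.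
have mcA (c : \bar R) : measurable_fun A (fun=> c) by exact: measurable_cst.
have mcB (c : \bar R) : measurable_fun B (fun=> c) by exact: measurable_cst.
have icB (c : \bar R) : \int[m2]_(_ in B) c = c * a2%:E by rewrite -a2E; exact: integral_cst.
have icA (c : \bar R) : \int[m1]_(_ in A) c = c * a1%:E by rewrite -a1E; exact: integral_cst.
have tw : (0 <= 2 * a2 :> R)%R by rewrite mulr_ge0.
have s1 t x s : \int[m2]_(y in B) ((f (t, x) - f (s, y)) ^+ 2)%:E <=
   (2 * a2)%:E * ((f (t, x) - f (s, x)) ^+ 2)%:E + 2%:E * V (s, x).
  apply: (@le_trans _ _ (\int[m2]_(y in B) (2%:E * ((f (t, x) - f (s, x)) ^+ 2)%:E + 2%:E * ((f (s, x) - f (s, y)) ^+ 2)%:E))).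
    apply: ge0_int_le => // y _; rewrite -!EFinM -EFinD lee_fin.
    set a := f (t, x); set b := f (s, x); set c := f (s, y).
    by have := sqr_ge0 ((a - b) - (b - c))%R; nra.
  rewrite ge0_int_lin//.
    have -> := icB (((f (t, x) - f (s, x)) ^+ 2)%:E).
    by rewrite -!EFinM leeD2r// lee_fin; lra.
  apply/mS1/msq; first exact: measurable_cst.
  by apply: measurable_fun_pair => //; exact: measurable_cst.
have s2 t x : \int[m1]_(s in A) \int[m2]_(y in B) ((f (t, x) - f (s, y)) ^+ 2)%:E <=
   (2 * a2)%:E * U (t, x) + 2%:E * W x.
  apply: (@le_trans _ _ (\int[m1]_(s in A) ((2 * a2)%:E * ((f (t, x) - f (s, x)) ^+ 2)%:E + 2%:E * V (s, x)))).
    by apply: ge0_int_le => s _; [exact: integral_ge0|exact: s1].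
  rewrite ge0_int_lin//.
    apply/mS1/msq; first exact: measurable_cst.
    by apply: measurable_fun_pair => //; exact: measurable_cst.
  apply/mS1; apply: (measurableT_comp mV); apply: measurable_fun_pair => //; exact: measurable_cst.
have mUt t : measurable_fun B (fun x => U (t, x)).
  apply/mS1; apply: (measurableT_comp mU); apply: measurable_fun_pair => //; exact: measurable_cst.
have s3 t : \int[m2]_(x in B) \int[m1]_(s in A) \int[m2]_(y in B) ((f (t, x) - f (s, y)) ^+ 2)%:E <=
   (2 * a2)%:E * (\int[m2]_(x in B) U (t, x)) + 2%:E * \int[m2]_(x in B) W x.
  apply: (@le_trans _ _ (\int[m2]_(x in B) ((2 * a2)%:E * U (t, x) + 2%:E * W x))).
    by apply: ge0_int_le => x _; [apply: integral_ge0 => s _; exact: integral_ge0|exact: s2].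
  by rewrite ge0_int_lin//; exact: mS1.
apply: (@le_trans _ _ (\int[m1]_(t in A) ((2 * a2)%:E * (\int[m2]_(x in B) U (t, x)) + 2%:E * \int[m2]_(x in B) W x))).
  by apply: ge0_int_le => t _; [do 3 (apply: integral_ge0 => ? _)|exact: s3].
rewrite ge0_int_lin//; last 3 first.
- by apply/mS1/measurable_int2.
- by move=> t _; exact: integral_ge0.
- by move=> t _; exact: integral_ge0.
apply: leeD.
  apply: lee_wpmul2l; first by rewrite lee_fin.
  rewrite !(integral_swap _ _ mA mB)//.
  by apply: ge0_int_le => x _; [exact: integral_ge0|exact: h1].
rewrite icA (muleC _ a1%:E) muleA -EFinM.
apply: lee_wpmul2l; first by rewrite lee_fin mulr_ge0.
rewrite /W -(integral_swap _ _ mA mB mV V0).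
by apply: ge0_int_le => t _; [exact: integral_ge0|exact: h2].
Qed.
End product_variance2.

(** * Cubes and the Poincare inequality *)

Section cubes.
Context {R : realType}.
Local Notation X n := 'rV[R]_n.
Local Notation leb := (@lebesgue_rV R).
Local Open Scope ereal_scope.

(** Half-open, so that cubes of equal side tile the space. *)
Definition cube n (l : 'I_n -> R) (r : R) : set (X n) :=
  [set x | forall i, (l i <= x 0 i < l i + r)%R].

Lemma cubeE n (l : 'I_n -> R) (r : R) :
  cube l r = [set x | forall i, [set` `[l i, (l i + r)%R[ ] (x 0%R i)].
Proof. by apply/seteqP; split => x h i; have := h i; rewrite /= in_itv. Qed.

Lemma measurable_cube n (l : 'I_n -> R) (r : R) : measurable (cube l r).
Proof.
have -> : cube l r = \bigcap_(i in [set: 'I_n])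
    ((fun x : X n => x 0%R i) @^-1` [set` `[l i, (l i + r)%R[ ]).
  by rewrite cubeE; apply/seteqP; split => x Ax i => [_|]; [exact: Ax|exact: (Ax i I)].
apply: fin_bigcap_measurable => // i _.
by rewrite -[Y in measurable Y]setTI; exact: measurable_coord.
Qed.

Lemma leb_cube n (l : 'I_n -> R) (r : R) : (0 <= r)%R -> leb n (cube l r) = (r ^+ n)%:E.
Proof.
move=> r0; rewrite cubeE.
have -> := @lebesgue_rV_box R n (fun i => [set` `[l i, (l i + r)%R[ ]) (fun i => measurable_itv _).
under eq_bigr => i _.
  rewrite lebesgue_measure_itv/= lte_fin ltrDl.
  rewrite (_ : (if _ then _ else _) = r%:E); last first.
    case: ltP => [_|r0']; first by rewrite EFinD addrAC subee// add0e.
    by congr (_%:E); apply/eqP; rewrite eq_le r0 r0'.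
  over.
by rewrite prodEFin prodr_const card_ord.
Qed.

Lemma cons_cube n (l : 'I_n.+1 -> R) (r : R) (t : R) (x : X n) :
  cube l r (cons_rV (t, x)) <->
  [set` `[l ord0, (l ord0 + r)%R[ ] t /\ cube (fun j => l (lift ord0 j)) r x.
Proof.
split=> [h|[h1 h2] i].
  split; first by have := h ord0; rewrite cons_rV0 /= in_itv.
  by move=> j; have := h (lift ord0 j); rewrite cons_rVS.
by have [j ->|->] := unliftP ord0 i; rewrite ?cons_rVS ?cons_rV0; [exact: h2|move: h1; rewrite /= in_itv].
Qed.

Lemma tonelli_cube n (l : 'I_n.+1 -> R) (r : R) (f : X n.+1 -> \bar R) :
  measurable_fun setT f -> (forall x, 0 <= f x) ->
  \int[leb n.+1]_(x in cube l r) f x =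
  \int[lebesgue_measure]_(t in [set` `[l ord0, (l ord0 + r)%R[ ])
    \int[leb n]_(x in cube (fun j => l (lift ord0 j)) r) f (cons_rV (t, x)).
Proof.
move=> mf f0; rewrite integral_mkcond tonelli_cons; last 2 first.
- by apply/(measurable_restrictT _ (measurable_cube l r)); exact: measurable_funTS.
- by move=> x; rewrite patchE; case: ifP.
rewrite [RHS]integral_mkcond; apply: eq_integral => t _; rewrite [RHS]patchE.
case: ifPn => tI.
  rewrite [RHS]integral_mkcond; apply: eq_integral => x _; rewrite !patchE.
  congr (if _ then _ else _); apply/idP/idP; rewrite !inE => h; first by have /cons_cube[] := h.
  by apply/cons_cube; split => //; exact/set_mem.
apply: integral0_eq => x _; rewrite patchE ifF//; apply/negP; rewrite inE => /cons_cube[h _].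
by move/negP : tI; apply; exact/mem_set.
Qed.

Lemma ftc_itv (f f' : R -> R) (a b : R) : (a < b)%R -> (forall t : R, is_derive t (1:R)%R f (f' t)) ->
  continuous f' -> \int[lebesgue_measure]_(t in `[a, b]) (f' t)%:E = (f b - f a)%:E.
Proof.
move=> ab df cf'; rewrite EFinB (@continuous_FTC2 _ f' f a b ab)//.
- exact: continuous_subspaceT.
- have cf : continuous f.
    by move=> t; apply: differentiable_continuous; apply/derivable1_diffP; have [] := df t.
  split; first by move=> t _; have [] := df t.
  + by apply: cvg_at_right_filter; exact: cf.
  + by apply: cvg_at_left_filter; exact: cf.
- by move=> t _; rewrite derive1E; have := df t => h; rewrite derive_val.
Qed.

(** The fundamental theorem of calculus and Cauchy-Schwarz on the segment between [s] and [t], which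
    is then enlarged to the whole interval. *)
Lemma osc1 (f f' : R -> R) (a b s t : R) : (a < b)%R -> (forall t : R, is_derive t (1:R)%R f (f' t)) ->
  continuous f' -> (a <= s < b)%R -> (a <= t < b)%R ->
  ((f t - f s) ^+ 2)%:E <= (b - a)%:E * \int[lebesgue_measure]_(t in `[a, b[) ((f' t) ^+ 2)%:E.
Proof.
move=> ab df cf'; wlog st : s t / (s <= t)%R.
  move=> h hs ht; have [st|/ltW ts] := leP s t; first exact: h.
  by rewrite -sqrrN opprB; exact: h.
move=> /andP[as_ sb] /andP[at_ tb]; move: st; rewrite le_eqVlt => /predU1P[->|st].
  rewrite subrr expr0n mule_ge0// ?lee_fin ?subr_ge0 ?(ltW ab)//.
  by apply: integral_ge0 => x _; rewrite lee_fin sqr_ge0.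
have c2 : continuous (fun x => (f' x ^+ 2)%R).
  by move=> x; apply: cvgM; exact: cf'.
have mc (g : R -> R) (D : set R) : continuous g -> measurable D -> measurable_fun D (EFin \o g).
  by move=> cg mD; apply/measurable_EFinP; apply: measurable_funTS; exact: continuous_measurable_fun.
have ici (g : R -> R) : continuous g -> ig (@lebesgue_measure R) `[s, t]%classic g.
  move=> cg; apply: continuous_compact_integrable; first exact: segment_compact.
  exact: continuous_subspaceT.
have mI : measurable `[s, t]%classic by [].
have h1 := ici _ cf'; have h2 := ici _ c2.
have L2f : L2 (@lebesgue_measure R) `[s, t]%classic f'.
  by split => //; exact: ig_meas h1.
have L21 : L2 (@lebesgue_measure R) `[s, t]%classic (fun=> 1%R).
  by split; [exact: measurable_cst|apply: ici; move=> x; exact: cvg_cst].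
have := @L2CS _ _ R (@lebesgue_measure R) `[s, t]%classic mI f' (fun=> 1%R) L2f L21.
under eq_Rintegral do rewrite mulr1.
under [Y in (_ <= _ * Y)%R -> _]eq_Rintegral do rewrite expr1n.
have -> : (Rintegral (@lebesgue_measure R) `[s, t]%classic (fun=> 1) = t - s)%R.
  have -> := @Rintegral_cst _ _ R (@lebesgue_measure R) _ mI 1%R.
  have e : lebesgue_measure [set` `[s, t]] = (t - s)%:E.
    by rewrite lebesgue_measure_itv/= lte_fin st.
  by rewrite mul1r; transitivity (fine (t - s)%:E) => //; congr fine; exact: e.
move=> h.
have -> : (f t - f s = Rintegral lebesgue_measure `[s, t]%classic f')%R.
  by rewrite /Rintegral (ftc_itv st df cf').
apply: (@le_trans _ _ ((b - a)%:E * \int[lebesgue_measure]_(t in `[s, t]) ((f' t) ^+ 2)%:E)).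
  rewrite (@ItE _ _ R (@lebesgue_measure R) _ mI _ h2) -EFinM lee_fin mulrC; apply: le_trans h _.
  by apply: ler_wpM2l; [exact: It_sqr_ge0|lra].
apply: lee_wpmul2l; first by rewrite lee_fin subr_ge0 ltW.
apply: ge0_subset_integral => //.
- exact: mc.
- by move=> x _; rewrite lee_fin sqr_ge0.
- by move=> x /=; rewrite !in_itv/= => /andP[sx xt]; lra.
Qed.

(** Induction on the dimension by [product_variance], each coordinate costing a factor 2. The double
    integral is preferred to the variance about the mean because it is the form that splits over
    products. *)
Lemma poincare_cube n (phi : X n -> R) (l : 'I_n -> R) (r : R) : (0 < r)%R -> C1 phi ->
  \int[leb n]_(x in cube l r) \int[leb n]_(y in cube l r) ((phi x - phi y) ^+ 2)%:E <=
  (2 ^+ n * r ^+ 2 * r ^+ n)%:E *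
    \int[leb n]_(x in cube l r) (\sum_(i < n) (partial i phi x) ^+ 2)%:E.
Proof.
move=> r0; elim: n phi l => [|n ih] phi l cphi.
  rewrite integral0_eq; first last.
    move=> x _; apply: integral0_eq => y _; rewrite (_ : x = y) ?subrr ?expr0n//.
    by apply/rowP => -[].
  apply: mule_ge0; first by rewrite lee_fin !mulr_ge0 ?exprn_ge0 ?(ltW r0).
  by apply: integral_ge0 => x _; rewrite lee_fin sumr_ge0// => i _; exact: sqr_ge0.
pose I := [set` `[l ord0, (l ord0 + r)%R[ ]; pose Q := cube (fun j => l (lift ord0 j)) r.
pose c : measurableTypeR R * X n -> X n.+1 := @cons_rV R n.
have mc : measurable_fun setT c by exact: measurable_cons_rV.
have mphi : measurable_fun setT phi by apply: cont_measurable; case: cphi => -[].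
have mpd i : measurable_fun setT (partial i phi) by apply: cont_measurable; case: cphi.
(* In [E1] one factor [r] comes from [osc1] and two from the double integration over [I]; [E2] is
   the induction hypothesis on a slice. *)
pose E1 (p : measurableTypeR R * X n) := ((r ^+ 3) * (partial ord0 phi (c p)) ^+ 2)%:E.
pose E2 (p : measurableTypeR R * X n) := ((2 ^+ n * r ^+ 2 * r ^+ n) * \sum_(j < n) (partial (lift ord0 j) phi (c p)) ^+ 2)%:E.
have mI : measurable I by exact: measurable_itv.
have mQ : measurable Q by exact: measurable_cube.
have lI : @lebesgue_measure R I = r%:E.
  rewrite lebesgue_measure_itv/= lte_fin ltrDl r0 EFinD addrAC subee// add0e//.
have sq0 (a : R) : (0 <= (a ^+ 2)%:E) by rewrite lee_fin sqr_ge0.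
have K0 : (0 <= 2 ^+ n * r ^+ 2 * r ^+ n :> R)%R by rewrite !mulr_ge0 ?exprn_ge0 ?(ltW r0).
have msq i : measurable_fun setT (fun p : measurableTypeR R * X n => (partial i phi (c p)) ^+ 2)%R.
  by apply: measurable_funX; exact: measurableT_comp.
have mS : measurable_fun setT (fun p : measurableTypeR R * X n => \sum_(j < n) (partial (lift ord0 j) phi (c p)) ^+ 2)%R.
  by apply: measurable_sum => j; exact: msq.
have mE1 : measurable_fun setT E1.
  by apply/measurable_EFinP; apply: measurable_funM => //; exact: measurable_cst.
have mE2 : measurable_fun setT E2.
  by apply/measurable_EFinP; apply: measurable_funM => //; exact: measurable_cst.
have S0 p : (0 <= \sum_(j < n) (partial (lift ord0 j) phi (c p)) ^+ 2)%R.
  by apply: sumr_ge0 => j _; exact: sqr_ge0.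
have r30 : (0 <= r ^+ 3)%R by rewrite exprn_ge0// ltW.
have E10 p : 0 <= E1 p.
  by rewrite lee_fin; apply: mulr_ge0 => //; exact: sqr_ge0.
have E20 p : 0 <= E2 p by rewrite lee_fin mulr_ge0.
have := @product_variance _ _ _ _ R (@lebesgue_measure R) (leb n) I Q mI mQ (phi \o c) E1 E2 r (r ^+ n)
  (measurableT_comp mphi mc) mE1 mE2 E10 E20 lI (leb_cube _ (ltW r0)).
have h1 x : \int[lebesgue_measure]_(t in I) \int[lebesgue_measure]_(s in I) (((phi \o c) (t, x) - (phi \o c) (s, x)) ^+ 2)%:E <=
    \int[lebesgue_measure]_(t in I) E1 (t, x).
  have cd : continuous (fun t => partial ord0 phi (cons_rV (t, x))).
    by apply: (@cont_slice0 R n (partial ord0 phi) x); case: cphi.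
  have m1 : measurable_fun I (fun t => (partial ord0 phi (cons_rV (t, x)) ^+ 2)%:E).
    apply/measurable_EFinP; apply: measurable_funX; apply: measurable_funTS.
    exact: continuous_measurable_fun.
  pose G := \int[lebesgue_measure]_(t in I) ((partial ord0 phi (cons_rV (t, x))) ^+ 2)%:E.
  have G0 : 0 <= G by exact: integral_ge0.
  apply: (@le_trans _ _ (\int[lebesgue_measure]_(t in I) \int[lebesgue_measure]_(s in I) (r%:E * G))).
    apply: ge0_int_le => t It; first exact: integral_ge0.
    apply: ge0_int_le => s Is //.
    have := @osc1 (fun t => phi (cons_rV (t, x))) (fun t => partial ord0 phi (cons_rV (t, x)))
      (l ord0) (l ord0 + r)%R s t.
    have Is' : (l ord0 <= s < l ord0 + r)%R by move: Is; rewrite /I/= in_itv.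
    have It' : (l ord0 <= t < l ord0 + r)%R by move: It; rewrite /I/= in_itv.
    rewrite ltrDl addrAC subrr add0r; apply => //.
    by move=> u; apply: (@is_derive_slice0 R n phi u x); exact: C1_der.
  have icI (a : \bar R) : \int[lebesgue_measure]_(_ in I) a = a * r%:E by rewrite -lI; exact: integral_cst.
  rewrite !icI /E1.
  under [Y in _ <= Y]eq_integral do rewrite EFinM.
  rewrite ge0_integralZl//.
  rewrite -/G (muleC r%:E) -!muleA (muleC G) -!EFinM; apply: lee_wpmul2r => //.
have h2 t : \int[leb n]_(x in Q) \int[leb n]_(y in Q) (((phi \o c) (t, x) - (phi \o c) (t, y)) ^+ 2)%:E <=
    \int[leb n]_(x in Q) E2 (t, x).
  have := ih (slice phi t) (fun j => l (lift ord0 j)) (C1_slice t cphi).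
  suff -> : \int[leb n]_(x in Q) E2 (t, x) = (2 ^+ n * r ^+ 2 * r ^+ n)%:E *
    \int[leb n]_(x in Q) (\sum_(i < n) partial i (slice phi t) x ^+ 2)%:E by [].
  rewrite -[RHS]ge0_integralZl; last 4 first.
  - exact: mQ.
  - apply/measurable_EFinP; apply: measurable_funTS; apply: measurable_sum => j.
    by apply: measurable_funX; apply: cont_measurable; case: (C1_slice t cphi).
  - by move=> x _; rewrite lee_fin sumr_ge0// => i _; exact: sqr_ge0.
  - by rewrite lee_fin.
  apply: eq_integral => x _; rewrite -EFinM; congr (_ * _)%:E; apply: eq_bigr => j _.
  by rewrite partial_slice.
move=> /(_ h1 h2) hpv.
rewrite tonelli_cube//; last 2 first.
- apply: (@measurable_int2 _ _ _ _ R (leb n.+1) (cube l r) (measurable_cube l r) (fun p => ((phi p.1 - phi p.2) ^+ 2)%:E)) => //.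
  apply/measurable_EFinP; apply: measurable_funX; apply: measurable_funB; exact: measurableT_comp.
- by move=> x; exact: integral_ge0.
have e1 t x : \int[leb n.+1]_(y in cube l r) ((phi (cons_rV (t, x)) - phi y) ^+ 2)%:E =
   \int[lebesgue_measure]_(s in I) \int[leb n]_(y in Q) ((phi (cons_rV (t, x)) - phi (cons_rV (s, y))) ^+ 2)%:E.
  apply: tonelli_cube => //.
  by apply/measurable_EFinP; apply: measurable_funX; apply: measurable_funB => //; exact: measurable_cst.
under eq_integral do under eq_integral do rewrite e1.
apply: le_trans hpv _.
rewrite [Y in _ <= _ * Y]tonelli_cube; last 2 first.
- by apply/measurable_EFinP; apply: measurable_sum => j; exact: measurable_funX.
- by move=> x; rewrite lee_fin sumr_ge0// => i _; exact: sqr_ge0.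
pose A1 := \int[lebesgue_measure]_(t in I) \int[leb n]_(x in Q) ((partial ord0 phi (c (t, x))) ^+ 2)%:E.
pose A2 := \int[lebesgue_measure]_(t in I) \int[leb n]_(x in Q) (\sum_(j < n) (partial (lift ord0 j) phi (c (t, x))) ^+ 2)%:E.
have cmeas (H : measurableTypeR R * X n -> R) t : measurable_fun setT H -> measurable_fun Q (fun x => (H (t, x))%:E).
  move=> mH; apply/measurable_EFinP; apply: measurable_funTS; apply: (measurableT_comp mH).
  by apply: measurable_fun_pair => //; exact: measurable_cst.
have cint (H : measurableTypeR R * X n -> R) : measurable_fun setT H -> (forall p, 0 <= H p)%R ->
    measurable_fun I (fun t => \int[leb n]_(x in Q) (H (t, x))%:E).
  move=> mH H0; apply: measurable_funTS.
  apply: (@measurable_int2 _ _ _ _ R (leb n) Q mQ (EFin \o H)) => [|p]; last by rewrite lee_fin.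
  exact/measurable_EFinP.
have mg1 := msq ord0.
have g10 p : (0 <= partial ord0 phi (c p) ^+ 2)%R by exact: sqr_ge0.
have eZ (H : measurableTypeR R * X n -> R) (k : R) : measurable_fun setT H -> (forall p, 0 <= H p)%R -> (0 <= k)%R ->
    \int[lebesgue_measure]_(t in I) \int[leb n]_(x in Q) (k * H (t, x))%:E =
    k%:E * \int[lebesgue_measure]_(t in I) \int[leb n]_(x in Q) (H (t, x))%:E.
  move=> mH H0 k0; rewrite -[RHS]ge0_integralZl; last 4 first.
  - exact: mI.
  - exact: cint.
  - by move=> t _; apply: integral_ge0 => x _; rewrite lee_fin.
  - by rewrite lee_fin.
  apply: eq_integral => t _; rewrite -[RHS]ge0_integralZl; last 4 first.
  - exact: mQ.
  - exact: cmeas.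
  - by move=> x _; rewrite lee_fin.
  - by rewrite lee_fin.
  by apply: eq_integral => x _; rewrite EFinM.
have eA1 := eZ _ _ mg1 g10 r30; rewrite -/A1 in eA1.
have eA2 := eZ _ _ mS S0 K0; rewrite -/A2 in eA2.
have -> : \int[lebesgue_measure]_(t in I) \int[leb n]_(x in Q) (\sum_(i < n.+1) partial i phi (cons_rV (t, x)) ^+ 2)%:E = A1 + A2.
  rewrite /A1 /A2 -[RHS]ge0_integralD; last 5 first.
  - exact: mI.
  - by move=> t _; exact: integral_ge0.
  - exact: (cint _ mg1 g10).
  - by move=> t _; apply: integral_ge0 => x _; rewrite lee_fin.
  - exact: (cint _ mS S0).
  apply: eq_integral => t _; rewrite -[RHS]ge0_integralD; last 5 first.
  - exact: mQ.
  - by move=> x _; rewrite lee_fin.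
  - exact: (cmeas _ t mg1).
  - by move=> x _; rewrite lee_fin.
  - exact: (cmeas _ t mS).
  by apply: eq_integral => x _; rewrite big_ord_recl EFinD.
have A10 : 0 <= A1 by do 2 (apply: integral_ge0 => ? _).
have A20 : 0 <= A2 by do 2 (apply: integral_ge0 => ? _); rewrite lee_fin.
have eA1' : \int[lebesgue_measure]_(t in I) \int[leb n]_(x in Q) E1 (t, x) = (r ^+ 3)%:E * A1 by exact: eA1.
have eA2' : \int[lebesgue_measure]_(t in I) \int[leb n]_(x in Q) E2 (t, x) = (2 ^+ n * r ^+ 2 * r ^+ n)%:E * A2 by exact: eA2.
rewrite eA1' eA2' [leRHS]ge0_muleDr; [|exact: A10|exact: A20].
rewrite !muleA -!EFinM; apply: leeD.
  apply: lee_wpmul2r => //; rewrite lee_fin.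
  have t1 : (1 <= 2 ^+ n :> R)%R by rewrite exprn_ege1// ler1n.
  rewrite [Y in (_ <= Y)%R](_ : _ = 2 ^+ n * (2 * r ^+ n * r ^+ 3))%R; last by rewrite !exprS; ring.
  by apply: ler_peMl => //; rewrite !mulr_ge0 ?exprn_ge0 ?(ltW r0).
apply: lee_wpmul2r => //; rewrite lee_fin !exprS; apply: le_of_eq; ring.
Qed.

End cubes.

(** * Integration by parts for functions of bounded support *)

Section integration_by_parts.
Context {R : realType}.
Local Notation X n := 'rV[R]_n.
Local Notation leb := (@lebesgue_rV R).

Definition cbounded n (phi : X n -> R) (M : R) :=
  forall x, phi x != 0 -> forall i, `|x 0 i| < M.

Local Notation cub n M := (cube (fun _ : 'I_n => - M) (2 * M)).

Lemma cbounded_cube n (phi : X n -> R) M : cbounded phi M -> phi = phi \_ (cub n M).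
Proof.
move=> h; apply/funext => x; rewrite patchE; case: ifPn => // nx.
apply/eqP; apply: contraNT nx => /h hx; rewrite inE => i.
by have := hx i; rewrite ltr_norml => /andP[h1 h2]; rewrite (ltW h1)/=; lra.
Qed.

Lemma cont_bounded n (f : X n -> R) M : continuous f -> cbounded f M ->
  exists2 K, 0 <= K & forall x, `|f x| <= K.
Proof.
move=> cf hf; have cK : compact [set v : X n | forall i, `[- M, M]%classic (v ord0 i)].
  exact: (@rV_compact R n (fun=> `[- M, M]%classic) (fun=> @segment_compact _ _ _)).
have [K [Kr hK]] : bounded_set (f @` [set v : X n | forall i, `[- M, M]%classic (v ord0 i)]).
  by apply: compact_bounded; apply: continuous_compact => //; exact: continuous_subspaceT.
exists (Num.max K 0 + 1) => [|x]; first by rewrite addr_ge0// le_max lexx orbT.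
have K1 : K < Num.max K 0 + 1 by rewrite (@le_lt_trans _ _ (Num.max K 0)) ?le_max ?lexx// ltrDl.
have [->|fx] := eqVneq (f x) 0; first by rewrite normr0 addr_ge0// le_max lexx orbT.
apply: hK K1 _ _; exists x => // i; rewrite /= in_itv/=.
by have := hf x fx i; rewrite ltr_norml => /andP[h1 h2]; rewrite !ltW.
Qed.

Lemma cbounded_partial n (phi : X n -> R) M i : cbounded phi M ->
  forall x, partial i phi x != 0 -> forall j, `|x 0 j| <= M.
Proof.
move=> h x px j; rewrite leNgt; apply/negP => Mx; move/eqP : px; apply.
have e : \forall y \near x, (fun=> 0) y = phi y.
  have h1 : (y : X n) 0 j @[y --> x] --> x 0 j by exact: coord_continuous.
  have /cvgrPdist_lt h2 : `|(y : X n) 0 j| @[y --> x] --> `|x 0 j|.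
    exact: (cvg_norm h1).
  have Mx' : 0 < `|x 0 j| - M by rewrite subr_gt0.
  move: (h2 _ Mx'); apply: filterS => y hy.
  apply/esym/eqP; apply: contraTT hy => /h/(_ j) hy.
  by rewrite -leNgt (le_trans _ (ler_norm _))// lerD2l lerN2 ltW.
by rewrite /partial -(near_eq_derive _ e) derive_cst.
Qed.

Lemma cont_integrable n (f : X n -> R) M : 0 <= M -> continuous f -> cbounded f M ->
  ig (leb n) setT f.
Proof.
move=> M0 cf hf; have [K K0 hK] := cont_bounded cf hf.
have mf := cont_measurable cf.
apply: (@ig_le _ _ _ _ _ measurableT _ (fun x => K * (\1_(cub n M) x : R))) => //.
  apply: igZ => //; apply/integrableP; split.
    by apply/measurable_EFinP; apply: measurable_indic; exact: measurable_cube.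
  under eq_integral do rewrite /= ger0_norm//.
  rewrite integral_indic//; last exact: measurable_cube.
  have M2 : 0 <= 2 * M by rewrite mulr_ge0.
  rewrite setIT; apply: (@le_lt_trans _ _ ((2 * M) ^+ n)%:E); last exact: ltry.
  by rewrite -(leb_cube (fun _ : 'I_n => - M) M2).
apply: aeDW => x _; rewrite indicE; have [xM|xM] := boolP (x \in cub n M); first by rewrite mulr1.
by rewrite [f](cbounded_cube hf) patchE (negbTE xM) normr0 mulr0.
Qed.

(** If the differentiation is in the first variable, that variable is integrated first and the
    fundamental theorem gives 0; otherwise the first variable is put outside and the slices are
    handled by induction. *)
Lemma int_partial0 n (phi : X n -> R) M i : 0 <= M -> C1 phi -> cbounded phi M ->
  (\int[leb n]_x (partial i phi x)%:E = 0)%E.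
Proof.
move=> Mge0; elim: n phi i => [|n ih] phi i; first by case: i.
move=> cphi hM.
(* The derivative may be nonzero on the boundary of the cube of half-side [M], while [cbounded] asks
   for a strict inequality. *)
have hM1 : cbounded (partial i phi) (M + 1).
  by move=> x /(cbounded_partial hM) h j; rewrite (le_lt_trans (h j))// ltrDl.
have cp : continuous (partial i phi) by case: cphi.
have [f1 f2] := fubini_cons (cont_integrable (addr_ge0 Mge0 ler01) cp hM1) (cont_measurable cp).
have [j ij|i0] := unliftP ord0 i.
  rewrite f1; apply: integral0_eq => t _.
  transitivity (\int[leb n]_x (partial j (slice phi t) x)%:E)%E.
    by apply: eq_integral => x _; rewrite partial_slice// ij.
  apply: ih; first exact: C1_slice.
  move=> x hx k; have := hM (cons_rV (t, x)) hx (lift ord0 k); by rewrite cons_rVS.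
rewrite f2; apply: integral0_eq => x _.
have M0 (t : R) : M + 1 <= `|t| -> partial i phi (cons_rV (t, x)) = 0.
  move=> h; apply/eqP; apply: contraLR h => /hM1/(_ ord0).
  by rewrite cons_rV0 -ltNge.
have P0 (t : R) : M + 1 <= `|t| -> phi (cons_rV (t, x)) = 0.
  move=> h; apply/eqP; apply: contraLR h => /hM/(_ ord0).
  by rewrite cons_rV0 -ltNge => h; rewrite (lt_trans h)// ltrDl.
pose K := Num.max (M + 1) 1.
have K1 : 1 <= K by rewrite le_max lexx orbT.
have KM : M + 1 <= K by rewrite le_max lexx.
transitivity (\int[@lebesgue_measure R]_(t in [set` `[- K, K]%R]) (partial i phi (cons_rV (t, x)))%:E)%E.
  rewrite [RHS]integral_mkcond; apply: eq_integral => t _; rewrite patchE.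
  case: ifPn => // tK; rewrite M0//; apply: le_trans KM _; rewrite leNgt; apply: contra tK.
  by rewrite ltr_norml inE/= in_itv/= => /andP[h1 h2]; rewrite !ltW.
have KK : - K < K by lra.
have d (t : R) : is_derive t (1:R) (fun t => phi (cons_rV (t, x))) (partial i phi (cons_rV (t, x))).
  by rewrite i0; apply: (@is_derive_slice0 R n phi t x); exact: C1_der.
have c : continuous (fun t => partial i phi (cons_rV (t, x))).
  exact: (@cont_slice0 R n (partial i phi) x).
apply: (etrans (ftc_itv KK d c)).
by rewrite !P0 ?subrr// ?normrN (le_trans KM)// ler_norm.
Qed.

End integration_by_parts.

(** * Integrals of test functions over a bounded open set *)

Section test_integrals.
Context {R : realType} {n : nat}.
Local Notation X := 'rV[R]_n.
Local Notation leb := (@lebesgue_rV R n).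
Variable Om : set X.
Hypotheses (oOm : open Om) (bOm : bounded_set Om).

Lemma mOm : measurable Om. Proof. exact: open_measurable_rV. Qed.

Lemma Om_bound : exists2 M : R, 0 < M & forall x, Om x -> forall i, `|x 0 i| < M.
Proof.
have [M [Mr hM]] := bOm.
exists (Num.max M 0 + 2) => [|x Ox i].
  by apply: ltr_wpDl => //; rewrite le_max lexx orbT.
have M1 : M < Num.max M 0 + 1 by rewrite (@le_lt_trans _ _ (Num.max M 0)) ?le_max ?lexx// ltrDl.
apply: (@le_lt_trans _ _ (Num.max M 0 + 1)); last by rewrite ltrD2l ltr1n.
apply: le_trans (hM _ M1 x Ox); rewrite [in leRHS]/Num.Def.normr/= mx_normrE.
exact: (le_bigmax _ (fun ij => `|x ij.1 ij.2|) (0, i)).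
Qed.

Lemma leb_Om : (leb Om < +oo)%E.
Proof.
have [M M0 hM] := Om_bound; have M2 : 0 <= 2 * M by rewrite mulr_ge0// ltW.
apply: (@le_lt_trans _ _ ((2 * M) ^+ n)%:E); last exact: ltry.
rewrite -(leb_cube (fun _ : 'I_n => - M) M2); apply: le_measure; rewrite ?inE.
- exact: mOm.
- exact: measurable_cube.
- move=> x /hM h i; have := h i; rewrite ltr_norml => /andP[h1 h2].
  by rewrite (ltW h1)/=; lra.
Qed.

Lemma test_C1 phi : test_function Om phi -> C1 phi.
Proof.
move=> tp; split; first exact: smooth_C1 (test_smooth tp).
by move=> i; apply: smooth_cont; apply: smooth_partial; exact: test_smooth tp.
Qed.

Lemma test_meas phi (D : set X) : test_function Om phi -> measurable_fun D phi.
Proof.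
move=> tp; apply: measurable_funTS; apply: cont_measurable; apply: smooth_cont.
exact: test_smooth tp.
Qed.

Lemma ig_bounded (f : X -> R) (M : R) : measurable_fun Om f -> (forall x, Om x -> `|f x| <= M) ->
  ig leb Om f.
Proof.
move=> mf fM; apply: measurable_bounded_integrable => //; first exact: mOm.
  exact: leb_Om.
exists M; split; first exact: num_real.
by move=> N MN x /= Ox; rewrite (le_trans (fM x Ox))// ltW.
Qed.

Lemma test_ig phi : test_function Om phi -> ig leb Om phi.
Proof.
move=> tp; have [M _ hM] := test_bounded tp.
by apply: (@ig_bounded _ M) => //; exact: test_meas tp.
Qed.

Lemma test_cbounded phi : test_function Om phi -> exists2 M, 0 < M & cbounded phi M.
Proof.
move=> tp; have [M M0 hM] := Om_bound; exists M => // x px i; apply: hM.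
by apply: contrapT => nx; move/eqP : px; apply; exact: test_out tp nx.
Qed.

Lemma intT_Om (f : X -> R) : (forall x, ~ Om x -> f x = 0) ->
  Rintegral leb setT f = Rintegral leb Om f.
Proof.
move=> f0; rewrite [RHS]Rintegral_mkcond; congr Rintegral; apply/funext => x.
by rewrite patchE; case: ifPn => // xO; apply: f0 => Ox; move/negP : xO; apply; exact/mem_set.
Qed.

Lemma test_int_partial phi i : test_function Om phi -> Rintegral leb Om (partial i phi) = 0.
Proof.
move=> tp; have [M M0 hM] := test_cbounded tp.
rewrite -intT_Om; last by move=> x; exact: test_out (test_partial i tp).
by rewrite /Rintegral (int_partial0 i (ltW M0) (test_C1 tp) hM).
Qed.

Lemma test_ibp phi psi i : test_function Om phi -> test_function Om psi ->
  Rintegral leb Om (fun x => phi x * partial i psi x) =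
  - Rintegral leb Om (fun x => partial i phi x * psi x).
Proof.
move=> tp tq; have sp := test_smooth tp; have sq := test_smooth tq.
have t1 : test_function Om (fun x => phi x * partial i psi x) := testM tp (smooth_partial i sq).
have t2 : test_function Om (fun x => psi x * partial i phi x) := testM tq (smooth_partial i sp).
have := test_int_partial i (testM tp sq).
rewrite (partialM i (smooth_C1 sp) (smooth_C1 sq)) (ItD mOm (test_ig t1) (test_ig t2)).
move=> /eqP; rewrite addr_eq0 => /eqP ->; congr (- _); congr Rintegral.
by apply/funext => x; rewrite mulrC.
Qed.

End test_integrals.

(** * The space H^1_0 *)

Section Lebesgue_spaces.
Context {R : realType} {n : nat}.
Local Notation X := 'rV[R]_n.
Local Notation leb := (@lebesgue_rV R n).
Variable Om : set X.
Hypothesis mO : measurable Om.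

Lemma Lp_ig (r : R) u : 0 < r ->
  Lp Om r%:E u <-> measurable_fun Om u /\ ig leb Om (fun x => `|u x| `^ r).
Proof.
move=> r0.
have e : (\int[leb]_x `|(EFin \o (u \_ Om)) x| `^ r = \int[leb]_(x in Om) (`|u x| `^ r)%:E)%E.
  rewrite [RHS]integral_mkcond; apply: eq_integral => x _ /=.
  by rewrite patchE/= [in RHS]patchE; case: ifPn => //= _; rewrite normr0 ?powR0 ?gt_eqF.
have mp : measurable_fun Om u -> measurable_fun Om (fun x => `|u x| `^ r).
  move=> m; apply: (@measurableT_comp _ _ _ _ _ _ (fun y : R => y `^ r)).
    exact: measurable_powR.
  exact: measurableT_comp m.
rewrite /Lp; split.
  rewrite inE => /andP[/[!inE] /(measurable_restrictT _ mO) m /=].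
  rewrite /finite_norm => fn.
  rewrite /ig; split=> //; apply/integrableP; split; first by apply/measurable_EFinP; exact: mp m.
  under eq_integral do rewrite /= ger0_norm ?powR_ge0//.
  by rewrite -e -(poweR_Lnorm _ _ (lt0r_neq0 r0)) poweR_lty// Lnorm_ge0.
move=> [m /integrableP[_ i]].
rewrite inE; apply/andP; split; first by rewrite inE; exact/(measurable_restrictT _ mO).
rewrite /finLfun/= inE /= /finite_norm unlock e poweR_lty//.
by move: i; under eq_integral do rewrite /= ger0_norm ?powR_ge0//.
Qed.

Lemma Lp2 u : Lp Om 2%:E u <-> L2 leb Om u.
Proof.
rewrite Lp_ig// /L2.
suff -> : (fun x => u x ^+ 2) = (fun x => `|u x| `^ 2) by [].
by apply/funext => x; rewrite powR_mulrn// real_normK ?num_real.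
Qed.

Lemma Lpoo u : Lp Om +oo%E u <-> measurable_fun Om u /\ exists M, aeD leb Om (fun x => `|u x| <= M).
Proof.
rewrite /Lp; split.
  rewrite inE => /andP[/[!inE] /(measurable_restrictT _ mO) m /=].
  rewrite /finite_norm unlock => fn; split=> //.
  (* The norm of index [+oo] is 0 by convention when the whole space is null; any property then
     holds almost everywhere. *)
  have [l0|l0] := ltP 0%E (leb setT); last first.
    exists 0; exists setT; split=> //.
    by apply/eqP; rewrite eq_le measure_ge0 andbT.
  move: fn; rewrite l0.
  have := @ess_sup_ge _ _ _ leb (abse \o (EFin \o (u \_ Om))).
  move: (ess_sup _ _) => [s|//|] h _; last first.
    exists 0; move: h; apply: filterS => x /= h Ox; move: h; by rewrite leeNy_eq.
  exists s; move: h; apply: filterS => x /= h Ox; move: h.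
  by rewrite patchE mem_set// lee_fin.
move=> [m [M h]]; rewrite inE; apply/andP; split; first by rewrite inE; exact/(measurable_restrictT _ mO).
rewrite /finLfun/= inE /= /finite_norm unlock; case: ifPn => // _.
apply: (@le_lt_trans _ _ (Num.max M 0)%:E); last exact: ltry.
have h2 : \forall x \ae leb, ((abse \o (EFin \o u \_ Om)) x <= (Num.max M 0)%:E)%E.
  have := aeDE h; apply: filterS => x hx /=.
  rewrite lee_fin patchE; case: ifPn => [/set_mem Ox|_]; first by rewrite le_max (hx Ox).
  by rewrite normr0 le_max lexx orbT.
exact/ess_supP.
Qed.

End Lebesgue_spaces.

Section vectors.
Context {R : realType} {n : nat}.
Implicit Types a b c : 'rV[R]_n.

Lemma dotC a b : dot a b = dot b a.
Proof. by apply: eq_bigr => i _; rewrite mulrC. Qed.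
Lemma dotDl a b c : dot (a + b) c = dot a c + dot b c.
Proof. by rewrite -big_split/=; apply: eq_bigr => i _; rewrite mxE mulrDl. Qed.
Lemma dotZl k a b : dot (k *: a) b = k * dot a b.
Proof. by rewrite mulr_sumr; apply: eq_bigr => i _; rewrite mxE mulrA. Qed.
Lemma dotDr a b c : dot c (a + b) = dot c a + dot c b.
Proof. by rewrite dotC dotDl !(dotC _ c). Qed.
Lemma dotZr k a b : dot b (k *: a) = k * dot b a.
Proof. by rewrite dotC dotZl dotC. Qed.
Lemma dotNl a b : dot (- a) b = - dot a b.
Proof. by rewrite -scaleN1r dotZl mulN1r. Qed.
Lemma dotNr a b : dot b (- a) = - dot b a.
Proof. by rewrite dotC dotNl dotC. Qed.
Definition dotE := (dotDl, dotDr, dotZl, dotZr, dotNl, dotNr).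
Lemma dot_ge0 a : 0 <= dot a a.
Proof. by apply: sumr_ge0 => i _; rewrite -expr2 sqr_ge0. Qed.
Lemma dot_coord a i : (a 0 i) ^+ 2 <= dot a a.
Proof.
rewrite /dot (bigD1 i)//= -expr2 lerDl.
by apply: sumr_ge0 => j _; rewrite -expr2 sqr_ge0.
Qed.
Lemma dotD2 a b : dot (a + b) (a + b) <= 2 * dot a a + 2 * dot b b.
Proof. by have := dot_ge0 (a - b); rewrite !dotE (dotC b a); lra. Qed.

End vectors.

(** * H^1_0 as a closure of test functions *)

Section Sobolev_space.
Context {R : realType} {n : nat}.
Local Notation X := 'rV[R]_n.
Local Notation leb := (@lebesgue_rV R n).
Variable Om : set X.
Hypotheses (oOm : open Om) (bOm : bounded_set Om).
Let mO : measurable Om := mOm oOm.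
Local Notation It f := (Rintegral leb Om f).
Local Notation L2 := (L2 leb Om).
Local Notation ig := (ig leb Om).
Local Notation aeD := (aeD leb Om).

Definition vL2 (Du : X -> X) := forall i, L2 (fun x => Du x 0 i).
Definition grad (u : X -> R) (x : X) : X := \row_i partial i u x.
Definition nq (Du : X -> X) := It (fun x => dot (Du x) (Du x)).

Lemma vL2_meas Du i : vL2 Du -> measurable_fun Om (fun x => Du x 0 i).
Proof. by move=> /(_ i) /L2_meas. Qed.

Lemma meas_dot (Du Dv : X -> X) : (forall i, measurable_fun Om (fun x => Du x 0 i)) ->
  (forall i, measurable_fun Om (fun x => Dv x 0 i)) -> measurable_fun Om (fun x => dot (Du x) (Dv x)).
Proof.
move=> h k; apply: (@measurable_sum _ _ _ Om _ (index_enum 'I_n) (fun i x => Du x 0 i * Dv x 0 i)) => i.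
exact: measurable_funM.
Qed.

Lemma ig_dot Du Dv : vL2 Du -> vL2 Dv -> ig (fun x => dot (Du x) (Dv x)).
Proof. by move=> h k; apply: (@ig_sum _ _ _ _ _ mO) => i _; exact: (L2M mO). Qed.

Lemma vL2B Du Dv : vL2 Du -> vL2 Dv -> vL2 (fun x => Du x - Dv x).
Proof.
move=> h k i; have := L2B mO (h i) (k i); congr L2.
by apply/funext => x; rewrite !mxE.
Qed.

Lemma vL2lin a Du Dv : vL2 Du -> vL2 Dv -> vL2 (fun x => a *: Du x + Dv x).
Proof.
move=> h k i; have := L2D mO (L2Z mO a (h i)) (k i); congr L2.
by apply/funext => x; rewrite !mxE.
Qed.

Lemma nq_ge0 Du : vL2 Du -> 0 <= nq Du.
Proof.
move=> h; apply: It_ge0 => //; last by apply: aeDW => x _; exact: dot_ge0.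
exact: ig_meas (ig_dot h h).
Qed.

Lemma nq_coord Du i : vL2 Du -> It (fun x => (Du x 0 i) ^+ 2) <= nq Du.
Proof.
move=> h; apply: (It_le mO); [exact: L2_ig|exact: ig_dot|].
by apply: aeDW => x _; exact: dot_coord.
Qed.

Lemma nqD Du Dv : vL2 Du -> vL2 Dv -> nq (fun x => Du x + Dv x) <= 2 * nq Du + 2 * nq Dv.
Proof.
move=> h k; have hi := ig_dot h h; have ki := ig_dot k k.
rewrite -!(ItZ mO)// -(ItD mO) ?igZ//; apply: (It_le mO).
- apply: ig_dot => i; (have := L2D mO (h i) (k i); congr L2; apply/funext => x; by rewrite mxE).
- by apply: (igD mO) => //; exact: (igZ mO).
- by apply: aeDW => x _; exact: dotD2.
Qed.

(** A version of [H10] with real-valued integrals and squared distances. That [Du] is a weak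
    gradient is not a clause: for limits of test functions it is a consequence, [Hs_weak]. *)
Definition Hs (u : X -> R) (Du : X -> X) := [/\ L2 u, vL2 Du &
  forall e, 0 < e -> exists2 phi, test_function Om phi &
    It (fun x => (u x - phi x) ^+ 2) + nq (fun x => Du x - grad phi x) < e].

Lemma test_L2 phi : test_function Om phi -> L2 phi.
Proof.
move=> tp; split; first exact: test_meas tp.
under [Y in ig Y]eq_fun do rewrite expr2.
by apply: test_ig => //; apply: testM => //; exact: test_smooth tp.
Qed.

Lemma test_vL2 phi : test_function Om phi -> vL2 (grad phi).
Proof.
move=> tp i; have := test_L2 (test_partial i tp); congr L2.
by apply/funext => x; rewrite mxE.
Qed.

Lemma Hs_L2 u Du : Hs u Du -> L2 u. Proof. by case. Qed.
Lemma Hs_vL2 u Du : Hs u Du -> vL2 Du. Proof. by case. Qed.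
Hint Resolve test_L2 test_vL2 Hs_L2 Hs_vL2 : core.

(** The triangle inequality for squared norms, at the cost of a factor 2 at each of the two
    approximations; later closure arguments rest on it. *)
Lemma Hs_lim u Du : L2 u -> vL2 Du -> (forall e, 0 < e -> exists v Dv, Hs v Dv /\
    It (fun x => (u x - v x) ^+ 2) + nq (fun x => Du x - Dv x) < e) -> Hs u Du.
Proof.
move=> Lu LDu h; split=> // e e0.
have e4 : 0 < e / 4 by rewrite divr_gt0.
have [v [Dv [[Lv LDv /(_ _ e4)[phi tp hp]] hv]]] := h _ e4.
exists phi => //.
have h1 : It (fun x => (u x - phi x) ^+ 2) <=
    2 * It (fun x => (u x - v x) ^+ 2) + 2 * It (fun x => (v x - phi x) ^+ 2).
  apply: le_trans (ItD2 mO (L2B mO Lu Lv) (L2B mO Lv (test_L2 tp))).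
  by apply/le_of_eq/eq_It => x _; congr (_ ^+ 2); ring.
have h2 : nq (fun x => Du x - grad phi x) <=
    2 * nq (fun x => Du x - Dv x) + 2 * nq (fun x => Dv x - grad phi x).
  apply: le_trans (nqD (vL2B LDu LDv) (vL2B LDv (test_vL2 tp))).
  by apply/le_of_eq/eq_It => x _; rewrite addrA subrK.
lra.
Qed.

Lemma Hs_test phi : test_function Om phi -> Hs phi (grad phi).
Proof.
move=> tp; split; auto => e e0; exists phi => //.
rewrite (@eq_It _ _ _ leb Om _ (fun=> 0)); last by move=> x _; rewrite subrr expr0n.
rewrite /nq (@eq_It _ _ _ leb Om (fun x => dot _ _) (fun=> 0)) ?It0 ?addr0// => x _.
by rewrite subrr /dot big1// => i _; rewrite mxE mul0r.
Qed.

Lemma grad_lin a phi psi x : test_function Om phi -> test_function Om psi ->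
  grad (fun x => a * phi x + psi x) x = a *: grad phi x + grad psi x.
Proof.
move=> tp tq; apply/rowP => i; rewrite !mxE.
have sp := smooth_C1 (test_smooth (testZ a tp)).
rewrite (partialD i sp (smooth_C1 (test_smooth tq))).
by rewrite (partialM i (C1part_cst a) (smooth_C1 (test_smooth tp))) partial_cst; ring.
Qed.

Lemma Hs_lin a u Du v Dv : Hs u Du -> Hs v Dv ->
  Hs (fun x => a * u x + v x) (fun x => a *: Du x + Dv x).
Proof.
move=> hu hv; apply: Hs_lim; first exact: (L2D mO (L2Z mO a (Hs_L2 hu)) (Hs_L2 hv)).
  exact: (vL2lin a (Hs_vL2 hu) (Hs_vL2 hv)).
move=> e e0; have [Lu LDu h1] := hu; have [Lv LDv h2] := hv.
pose d := e / (4 * (a ^+ 2 + 1)).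
have a1 : 0 < a ^+ 2 + 1 by rewrite ltr_wpDl// sqr_ge0.
have d0 : 0 < d by rewrite divr_gt0// mulr_gt0.
have [phi tp hp] := h1 _ d0; have [psi tq hq] := h2 _ d0.
exists (fun x => a * phi x + psi x), (grad (fun x => a * phi x + psi x)); split.
  by apply: Hs_test; apply: testD => //; exact: testZ.
have LA := L2B mO Lu (test_L2 tp); have LB := L2B mO Lv (test_L2 tq).
have VA := vL2B LDu (test_vL2 tp); have VB := vL2B LDv (test_vL2 tq).
have i1 : It (fun x => (a * u x + v x - (a * phi x + psi x)) ^+ 2) <=
    2 * (a ^+ 2 * It (fun x => (u x - phi x) ^+ 2)) + 2 * It (fun x => (v x - psi x) ^+ 2).
  rewrite -(ItZ mO) ?L2_ig//.
  rewrite (@eq_It _ _ _ leb Om (fun x => a ^+ 2 * _) (fun x => (a * (u x - phi x)) ^+ 2)); last first.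
    by move=> x _; rewrite exprMn.
  apply: le_trans (ItD2 mO (L2Z mO a LA) LB).
  by apply/le_of_eq/eq_It => x _; congr (_ ^+ 2); ring.
have i2 : nq (fun x => a *: Du x + Dv x - grad (fun x => a * phi x + psi x) x) <=
    2 * (a ^+ 2 * nq (fun x => Du x - grad phi x)) + 2 * nq (fun x => Dv x - grad psi x).
  rewrite /nq -(ItZ mO); last exact: (ig_dot VA VA).
  rewrite (@eq_It _ _ _ leb Om (fun x => a ^+ 2 * _)
     (fun x => dot (a *: (Du x - grad phi x)) (a *: (Du x - grad phi x)))); last first.
    by move=> x _; rewrite !dotE; ring.
  have VA' : vL2 (fun x => a *: (Du x - grad phi x)).
    move=> i; have := L2Z mO a (VA i); congr L2; by apply/funext => x; rewrite !mxE.
  apply: le_trans (nqD VA' VB).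
  apply/le_of_eq/eq_It => x _; rewrite grad_lin//.
  by congr dot; apply/rowP => i; rewrite !mxE; ring.
apply: (le_lt_trans (lerD i1 i2)).
set A := It _ in hp *; set A2 := nq _ in hp *; set B := It _ in hq *; set B2 := nq _ in hq *.
have A0 : 0 <= A + A2 by rewrite addr_ge0 ?(nq_ge0 VA)// Rintegral_ge0// => x _; exact: sqr_ge0.
have -> : e = 4 * (a ^+ 2 + 1) * d by rewrite /d; field; rewrite gt_eqF.
have h3 : 0 <= a ^+ 2 * d := mulr_ge0 (sqr_ge0 a) (ltW d0).
have := ler_wpM2l (sqr_ge0 a) (ltW hp); move: hp hq h3 d0; clear.
move: (a ^+ 2) => q; clearbody A A2 B B2 d; lra.
Qed.

Lemma le_pow2 (k l : nat) : (k <= l)%N -> (2 ^- l : R) <= 2 ^- k.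
Proof. by move=> kl; rewrite -!exprVn ler_wiXn2l// ?invr_ge0// invf_le1// ler1n. Qed.

Lemma pow2_small (e : R) : 0 < e -> exists k : nat, 2 ^- k < e.
Proof.
move=> e0; have [k _ hk] := near_infty_natSinv_lt (PosNum e0).
exists k; apply: le_lt_trans (hk k (leqnn k)).
by rewrite lef_pV2 ?posrE ?exprn_gt0// -natrX ler_nat ltn_expl.
Qed.

Lemma Hs_seq u Du : Hs u Du -> exists phi : nat -> X -> R, forall k,
  [/\ test_function Om (phi k), It (fun x => (u x - phi k x) ^+ 2) <= 2 ^- k &
      nq (fun x => Du x - grad (phi k) x) <= 2 ^- k].
Proof.
move=> [Lu LDu h].
have /choice[phi hphi] : forall k, exists phi, test_function Om phi /\
    It (fun x => (u x - phi x) ^+ 2) + nq (fun x => Du x - grad phi x) < 2 ^- k.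
  by move=> k; have [|phi] := h (2 ^- k); [rewrite invr_gt0 exprn_gt0|exists phi].
exists phi => k; have [tk hk] := hphi k.
have h1 := nq_ge0 (vL2B LDu (test_vL2 tk)).
have h2 : 0 <= It (fun x => (u x - phi k x) ^+ 2) by exact: It_sqr_ge0.
by split=> //; lra.
Qed.

Lemma Hs_ae_seq u Du : Hs u Du -> exists phi : nat -> X -> R,
  [/\ forall k, [/\ test_function Om (phi k), It (fun x => (u x - phi k x) ^+ 2) <= 2 ^- k &
      nq (fun x => Du x - grad (phi k) x) <= 2 ^- k],
   aeD (fun x => (phi ^~ x) @ \oo --> u x) &
   forall i, aeD (fun x => (fun k => partial i (phi k) x) @ \oo --> Du x 0 i)].
Proof.
move=> hu; have [Lu LDu _] := hu; have [phi hphi] := Hs_seq hu; exists phi; split=> //.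
  apply: (L2_fast_ae mO) => // k; first by apply: test_L2; case: (hphi k).
  have [_ h _] := hphi k; apply: le_trans h; apply/le_of_eq/eq_It => x _.
  by rewrite -sqrrN opprB.
move=> i; apply: (L2_fast_ae mO) => // k; first by apply: test_L2; apply: test_partial; case: (hphi k).
have [tk _ h] := hphi k; apply: le_trans h.
apply: le_trans (nq_coord i (vL2B LDu (test_vL2 tk))).
apply/le_of_eq/eq_It => x _.
by rewrite !mxE -sqrrN opprB.
Qed.

Lemma L2_cvgM (u_ : nat -> X -> R) u w : (forall k, L2 (u_ k)) -> L2 u -> L2 w ->
  (fun k => It (fun x => (u_ k x - u x) ^+ 2)) @ \oo --> 0 ->
  (fun k => It (fun x => u_ k x * w x)) @ \oo --> It (fun x => u x * w x).
Proof.
move=> Lk Lu Lw h; apply/cvgrPdist_lt => e e0.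
pose W := It (fun x => w x ^+ 2) + 1.
have W0 : 0 <= It (fun x => w x ^+ 2) by exact: It_sqr_ge0.
have W1 : 0 < W by rewrite ltr_wpDl.
have d0 : 0 < e ^+ 2 / W by rewrite divr_gt0// exprn_gt0.
move/cvgrPdist_lt : h => /(_ _ d0); apply: filterS => k.
rewrite sub0r normrN => h.
rewrite -(ItB mO (L2M mO Lu Lw) (L2M mO (Lk k) Lw)).
apply: ltr_sqr_norm => //; rewrite real_normK ?num_real//.
rewrite (@eq_It _ _ _ leb Om _ (fun x => (u x - u_ k x) * w x)); last by move=> x _; ring.
apply: le_lt_trans (L2CS mO (L2B mO Lu (Lk k)) Lw) _.
have h' : It (fun x => (u x - u_ k x) ^+ 2) < e ^+ 2 / W.
  apply: le_lt_trans h; apply: le_trans (ler_norm _).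
  by apply/le_of_eq/eq_It => x _; rewrite -sqrrN opprB.
have -> : e ^+ 2 = e ^+ 2 / W * W by rewrite divfK// gt_eqF.
apply: (@le_lt_trans _ _ (It (fun x => (u x - u_ k x) ^+ 2) * W)).
  by rewrite ler_wpM2l ?lerDl//; exact: It_sqr_ge0.
by rewrite ltr_pM2r.
Qed.

Lemma pow2_cvg (f : nat -> R) : (forall k, 0 <= f k) -> (forall k, f k <= 2 ^- k) -> f @ \oo --> 0.
Proof.
move=> f0 f1; apply/cvgrPdist_lt => e e0; have [k hk] := pow2_small e0.
exists k => // l /= kl; rewrite sub0r normrN ger0_norm//.
exact: le_lt_trans (le_trans (f1 l) (le_pow2 kl)) hk.
Qed.

(** Integration by parts holds for the approximating test functions, and both of its sides are
    continuous for L2 convergence. *)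
Lemma Hs_weak u Du : Hs u Du -> weak_gradient Om u Du.
Proof.
move=> hu psi i tp; have [Lu LDu _] := hu; have [phi hphi] := Hs_seq hu.
have tphi k : test_function Om (phi k) by case: (hphi k).
have c1 : (fun k => It (fun x => phi k x * partial i psi x)) @ \oo --> It (fun x => u x * partial i psi x).
  apply: L2_cvgM => //; [by move=> k; exact: test_L2|by apply: test_L2; exact: test_partial|].
  apply: pow2_cvg => k; first by exact: It_sqr_ge0.
  have [_ h _] := hphi k; apply: le_trans h; apply/le_of_eq/eq_It => x _.
  by rewrite -sqrrN opprB.
have c2 : (fun k => It (fun x => partial i (phi k) x * psi x)) @ \oo --> It (fun x => Du x 0 i * psi x).
  apply: L2_cvgM => //; [by move=> k; exact/test_L2/test_partial|by apply: test_L2|].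
  apply: pow2_cvg => k; first by exact: It_sqr_ge0.
  have [tk _ h] := hphi k; apply: le_trans h.
  apply: le_trans (nq_coord i (vL2B LDu (test_vL2 tk))).
  apply/le_of_eq/eq_It => x _.
  by rewrite !mxE -sqrrN opprB.
rewrite -(cvg_lim (@Rhausdorff R) c1).
rewrite (_ : (fun k => _) = (fun k => - It (fun x => partial i (phi k) x * psi x))).
  by rewrite (cvg_lim (@Rhausdorff R) (cvgN c2)).
by apply/funext => k /=; rewrite (test_ibp oOm bOm i (tphi k) tp).
Qed.

Lemma H10_Hs u Du : H10 Om u Du <-> Hs u Du.
Proof.
have key phi : L2 u -> vL2 Du -> test_function Om phi ->
   (\int[leb]_(x in Om) ((u x - phi x) ^+ 2 +
        \sum_(i < n) (Du x 0 i - partial i phi x) ^+ 2)%:E)%E =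
   (It (fun x => (u x - phi x) ^+ 2) + nq (fun x => Du x - grad phi x))%:E.
  move=> Lu LDu tp; have LA := L2B mO Lu (test_L2 tp); have VA := vL2B LDu (test_vL2 tp).
  rewrite /nq -(ItD mO (L2_ig LA) (ig_dot VA VA)) -(ItE mO); last first.
    by apply: (igD mO (L2_ig LA) (ig_dot VA VA)).
  apply: eq_integral => x _; congr (_ + _)%:E; apply: eq_bigr => i _.
  by rewrite !mxE -expr2.
split.
  move=> [[/(Lp2 mO) Lu LDu wu] h]; have vDu : vL2 Du by move=> i; exact/(Lp2 mO).
  split=> // e e0; have [|phi tp] := h (Num.sqrt e); first by rewrite sqrtr_gt0.
  by rewrite key// sqr_sqrtr ?(ltW e0)// lte_fin => hp; exists phi.
move=> hu; have [Lu LDu h] := hu; split.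
  split; [exact/(Lp2 mO)| |exact: Hs_weak].
  by move=> i; apply/(Lp2 mO).
move=> e e0; have [|phi tp hp] := h (e ^+ 2); first by rewrite exprn_gt0.
by exists phi => //; rewrite key// lte_fin.
Qed.

Lemma Hs_ae u Du v (Dv : X -> X) : Hs u Du -> measurable_fun Om v -> (forall i, measurable_fun Om (fun x => Dv x 0 i)) ->
  aeD (fun x => u x = v x) -> aeD (fun x => Du x = Dv x) -> Hs v Dv.
Proof.
move=> hu mv mDv uv Duv; have [Lu LDu _] := hu.
have Lv : L2 v.
  apply: (@L2_le _ _ _ _ _ mO _ _ mv (L2_ig Lu)).
  by apply: aeD1 uv => x _ ->.
have LDv : vL2 Dv.
  move=> i; apply: (@L2_le _ _ _ _ _ mO _ _ (mDv i) (L2_ig (LDu i))).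
  by apply: aeD1 Duv => x _ ->.
apply: Hs_lim => // e e0; exists u, Du; split=> //.
have -> : It (fun x => (v x - u x) ^+ 2) = It (fun=> 0).
  apply: (It_eq mO) => //; first exact: L2_ig (L2B mO Lv Lu).
  by apply: aeD1 uv => x _ ->; rewrite subrr expr0n.
have -> : nq (fun x => Dv x - Du x) = It (fun=> 0).
  apply: (It_eq mO) => //; first exact: ig_dot (vL2B LDv LDu) (vL2B LDv LDu).
  by apply: aeD1 Duv => x _ ->; rewrite subrr /dot big1// => i _; rewrite mxE mul0r.
by rewrite !It0 addr0.
Qed.

Lemma Hs_complete (u_ : nat -> X -> R) (Du_ : nat -> X -> X) : (forall k, Hs (u_ k) (Du_ k)) ->
  (forall e, 0 < e -> exists N, forall k l, (N <= k)%N -> (N <= l)%N ->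
     It (fun x => (u_ k x - u_ l x) ^+ 2) <= e /\ nq (fun x => Du_ k x - Du_ l x) <= e) ->
  exists u Du, [/\ Hs u Du, (fun k => It (fun x => (u_ k x - u x) ^+ 2)) @ \oo --> 0 &
    (fun k => nq (fun x => Du_ k x - Du x)) @ \oo --> 0].
Proof.
move=> hH hC.
have [u Lu cu] : exists2 u, L2 u & (fun k => It (fun x => (u_ k x - u x) ^+ 2)) @ \oo --> 0.
  apply: (L2_complete mO) => [k|e /hC[N hN]]; first by case: (hH k).
  by exists N => k l Nk Nl; case: (hN k l Nk Nl).
have /choice[Di hDi] i : exists Di, L2 Di /\ (fun k => It (fun x => (Du_ k x 0 i - Di x) ^+ 2)) @ \oo --> 0.
  have [|e /hC[N hN]|Di] := @L2_complete _ _ _ leb _ mO (fun k x => Du_ k x 0 i); last by exists Di.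
    by move=> k; case: (hH k).
  exists N => k l Nk Nl; have [_] := hN k l Nk Nl; apply: le_trans.
  apply: le_trans (nq_coord i (vL2B (Hs_vL2 (hH k)) (Hs_vL2 (hH l)))).
  by apply/le_of_eq/eq_It => x _; rewrite !mxE.
pose Du x : X := \row_i Di i x.
have LDu : vL2 Du.
  by move=> i; have [h _] := hDi i; move: h; congr L2; apply/funext => x; rewrite mxE.
have cD : (fun k => nq (fun x => Du_ k x - Du x)) @ \oo --> 0.
  have -> : (fun k => nq (fun x => Du_ k x - Du x)) =
      (fun k => \sum_(i < n) It (fun x => (Du_ k x 0 i - Di i x) ^+ 2)).
    apply/funext => k; rewrite -(It_sum mO); last first.
      move=> i _; apply: L2_ig; apply: (L2B mO); first by case: (hH k).
      by have [] := hDi i.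
    by apply: eq_It => x _; apply: eq_bigr => i _; rewrite !mxE expr2.
  have h0 : \sum_(i < n) (0 : R) = 0 by rewrite big1.
  rewrite -[Y in _ --> Y]h0; apply: cvg_big => [|i _].
    exact: add_continuous.
  by have [] := hDi i.
exists u, Du; split=> //; apply: Hs_lim => // e e0.
have /cvgrPdist_lt/(_ e e0) : (fun k => It (fun x => (u_ k x - u x) ^+ 2) +
    nq (fun x => Du_ k x - Du x)) @ \oo --> 0 by rewrite -[0]addr0; exact: cvgD cu cD.
move=> [k _ /(_ k (leqnn k))]; rewrite sub0r normrN => hk.
exists (u_ k), (Du_ k); split=> //; apply: le_lt_trans hk; apply: le_trans (ler_norm _).
apply: lerD; apply/le_of_eq/eq_It => x _.
  by rewrite -sqrrN opprB.
by rewrite -(opprB (Du_ k x)) !dotNl !dotNr opprK.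
Qed.

End Sobolev_space.

(** * Chain rule *)

Section polynomial_approximation.
Context {R : realType}.
Implicit Types (g : R -> R) (p : {poly R}).

(* [T f j = s f(j+1) + (1-s) f(j)] preserves positivity and affine functions, and adds the
   variance [s(1-s)] to [(j+c)^2]; its [m]-th iterate at [0] is the Bernstein polynomial. *)
Fixpoint bernstein (m : nat) (f : nat -> R) : {poly R} :=
  if m is m'.+1 then 'X * bernstein m' (fun j => f j.+1) + (1 - 'X) * bernstein m' f
  else (f 0%N)%:P.

Lemma bernsteinS m f (s : R) : (bernstein m.+1 f).[s] =
  s * (bernstein m (fun j => f j.+1)).[s] + (1 - s) * (bernstein m f).[s].
Proof. by rewrite /= !hornerE. Qed.

Lemma bernstein_le m f h (s : R) : 0 <= s <= 1 -> (forall j, (j <= m)%N -> `|f j| <= h j) ->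
  `|(bernstein m f).[s]| <= (bernstein m h).[s].
Proof.
move=> /andP[s0 s1]; elim: m f h => [|m ih] f h fh; first by rewrite /= !hornerC fh.
rewrite !bernsteinS; apply: le_trans (ler_normD _ _) _.
rewrite !normrM (ger0_norm s0) [`|1 - s|]ger0_norm ?subr_ge0//.
apply: lerD; apply: ler_wpM2l; rewrite ?subr_ge0//; apply: ih => j jm; apply: fh => //.
exact: leqW.
Qed.

Lemma bernsteinB m f (c s : R) : (bernstein m (fun j => f j - c)).[s] = (bernstein m f).[s] - c.
Proof.
elim: m f => [|m ih] f; first by rewrite /= !hornerC.
by rewrite !bernsteinS !ih; ring.
Qed.

Lemma bernstein_moment m (A B c s : R) : (bernstein m (fun j => A + B * (j%:R + c) ^+ 2)).[s] =
  A + B * ((c + m%:R * s) ^+ 2 + m%:R * (s * (1 - s))).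
Proof.
elim: m c => [|m ih] c; first by rewrite /= !hornerC; ring.
rewrite bernsteinS ih.
rewrite (_ : (fun j => _) = (fun j : nat => A + B * (j%:R + (c + 1)) ^+ 2)); last first.
  by apply/funext => j; rewrite -natr1; congr (_ + _ * _ ^+ 2); ring.
by rewrite ih -[in RHS]natr1; ring.
Qed.

(** Compactness of the segment in its near-covering form; only [s] is confined to the segment. *)
Lemma unif_cont g (a b e : R) : continuous g -> 0 < e ->
  exists2 d, 0 < d & forall s t, a <= s <= b -> `|s - t| < d -> `|g s - g t| <= e.
Proof.
move=> cg e0.
have /compact_near_coveringP/(_ R (nbhs (0:R)^'+) (fun d s => forall t, `|s - t| < d -> `|g s - g t| <= e) _) :=
  @segment_compact R a b.
have h : forall x, `[a, b]%classic x -> \forall x' \near x & i \near 0^'+,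
    forall t, `|x' - t| < i -> `|g x' - g t| <= e.
  move=> x _; have /cvgrPdist_lt/(_ (e / 2)) := cg x.
  rewrite divr_gt0// => /(_ isT)/nbhs_ballP[d /= d0 hd].
  exists ([set y | `|x - y| < d / 2], [set i | 0 < i < d / 2]).
    split => /=; first by apply/nbhs_ballP; exists (d / 2) => //=; rewrite divr_gt0.
    near=> i; apply/andP; split; first by near: i; exact: nbhs_right_gt.
    by near: i; apply: nbhs_right_lt; rewrite divr_gt0.
  move=> [y i] [/= xy /andP[i0 id]] t yt.
  have h1 : `|g x - g y| < e / 2 by apply: hd; rewrite /ball/=; lra.
  have h2 : `|g x - g t| < e / 2.
    apply: hd; rewrite /ball/=; have := ler_distD y x t; lra.
  have := ler_distD (g x) (g y) (g t); rewrite (distrC (g y) (g x)); lra.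
move=> /(_ h) [d /= d0 hd].
exists (d / 2); first by rewrite divr_gt0.
move=> s t sab; apply: (hd (d / 2)) => //=.
- by rewrite sub0r normrN gtr0_norm ?divr_gt0//; lra.
- by rewrite divr_gt0.
Unshelve. all: by end_near. Qed.

Lemma seg_bounded g (a b : R) : continuous g -> exists2 M, 0 <= M & forall s, a <= s <= b -> `|g s| <= M.
Proof.
move=> cg; have cK : compact (g @` `[a, b]%classic).
  by apply: continuous_compact; [exact: continuous_subspaceT|exact: segment_compact].
have [M [Mr hM]] := compact_bounded cK.
exists (Num.max M 0 + 1) => [|s sab]; first by rewrite addr_ge0// le_max lexx orbT.
apply: (hM (Num.max M 0 + 1)); last by exists s.
by rewrite (@le_lt_trans _ _ (Num.max M 0)) ?le_max ?lexx// ltrDl.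
Qed.

(** Bernstein's proof. Uniform continuity gives [|g t - g s| <= e / 2 + D (t - s)^2] with
    [D = 2 M / d^2]; the Bernstein operator is positive, so the error is at most the image of the
    right side, and the variance [x (1 - x) / m] makes the quadratic term small. *)
Lemma weierstrass g (a b e : R) : continuous g -> a < b -> 0 < e ->
  exists p, forall s, a <= s <= b -> `|p.[s] - g s| <= e.
Proof.
move=> cg ab e0; have e2 : 0 < e / 2 by rewrite divr_gt0.
have [d d0 hd] := unif_cont a b cg e2.
have [M M0 hM] := seg_bounded a b cg.
pose D := 2 * M / d ^+ 2.
have D0 : 0 <= D by apply: divr_ge0; [exact: mulr_ge0|exact: sqr_ge0].
have est s t : a <= s <= b -> a <= t <= b -> `|g t - g s| <= e / 2 + D * (t - s) ^+ 2.
  move=> sab tab; have D2 : 0 <= D * (t - s) ^+ 2 by rewrite mulr_ge0// sqr_ge0.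
  have [h|h] := ltP `|s - t| d; first by rewrite distrC; have := hd s t sab h; lra.
  have : 2 * M <= D * (t - s) ^+ 2.
    rewrite /D mulrAC ler_pdivlMr ?exprn_gt0// ler_wpM2l ?mulr_ge0//.
    by rewrite -[(t - s) ^+ 2]real_normK ?num_real// distrC ler_pXn2r ?nnegrE// ltW.
  have := ler_normB (g t) (g s); have := hM _ sab; have := hM _ tab; lra.
pose l := b - a; have l0 : 0 < l by rewrite subr_gt0.
have [m hm] : exists m : nat, 0 < m%:R :> R /\ D * l ^+ 2 <= m%:R * (e / 2).
  exists (Num.trunc (D * l ^+ 2 / (e / 2))).+1; split; first by rewrite ltr0n.
  by rewrite -ler_pdivrMr// ltW// truncnS_gt.
have [m0 hm1] := hm.
pose f (j : nat) := g (a + l * (j%:R / m%:R)).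
exists (bernstein m f \Po (l^-1 *: ('X - a%:P))) => s sab.
rewrite horner_comp !hornerE; set x := l^-1 * (s - a).
have x01 : 0 <= x <= 1.
  have /andP[h1 h2] := sab; apply/andP; split; first by rewrite /x mulr_ge0 ?invr_ge0 ?(ltW l0)// subr_ge0.
  by rewrite /x mulrC ler_pdivrMr// mul1r lerD2r.
have sx : s = a + l * x by rewrite /x mulrA mulfV ?gt_eqF// mul1r addrC subrK.
rewrite -bernsteinB.
apply: (@le_trans _ _ (bernstein m (fun j => e / 2 + (D * (l / m%:R) ^+ 2) * (j%:R + - (m%:R * x)) ^+ 2)).[x]).
  apply: bernstein_le => // j jm; apply: le_trans (est s _ sab _) _.
    have j1 : 0 <= (j%:R / m%:R : R) <= 1 by rewrite divr_ge0//= ler_pdivrMr// mul1r ler_nat.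
    by move: j1; rewrite /l => /andP[j1 j2]; apply/andP; split; nra.
  rewrite {1}sx; apply: le_of_eq; congr (_ + _).
  by field; rewrite gt_eqF.
rewrite bernstein_moment [- _ + _]addrC subrr expr0n add0r.
have -> : D * (l / m%:R) ^+ 2 * (m%:R * (x * (1 - x))) = D * l ^+ 2 / m%:R * (x * (1 - x)).
  by field; rewrite gt_eqF.
have h1 : D * l ^+ 2 / m%:R <= e / 2 by rewrite ler_pdivrMr// [e / 2 * _]mulrC.
have h2 : 0 <= D * l ^+ 2 / m%:R by rewrite divr_ge0// mulr_ge0// sqr_ge0.
have /andP[x0 x1] := x01; move: h1 h2; move: (D * l ^+ 2 / m%:R) => q h1 h2.
by nra.
Qed.

Definition prim p : {poly R} := \poly_(i < (size p).+1) (p`_i.-1 / i%:R).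

Lemma deriv_prim p : (prim p)^`() = p.
Proof.
apply/polyP => i; rewrite coef_deriv coef_poly ltnS; case: ltnP => h /=.
  by rewrite -(mulr_natr (_ / _)) divfK// pnatr_eq0.
by rewrite mul0rn nth_default.
Qed.

Lemma prim0 p : (prim p).[0] = 0.
Proof. by rewrite horner_coef0 coef_poly /= invr0 mulr0. Qed.

Lemma lip_MVT f g (a b M : R) : (forall s, a <= s <= b -> is_derive s (1:R) f (g s)) ->
  (forall s, a <= s <= b -> `|g s| <= M) ->
  forall s t, a <= s <= b -> a <= t <= b -> `|f s - f t| <= M * `|s - t|.
Proof.
move=> df gM; have main s t : a <= s -> s <= t -> t <= b -> `|f t - f s| <= M * `|t - s|.
  move=> as_ st tb; have sub x : s <= x <= t -> a <= x <= b.
    by move=> /andP[h1 h2]; rewrite (le_trans as_ h1) (le_trans h2 tb).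
  have d1 x : x \in `]s, t[%R -> is_derive x (1:R) f (g x).
    by rewrite in_itv/= => /andP[h1 h2]; apply/df/sub; rewrite !ltW.
  have wc : {within `[s, t], continuous f}.
    apply: derivable_within_continuous => x; rewrite in_itv/= => hx.
    by have [] := df x (sub x hx).
  have [c cst ->] := MVT_segment st d1 wc.
  by rewrite normrM ler_wpM2r// gM// sub//; move: cst; rewrite in_itv.
move=> s t /andP[s1 s2] /andP[t1 t2]; have [st|ts] := leP s t.
  by rewrite distrC (distrC s); exact: main.
by apply: main => //; exact: ltW.
Qed.

(** The derivative is approximated within [e / M] and a primitive vanishing at 0 is taken; the mean
    value inequality costs the length of the interval, included in [M]. A zero at 0 is what
    composition with a test function requires. *)
Lemma approx_C1 f g (a b e : R) : a <= 0 <= b -> a < b -> 0 < e -> continuous g ->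
  (forall s, a <= s <= b -> is_derive s (1:R) f (g s)) -> f 0 = 0 ->
  exists p, p.[0] = 0 /\ forall s, a <= s <= b -> `|p.[s] - f s| <= e /\ `|(p^`()).[s] - g s| <= e.
Proof.
move=> ab0 ab e0 cg df f0; pose M := 1 + (b - a).
have M0 : 0 < M by rewrite ltr_wpDr ?subr_ge0 ?(ltW ab).
have eM : 0 < e / M by rewrite divr_gt0.
have [p hp] := weierstrass cg ab eM; exists (prim p); split; first exact: prim0.
have eM1 : e / M <= e by rewrite ler_pdivrMr// ler_peMr ?(ltW e0)// lerDl subr_ge0 ltW.
move=> s sab; split; last by rewrite deriv_prim (le_trans (hp s sab)).
have d x : a <= x <= b -> is_derive x (1:R) (fun y => (prim p).[y] - f y) (p.[x] - g x).
  move=> xab; have := df x xab => dfx; have dp := is_derive_poly (prim p) x.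
  by have := is_deriveB dp dfx; rewrite deriv_prim.
have := lip_MVT d hp sab ab0; rewrite prim0 f0 subrr !subr0 => /le_trans; apply.
rewrite mulrAC ler_pdivrMr// ler_wpM2l ?(ltW e0)//.
have /andP[s1 s2] := sab; have /andP[a1 b1] := ab0; rewrite ler_norml; apply/andP; split; rewrite /M; lra.
Qed.

End polynomial_approximation.

(** * Composition, truncation and products in H^1_0 *)

Section chain_rule.
Context {R : realType} {n : nat}.
Local Notation X := 'rV[R]_n.
Local Notation leb := (@lebesgue_rV R n).
Variable Om : set X.
Hypotheses (oOm : open Om) (bOm : bounded_set Om).
Let mO : measurable Om := mOm oOm.
Local Notation It f := (Rintegral leb Om f).
Local Notation L2 := (L2 leb Om).
Local Notation ig := (ig leb Om).
Local Notation aeD := (aeD leb Om).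
Local Notation Hs := (Hs Om).
Local Notation vL2 := (vL2 Om).
Local Notation nq := (nq Om).

Lemma L2_cst (c : R) : L2 (fun=> c).
Proof.
split; first exact: measurable_cst.
apply: (@ig_bounded _ _ _ oOm bOm _ (c ^+ 2)) => //.
by move=> x _; rewrite ger0_norm ?sqr_ge0.
Qed.

Lemma L2_dom (f g : X -> R) : measurable_fun Om f -> L2 g -> aeD (fun x => `|f x| <= g x) -> L2 f.
Proof.
move=> mf Lg h; apply: (L2_le mO mf (L2_ig Lg)); apply: aeD1 h => x _ h.
rewrite -[f x ^+ 2]real_normK ?num_real// ler_pXn2r ?nnegrE//.
exact: le_trans h.
Qed.

Lemma L2_bounded (f : X -> R) (M : R) : measurable_fun Om f -> aeD (fun x => `|f x| <= M) -> L2 f.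
Proof. by move=> mf h; apply: L2_dom mf (L2_cst M) h. Qed.

Lemma vL2Z (b : X -> R) (L : R) (Du : X -> X) : measurable_fun Om b -> aeD (fun x => `|b x| <= L) ->
  vL2 Du -> vL2 (fun x => b x *: Du x).
Proof.
move=> mb hb hD i; apply: (@L2_dom _ (fun x => `|L| * `|Du x 0 i|)).
- under eq_fun do rewrite mxE; exact: (measurable_funM mb (vL2_meas i hD)).
- apply: (L2Z mO); have [m2 i2] := hD i; split; first exact: measurableT_comp m2.
  by move: i2; under eq_fun do rewrite -real_normK ?num_real//.
- apply: aeD1 hb => x _ h; rewrite mxE normrM ler_wpM2r//.
  by apply: (le_trans h); exact: ler_norm.
Qed.

Lemma nqZ (b : X -> R) (L : R) (Du : X -> X) : measurable_fun Om b -> aeD (fun x => `|b x| <= L) ->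
  vL2 Du -> nq (fun x => b x *: Du x) <= L ^+ 2 * nq Du.
Proof.
move=> mb hb hD; have hZ := vL2Z mb hb hD.
rewrite -(ItZ mO); last exact: (ig_dot oOm hD hD).
apply: (It_le mO); [exact: (ig_dot oOm hZ hZ)|by apply: (igZ mO); exact: (ig_dot oOm hD hD)|].
apply: aeD1 hb => x _ h; rewrite !dotE mulrA ler_wpM2r ?dot_ge0// -expr2.
rewrite -[b x ^+ 2]real_normK ?num_real// ler_pXn2r ?nnegrE//.
exact: le_trans h.
Qed.

Lemma cvg_near (f : nat -> R) (e : R) : f @ \oo --> 0 -> 0 < e -> exists k, f k < e.
Proof.
move=> /cvgrPdist_lt/(_ e) + e0 => /(_ e0)[k _ /(_ k (leqnn k))].
by rewrite sub0r normrN => h; exists k; exact: le_lt_trans (ler_norm _) h.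
Qed.

Lemma sqrB_cvg0 (f_ : nat -> R) (f : R) : f_ @ \oo --> f -> (fun k => (f - f_ k) ^+ 2) @ \oo --> 0.
Proof.
move=> h; have c : (fun k => f - f_ k) @ \oo --> 0.
  by rewrite -(subrr f); apply: cvgB => //; exact: cvg_cst.
have h2 : (fun k => (f - f_ k) ^+ 2) @ \oo --> (0:R) ^+ 2 by exact: cvg_expn c.
have e0 : (0:R) ^+ 2 = 0 by rewrite expr0n.
by rewrite e0 in h2.
Qed.

(** Dominated convergence for functions and gradients at once. All gradients are multiples of one
    fixed field [Dv], so pointwise convergence of the scalar factors is enough. *)
Lemma Hs_dct Dv (F_ : nat -> X -> R) (g_ : nat -> X -> R) (F g H : X -> R) (L : R) :
  vL2 Dv -> (forall k, Hs (F_ k) (fun x => g_ k x *: Dv x)) ->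
  measurable_fun Om F -> measurable_fun Om g -> L2 H ->
  (forall k, measurable_fun Om (g_ k)) ->
  (forall k, aeD (fun x => `|F_ k x| <= H x)) -> (forall k, aeD (fun x => `|g_ k x| <= L)) ->
  aeD (fun x => F_ ^~ x @ \oo --> F x) -> aeD (fun x => g_ ^~ x @ \oo --> g x) ->
  Hs F (fun x => g x *: Dv x).
Proof.
move=> hDv hk mF mg LH mg_ FH gL cF cg.
have lim_le (f_ : nat -> R) (f M : R) : f_ @ \oo --> f -> (forall k, `|f_ k| <= M) -> `|f| <= M.
  by move=> /cvg_norm h hM; rewrite -(cvg_lim (@Rhausdorff R) h); apply: limr_le; [apply/cvg_ex; by exists `|f| |exact: nearW].
have FH' : aeD (fun x => `|F x| <= H x).
  by apply: aeD2 cF (aeD_forall FH) => x _ h1 h2; exact: lim_le h1 h2.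
have gL' : aeD (fun x => `|g x| <= L).
  by apply: aeD2 cg (aeD_forall gL) => x _ h1 h2; exact: lim_le h1 h2.
have LF := L2_dom mF LH FH'; have LD := vL2Z mg gL' hDv.
apply: (Hs_lim oOm bOm) => // e e0.
have c1 : (fun k => It (fun x => (F x - F_ k x) ^+ 2)) @ \oo --> It (fun=> 0 : R).
  have [|//||||_ //] := @It_DCT _ _ _ leb _ mO (fun k x => (F x - F_ k x) ^+ 2) (fun=> 0) (fun x => 4 * H x ^+ 2).
  - by move=> k; apply: measurable_funX; apply: measurable_funB => //; exact: L2_meas (Hs_L2 (hk k)).
  - by apply: aeD1 cF => x _; exact: sqrB_cvg0.
  - by apply: (igZ mO); exact: L2_ig.
  - move=> k; apply: aeD2 FH' (FH k) => x _ h1 h2.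
    rewrite ger0_norm ?sqr_ge0//; move: h1 h2; rewrite !ler_norml => /andP[? ?] /andP[? ?]; nra.
have c2 : (fun k => nq (fun x => g x *: Dv x - g_ k x *: Dv x)) @ \oo --> It (fun=> 0 : R).
  have mgk k := measurable_funB mg (mg_ k).
  have [|//||||_ //] := @It_DCT _ _ _ leb _ mO (fun k x => dot (g x *: Dv x - g_ k x *: Dv x) (g x *: Dv x - g_ k x *: Dv x))
    (fun=> 0) (fun x => 4 * L ^+ 2 * dot (Dv x) (Dv x)).
  - move=> k; apply: meas_dot => i; under eq_fun do rewrite -scalerBl mxE;
      exact: measurable_funM (mgk k) (vL2_meas i hDv).
  - apply: aeD1 cg => x _ h.
    under eq_fun do rewrite -scalerBl !dotE mulrA -expr2.
    have h2 : (fun k => (g x - g_ k x) ^+ 2 * dot (Dv x) (Dv x)) @ \oo --> 0 * dot (Dv x) (Dv x).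
      exact: cvgMl (sqrB_cvg0 h).
    by rewrite mul0r in h2.
  - by apply: (igZ mO); exact: ig_dot.
  - move=> k; apply: aeD2 gL' (gL k) => x _ h1 h2.
    rewrite ger0_norm ?dot_ge0// -scalerBl !dotE mulrA ler_wpM2r ?dot_ge0// -expr2.
    move: h1 h2; rewrite !ler_norml => /andP[? ?] /andP[? ?]; nra.
rewrite It0 in c1 c2.
have c : (fun k => It (fun x => (F x - F_ k x) ^+ 2) + nq (fun x => g x *: Dv x - g_ k x *: Dv x)) @ \oo --> 0.
  by rewrite -[Y in _ --> Y]addr0; exact: cvgD c1 c2.
have [k hke] := cvg_near c e0.
by exists (F_ k), (fun x => g_ k x *: Dv x).
Qed.

(** Polynomials without constant term preserve test functions, and on the bounded range of [phi]
    they approximate [f] together with its derivative. *)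
Lemma Hs_comp_test phi (f g : R -> R) : test_function Om phi ->
  (forall s, is_derive s (1:R) f (g s)) -> continuous g -> f 0 = 0 ->
  Hs (fun x => f (phi x)) (fun x => g (phi x) *: grad phi x).
Proof.
move=> tp df cg f0; have [K K0 hK] := test_bounded tp.
have K1 : - K - 1 < K + 1 by lra.
have K00 : - K - 1 <= 0 <= K + 1 by apply/andP; split; lra.
have pK x : - K - 1 <= phi x <= K + 1 by move: (hK x); rewrite ler_norml => /andP[? ?]; apply/andP; split; lra.
have cf : continuous f.
  by move=> s; apply: differentiable_continuous; apply/derivable1_diffP; case: (df s).
have /choice[P hP] : forall k : nat, exists p : {poly R}, p.[0] = 0 /\ forall s, - K - 1 <= s <= K + 1 ->
    `|p.[s] - f s| <= 2 ^- k /\ `|(p^`()).[s] - g s| <= 2 ^- k.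
  by move=> k; apply: (approx_C1 K00 K1 _ cg (fun s _ => df s) f0); rewrite invr_gt0 exprn_gt0.
have [M1 M10 hM1] := seg_bounded (- K - 1) (K + 1) cf.
have [M2 M20 hM2] := seg_bounded (- K - 1) (K + 1) cg.
have mphi := test_meas tp.
have cm (u : R -> R) : continuous u -> measurable_fun Om (fun x => u (phi x)).
  by move=> cu; apply: (measurableT_comp (continuous_measurable_fun cu)); exact: mphi.
have p1 k : (2 ^- k : R) <= 1 by rewrite invf_le1 ?exprn_gt0// exprn_ege1// ler1n.
have cvp (a : nat -> R) (b : R) : (forall k, `|a k - b| <= 2 ^- k) -> a @ \oo --> b.
  move=> h; apply: cvg_zero; apply/cvgrPdist_lt => e e0; have [k hk] := pow2_small e0.
  exists k => // l /= kl; rewrite sub0r normrN.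
  exact: le_lt_trans (le_trans (h l) (le_pow2 kl)) hk.
apply: (@Hs_dct _ (fun k x => (P k).[phi x]) (fun k x => ((P k)^`()).[phi x]) _ _ (fun=> M1 + 1) (M2 + 1)).
- exact: test_vL2.
- move=> k; have [P0 _] := hP k; have := Hs_test oOm bOm (test_horner P0 tp); congr Hs.
  apply/funext => x; apply/rowP => i; rewrite !mxE partial_horner//.
  exact: test_smooth tp.
- exact: cm.
- exact: cm.
- exact: L2_cst.
- by move=> k; apply: cm; exact: continuous_horner.
- move=> k; apply: aeDW => x _; have [_ /(_ _ (pK x))[h _]] := hP k.
  have := hM1 _ (pK x); have := ler_distD (f (phi x)) (P k).[phi x] 0; rewrite !subr0.
  have := p1 k; lra.
- move=> k; apply: aeDW => x _; have [_ /(_ _ (pK x))[_ h]] := hP k.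
  have := hM2 _ (pK x); have := ler_distD (g (phi x)) ((P k)^`()).[phi x] 0; rewrite !subr0.
  have := p1 k; lra.
- by apply: aeDW => x _; apply: cvp => k; have [_ /(_ _ (pK x))[h _]] := hP k.
- by apply: aeDW => x _; apply: cvp => k; have [_ /(_ _ (pK x))[_ h]] := hP k.
Qed.

Lemma der_cont (f g : R -> R) : (forall s, is_derive s (1:R) f (g s)) -> continuous f.
Proof. by move=> df s; apply: differentiable_continuous; apply/derivable1_diffP; case: (df s). Qed.

Lemma cont_comp_meas (f : R -> R) (v : X -> R) : continuous f -> measurable_fun Om v ->
  measurable_fun Om (fun x => f (v x)).
Proof. by move=> cf mv; apply: (measurableT_comp (continuous_measurable_fun cf)). Qed.

(** The gradient error splits into [(g v - g phi_k) Dv], which tends to 0 by dominated convergence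
    along an almost everywhere convergent sequence, and [g phi_k (Dv - grad phi_k)], controlled by
    the bound [L]. *)
Lemma Hs_comp v Dv (f g : R -> R) (L : R) : Hs v Dv ->
  (forall s, is_derive s (1:R) f (g s)) -> continuous g -> f 0 = 0 -> (forall s, `|g s| <= L) ->
  Hs (fun x => f (v x)) (fun x => g (v x) *: Dv x).
Proof.
move=> hv df cg f0 gL; have [Lv LDv _] := hv.
have L0 : 0 <= L := le_trans (normr_ge0 _) (gL 0).
have [phi [hphi cphi cD]] := Hs_ae_seq oOm bOm hv.
have tp k : test_function Om (phi k) by case: (hphi k).
have cf := der_cont df.
have lip s t : `|f s - f t| <= L * `|s - t|.
  apply: (@lip_MVT _ _ g (Num.min s t) (Num.max s t)) => //.
  - by rewrite ge_min lexx le_max lexx.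
  - by rewrite ge_min lexx orbT le_max lexx orbT.
have mf := cont_comp_meas cf (L2_meas Lv).
have mg := cont_comp_meas cg (L2_meas Lv).
have fL2 : L2 (fun x => f (v x)).
  apply: (L2_le mO mf (igZ mO (L ^+ 2) (L2_ig Lv))); apply: aeDW => x _.
  rewrite -exprMn -[f _ ^+ 2]real_normK ?num_real// -[(L * _) ^+ 2]real_normK ?num_real//.
  rewrite ler_pXn2r ?nnegrE// normrM (ger0_norm L0).
  by have := lip (v x) 0; rewrite f0 !subr0.
have gb := @aeDW _ _ _ leb Om _ (fun x _ => gL (v x)).
apply: (Hs_lim oOm bOm fL2 (vL2Z mg gb LDv)) => e e0.
have i1 k : It (fun x => (f (v x) - f (phi k x)) ^+ 2) <= L ^+ 2 * 2 ^- k.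
  have [_ h _] := hphi k; have LB := L2B mO Lv (test_L2 oOm bOm (tp k)).
  apply: le_trans (ler_wpM2l (sqr_ge0 L) h); rewrite -(ItZ mO) ?L2_ig//.
  have [Lk _ _] := Hs_comp_test (tp k) df cg f0.
  apply: (It_le mO); [exact: L2_ig (L2B mO fL2 Lk)|by apply: (igZ mO); exact: L2_ig|].
  apply: aeDW => x _.
  rewrite -exprMn -[(f _ - _) ^+ 2]real_normK ?num_real// -[(L * _) ^+ 2]real_normK ?num_real//.
  by rewrite ler_pXn2r ?nnegrE// normrM (ger0_norm L0).
have mgk k : measurable_fun Om (fun x => g (phi k x)) := cont_comp_meas cg (test_meas (tp k)).
have c2 : (fun k => nq (fun x => (g (v x) - g (phi k x)) *: Dv x)) @ \oo --> It (fun=> 0 : R).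
  have [|//||||_ //] := @It_DCT _ _ _ leb _ mO
      (fun k x => dot ((g (v x) - g (phi k x)) *: Dv x) ((g (v x) - g (phi k x)) *: Dv x))
      (fun=> 0) (fun x => 4 * L ^+ 2 * dot (Dv x) (Dv x)).
  - move=> k; apply: meas_dot => i; under eq_fun do rewrite mxE;
      exact: measurable_funM (measurable_funB mg (mgk k)) (vL2_meas i LDv).
  - apply: aeD1 cphi => x _ h.
    under eq_fun do rewrite !dotE mulrA -expr2.
    have h1 : (fun k => g (phi k x)) @ \oo --> g (v x) by exact: (cvg_comp _ _ h (cg (v x))).
    have h2 : (fun k => (g (v x) - g (phi k x)) ^+ 2 * dot (Dv x) (Dv x)) @ \oo --> 0 * dot (Dv x) (Dv x).
      exact: cvgMl (sqrB_cvg0 h1).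
    by rewrite mul0r in h2.
  - by apply: (igZ mO); exact: (ig_dot oOm LDv LDv).
  - move=> k; apply: aeDW => x _.
    rewrite ger0_norm ?dot_ge0// !dotE mulrA ler_wpM2r ?dot_ge0// -expr2.
    move: (gL (v x)) (gL (phi k x)); rewrite !ler_norml => /andP[? ?] /andP[? ?]; nra.
rewrite It0 in c2.
have i2 k : nq (fun x => g (v x) *: Dv x - g (phi k x) *: grad (phi k) x) <=
    2 * nq (fun x => (g (v x) - g (phi k x)) *: Dv x) + 2 * (L ^+ 2 * 2 ^- k).
  have [_ _ h] := hphi k; have VB := vL2B oOm LDv (test_vL2 oOm bOm (tp k)).
  have gk := @aeDW _ _ _ leb Om _ (fun x _ => gL (phi k x)).
  have h1 : nq (fun x => g (phi k x) *: (Dv x - grad (phi k) x)) <= L ^+ 2 * 2 ^- k.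
    exact: le_trans (nqZ (mgk k) gk VB) (ler_wpM2l (sqr_ge0 L) h).
  have gd : aeD (fun x => `|g (v x) - g (phi k x)| <= 2 * L).
    apply: aeDW => x _; apply: le_trans (ler_normB _ _) _.
    by have := gL (v x); have := gL (phi k x); lra.
  have V1 := vL2Z (measurable_funB mg (mgk k)) gd LDv.
  have V2 := vL2Z (mgk k) gk VB.
  apply: le_trans (lerD (lexx _) (ler_wpM2l (ler0n R 2) h1)).
  apply: le_trans (nqD oOm V1 V2); apply/le_of_eq/eq_It => x _.
  by rewrite scalerBl scalerBr addrA subrK.
have c0 : (fun k => L ^+ 2 * 2 ^- k : R) @ \oo --> 0.
  rewrite -[Y in _ --> Y](mulr0 (L ^+ 2)); apply: cvgMr; apply: pow2_cvg => k; last by [].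
  by rewrite invr_ge0 exprn_ge0.
have c : (fun k => L ^+ 2 * 2 ^- k + (2 * nq (fun x => (g (v x) - g (phi k x)) *: Dv x) + 2 * (L ^+ 2 * 2 ^- k))) @ \oo --> 0.
  have h3 : (fun k => L ^+ 2 * 2 ^- k + (2 * nq (fun x => (g (v x) - g (phi k x)) *: Dv x) + 2 * (L ^+ 2 * 2 ^- k)))
    @ \oo --> (0 + (2 * 0 + 2 * 0) : R).
    by apply: cvgD; [exact: c0|apply: cvgD; apply: cvgMr; [exact: c2|exact: c0]].
  by rewrite !mulr0 !addr0 in h3.
have [k hke] := cvg_near c e0.
exists (fun x => f (phi k x)), (fun x => g (phi k x) *: grad (phi k) x); split.
  exact: Hs_comp_test.
exact: le_lt_trans (lerD (i1 k) (i2 k)) hke.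
Qed.

(** The truncation is the limit of functions built from [sqrt ((s - k)^2 + 2^-j)]. Subtracting their
    value at 0 keeps them zero there, and for [0 <= k] the limit is then exactly [max (s - k) 0]. On
    the level set [v = k] the factor [chi] is only located between 0 and 1. *)
Lemma Hs_pos v Dv k : 0 <= k -> Hs v Dv -> exists chi : X -> R,
  [/\ measurable_fun Om chi, forall x, 0 <= chi x <= 1, forall x, v x < k -> chi x = 0,
      forall x, k < v x -> chi x = 1 &
      Hs (fun x => Num.max (v x - k) 0) (fun x => chi x *: Dv x)].
Proof.
move=> k0 hv; have [Lv LDv _] := hv; have mv := L2_meas Lv.
pose r (j : nat) (s : R) := Num.sqrt ((s - k) ^+ 2 + 2 ^- j).
have p0 j : 0 < 2 ^- j :> R by rewrite invr_gt0 exprn_gt0.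
have p1 j : 2 ^- j <= 1 :> R by rewrite invf_le1 ?exprn_gt0// exprn_ege1// ler1n.
have q0 j s : 0 < (s - k) ^+ 2 + 2 ^- j by rewrite ltr_wpDl ?sqr_ge0.
have r0 j s : 0 < r j s by rewrite sqrtr_gt0.
have rsq j s : r j s ^+ 2 = (s - k) ^+ 2 + 2 ^- j by rewrite sqr_sqrtr// ltW.
have rlo j s : `|s - k| <= r j s.
  by rewrite -(@ler_pXn2r _ 2) ?nnegrE ?(ltW (r0 _ _))// rsq real_normK ?num_real// lerDl ltW.
have rhi j s : r j s <= `|s - k| + r j k.
  have rk : r j k ^+ 2 = 2 ^- j by rewrite rsq subrr expr0n add0r.
  rewrite -(@ler_pXn2r _ 2) ?nnegrE ?addr_ge0 ?(ltW (r0 _ _))// rsq -[(s - k) ^+ 2]real_normK ?num_real//.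
  by rewrite -rk; have := mulr_ge0 (normr_ge0 (s - k)) (ltW (r0 j k)); nra.
pose f j s := 2^-1 * (s + r j s - r j 0).
pose g j s := 2^-1 * (1 + (s - k) / r j s).
have df j s : is_derive s (1:R) (f j) (g j s).
  have d1 : is_derive s (1:R) (fun t : R => (t - k) ^+ 2 + 2 ^- j) (2 * (s - k)).
    apply: is_derive_eq; rewrite ?scaler0 ?addr0 ?subr0 /GRing.scale/=; ring.
  have d2 := @is_derive1_comp R Num.sqrt (fun t : R => (t - k) ^+ 2 + 2 ^- j) s _ _ (is_derive1_sqrt (q0 j s)) d1.
  have d3 : is_derive s (1:R) (r j) ((2 * Num.sqrt ((s - k) ^+ 2 + 2 ^- j))^-1 * (2 * (s - k))).
    exact: d2.
  have d4 : is_derive s (1:R) (fun t => 2^-1 * (t + r j t - r j 0)) (g j s).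
    apply: is_derive_eq; rewrite /GRing.scale/= /g -/(r j s).
    by field; rewrite gt_eqF.
  exact: d4.
have cr j : continuous (r j).
  move=> s; apply: (@continuous_comp _ _ _ (fun t : R => (t - k) ^+ 2 + 2 ^- j) Num.sqrt).
    apply: continuousD; last exact: cst_continuous.
    by apply: (@cvg_expn _ _ _ _ (fun t : R => t - k)); apply: cvgB; [exact: cvg_id|exact: cvg_cst].
  exact: sqrt_continuous.
have cg j : continuous (g j).
  move=> s; apply: cvgMr; apply: cvgD; first exact: cvg_cst.
  apply: cvgM; first by apply: cvgB; [exact: cvg_id|exact: cvg_cst].
  by apply: cvgV; [rewrite gt_eqF|exact: cr].
have quo j s : `|(s - k) / r j s| <= 1.
  by rewrite normrM normfV (gtr0_norm (r0 _ _)) ler_pdivrMr// mul1r.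
have gL j s : `|g j s| <= 1.
  move: (quo j s); rewrite /g !ler_norml => /andP[h1 h2]; apply/andP; split; lra.
have f0 j : f j 0 = 0 by rewrite /f add0r subrr mulr0.
(* The value 1/2 at [s = k] is the limit there of the derivatives of the smoothed truncations. *)
pose chi s : R := if s < k then 0 else if s == k then 2^-1 else 1.
have rk0 : (fun j => r j k) @ \oo --> 0.
  have h : (fun j => Num.sqrt (2 ^- j : R)) @ \oo --> Num.sqrt (0:R).
    apply: continuous_cvg; first exact: sqrt_continuous.
    by apply: pow2_cvg => j; [exact: ltW|].
  rewrite sqrtr0 in h; apply: cvg_trans h; apply: near_eq_cvg; apply: nearW => j /=.
  by rewrite /r subrr expr0n add0r.
have cvr s : (fun j => r j s) @ \oo --> `|s - k|.
  have h : (fun j => `|s - k| + r j k) @ \oo --> `|s - k| + 0 by apply: cvgD => //; exact: cvg_cst.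
  rewrite addr0 in h; apply: (squeeze_cvgr _ (cvg_cst _) h).
  by apply: nearW => j; rewrite rlo rhi.
have cvf s : (fun j => f j s) @ \oo --> Num.max (s - k) 0.
  have h : (fun j => f j s) @ \oo --> 2^-1 * (s + `|s - k| - `|0 - k|).
    by apply: cvgMr; apply: cvgB; [apply: cvgD; [exact: cvg_cst|exact: cvr]|exact: cvr].
  have <- : 2^-1 * (s + `|s - k| - `|0 - k|) = Num.max (s - k) 0.
    rewrite sub0r normrN (ger0_norm k0); case: (leP 0 (s - k)) => h1.
      by rewrite ger0_norm//; field.
    by rewrite ltr0_norm//; field.
  exact: h.
have cvgg s : (fun j => g j s) @ \oo --> chi s.
  rewrite /chi; case: ltgtP => sk.
  - have n0 : `|s - k| != 0 by rewrite normr_eq0 subr_eq0 lt_eqF.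
    have h : (fun j => g j s) @ \oo --> 2^-1 * (1 + (s - k) / `|s - k|).
      by apply: cvgMr; apply: cvgD; [exact: cvg_cst|apply: cvgMr; apply: cvgV].
    move: h; rewrite ltr0_norm ?subr_lt0// invrN mulrN divff ?subr_eq0 ?lt_eqF// subrr mulr0; exact.
  - have n0 : `|s - k| != 0 by rewrite normr_eq0 subr_eq0 gt_eqF.
    have h : (fun j => g j s) @ \oo --> 2^-1 * (1 + (s - k) / `|s - k|).
      by apply: cvgMr; apply: cvgD; [exact: cvg_cst|apply: cvgMr; apply: cvgV].
    move: h; rewrite gtr0_norm ?subr_gt0// divff ?subr_eq0 ?gt_eqF//.
    by rewrite (_ : 2^-1 * (1 + 1) = 1)//; field.
  - rewrite (_ : (fun j => g j s) = fun=> 2^-1); first exact: cvg_cst.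
    by apply/funext => j; rewrite /g sk subrr mul0r addr0 mulr1.
exists (fun x => chi (v x)).
have mg j : measurable_fun Om (fun x => g j (v x)) := cont_comp_meas (cg j) mv.
have mchi : measurable_fun Om (fun x => chi (v x)).
  by apply: (measurable_fun_cvg mg) => x _; exact: cvgg.
split=> //.
- by move=> x; rewrite /chi; case: ltgtP => _; lra.
- by move=> x h; rewrite /chi h.
- by move=> x h; rewrite /chi ltNge (ltW h)/= gt_eqF.
apply: (@Hs_dct _ (fun j x => f j (v x)) (fun j x => g j (v x)) _ _ (fun x => `|v x|) 1) => //.
- by move=> j; exact: (Hs_comp hv (df j) (cg j) (f0 j) (gL j)).
- apply: measurable_maxr; last exact: measurable_cst.
  by apply: measurable_funB => //; exact: measurable_cst.
- by split; [exact: measurableT_comp mv|move: (L2_ig Lv); under eq_fun do rewrite -real_normK ?num_real//].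
- move=> j; apply: aeDW => x _.
  have := @lip_MVT _ (f j) (g j) (Num.min (v x) 0) (Num.max (v x) 0) 1 (fun s _ => df j s) (fun s _ => gL j s) (v x) 0.
  by rewrite f0 !subr0 mul1r; apply; rewrite ?ge_min ?le_max !lexx ?orbT.
- by move=> j; apply: aeDW => x _.
- by apply: aeDW => x _; exact: cvf.
- by apply: aeDW => x _; exact: cvgg.
Qed.

(** The derivative of a polynomial is unbounded, so [Hs_comp] is applied after the change of
    variable [s / (1 + s^2 2^-j)]. It is bounded, its slope is at most 1 in absolute value, and it
    tends to the identity; the bound on [v] provides the domination. *)
Lemma Hs_horner_bounded v Dv (M : R) (p : {poly R}) : Hs v Dv -> aeD (fun x => `|v x| <= M) -> p.[0] = 0 ->
  Hs (fun x => p.[v x]) (fun x => (p^`()).[v x] *: Dv x).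
Proof.
move=> hv vM P0; have [Lv LDv _] := hv; have mv := L2_meas Lv.
pose q (j : nat) : R := 2 ^- j.
have q0 j : 0 < q j by rewrite invr_gt0 exprn_gt0.
pose d j s := 1 + s ^+ 2 * q j.
have d1 j s : 1 <= d j s by rewrite lerDl mulr_ge0 ?sqr_ge0// ltW.
have d0 j s : 0 < d j s := lt_le_trans ltr01 (d1 j s).
pose th j s : R := s / d j s.
pose dth j s : R := (1 - s ^+ 2 * q j) / d j s ^+ 2.
have dd j s : is_derive s (1:R) (d j) (2 * s * q j).
  apply: is_derive_eq; rewrite /GRing.scale/=; ring.
have dt j s : is_derive s (1:R) (th j) (dth j s).
  have dn : d j s != 0 by rewrite gt_eqF.
  have d2 := @is_deriveV _ (d j) s _ 1 dn (dd j s).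
  have d3 : is_derive s (1:R) (fun t => t * (d j t)^-1) (dth j s).
    apply: is_derive_eq; rewrite /GRing.scale/= /dth /d.
    by field; rewrite -/(d j s) gt_eqF.
  exact: d3.
have cd j : continuous (d j) by move=> s; exact: (der_cont (dd j)).
have cth j : continuous (th j) := der_cont (dt j).
have cdth j : continuous (dth j).
  move=> s; apply: cvgM; last first.
    by apply: cvgV; [rewrite expf_neq0// gt_eqF|apply: cvg_expn; exact: cd].
  apply: cvgB; first exact: cvg_cst.
  by apply: cvgMl; apply: cvg_expn; exact: cvg_id.
have thv j s : `|th j s| <= `|s|.
  by rewrite normrM normfV (gtr0_norm (d0 _ _)) ler_pdivrMr// ler_peMr.
have thb j s : `|th j s| <= 1 + (q j)^-1.
  rewrite normrM normfV (gtr0_norm (d0 _ _)) ler_pdivrMr// mulrDl mul1r /d.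
  have -> : (q j)^-1 * (1 + s ^+ 2 * q j) = (q j)^-1 + s ^+ 2 by field; rewrite gt_eqF.
  have h1 : 0 < (q j)^-1 by rewrite invr_gt0.
  have h2 := mulr_ge0 (sqr_ge0 s) (ltW (q0 j)).
  have : `|s| <= 1 + s ^+ 2 by rewrite -[s ^+ 2]real_normK ?num_real//; have := sqr_ge0 (`|s| - 2^-1); nra.
  lra.
have dthb j s : `|dth j s| <= 1.
  rewrite normrM normfV [`|d j s ^+ 2|]ger0_norm ?sqr_ge0// ler_pdivrMr ?exprn_gt0// mul1r.
  apply: (@le_trans _ _ (d j s)); last by rewrite expr2 ler_peMr// ltW.
  by rewrite ler_norml /d; have h2 := mulr_ge0 (sqr_ge0 s) (ltW (q0 j)); apply/andP; split; lra.
have bb (u : {poly R}) (K : R) : exists C, forall s, `|s| <= K -> `|u.[s]| <= C.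
  have [C _ hC] := seg_bounded (- K) K (@continuous_horner _ u).
  by exists C => s; rewrite ler_norml; exact: hC.
have q0c : q @ \oo --> 0 by apply: pow2_cvg => j; [exact: ltW|].
have dc s : (fun j => d j s) @ \oo --> (1:R).
  have h : (fun j => d j s) @ \oo --> 1 + s ^+ 2 * 0 by apply: cvgD; [exact: cvg_cst|exact: cvgMr].
  by rewrite mulr0 addr0 in h.
have thc s : (fun j => th j s) @ \oo --> s.
  have h : (fun j => th j s) @ \oo --> s * 1^-1 by apply: cvgMr; apply: cvgV; [exact: oner_neq0|exact: dc].
  by rewrite invr1 mulr1 in h.
have dthc s : (fun j => dth j s) @ \oo --> (1:R).
  have h : (fun j => dth j s) @ \oo --> (1 - s ^+ 2 * 0) * (1 ^+ 2)^-1.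
    apply: cvgM; first by apply: cvgB; [exact: cvg_cst|exact: cvgMr].
    by apply: cvgV; [rewrite expr1n oner_neq0|apply: cvg_expn; exact: dc].
  by rewrite mulr0 subr0 expr1n invr1 mulr1 in h.
have [C1 hC1] := bb p M; have [C2 hC2] := bb p^`() M.
pose g j s := (p^`()).[th j s] * dth j s.
have dg j s : is_derive s (1:R) (fun t => p.[th j t]) (g j s).
  exact: (is_derive1_comp (is_derive_poly p (th j s)) (dt j s)).
have cp (u : {poly R}) j : continuous (fun s => u.[th j s]).
  by move=> s; apply: (@continuous_comp _ _ _ (th j) (horner u)); [exact: cth|exact: continuous_horner].
have cg j : continuous (g j) by move=> s; apply: cvgM; [exact: cp|exact: cdth].
apply: (@Hs_dct _ (fun j x => p.[th j (v x)]) (fun j x => g j (v x)) _ _ (fun=> C1) C2) => //.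
- move=> j; have [C hC] := bb p^`() (1 + (q j)^-1).
  apply: (@Hs_comp _ _ _ _ C hv (dg j) (cg j)); first by rewrite /th mul0r.
  by move=> s; rewrite /g normrM -[C]mulr1 ler_pM// hC// thb.
- by apply: cont_comp_meas => //; exact: continuous_horner.
- by apply: cont_comp_meas => //; exact: continuous_horner.
- exact: L2_cst.
- by move=> j; apply: cont_comp_meas.
- by move=> j; apply: aeD1 vM => x _ h; apply: hC1; exact: le_trans (thv _ _) h.
- move=> j; apply: aeD1 vM => x _ h; rewrite /g normrM -[C2]mulr1 ler_pM// hC2//.
  exact: le_trans (thv _ _) h.
- by apply: aeDW => x _; exact: (cvg_comp _ _ (thc (v x)) (@continuous_horner _ p (v x))).
- apply: aeDW => x _.
  have h : (fun j => g j (v x)) @ \oo --> (p^`()).[v x] * 1.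
    apply: cvgM; last exact: dthc.
    exact: (cvg_comp _ _ (thc (v x)) (@continuous_horner _ p^`() (v x))).
  by rewrite mulr1 in h.
Qed.

(** Meant for functions such as the logarithm, differentiable only on an interval that contains the
    values of [v]; polynomial approximation there reduces to [Hs_horner_bounded]. The derivative [g]
    must come with a continuous extension to the line. *)
Lemma Hs_comp_bounded v Dv (a b : R) (f g : R -> R) : Hs v Dv -> a <= 0 <= b -> a < b ->
  aeD (fun x => a <= v x <= b) -> (forall s, a <= s <= b -> is_derive s (1:R) f (g s)) ->
  continuous g -> f 0 = 0 -> measurable_fun Om (fun x => f (v x)) ->
  Hs (fun x => f (v x)) (fun x => g (v x) *: Dv x).
Proof.
move=> hv ab0 ab vab df cg f0 mf; have [Lv LDv _] := hv; have mv := L2_meas Lv.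
have vM : aeD (fun x => `|v x| <= b - a).
  apply: aeD1 vab => x _ /andP[h1 h2]; move: ab0 => /andP[h3 h4].
  by rewrite ler_norml; apply/andP; split; lra.
have /choice[P hP] : forall k : nat, exists p : {poly R}, p.[0] = 0 /\ forall s, a <= s <= b ->
    `|p.[s] - f s| <= 2 ^- k /\ `|(p^`()).[s] - g s| <= 2 ^- k.
  by move=> k; apply: (approx_C1 ab0 ab _ cg df f0); rewrite invr_gt0 exprn_gt0.
have p1 k : (2 ^- k : R) <= 1 by rewrite invf_le1 ?exprn_gt0// exprn_ege1// ler1n.
have cvp (u : nat -> R) (l : R) : (forall k, `|u k - l| <= 2 ^- k) -> u @ \oo --> l.
  move=> h; apply: cvg_zero; apply/cvgrPdist_lt => e e0; have [k hk] := pow2_small e0.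
  exists k => // m /= km; rewrite sub0r normrN.
  exact: le_lt_trans (le_trans (h m) (le_pow2 km)) hk.
have [M M0 hM] := seg_bounded a b cg.
have fb s : a <= s <= b -> `|f s| <= M * (b - a).
  move=> sab; have := lip_MVT df hM sab ab0; rewrite f0 !subr0 => /le_trans; apply.
  apply: ler_wpM2l => //; move: sab ab0 => /andP[h1 h2] /andP[h3 h4].
  by rewrite ler_norml; apply/andP; split; lra.
apply: (@Hs_dct _ (fun k x => (P k).[v x]) (fun k x => ((P k)^`()).[v x]) _ _ (fun=> M * (b - a) + 1) (M + 1)) => //.
- by move=> k; have [P0 _] := hP k; exact: Hs_horner_bounded hv vM P0.
- exact: cont_comp_meas.
- exact: L2_cst.
- by move=> k; apply: cont_comp_meas => //; exact: continuous_horner.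
- move=> k; apply: aeD1 vab => x _ h; have [_ /(_ _ h)[h1 _]] := hP k.
  have := fb _ h; have := ler_distD (f (v x)) (P k).[v x] 0; rewrite !subr0.
  have := p1 k; lra.
- move=> k; apply: aeD1 vab => x _ h; have [_ /(_ _ h)[_ h1]] := hP k.
  have := hM _ h; have := ler_distD (g (v x)) ((P k)^`()).[v x] 0; rewrite !subr0.
  have := p1 k; lra.
- by apply: aeD1 vab => x _ h; apply: cvp => k; have [_ /(_ _ h)[]] := hP k.
- by apply: aeD1 vab => x _ h; apply: cvp => k; have [_ /(_ _ h)[]] := hP k.
Qed.

(** Polarization: [v w] is half of [(v + w)^2 - v^2 - w^2], and squares are polynomials of bounded
    functions. *)
Lemma HsM v Dv w Dw (M : R) : Hs v Dv -> Hs w Dw -> aeD (fun x => `|v x| <= M) -> aeD (fun x => `|w x| <= M) ->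
  Hs (fun x => v x * w x) (fun x => v x *: Dw x + w x *: Dv x).
Proof.
move=> hv hw vM wM.
have sq u Du : Hs u Du -> aeD (fun x => `|u x| <= M + M) -> Hs (fun x => u x ^+ 2) (fun x => (2 * u x) *: Du x).
  move=> hu uM; have := Hs_horner_bounded (p := 'X^2) hu uM; rewrite hornerXn expr0n => /(_ erefl).
  rewrite derivXn; congr Hs; apply/funext => x; rewrite ?hornerMn !hornerXn//=.
  by rewrite expr1 mulr_natl.
have leD (u : X -> R) : aeD (fun x => `|u x| <= M) -> aeD (fun x => `|u x| <= M + M).
  by apply: aeD1 => x _ h; apply: (le_trans h); rewrite lerDl (le_trans _ h).
have hs : Hs (fun x => 1 * v x + w x) (fun x => 1 *: Dv x + Dw x) := Hs_lin oOm bOm 1 hv hw.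
have sM : aeD (fun x => `|1 * v x + w x| <= M + M).
  by apply: aeD2 vM wM => x _ h1 h2; rewrite mul1r (le_trans (ler_normD _ _))// lerD.
have h1 := Hs_lin oOm bOm (-1) (sq _ _ hv (leD _ vM)) (sq _ _ hs sM).
have h2 := Hs_lin oOm bOm (-1) (sq _ _ hw (leD _ wM)) h1.
have := Hs_lin oOm bOm 2^-1 h2 (Hs_test oOm bOm (test0 Om)).
congr Hs; apply/funext => x; first by field.
by apply/rowP => i; rewrite !mxE partial_cst; field.
Qed.

End chain_rule.

(** * Compact embedding *)

Section cubes.
Context {R : realType} {n : nat}.
Local Notation X := 'rV[R]_n.
Local Notation leb := (@lebesgue_rV R n).
Variable Om : set X.
Hypotheses (oOm : open Om) (bOm : bounded_set Om).
Let mO : measurable Om := mOm oOm.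

Lemma test_ig_cube phi (l : 'I_n -> R) (r : R) : 0 <= r -> test_function Om phi ->
  ig leb (cube l r) phi.
Proof.
move=> r0 tp; have [M _ hM] := test_bounded tp.
apply: measurable_bounded_integrable => //.
- exact: measurable_cube.
- by rewrite [ltLHS](leb_cube l r0) ltry.
- exact: test_meas tp.
- by exists M; split; [exact: num_real|move=> N MN x _ /=; rewrite (le_trans (hM x))// ltW].
Qed.

Lemma dot_grad_test phi : test_function Om phi -> test_function Om (fun x => dot (grad phi x) (grad phi x)).
Proof.
move=> tp; have -> : (fun x => dot (grad phi x) (grad phi x)) = (fun x => \sum_(i < n) partial i phi x * partial i phi x).
  by apply/funext => x; apply: eq_bigr => i _; rewrite !mxE.
elim: (index_enum _) => [|i s ih].
  by under eq_fun do rewrite big_nil; exact: test0.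
under eq_fun do rewrite big_cons.
have ti := test_partial i tp.
exact: testD (testM ti (test_smooth ti)) ih.
Qed.

Lemma test_sqr phi : test_function Om phi -> test_function Om (fun x => phi x ^+ 2).
Proof.
move=> tp; under eq_fun do rewrite expr2.
by apply: testM => //; exact: test_smooth tp.
Qed.

(** The double integral in [poincare_cube] equals [2 r^n A - 2 b^2], where [A] is the integral of
    [phi^2] and [b] that of [phi]. *)
Lemma cube_variance phi (l : 'I_n -> R) (r : R) : 0 < r -> test_function Om phi ->
  Rintegral leb (cube l r) (fun x => phi x ^+ 2) <=
  2 ^+ n * r ^+ 2 * Rintegral leb (cube l r) (fun x => dot (grad phi x) (grad phi x)) +
  r ^- n * (Rintegral leb (cube l r) phi) ^+ 2.
Proof.
move=> r0 tp; set Q := cube l r; have mQ : measurable Q := measurable_cube l r.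
have i1 := test_ig_cube l (ltW r0) tp; have i2 := test_ig_cube l (ltW r0) (test_sqr tp).
have i3 := test_ig_cube l (ltW r0) (dot_grad_test tp).
have lQ : leb Q = (r ^+ n)%:E := leb_cube l (ltW r0).
have ic c : ig leb Q (fun=> c).
  apply: measurable_bounded_integrable => //; first by rewrite [ltLHS]lQ ltry.
  by exists `|c|; split; [exact: num_real|move=> N MN x _ /=; exact: ltW].
have Ic c : Rintegral leb Q (fun=> c) = c * r ^+ n.
  have h : (\int[leb]_(x in Q) c%:E = c%:E * (r ^+ n)%:E)%E by rewrite -lQ; exact: integral_cst.
  by rewrite /Rintegral h.
set A := Rintegral _ _ (fun x => phi x ^+ 2); set b := Rintegral _ _ phi; set G := Rintegral _ _ (fun x => dot _ _).
have inner x : (\int[leb]_(y in Q) ((phi x - phi y) ^+ 2)%:E)%E =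
    (r ^+ n * phi x ^+ 2 - 2 * b * phi x + A)%:E.
  have e y : (phi x - phi y) ^+ 2 = phi x ^+ 2 - 2 * phi x * phi y + phi y ^+ 2 by ring.
  under eq_integral do rewrite e.
  have i4 := igZ mQ (2 * phi x) i1.
  rewrite (ItE mQ (igD mQ (igB mQ (ic _) i4) i2)) (ItD mQ (igB mQ (ic _) i4) i2) (ItB mQ (ic _) i4).
  by rewrite (ItZ mQ _ i1) Ic; congr (_%:E); rewrite /A /b; ring.
have outer : (\int[leb]_(x in Q) \int[leb]_(y in Q) ((phi x - phi y) ^+ 2)%:E)%E =
    (2 * r ^+ n * A - 2 * b ^+ 2)%:E.
  under eq_integral do rewrite inner.
  have j1 := igZ mQ (r ^+ n) i2; have j2 := igZ mQ (2 * b) i1.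
  rewrite (ItE mQ (igD mQ (igB mQ j1 j2) (ic _))) (ItD mQ (igB mQ j1 j2) (ic _)) (ItB mQ j1 j2).
  rewrite (ItZ mQ _ i2) (ItZ mQ _ i1) Ic; congr (_%:E); rewrite -/A -/b; ring.
have := poincare_cube l r0 (test_C1 tp); rewrite outer.
have -> : (\int[leb]_(x in cube l r) (\sum_(i < n) (partial i phi x) ^+ 2)%:E)%E = G%:E.
  rewrite -(ItE mQ i3); apply: eq_integral => x _; congr (_%:E); apply: eq_bigr => i _.
  by rewrite !mxE expr2.
rewrite -EFinM lee_fin => h.
have rn : 0 < r ^+ n by rewrite exprn_gt0.
have h2 : 2 * r ^+ n * A <= r ^+ n * (2 ^+ n * r ^+ 2 * G) + 2 * b ^+ 2 by move: h; lra.
have G0 : 0 <= G by apply: Rintegral_ge0 => x _; exact: dot_ge0.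
have h3 : 0 <= 2 ^+ n * r ^+ 2 * G by rewrite !mulr_ge0 ?exprn_ge0 ?(ltW r0).
have rb : b ^+ 2 = r ^+ n * (r ^- n * b ^+ 2) by rewrite mulrA mulfV ?mul1r ?gt_eqF.
have : r ^+ n * A <= r ^+ n * (2 ^+ n * r ^+ 2 * G + r ^- n * b ^+ 2).
  have : 0 <= r ^+ n * (2 ^+ n * r ^+ 2 * G) by rewrite mulr_ge0// ltW.
  by rewrite mulrDr -rb; lra.
by rewrite ler_pM2l.
Qed.

Local Notation It f := (Rintegral leb Om f).
Local Notation L2 := (L2 leb Om).
Local Notation ig := (ig leb Om).
Local Notation aeD := (aeD leb Om).
Local Notation Hs := (Hs Om).
Local Notation vL2 := (vL2 Om).
Local Notation nq := (nq Om).

Lemma L2_cvg_sqr (u_ : nat -> X -> R) u : (forall k, L2 (u_ k)) -> L2 u ->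
  (fun k => It (fun x => (u_ k x - u x) ^+ 2)) @ \oo --> 0 ->
  (fun k => It (fun x => u_ k x ^+ 2)) @ \oo --> It (fun x => u x ^+ 2).
Proof.
move=> Lk Lu h; have c := L2_cvgM oOm Lk Lu Lu h.
have e : (fun k => It (fun x => u_ k x ^+ 2)) = (fun k => It (fun x => (u_ k x - u x) ^+ 2) +
    (2 * It (fun x => u_ k x * u x) - It (fun x => u x * u x))).
  apply/funext => k; have i0 := L2_ig (L2B mO (Lk k) Lu).
  have i1 := L2M mO (Lk k) Lu; have i2 := L2M mO Lu Lu.
  rewrite -(ItZ mO _ i1) -(ItB mO (igZ mO 2 i1) i2) -(ItD mO i0 (igB mO (igZ mO 2 i1) i2)).
  by apply: eq_It => x _; ring.
rewrite e.
have h2 : (fun k => It (fun x => (u_ k x - u x) ^+ 2) +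
    (2 * It (fun x => u_ k x * u x) - It (fun x => u x * u x))) @ \oo -->
  0 + (2 * It (fun x => u x * u x) - It (fun x => u x * u x)).
  by apply: cvgD; [exact: h|apply: cvgB; [apply: cvgMr; exact: c|exact: cvg_cst]].
have e2 : 0 + (2 * It (fun x => u x * u x) - It (fun x => u x * u x)) = It (fun x => u x ^+ 2).
  by rewrite (@eq_It _ _ _ leb Om (fun x => u x ^+ 2) (fun x => u x * u x)) ?expr2//; ring.
by rewrite e2 in h2.
Qed.

Lemma Hs_cvg v Dv : Hs v Dv -> exists phi : nat -> X -> R,
  [/\ forall k, test_function Om (phi k),
   aeD (fun x => phi ^~ x @ \oo --> v x),
   (fun k => It (fun x => phi k x ^+ 2)) @ \oo --> It (fun x => v x ^+ 2),
   (fun k => nq (grad (phi k))) @ \oo --> nq Dv &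
   forall w, L2 w -> (fun k => It (fun x => phi k x * w x)) @ \oo --> It (fun x => v x * w x)].
Proof.
move=> hv; have [phi [hphi c1 _]] := Hs_ae_seq oOm bOm hv; have [Lv LDv _] := hv.
have tp k : test_function Om (phi k) by case: (hphi k).
have c2 : (fun k => It (fun x => (phi k x - v x) ^+ 2)) @ \oo --> 0.
  apply: pow2_cvg => k; first by exact: It_sqr_ge0.
  have [_ h _] := hphi k; apply: le_trans h; apply/le_of_eq/eq_It => x _.
  by rewrite -sqrrN opprB.
have Lk k : L2 (phi k) := test_L2 oOm bOm (tp k).
exists phi; split=> //.
- exact: L2_cvg_sqr.
- have e (Du : X -> X) : vL2 Du -> nq Du = \sum_(i < n) It (fun x => Du x 0 i ^+ 2).
    move=> h; rewrite -(It_sum mO); last by move=> i _; exact: L2_ig.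
    by apply: eq_It => x _; apply: eq_bigr => i _; rewrite expr2.
  rewrite (e _ LDv) (_ : (fun k => nq _) = fun k => \sum_(i < n) It (fun x => grad (phi k) x 0 i ^+ 2)); last first.
    by apply/funext => k; rewrite e//; exact: test_vL2.
  apply: cvg_big => [|i _]; first exact: add_continuous.
  apply: L2_cvg_sqr => //; first by move=> k; exact: (test_vL2 oOm bOm (tp k) i).
  apply: pow2_cvg => k; first by exact: It_sqr_ge0.
  have [_ _ h] := hphi k; apply: le_trans h.
  apply: le_trans (nq_coord oOm i (vL2B oOm LDv (test_vL2 oOm bOm (tp k)))).
  apply/le_of_eq/eq_It => x _.
  by rewrite !mxE -sqrrN opprB.
- by move=> w Lw; exact: L2_cvgM.
Qed.

Lemma sum_cubes (M : R) (m : nat) : 0 < M -> (0 < m)%N -> (forall x, Om x -> forall i, `|x 0 i| < M) ->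
  exists I : finType, exists l : I -> 'I_n -> R, forall u, (forall x, ~ Om x -> u x = 0) ->
    forall x, \sum_(f : I) (u \_ (cube (l f) (2 * M / m%:R))) x = u x :> R.
Proof.
move=> M0 m0 hM; set ell := 2 * M / m%:R; have mR : 0 < m%:R :> R by rewrite ltr0n.
have ell0 : 0 < ell by rewrite divr_gt0// mulr_gt0.
exists {ffun 'I_n -> 'I_m}, (fun (f : {ffun 'I_n -> 'I_m}) i => - M + (f i)%:R * ell) => u u0 x.
have [Ox|nO] := pselect (Om x); last first.
  rewrite big1 ?u0// => f _; rewrite patchE; case: ifP => // _; exact: u0.
pose z i : R := (x 0 i + M) / ell.
have z0 i : 0 <= z i.
  by rewrite /z divr_ge0 ?(ltW ell0)//; have := hM x Ox i; rewrite ltr_norml => /andP[h _]; lra.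
have zm i : (Num.trunc (z i) < m)%N.
  rewrite truncn_lt_nat// ?z0// /z ltr_pdivrMr// /ell mulrC divfK ?gt_eqF//.
  by have := hM x Ox i; rewrite ltr_norml => /andP[_ h]; lra.
pose f0 := [ffun i => Ordinal (zm i)].
have inQ (f : {ffun 'I_n -> 'I_m}) : cube (fun i => - M + (f i)%:R * ell) ell x <-> f = f0.
  have e i (j : nat) : (- M + j%:R * ell <= x 0 i < - M + j%:R * ell + ell) = (Num.trunc (z i) == j).
    rewrite truncn_eq ?z0// /z ler_pdivlMr// ltr_pdivrMr// -natr1 mulrDl mul1r.
    by apply/andP/andP => -[h1 h2]; split; lra.
  split=> [h|-> i].
    by apply/ffunP => i; apply/val_inj; rewrite /f0 ffunE /=; have := h i; rewrite e => /eqP.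
  by rewrite e ffunE.
rewrite (bigD1 f0)//= patchE ifT; last by apply/mem_set/inQ.
rewrite big1 ?addr0// => f ff0; rewrite patchE ifF//.
by apply/negP => /set_mem/inQ ef; rewrite ef eqxx in ff0.
Qed.

Lemma int_restrict u (Q : set X) : (forall x, ~ Om x -> u x = 0) ->
  Rintegral leb Q u = It (u \_ Q).
Proof.
move=> u0; rewrite Rintegral_mkcond -(intT_Om (Om := Om))// => x nO.
by rewrite patchE; case: ifP => // _; exact: u0.
Qed.

(** Compactness in quantitative form. On a partition into cubes of small side the Poincare
    inequality leaves only the integrals over the cubes, a finite family of L2 functionals; a
    sequence bounded in H^1_0 along which these converge is Cauchy in L2 up to an error of order
    [e]. *)
Lemma rellich_test (e : R) : 0 < e -> exists (I : finType) (w : I -> X -> R) (C : R), 0 <= C /\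
  (forall f, L2 (w f)) /\ forall phi, test_function Om phi ->
    It (fun x => phi x ^+ 2) <= e * nq (grad phi) + C * \sum_(f : I) (It (fun x => phi x * w f x)) ^+ 2.
Proof.
move=> e0; have [M M0 hM] := Om_bound bOm.
pose K := 2 ^+ n * (2 * M) ^+ 2; have K0 : 0 < K by rewrite mulr_gt0 ?exprn_gt0// mulr_gt0.
(* From [m >= K / e] and [m >= 1] follows [K / m^2 <= e]. *)
pose m := (Num.trunc (K / e)).+1.
have mK : K / e < m%:R by rewrite truncnS_gt.
have m1 : 1 <= m%:R :> R by rewrite ler1n.
have m0 : 0 < m%:R :> R by rewrite ltr0n.
set ell := 2 * M / m%:R; have ell0 : 0 < ell by rewrite divr_gt0// mulr_gt0.
have small : 2 ^+ n * ell ^+ 2 <= e.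
  have -> : 2 ^+ n * ell ^+ 2 = K / m%:R ^+ 2 by rewrite /ell /K expr_div_n mulrA.
  rewrite ler_pdivrMr ?exprn_gt0//; apply: (@le_trans _ _ (e * m%:R)).
    by rewrite mulrC -ler_pdivrMr// ltW.
  by rewrite ler_pM2l// expr2 ler_peMr// ltW.
have [I [l hl]] := @sum_cubes M m M0 isT hM.
pose w (f : I) (x : X) : R := \1_(cube (l f) ell) x.
have Lw f : L2 (w f).
  apply: (L2_bounded oOm bOm (M := 1)).
    by apply: measurable_funTS; apply: measurable_indic; exact: measurable_cube.
  by apply: aeDW => x _; rewrite /w indicE ger0_norm//; case: (_ \in _).
exists I, w, (ell ^- n); split; first by rewrite invr_ge0 exprn_ge0// ltW.
split=> // phi tp.
have t2 := test_sqr tp; have t3 := dot_grad_test tp.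
have out u : test_function Om u -> forall x, ~ Om x -> u x = 0 by move=> tu x; exact: test_out tu.
have irest u f : test_function Om u -> ig (u \_ (cube (l f) ell)).
  move=> tu; have := L2M mO (test_L2 oOm bOm tu) (Lw f); congr ig; apply/funext => x.
  by rewrite patchE /w indicE; case: (x \in _); rewrite ?mulr1 ?mulr0.
have tot u : test_function Om u -> It u = \sum_(f : I) Rintegral leb (cube (l f) ell) u.
  move=> tu; rewrite (eq_bigr (fun f => It (u \_ (cube (l f) ell)))); last first.
    by move=> f _; rewrite int_restrict//; exact: out.
  rewrite -(It_sum mO); last by move=> f _; exact: irest.
  by apply: eq_It => x _; rewrite hl//; exact: out.
rewrite (tot _ t2) [nq _](tot _ t3) mulr_sumr mulr_sumr -big_split/=.
apply: ler_sum => f _; apply: le_trans (cube_variance (l f) ell0 tp) _.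
apply: lerD.
  by apply: ler_wpM2r => //; apply: Rintegral_ge0 => x _; exact: dot_ge0.
rewrite int_restrict; last exact: out.
rewrite (@eq_It _ _ _ leb Om (phi \_ _) (fun x => phi x * w f x))// => x _.
by rewrite patchE /w indicE; case: (x \in _); rewrite ?mulr1 ?mulr0.
Qed.

(** A single cube, of twice the side of one containing [Om]: by Cauchy-Schwarz the squared mean
    carries the ratio [2^-n <= 1/2] of the two volumes, and is absorbed on the left. *)
Lemma poincare_test : (0 < n)%N -> exists2 P : R, 0 < P & forall phi, test_function Om phi ->
  It (fun x => phi x ^+ 2) <= P * nq (grad phi).
Proof.
move=> n0; have [M M0 hM] := Om_bound bOm.
pose ell := 4 * M; have ell0 : 0 < ell by rewrite mulr_gt0.
exists (2 * (2 ^+ n * ell ^+ 2)) => [|phi tp]; first by rewrite !mulr_gt0 ?exprn_gt0.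
pose Q := cube (fun _ : 'I_n => - (2 * M)) ell.
have full u : test_function Om u -> Rintegral leb Q u = It u.
  move=> tu; rewrite int_restrict; last by move=> x; exact: test_out tu.
  apply: eq_It => x Ox; rewrite patchE ifT//; apply/mem_set => i.
  by have := hM x Ox i; rewrite ltr_norml /ell => /andP[h1 h2]; apply/andP; split; lra.
have := cube_variance (fun _ : 'I_n => - (2 * M)) ell0 tp.
rewrite -/Q (full _ tp) (full _ (test_sqr tp)) (full _ (dot_grad_test tp)) -/(nq (grad phi)).
have L1 : L2 (fun=> 1 : R) := L2_cst oOm bOm 1.
have M2 : 0 <= 2 * M by rewrite mulr_ge0// ltW.
have v1 : It (fun=> 1 ^+ 2 : R) <= (2 * M) ^+ n.
  rewrite -lee_fin -(ItE mO (L2_ig L1)) expr1n integral_cst// mul1e.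
  rewrite -(leb_cube (fun _ : 'I_n => - M) M2); apply: le_measure; rewrite ?inE//.
    exact: measurable_cube.
  move=> x /hM h i; have := h i; rewrite ltr_norml => /andP[h1 h2].
  by rewrite (ltW h1)/=; lra.
have cs := L2CS mO (test_L2 oOm bOm tp) L1.
have e1 : It (fun x => phi x * 1) = It phi by apply: eq_It => x _; rewrite mulr1.
rewrite e1 in cs.
set A := It (fun x => phi x ^+ 2) in cs *; set G := nq _.
have A0 : 0 <= A by exact: It_sqr_ge0.
have h2 : ell ^- n * It phi ^+ 2 <= 2^-1 * A.
  rewrite mulrC ler_pdivrMr ?exprn_gt0//; apply: (le_trans cs).
  apply: le_trans (ler_wpM2l A0 v1) _; rewrite [leRHS]mulrAC mulrC ler_wpM2r//.
  have -> : ell = 2 * (2 * M) by rewrite /ell mulrA -natrM.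
  move: M2; move: (2 * M) => y y0; rewrite exprMn mulrA ler_peMl ?exprn_ge0// -[n]prednK// exprS mulrA mulVf// mul1r.
  by rewrite exprn_ege1// ler1n.
lra.
Qed.

Lemma poincare : (0 < n)%N -> exists2 P : R, 0 < P & forall v Dv, Hs v Dv ->
  It (fun x => v x ^+ 2) <= P * nq Dv.
Proof.
move=> /poincare_test[P P0 hP]; exists P => // v Dv /Hs_cvg[phi [tp _ c1 c2 _]].
have c3 : (fun k => P * nq (grad (phi k))) @ \oo --> P * nq Dv by apply: cvgMr; exact: c2.
by apply: (ler_cvg_to c1 c3); apply: nearW => k; exact: hP.
Qed.

Lemma rellich (e : R) : 0 < e -> exists (I : finType) (w : I -> X -> R) (C : R), 0 <= C /\
  (forall f, L2 (w f)) /\ forall v Dv, Hs v Dv ->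
    It (fun x => v x ^+ 2) <= e * nq Dv + C * \sum_(f : I) (It (fun x => v x * w f x)) ^+ 2.
Proof.
move=> /rellich_test[I [w [C [C0 [Lw h]]]]]; exists I, w, C; split=> //; split=> // v Dv /Hs_cvg[phi [tp _ c1 c2 c3]].
have c4 : (fun k => e * nq (grad (phi k)) + C * \sum_(f : I) (It (fun x => phi k x * w f x)) ^+ 2) @ \oo -->
   e * nq Dv + C * \sum_(f : I) (It (fun x => v x * w f x)) ^+ 2.
  apply: cvgD; apply: cvgMr; first exact: c2.
  apply: cvg_big => [|f _]; first exact: add_continuous.
  by apply: cvg_expn; exact: c3.
by apply: (ler_cvg_to c1 c4); apply: nearW => k; exact: h.
Qed.

End cubes.

(** * Morrey weights *)

Section dyadic.
Context {R : realType} {n : nat}.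
Local Notation X := 'rV[R]_n.
Local Notation leb := (@lebesgue_rV R n).

Definition dyadic (k : nat) (x : X) : set X :=
  cube (fun i => (Num.floor (2 ^+ k * x 0 i))%:~R / 2 ^+ k) (2 ^- k).

Lemma dyadicP k x y : dyadic k x y <-> forall i, Num.floor (2 ^+ k * x 0 i) = Num.floor (2 ^+ k * y 0 i).
Proof.
have p0 : 0 < 2 ^+ k :> R by rewrite exprn_gt0.
have e i : ((Num.floor (2 ^+ k * x 0 i))%:~R / 2 ^+ k <= y 0 i <
    (Num.floor (2 ^+ k * x 0 i))%:~R / 2 ^+ k + 2 ^- k) =
    (Num.floor (2 ^+ k * y 0 i) == Num.floor (2 ^+ k * x 0 i)).
  rewrite floor_eq intrD; move: (_%:~R) => m.
  by rewrite -[Y in _ < _ + Y]mul1r -mulrDl ltr_pdivlMr// ler_pdivrMr// [y 0 i * _]mulrC.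
split=> h i; first by have := h i; rewrite e => /eqP.
by rewrite e (h i).
Qed.

Lemma dyadic_refl k x : dyadic k x x. Proof. exact/dyadicP. Qed.
Lemma dyadic_sym k x y : dyadic k x y -> dyadic k y x.
Proof. by move=> /dyadicP h; apply/dyadicP => i; rewrite h. Qed.

Lemma dyadicS k x : dyadic k.+1 x `<=` dyadic k x.
Proof.
move=> y /dyadicP h; apply/dyadicP => i; apply/esym/eqP.
set m := Num.floor (2 ^+ k * x 0 i); have := floor_itv (2 ^+ k * x 0 i); rewrite -/m => /andP[h1 h2].
have e (z : X) : 2 ^+ k.+1 * z 0 i = 2 * (2 ^+ k * z 0 i) by rewrite exprS mulrA.
rewrite floor_eq; apply/andP; split.
  have h3 : 2 * m <= Num.floor (2 ^+ k.+1 * x 0 i) by rewrite floor_ge_int e intrM ler_pM2l.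
  by rewrite (h i) floor_ge_int e intrM ler_pM2l in h3.
have h3 : ~~ (2 * (m + 1) <= Num.floor (2 ^+ k.+1 * x 0 i)).
  by rewrite floor_ge_int -ltNge e intrM ltr_pM2l.
by rewrite (h i) floor_ge_int e intrM ler_pM2l// -ltNge in h3.
Qed.

Lemma measurable_dyadic k x : measurable (dyadic k x). Proof. exact: measurable_cube. Qed.

Lemma leb_dyadic k x : leb (dyadic k x) = ((2 ^- k) ^+ n)%:E.
Proof. by rewrite leb_cube// invr_ge0 exprn_ge0. Qed.

(** As a measurable set of pairs, this relation makes Tonelli's theorem available for integrals over
    a cube that moves with the point. *)
Definition same k : set (X * X) := [set p | dyadic k p.1 p.2].

Lemma measurable_same k : measurable (same k).
Proof.
pose Q (z : 'rV[int]_n) : set X := cube (fun i => (z 0 i)%:~R / 2 ^+ k) (2 ^- k).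
have -> : same k = \bigcup_z (Q z `*` Q z).
  apply/seteqP; split => [[x y] /= h|[x y] /= [z _ [/= h1 h2]]].
    exists (\row_i Num.floor (2 ^+ k * x 0 i)) => //; split => /= i; rewrite mxE.
      exact: (dyadic_refl k x i).
    exact: (h i).
  have p0 : 0 < 2 ^+ k :> R by rewrite exprn_gt0.
  have e (w : X) i : (z 0 i)%:~R / 2 ^+ k <= w 0 i < (z 0 i)%:~R / 2 ^+ k + 2 ^- k ->
      Num.floor (2 ^+ k * w 0 i) = z 0 i.
    rewrite ler_pdivrMr// mulrC => /andP[a1 a2]; apply: floor_def; rewrite a1 intrD/=.
    by move: a2; rewrite -(@ltr_pM2l _ (2 ^+ k))// mulrDr mulrCA mulfV ?gt_eqF// mulr1.
  by apply/dyadicP => i; rewrite (e _ _ (h1 i)) (e _ _ (h2 i)).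
apply: countable_bigcupT_measurable => // z.
by apply: measurableX; exact: measurable_cube.
Qed.

(** Lying in a common dyadic cube is symmetric, so exchanging the integrations moves the cube from
    [g] to [W], where the bound by [B] applies. *)
Lemma dyadic_swap k (W g : X -> R) (B : R) : measurable_fun setT W -> (forall x, 0 <= W x) ->
  measurable_fun setT g -> (forall x, 0 <= g x) -> (forall x, ig leb (dyadic k x) g) -> ig leb setT g ->
  (forall y, (\int[leb]_(x in dyadic k y) (W x)%:E <= B%:E)%E) ->
  ig leb setT (fun x => W x * Rintegral leb (dyadic k x) g) /\
  Rintegral leb setT (fun x => W x * Rintegral leb (dyadic k x) g) <= B * Rintegral leb setT g.
Proof.
move=> mW W0 mg g0 gi giT hB.
pose H (p : X * X) : \bar R := (W p.1 * g p.2 * \1_(same k) p)%:E.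
have mH : measurable_fun setT H.
  apply/measurable_EFinP; apply: measurable_funM; last exact: measurable_indic (measurable_same k).
  by apply: measurable_funM; [exact: measurableT_comp mW measurable_fst|exact: measurableT_comp mg measurable_snd].
have H0 p : (0 <= H p)%E by rewrite lee_fin !mulr_ge0// indicE.
have sameE x y : \1_(same k) (x, y) = \1_(dyadic k x) y :> R.
  by rewrite !indicE /same; congr (_%:R); apply/idP/idP => /set_mem h; apply/mem_set.
have restr (D : set X) (u : X -> \bar R) : (\int[leb]_y (u y * (\1_D y)%:E) = \int[leb]_(y in D) u y)%E.
  rewrite [RHS]integral_mkcond; apply: eq_integral => y _; rewrite patchE indicE.
  by case: (y \in D); rewrite ?mule1 ?mule0.
have e1 x : (\int[leb]_y H (x, y) = (W x * Rintegral leb (dyadic k x) g)%:E)%E.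
  transitivity (\int[leb]_y ((W x)%:E * (g y)%:E * (\1_(dyadic k x) y)%:E))%E.
    by apply: eq_integral => y _; rewrite /H /= sameE !EFinM.
  rewrite restr ge0_integralZl.
  - by rewrite (ItE (measurable_dyadic k x) (gi x)).
  - exact: measurable_dyadic.
  - by apply/measurable_EFinP; exact: measurable_funTS.
  - by move=> y _; rewrite lee_fin.
  - by rewrite lee_fin.
have e2 y : (\int[leb]_x H (x, y) <= B%:E * (g y)%:E)%E.
  apply: (@le_trans _ _ (\int[leb]_x ((g y)%:E * (W x)%:E * (\1_(dyadic k y) x)%:E))%E).
    apply: le_of_eq; apply: eq_integral => x _; rewrite /H /= sameE !EFinM.
    rewrite [((W x)%:E * _)%E]muleC; congr (_ * (_%:E))%E; rewrite !indicE; congr ((nat_of_bool _)%:R).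
    by apply/idP/idP => /set_mem h; apply/mem_set; exact: dyadic_sym.
  rewrite restr ge0_integralZl.
  - by rewrite muleC lee_wpmul2r// lee_fin.
  - exact: measurable_dyadic.
  - by apply/measurable_EFinP; exact: measurable_funTS.
  - by move=> x _; rewrite lee_fin.
  - by rewrite lee_fin.
have m1 := measurable_int2 leb measurableT mH H0.
have B0 : 0 <= B.
  by rewrite -lee_fin; apply: le_trans (hB 0); apply: integral_ge0 => x _; rewrite lee_fin.
have sw := integral_swap leb leb measurableT measurableT mH H0.
have le1 : (\int[leb]_x (W x * Rintegral leb (dyadic k x) g)%:E <= (B * Rintegral leb setT g)%:E)%E.
  apply: (@le_trans _ _ (\int[leb]_y \int[leb]_x H (x, y))%E).
    rewrite -sw; apply: le_of_eq; apply: eq_integral => x _.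
    by rewrite e1.
  apply: (@le_trans _ _ (\int[leb]_y (B%:E * (g y)%:E))%E).
    apply: ge0_int_le => y _; last exact: e2.
    exact: integral_ge0.
  rewrite ge0_integralZl.
  - by rewrite (ItE measurableT giT) EFinM.
  - exact: measurableT.
  - exact/measurable_EFinP.
  - by move=> y _; rewrite lee_fin.
  - by rewrite lee_fin.
have mr : measurable_fun setT (fun x => W x * Rintegral leb (dyadic k x) g).
  apply/measurable_EFinP; move: m1; congr measurable_fun; apply/funext => x; exact: e1.
have r0 x : 0 <= W x * Rintegral leb (dyadic k x) g.
  by apply: mulr_ge0; [exact: W0|apply: Rintegral_ge0 => y _; exact: g0].
have irr : ig leb setT (fun x => W x * Rintegral leb (dyadic k x) g).
  apply/integrableP; split; first exact/measurable_EFinP.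
  under eq_integral => x _ do rewrite /= (ger0_norm (r0 x)).
  exact: le_lt_trans le1 (ltry _).
split; first exact: irr.
by rewrite -lee_fin -(ItE measurableT irr); exact: le1.
Qed.

End dyadic.

(** The sequence [I j + c] grows at each step by a factor at most [1 + r^j <= expR (r^j)], and the
    exponents add up to at most [1 / (1 - r)]. *)
Lemma growth_bound {R : realType} (r c : R) (I : nat -> R) : 0 < r < 1 -> 0 <= c ->
  (forall j, 0 <= I j) -> (forall j, I j.+1 <= (1 + r ^+ j) * I j + c * r ^+ j) ->
  forall j, I j <= expR ((1 - r)^-1) * (I 0%N + c).
Proof.
move=> /andP[r0 r1] c0 I0 h.
have s1 : 0 < 1 - r by rewrite subr_gt0.
have key j : I j + c <= expR ((1 - r)^-1 * (1 - r ^+ j)) * (I 0%N + c).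
  elim: j => [|j ih]; first by rewrite expr0 subrr mulr0 expR0 mul1r.
  apply: (@le_trans _ _ ((1 + r ^+ j) * (I j + c))); first by have := h j; lra.
  apply: (@le_trans _ _ (expR (r ^+ j) * (expR ((1 - r)^-1 * (1 - r ^+ j)) * (I 0%N + c)))).
    apply: ler_pM => //; first by rewrite addr_ge0// exprn_ge0// ltW.
      by rewrite addr_ge0.
    exact: expR_ge1Dx.
  rewrite mulrA -expRD; apply: le_of_eq; congr (expR _ * _).
  rewrite exprS; move: (r ^+ j) => q; field; by rewrite gt_eqF.
move=> j; apply: (@le_trans _ _ (I j + c)); first by rewrite lerDl.
apply: (le_trans (key j)); apply: ler_wpM2r; first by rewrite addr_ge0.
by rewrite ler_expR ler_piMr ?invr_ge0 ?(ltW s1)// gerBl exprn_ge0// ltW.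
Qed.

(** * Dyadic averages against a weight *)

Section Morrey.
Context {R : realType} {n : nat}.
Local Notation X := 'rV[R]_n.
Local Notation leb := (@lebesgue_rV R n).
Variable Om : set X.
Hypotheses (oOm : open Om) (bOm : bounded_set Om).
Let mO : measurable Om := mOm oOm.
Local Notation It f := (Rintegral leb Om f).
Local Notation nq := (nq Om).

Lemma ig_cube_bounded (Q : set X) (u : X -> R) (M : R) : measurable Q -> (leb Q < +oo)%E ->
  measurable_fun Q u -> (forall x, `|u x| <= M) -> ig leb Q u.
Proof.
move=> mQ lQ mu_ hu; apply: measurable_bounded_integrable => //.
by exists M; split; [exact: num_real|move=> N MN x _ /=; rewrite (le_trans (hu x))// ltW].
Qed.

Lemma sqr_split (a b s : R) : 0 < s -> (a + b) ^+ 2 <= (1 + s) * a ^+ 2 + (1 + s^-1) * b ^+ 2.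
Proof.
move=> s0; have h : 0 <= s * (a - s^-1 * b) ^+ 2 by rewrite mulr_ge0 ?sqr_ge0// ltW.
have e : s * (a - s^-1 * b) ^+ 2 = s * a ^+ 2 - 2 * a * b + s^-1 * b ^+ 2 by field; rewrite gt_eqF.
by rewrite e in h; nra.
Qed.

(** With [m] the mean on the parent cube, [phi = m + (phi - m)] is squared with parameter [s]. The
    square of [m] is at most the parent average of [phi^2], and [cube_variance] bounds the
    oscillation; [4^n] is the [2^n] of that inequality times the [2^n] from the smaller volume of
    the child. *)
Lemma dyadic_step phi (k : nat) (x : X) (s : R) : test_function Om phi -> 0 < s ->
  (2 ^+ k.+1) ^+ n * Rintegral leb (dyadic k.+1 x) (fun y => phi y ^+ 2) <=
  (1 + s) * ((2 ^+ k) ^+ n * Rintegral leb (dyadic k x) (fun y => phi y ^+ 2)) +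
  (1 + s^-1) * (4 ^+ n * 4 ^- k) *
    ((2 ^+ k) ^+ n * Rintegral leb (dyadic k x) (fun y => dot (grad phi y) (grad phi y))).
Proof.
move=> tp s0; set Q := dyadic k x; set Q' := dyadic k.+1 x.
have mQ : measurable Q := measurable_dyadic k x; have mQ' : measurable Q' := measurable_dyadic k.+1 x.
have [M M0 hM] := test_bounded tp.
have lQ : leb Q = ((2 ^- k) ^+ n)%:E := leb_dyadic k x.
have lQ' : leb Q' = ((2 ^- k.+1) ^+ n)%:E := leb_dyadic k.+1 x.
have lQoo : (leb Q < +oo)%E by rewrite [ltLHS]lQ ltry.
have lQoo' : (leb Q' < +oo)%E by rewrite [ltLHS]lQ' ltry.
pose q : R := (2 ^+ k) ^+ n; have q0 : 0 < q by rewrite !exprn_gt0.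
have qV : (2 ^- k) ^+ n = q^-1 by rewrite /q exprVn.
have qS : (2 ^+ k.+1) ^+ n = 2 ^+ n * q by rewrite exprS exprMn.
have k0 : 0 <= 2 ^- k :> R by rewrite invr_ge0 exprn_ge0.
have k0' : 0 <= 2 ^- k.+1 :> R by rewrite invr_ge0 exprn_ge0.
have i1 : ig leb Q phi by exact: (test_ig_cube _ k0 tp).
have i2 : ig leb Q (fun y => phi y ^+ 2) by exact: (test_ig_cube _ k0 (test_sqr tp)).
have i2' : ig leb Q' (fun y => phi y ^+ 2) by exact: (test_ig_cube _ k0' (test_sqr tp)).
set A := Rintegral _ Q (fun y => phi y ^+ 2); set b := Rintegral leb Q phi.
set G := Rintegral _ Q (fun y => dot _ _).
pose m : R := q * b.
have ic c : ig leb Q (fun=> c) by apply: ig_cube_bounded.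
have ic' c : ig leb Q' (fun=> c) by apply: ig_cube_bounded.
have Ic c : Rintegral leb Q (fun=> c) = c * q^-1.
  have h : (\int[leb]_(x in Q) c%:E = c%:E * q^-1%:E)%E by rewrite -qV -lQ; exact: integral_cst.
  by rewrite /Rintegral h.
have Ic' c : Rintegral leb Q' (fun=> c) = c * (2 ^+ n * q)^-1.
  have h : (\int[leb]_(x in Q') c%:E = c%:E * (2 ^+ n * q)^-1%:E)%E.
    by rewrite -qS -exprVn -lQ'; exact: integral_cst.
  by rewrite /Rintegral h.
have iB : ig leb Q (fun y => (phi y - m) ^+ 2).
  have -> : (fun y => (phi y - m) ^+ 2) = (fun y => phi y ^+ 2 - 2 * m * phi y + m ^+ 2).
    by apply/funext => y; ring.
  exact: (igD mQ (igB mQ i2 (igZ mQ (2 * m) i1)) (ic (m ^+ 2))).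
have eB : Rintegral leb Q (fun y => (phi y - m) ^+ 2) = A - q * b ^+ 2.
  have -> : (fun y => (phi y - m) ^+ 2) = (fun y => phi y ^+ 2 - 2 * m * phi y + m ^+ 2).
    by apply/funext => y; ring.
  rewrite (ItD mQ (igB mQ i2 (igZ mQ (2 * m) i1)) (ic _)) (ItB mQ i2 (igZ mQ (2 * m) i1)) (ItZ mQ _ i1) Ic.
  by rewrite -/A -/b /m; field; rewrite gt_eqF.
have mA : m ^+ 2 <= q * A.
  have : 0 <= A - q * b ^+ 2 by rewrite -eB; exact: It_sqr_ge0.
  by rewrite subr_ge0 /m exprMn expr2 -mulrA ler_pM2l.
have iB' : ig leb Q' (fun y => (phi y - m) ^+ 2) by apply: (integrableS mQ) => //; exact: dyadicS.
have var : A - q * b ^+ 2 <= 2 ^+ n * 4 ^- k * G.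
  have p0 : 0 < 2 ^- k :> R by rewrite invr_gt0 exprn_gt0.
  have := cube_variance (fun i => (Num.floor (2 ^+ k * x 0 i))%:~R / 2 ^+ k) p0 tp.
  rewrite -/Q -/A -/b -/G qV invrK.
  have -> : (2 ^- k) ^+ 2 = 4 ^- k :> R.
    by rewrite exprVn -exprM mulnC exprM; congr ((_ ^+ _)^-1); rewrite expr2; ring.
  by lra.
have B' : Rintegral leb Q' (fun y => (phi y - m) ^+ 2) <= A - q * b ^+ 2.
  rewrite -eB -lee_fin -(ItE mQ' iB') -(ItE mQ iB); apply: ge0_subset_integral => //.
  - by apply/measurable_EFinP; exact: ig_meas iB.
  - by move=> y _; rewrite lee_fin sqr_ge0.
  - exact: dyadicS.
have s1 : 0 < s^-1 by rewrite invr_gt0.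
have main : Rintegral leb Q' (fun y => phi y ^+ 2) <=
    (1 + s) * m ^+ 2 * (2 ^+ n * q)^-1 + (1 + s^-1) * (2 ^+ n * 4 ^- k * G).
  apply: (@le_trans _ _ (Rintegral leb Q' (fun y => (1 + s) * m ^+ 2 + (1 + s^-1) * (phi y - m) ^+ 2))).
    apply: (It_le mQ') => //; first by apply: (igD mQ' (ic' _)); exact: igZ.
    apply: aeDW => y _; have := sqr_split m (phi y - m) s0; rewrite addrC subrK; exact.
  rewrite (ItD mQ' (ic' _) (igZ mQ' _ iB')) Ic' (ItZ mQ' _ iB') lerD2l.
  by rewrite ler_pM2l ?addr_gt0//; exact: le_trans B' var.
have w0 : 0 < 2 ^+ n * q by rewrite mulr_gt0 ?exprn_gt0.
rewrite qS; apply: le_trans (ler_wpM2l (ltW w0) main) _.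
rewrite mulrDr; apply: lerD.
  by rewrite mulrC divfK ?gt_eqF// ler_pM2l ?addr_gt0.
have -> : (4 : R) ^+ n = 2 ^+ n * 2 ^+ n by rewrite -exprMn -natrM.
rewrite -/q; apply: le_of_eq.
by move: (2 ^+ n) (4 ^- k) => u v; ring.
Qed.

Lemma dyadic_avg_cvg (u : X -> R) (x : X) : continuous u ->
  (forall k, ig leb (dyadic k x) u) ->
  (fun k => (2 ^+ k) ^+ n * Rintegral leb (dyadic k x) u) @ \oo --> u x.
Proof.
move=> cu iu; apply/cvgrPdist_le => e e0.
have /cvgrPdist_le/(_ e e0) := cu x => /nbhs_ballP[d /= d0 hd].
have [k hk] := pow2_small d0.
exists k => // l /= kl.
set Q := dyadic l x; have mQ : measurable Q := measurable_dyadic l x.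
have lQ : leb Q = ((2 ^- l) ^+ n)%:E := leb_dyadic l x.
have lQoo : (leb Q < +oo)%E by rewrite [ltLHS]lQ ltry.
pose q : R := (2 ^+ l) ^+ n; have q0 : 0 < q by rewrite !exprn_gt0.
have qV : (2 ^- l) ^+ n = q^-1 by rewrite /q exprVn.
have ic c : ig leb Q (fun=> c) by apply: (@ig_cube_bounded _ _ `|c|).
have Ic c : Rintegral leb Q (fun=> c) = c * q^-1.
  have h : (\int[leb]_(x in Q) c%:E = c%:E * q^-1%:E)%E by rewrite -qV -lQ; exact: integral_cst.
  by rewrite /Rintegral h.
rewrite -/q.
have -> : u x - q * Rintegral leb Q u = q * Rintegral leb Q (fun y => u x - u y).
  by rewrite (ItB mQ (ic _) (iu l)) Ic; field; rewrite gt_eqF.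
rewrite normrM (gtr0_norm q0) mulrC -ler_pdivlMr//.
apply: le_trans (It_abs_le mQ (igB mQ (ic (u x)) (iu l)) (ic e) _) _; last by rewrite Ic.
apply: aeDW => y hy; apply: hd; split=> // i j; rewrite ord1 /ball /= ltr_norml.
have p0 : 0 < 2 ^+ l :> R by rewrite exprn_gt0.
have /andP[h1 h2] := hy j; have /andP[h3 h4] := dyadic_refl l x j.
have h5 : 2 ^- l < d := le_lt_trans (le_pow2 kl) hk.
by apply/andP; split; lra.
Qed.

(** The hypothesis reads [W(Q) <= K |Q| side^-2 r^(2k)] on cubes of generation [k]. The averages of
    [phi^2], integrated against [W], are compared from one generation to the next at a summable
    cost, and tend to [phi^2]. Starting at generation [k0] pays with the L2 norm and leaves the
    Dirichlet integral with the factor [r^k0]. *)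
Lemma morrey_test (W : X -> R) (K r : R) phi (k0 : nat) : measurable_fun setT W -> (forall x, 0 <= W x) ->
  0 < r < 1 -> 0 <= K ->
  (forall k y, (\int[leb]_(x in dyadic k y) (W x)%:E <= (K * ((2 ^- k) ^+ n * (4 ^+ k * (r ^+ k) ^+ 2)))%:E)%E) ->
  test_function Om phi ->
  ig leb setT (fun x => W x * phi x ^+ 2) /\
  Rintegral leb setT (fun x => W x * phi x ^+ 2) <= expR ((1 - r)^-1) *
    (K * (4 ^+ k0 * (r ^+ k0) ^+ 2) * It (fun x => phi x ^+ 2) + 2 * 4 ^+ n * K * r ^+ k0 * nq (grad phi)).
Proof.
move=> mW W0 r01 K0 hW tp; have /andP[r0 r1] := r01.
have rk0 k : 0 < r ^+ k by rewrite exprn_gt0.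
have t2 := test_sqr tp; have t3 := dot_grad_test tp.
have [M [M0 hM]] : exists M, 0 <= M /\ cbounded phi M.
  by have [M M0 hM] := test_cbounded bOm tp; exists M; split; [exact: ltW|].
have iT u : test_function Om u -> ig leb setT u.
  move=> tu; have [L L0 hL] := test_cbounded bOm tu.
  by apply: (cont_integrable (ltW L0) _ hL); apply: smooth_cont; exact: test_smooth tu.
have toOm u : test_function Om u -> Rintegral leb setT u = It u.
  by move=> tu; apply: intT_Om => x; exact: test_out tu.
have iQ u k x : test_function Om u -> ig leb (dyadic k x) u.
  by move=> tu; apply: test_ig_cube tu; rewrite invr_ge0 exprn_ge0.
have sw u k : test_function Om u -> (forall x, 0 <= u x) ->
    ig leb setT (fun x => W x * ((2 ^+ k) ^+ n * Rintegral leb (dyadic k x) u)) /\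
    Rintegral leb setT (fun x => W x * ((2 ^+ k) ^+ n * Rintegral leb (dyadic k x) u)) <=
      K * (4 ^+ k * (r ^+ k) ^+ 2) * It u.
  move=> tu u0; have [h1 h2] := dyadic_swap mW W0 (test_meas tu) u0 (fun x => iQ u k x tu) (iT u tu) (hW k).
  have -> : (fun x => W x * ((2 ^+ k) ^+ n * Rintegral leb (dyadic k x) u)) =
      (fun x => (2 ^+ k) ^+ n * (W x * Rintegral leb (dyadic k x) u)).
    by apply/funext => x; rewrite mulrCA.
  split; first exact: (igZ measurableT _ h1).
  rewrite (ItZ measurableT _ h1); rewrite (toOm _ tu) in h2.
  have q0 : 0 < (2 ^+ k) ^+ n :> R by rewrite !exprn_gt0.
  apply: le_trans (ler_wpM2l (ltW q0) h2) _.
  rewrite exprVn; apply: le_of_eq; move: (4 ^+ k * _) => z.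
  by field; rewrite gt_eqF.
have sq0 (x : X) : 0 <= phi x ^+ 2 := sqr_ge0 _.
have dt0 (x : X) : 0 <= dot (grad phi x) (grad phi x) := dot_ge0 _.
pose a k x := (2 ^+ k) ^+ n * Rintegral leb (dyadic k x) (fun y => phi y ^+ 2).
have a0 k x : 0 <= W x * a k x.
  by rewrite !mulr_ge0 ?exprn_ge0//; exact: It_sqr_ge0.
pose I j := Rintegral leb setT (fun x => W x * a (k0 + j)%N x).
have ia k : ig leb setT (fun x => W x * a k x) by have [] := sw _ k t2 sq0.
pose c := 2 * 4 ^+ n * K * r ^+ k0 * nq (grad phi).
have G0 : 0 <= nq (grad phi) by apply: Rintegral_ge0 => x _; exact: dt0.
have n40 : 0 <= 4 ^+ n :> R by rewrite exprn_ge0.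
have c0 : 0 <= c by rewrite /c !mulr_ge0// ltW.
have I0 j : 0 <= I j by apply: Rintegral_ge0 => x _; exact: a0.
(* [dyadic_step] is used with [s = r^k]: then the relative loss is [r^k], and the gradient costs
   about [s^-1 r^(2k) = r^k], so both are geometric. *)
have step j : I j.+1 <= (1 + r ^+ j) * I j + c * r ^+ j.
  rewrite /I addnS; set k := (k0 + j)%N.
  have [b1 b2] := sw _ k t3 dt0.
  pose A := 1 + r ^+ k; pose D := (1 + (r ^+ k)^-1) * (4 ^+ n * 4 ^- k).
  have D0 : 0 <= D by rewrite mulr_ge0 ?mulr_ge0 ?addr_ge0 ?invr_ge0 ?exprn_ge0// ltW.
  apply: (@le_trans _ _ (A * I j + D * (K * (4 ^+ k * (r ^+ k) ^+ 2) * nq (grad phi)))).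
    apply: (@le_trans _ _ (A * I j + D * Rintegral leb setT (fun x => W x * ((2 ^+ k) ^+ n * Rintegral leb (dyadic k x) (fun y => dot (grad phi y) (grad phi y)))))).
      rewrite -(ItZ measurableT _ (ia k)) -(ItZ measurableT _ b1).
      rewrite -(ItD measurableT (igZ measurableT _ (ia k)) (igZ measurableT _ b1)).
      apply: (It_le measurableT (ia k.+1) (igD measurableT (igZ measurableT _ (ia k)) (igZ measurableT _ b1))).
      apply: aeDW => x _; rewrite [A * _]mulrCA [D * _]mulrCA -[leRHS]mulrDr; apply: ler_wpM2l; first exact: W0.
      exact: dyadic_step tp (rk0 k).
    by rewrite lerD2l; apply: ler_wpM2l.
  have rkj : r ^+ k <= r ^+ j by rewrite /k exprD ler_piMl ?exprn_ile1// ?exprn_ge0// ?(ltW r0)// ltW.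
  apply: lerD; first by rewrite ler_wpM2r// /A lerD2l.
  have -> : c * r ^+ j = 4 ^+ n * K * nq (grad phi) * (2 * r ^+ k) by rewrite /c /k exprD; ring.
  have -> : D * (K * (4 ^+ k * (r ^+ k) ^+ 2) * nq (grad phi)) =
      4 ^+ n * K * nq (grad phi) * ((r ^+ k) ^+ 2 + r ^+ k).
    have p4 : 4 ^+ k != 0 :> R by rewrite expf_neq0.
    by rewrite /D; move: p4 (rk0 k); move: (4 ^+ k) (r ^+ k) => u v u0 v0; field; rewrite u0 gt_eqF.
  rewrite ler_wpM2l ?mulr_ge0//.
  have : r ^+ k <= 1 by rewrite exprn_ile1// ltW.
  by have := rk0 k; nra.
have gb := growth_bound r01 c0 I0 step.
apply: (@It_fatou _ _ _ leb setT measurableT (fun j x => W x * a (k0 + j)%N x)).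
- by move=> j; exact: ia.
- by move=> j; apply: aeDW => x _.
- by apply: measurable_funM => //; exact: test_meas t2.
- apply: aeDW => x _; apply: cvgMr.
  have h := dyadic_avg_cvg (smooth_cont (test_smooth t2)) (fun k => iQ _ k x t2).
  have := h; rewrite -(cvg_shiftn k0); apply: cvg_trans; apply: near_eq_cvg; apply: nearW => j /=.
  by rewrite addnC.
apply: nearW => j; apply: le_trans (gb j) _; rewrite ler_wpM2l ?expR_ge0// lerD2r.
by rewrite /I addn0; have [] := sw _ k0 t2 sq0.
Qed.

End Morrey.

(** * Weights dominated by powers of the volume *)

Section weights.
Context {R : realType} {n : nat}.
Local Notation X := 'rV[R]_n.
Local Notation leb := (@lebesgue_rV R n).
Variable Om : set X.
Hypotheses (oOm : open Om) (bOm : bounded_set Om).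
Let mO : measurable Om := mOm oOm.
Local Notation It f := (Rintegral leb Om f).
Local Notation L2 := (L2 leb Om).
Local Notation ig := (ig leb Om).
Local Notation aeD := (aeD leb Om).
Local Notation Hs := (Hs Om).
Local Notation vL2 := (vL2 Om).
Local Notation nq := (nq Om).

Definition vol (E : set X) : R := fine (leb (E `&` Om)).

Lemma volE E : measurable E -> leb (E `&` Om) = (vol E)%:E.
Proof.
move=> mE; rewrite /vol fineK// ge0_fin_numE//.
apply: le_lt_trans (leb_Om oOm bOm); apply: le_measure; rewrite ?inE//; exact: measurableI.
Qed.

Lemma vol_ge0 E : 0 <= vol E. Proof. exact: fine_ge0. Qed.

Lemma le_vol E F : measurable E -> measurable F -> E `<=` F -> vol E <= vol F.
Proof.
move=> mE mF EF; rewrite -lee_fin -!volE//; apply: le_measure; rewrite ?inE; [exact: measurableI..|].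
exact: setSI.
Qed.

Lemma It_ind E : measurable E -> ig (fun x => \1_E x) /\ It (fun x => \1_E x) = vol E.
Proof.
move=> mE; have mI : measurable_fun Om (\1_E : X -> R) by exact: measurable_indic.
have h : (\int[leb]_(x in Om) (\1_E x)%:E = (vol E)%:E)%E by rewrite integral_indic//; exact: volE.
have i : ig (fun x => \1_E x).
  apply/integrableP; split; first exact/measurable_EFinP.
  by under eq_integral => x _ do rewrite /= ger0_norm//; rewrite h ltry.
by split=> //; rewrite /Rintegral h.
Qed.

(** For [th < 1] this is a condition of weak Lebesgue type with exponent [1 / (1 - th)]. On a cube
    of side s it gives [K s^(n th)], and the requirement [n (1 - th) < 2] makes this a Morrey
    condition with room to spare; the room is the ratio [r < 1] of [morrey_test]. *)
Definition morrey (th K : R) (W : X -> R) := [/\ ig W, forall x, 0 <= W x &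
  forall E, measurable E -> It (fun x => W x * \1_E x) <= K * vol E `^ th].

Lemma ig_ind W E : measurable E -> ig W -> ig (fun x => W x * \1_E x).
Proof.
move=> mE iW; apply: (@ig_le _ _ _ leb Om mO _ (fun x => `|W x|)); [|exact: ig_norm|].
  by apply: measurable_funM; [exact: ig_meas iW|exact: measurable_indic].
apply: aeDW => x _; rewrite normrM ler_piMr// indicE.
by case: (x \in E); rewrite ?normr1 ?normr0.
Qed.

Lemma morrey_dyadic th K W (k : nat) y : 0 < th -> 0 <= K -> morrey th K W ->
  (\int[leb]_(x in dyadic k y) ((W \_ Om) x)%:E <=
   (K * ((2 ^- k) ^+ n * (4 ^+ k * ((2 `^ ((n%:R * (1 - th) - 2) / 2)) ^+ k) ^+ 2)))%:E)%E.
Proof.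
move=> th0 K0 [iW W0 hE]; have mE := measurable_dyadic k y.
have -> : (\int[leb]_(x in dyadic k y) ((W \_ Om) x)%:E = (It (fun x => W x * \1_(dyadic k y) x))%:E)%E.
  rewrite -(ItE mO (ig_ind mE iW)) [LHS]integral_mkcond [RHS]integral_mkcond; apply: eq_integral => x _.
  rewrite !patchE indicE; case: (x \in Om); case: (x \in dyadic k y); rewrite ?mulr1 ?mulr0//.
rewrite lee_fin; apply: le_trans (hE _ mE) _; apply: ler_wpM2l => //.
have two0 : 0 < 2 :> R by [].
apply: (@le_trans _ _ (((2 ^- k) ^+ n) `^ th)).
  apply: ge0_ler_powR; rewrite ?nnegrE ?(ltW th0) ?vol_ge0 ?exprn_ge0 ?invr_ge0//.
  by rewrite -lee_fin -(leb_dyadic k y) -volE//; apply: le_measure; rewrite ?inE//; exact: measurableI.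
have e1 : (2 ^- k) ^+ n = 2 `^ (- (k%:R * n%:R)) :> R.
  by rewrite exprVn -exprM powRN -natrM powR_mulrn.
have e2 : 4 ^+ k = 2 `^ (2 * k%:R) :> R.
  by rewrite -natrM powR_mulrn// exprM; congr (_ ^+ _); rewrite expr2; ring.
rewrite e1 e2 -exprM -powR_mulrn ?powR_ge0// -!powRrM natrM.
rewrite -!powRD; first by apply: le_of_eq; congr (_ `^ _); field.
all: by rewrite pnatr_eq0 implybT.
Qed.

Lemma morrey_exp_lt1 (th : R) : n%:R * (1 - th) < 2 -> 0 < 2 `^ ((n%:R * (1 - th) - 2) / 2) < (1 : R).
Proof.
move=> h; rewrite powR_gt0//= /powR pnatr_eq0/= expR_lt1 pmulr_llt0; first by lra.
by rewrite ln_gt0// ltr1n.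
Qed.

Lemma pow_small (r e : R) : 0 < r < 1 -> 0 < e -> exists k : nat, r ^+ k < e.
Proof.
move=> /andP[r0 r1] e0; have r1' : `|r| < 1 by rewrite gtr0_norm.
have /cvgrPdist_lt/(_ e e0)[k _ /(_ k (leqnn k))] := cvg_expr r1'.
rewrite sub0r normrN => h; exists k; exact: le_lt_trans (ler_norm _) h.
Qed.

(** A small factor before the Dirichlet integral is reached by starting the dyadic comparison at a
    late generation. The weight enters only through the linear factor [K], so one [C] serves all
    weights with exponent [th]. *)
Lemma morrey_ineq th (e : R) : 0 < th -> n%:R * (1 - th) < 2 -> 0 < e -> exists2 C : R, 0 <= C &
  forall K W v Dv, 0 <= K -> morrey th K W -> Hs v Dv ->
    ig (fun x => W x * v x ^+ 2) /\
    It (fun x => W x * v x ^+ 2) <= K * (e * nq Dv + C * It (fun x => v x ^+ 2)).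
Proof.
move=> th0 hth e0; have r01 := morrey_exp_lt1 hth; set r := 2 `^ _ in r01.
pose P := expR ((1 - r)^-1); have P0 : 0 < P := expR_gt0 _.
have D0 : 0 < P * (2 * 4 ^+ n) by rewrite !mulr_gt0 ?exprn_gt0.
have [k hk] := pow_small r01 (divr_gt0 e0 D0).
have /andP[r0 r1] := r01.
have C0 : 0 <= P * (4 ^+ k * (r ^+ k) ^+ 2).
  by apply: mulr_ge0; [exact: ltW|apply: mulr_ge0; [exact: exprn_ge0|exact: sqr_ge0]].
exists (P * (4 ^+ k * (r ^+ k) ^+ 2)) => // K W v Dv K0 mW hv.
have [iW W0 hE] := mW; have mWm := ig_meas iW.
have test phi : test_function Om phi -> ig (fun x => W x * phi x ^+ 2) /\
    It (fun x => W x * phi x ^+ 2) <= K * (e * nq (grad phi) + P * (4 ^+ k * (r ^+ k) ^+ 2) * It (fun x => phi x ^+ 2)).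
  move=> tp; have mW' : measurable_fun setT (W \_ Om) by apply/(measurable_restrictT _ mO).
  have W0' x : 0 <= (W \_ Om) x by rewrite patchE; case: ifP.
  have [h1 h2] := morrey_test bOm k mW' W0' r01 K0 (fun k y => morrey_dyadic k y th0 K0 mW) tp.
  have e1 : (fun x => W x * phi x ^+ 2) \_ Om = (fun x => (W \_ Om) x * phi x ^+ 2).
    by apply/funext => x; rewrite !patchE; case: ifP => // _; rewrite mul0r.
  have i1 : ig (fun x => W x * phi x ^+ 2).
    apply/integrable_mkcond => //; move: h1; congr (_.-integrable _); apply/funext => x /=.
    by rewrite !patchE /=; case: ifP => // _; rewrite mul0r.
  split=> //; rewrite [leLHS](Rintegral_mkcond) e1; apply: (le_trans h2).
  have G0 : 0 <= nq (grad phi) by apply: Rintegral_ge0 => x _; exact: dot_ge0.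
  have : P * (2 * 4 ^+ n) * r ^+ k * (K * nq (grad phi)) <= e * (K * nq (grad phi)).
    apply: ler_wpM2r; first exact: mulr_ge0.
    by rewrite mulrC -ler_pdivlMr// ltW.
  rewrite -/P; move: (It _) (nq _) (r ^+ k) (4 ^+ n) (4 ^+ k) => A G s u t; lra.
have [phi [tp c1 c2 c3 _]] := Hs_cvg oOm bOm hv.
set C := P * (4 ^+ k * (r ^+ k) ^+ 2) in C0 test *.
set B := K * _.
have cB : (fun j => K * (e * nq (grad (phi j)) + C * It (fun x => phi j x ^+ 2))) @ \oo --> B.
  by apply: cvgMr; apply: cvgD; apply: cvgMr; [exact: c3|exact: c2].
have main (d : R) : 0 < d -> ig (fun x => W x * v x ^+ 2) /\ It (fun x => W x * v x ^+ 2) <= B + d.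
  move=> d0; apply: (@It_fatou _ _ _ leb Om mO (fun j x => W x * phi j x ^+ 2)).
  - by move=> j; have [] := test _ (tp j).
  - by move=> j; apply: aeDW => x _; rewrite mulr_ge0// sqr_ge0.
  - by apply: measurable_funM => //; apply: measurable_funX; exact: L2_meas (Hs_L2 hv).
  - by apply: aeD1 c1 => x _ h; apply: cvgMr; apply: cvg_expn.
  - have /cvgrPdist_lt/(_ d d0) := cB; apply: filterS => j; rewrite ltr_distlC => /andP[_ h].
    by have [_ /le_trans] := test _ (tp j); apply; exact: ltW.
split; first by have [] := main 1 ltr01.
by apply/ler_addgt0Pr => d d0; have [] := main d d0.
Qed.

(** Each factor is at most the same power of the sum, and the exponents add up to 1. A crude form of
    Young's inequality. *)
Lemma powR_prod_le (s1 s2 s3 t1 t2 t3 : R) : 0 <= t1 -> 0 <= t2 -> 0 <= t3 ->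
  0 <= s1 -> 0 <= s2 -> 0 <= s3 -> s1 + s2 + s3 = 1 ->
  t1 `^ s1 * t2 `^ s2 * t3 `^ s3 <= t1 + t2 + t3.
Proof.
move=> t10 t20 t30 s10 s20 s30 s1E; set S := t1 + t2 + t3.
have S0 : 0 <= S by rewrite !addr_ge0.
have h t s : 0 <= t -> 0 <= s -> t <= S -> t `^ s <= S `^ s.
  by move=> t0 s0 tS; apply: ge0_ler_powR; rewrite ?nnegrE.
apply: (@le_trans _ _ (S `^ s1 * S `^ s2 * S `^ s3)).
  by apply: ler_pM; rewrite ?mulr_ge0 ?powR_ge0//; [apply: ler_pM; rewrite ?powR_ge0//; apply: h|apply: h]; rewrite // /S; lra.
have [S1|S1] := eqVneq S 0; last by rewrite -!powRD ?S1 ?implybT// s1E powRr1.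
rewrite S1; have [z1|n1] := eqVneq s1 0; last by rewrite powR0// !mul0r.
have [z2|n2] := eqVneq s2 0; last by rewrite (powR0 n2) mulr0 mul0r.
have n3 : s3 != 0 by move: s1E; rewrite z1 z2 !add0r => ->; exact: oner_neq0.
by rewrite (powR0 n3) mulr0.
Qed.

(** Hoelder's inequality for three factors, up to the constant 3: after scaling by [P], [Q] and
    [vol E], [powR_prod_le] is integrated and each of its three terms contributes at most 1. The 1
    added in [P] and [Q] keeps the scaling factors positive. *)
Lemma holder3 (c w : X -> R) (q d s : R) (E : set X) : measurable E -> 0 < q -> 0 <= d -> 0 <= s ->
  q^-1 + d / 2 + s = 1 -> measurable_fun Om c -> ig (fun x => `|c x| `^ q) ->
  L2 w -> (forall x, 1 <= w x) ->
  ig (fun x => `|c x| * w x `^ d * \1_E x) /\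
  It (fun x => `|c x| * w x `^ d * \1_E x) <=
    3 * (1 + It (fun x => `|c x| `^ q)) `^ (q^-1) * (1 + It (fun x => w x ^+ 2)) `^ (d / 2) * vol E `^ s.
Proof.
move=> mE q0 d0 s0 sE mc ic Lw w1.
have w0 x : 0 <= w x := le_trans ler01 (w1 x).
set P := 1 + _; set Q := 1 + _.
have P1 : 1 <= P by rewrite lerDl; apply: Rintegral_ge0 => x _; exact: powR_ge0.
have Q1 : 1 <= Q by rewrite lerDl; exact: It_sqr_ge0.
have P0 : 0 < P := lt_le_trans ltr01 P1; have Q0 : 0 < Q := lt_le_trans ltr01 Q1.
have [iE IE] := It_ind mE.
have mf : measurable_fun Om (fun x => `|c x| * w x `^ d * \1_E x).
  apply: measurable_funM; last exact: measurable_indic.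
  apply: measurable_funM; first exact: measurableT_comp mc.
  by apply: (measurableT_comp (measurable_powR d)); exact: L2_meas Lw.
have f0 x : 0 <= `|c x| * w x `^ d * \1_E x by rewrite !mulr_ge0 ?powR_ge0// indicE.
have gen (t : R) : 0 < t -> forall x, `|c x| * w x `^ d * \1_E x <=
    t `^ s * P `^ (q^-1) * Q `^ (d / 2) * (t^-1 * \1_E x + P^-1 * `|c x| `^ q + Q^-1 * w x ^+ 2).
  move=> t0 x; rewrite indicE; case: (x \in E); last first.
    rewrite mulr0 mulr_ge0 ?mulr_ge0 ?powR_ge0// mulr0 add0r.
    by rewrite addr_ge0 ?mulr_ge0 ?invr_ge0 ?powR_ge0 ?sqr_ge0// ltW.
  rewrite !mulr1; set t1 := t^-1; set t2 := P^-1 * _; set t3 := Q^-1 * _.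
  have t10 : 0 <= t1 by rewrite invr_ge0 ltW.
  have t20 : 0 <= t2 by rewrite mulr_ge0 ?powR_ge0// invr_ge0 ltW.
  have t30 : 0 <= t3 by rewrite mulr_ge0 ?sqr_ge0// invr_ge0 ltW.
  have h := @powR_prod_le s (q^-1) (d / 2) t1 t2 t3 t10 t20 t30 s0.
  have q0' : 0 <= q^-1 by rewrite invr_ge0 ltW.
  have d20 : 0 <= d / 2 by rewrite divr_ge0.
  have sE' : s + q^-1 + d / 2 = 1 by move: sE; lra.
  have {}h := h q0' d20 sE'.
  apply: le_trans (ler_wpM2l _ h); last by rewrite !mulr_ge0 ?powR_ge0.
  have e1 : t `^ s * t1 `^ s = 1 by rewrite -powRM ?(ltW t0)// mulfV ?gt_eqF// powR1.
  have e2 : P `^ q^-1 * t2 `^ q^-1 = `|c x|.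
    rewrite -powRM ?(ltW P0)// /t2 mulrA mulfV ?gt_eqF// mul1r -powRrM mulfV ?gt_eqF// powRr1//.
  have e3 : Q `^ (d / 2) * t3 `^ (d / 2) = w x `^ d.
    rewrite -powRM ?(ltW Q0)// /t3 mulrA mulfV ?gt_eqF// mul1r -powR_mulrn// -powRrM.
    by congr (_ `^ _); field.
  apply: le_of_eq.
  have -> : `|c x| * w x `^ d = 1 * (`|c x| * w x `^ d) by rewrite mul1r.
  rewrite -[in 1 * _]e1 -e2 -e3; move: (t `^ s) (t1 `^ s) (P `^ _) (t2 `^ _) (Q `^ _) (t3 `^ _) => z1 z2 z3 z4 z5 z6; ring.
have iw2 := L2_ig Lw.
have igen t : ig (fun x => t `^ s * P `^ (q^-1) * Q `^ (d / 2) * (t^-1 * \1_E x + P^-1 * `|c x| `^ q + Q^-1 * w x ^+ 2)).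
  by apply: (igZ mO); apply: (igD mO); [apply: (igD mO)|]; apply: (igZ mO).
have iF : ig (fun x => `|c x| * w x `^ d * \1_E x).
  by apply: (ig_le mO mf (igen 1)); apply: aeDW => x _; rewrite ger0_norm ?gen.
split=> //.
have [v0|v0] := eqVneq (vol E) 0.
  have -> : It (fun x => `|c x| * w x `^ d * \1_E x) = It (fun=> 0).
    apply: (It_eq mO iF) => //.
    have i0 (x : X) : 0 <= \1_E x :> R by rewrite indicE.
    have := It_eq0 mO iE (@aeDW _ _ _ leb Om _ (fun x _ => i0 x)).
    by rewrite IE v0 => /(_ erefl); apply: aeD1 => x _ ->; rewrite mulr0.
  by rewrite It0 !mulr_ge0 ?powR_ge0.
have v1 : 0 < vol E by rewrite lt_neqAle eq_sym v0 vol_ge0.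
apply: le_trans (It_le mO iF (igen (vol E)) (@aeDW _ _ _ leb Om _ (fun x _ => gen _ v1 x))) _.
have j1 := igZ mO ((vol E)^-1) iE; have j2 := igZ mO P^-1 ic; have j3 := igZ mO Q^-1 iw2.
rewrite (ItZ mO _ (igD mO (igD mO j1 j2) j3)) (ItD mO (igD mO j1 j2) j3) (ItD mO j1 j2).
rewrite (ItZ mO _ iE) (ItZ mO _ ic) (ItZ mO _ iw2) IE mulVf//.
have b2 : P^-1 * It (fun x => `|c x| `^ q) <= 1 by rewrite mulrC ler_pdivrMr// mul1r lerDr.
have b3 : Q^-1 * It (fun x => w x ^+ 2) <= 1 by rewrite mulrC ler_pdivrMr// mul1r lerDr.
have -> : 3 * P `^ q^-1 * Q `^ (d / 2) * vol E `^ s = vol E `^ s * P `^ q^-1 * Q `^ (d / 2) * 3.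
  by move: (P `^ _) (Q `^ _) (vol E `^ _) => z1 z2 z3; ring.
by apply: ler_wpM2l; [rewrite !mulr_ge0 ?powR_ge0|lra].
Qed.

(* With [2/n - 1/q = tau > 0], the exponents [d = tau/2] and [g = tau/4] leave [1 - th < 2/n]. *)
Lemma weight_morrey (c : X -> R) (q : R) : (2 <= n)%N -> n%:R / 2 < q -> measurable_fun Om c ->
  ig (fun x => `|c x| `^ q) ->
  exists d g th C : R, [/\ 0 < d < 1, 0 < g, 0 < th /\ n%:R * (1 - th) < 2, 0 < C &
    forall v A, L2 v -> measurable A ->
      morrey th (C * (1 + It (fun x => v x ^+ 2)) * vol A `^ g)
        (fun x => `|c x| * (1 + `|v x|) `^ d * \1_A x)].
Proof.
move=> n2 nq mc ic; have n0 : 0 < n%:R :> R by rewrite ltr0n ltnW.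
have q0 : 0 < q by apply: lt_trans nq; rewrite divr_gt0.
have nR : 2 <= n%:R :> R by rewrite ler_nat.
pose tau := 2 / n%:R - q^-1.
have tau0 : 0 < tau.
  by rewrite /tau subr_gt0 -[2 / _]invrK ltf_pV2 ?posrE ?invr_gt0 ?divr_gt0// invf_div.
have n1 : 2 / n%:R <= 1 :> R by rewrite ler_pdivrMr// mul1r.
have qV : 0 < q^-1 by rewrite invr_gt0.
have tau1 : tau < 1 by rewrite /tau; lra.
pose d := tau / 2; pose g := tau / 4; pose th := 1 - q^-1 - d / 2 - g.
have e1 : q^-1 + d / 2 + (th + g) = 1 by rewrite /th; ring.
have th0 : 0 < th by rewrite /th /d /g; move: tau0 n1; rewrite /tau; lra.
have nth : n%:R * (1 - th) < 2.
  have : 1 - th < 2 / n%:R by rewrite /th /d /g; move: tau0; rewrite /tau; lra.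
  by rewrite ltr_pdivlMr// mulrC.
have dle : d / 2 <= 1 by rewrite /d; lra.
pose Vm := It (fun=> 1 : R); have Vm0 : 0 <= Vm by apply: Rintegral_ge0.
pose P := (1 + It (fun x => `|c x| `^ q)) `^ (q^-1).
have P0 : 0 < P.
  by rewrite powR_gt0// ltr_wpDr//; apply: Rintegral_ge0 => x _; exact: powR_ge0.
have V10 : 0 < 1 + 2 * Vm + 2 by lra.
exists d, g, th, (3 * P * (1 + 2 * Vm + 2)); split.
- by rewrite /d; apply/andP; split; lra.
- by rewrite /g; lra.
- by [].
- by rewrite !mulr_gt0.
move=> v A Lv mA; pose w x := 1 + `|v x|.
have L1 := L2_cst oOm bOm 1; have mv := L2_meas Lv.
have La : L2 (fun x => `|v x|).
  split; first exact: measurableT_comp mv.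
  by move: (L2_ig Lv); under eq_fun do rewrite -real_normK ?num_real//.
have Lw : L2 w := L2D mO L1 La.
have w1 x : 1 <= w x by rewrite lerDl.
have Q2 : 1 + It (fun x => w x ^+ 2) <= (1 + 2 * Vm + 2) * (1 + It (fun x => v x ^+ 2)).
  have := ItD2 mO L1 La.
  have -> : It (fun x => `|v x| ^+ 2) = It (fun x => v x ^+ 2).
    by apply: eq_It => x _; rewrite real_normK ?num_real.
  have -> : It (fun=> 1 ^+ 2 : R) = Vm by apply: eq_It => x _; rewrite expr1n.
  have A0 : 0 <= It (fun x => v x ^+ 2) by exact: It_sqr_ge0.
  by move: (It _) A0 Vm0 => a a0 V0 h; have := mulr_ge0 V0 a0; rewrite /w; lra.
have main E : measurable E -> ig (fun x => `|c x| * w x `^ d * \1_E x) /\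
    It (fun x => `|c x| * w x `^ d * \1_E x) <= 3 * P * (1 + 2 * Vm + 2) * (1 + It (fun x => v x ^+ 2)) * vol E `^ (th + g).
  move=> mE; have [||i h] := @holder3 c w q d (th + g) E mE q0 _ _ e1 mc ic Lw w1.
  - by rewrite /d divr_ge0// ltW.
  - by rewrite addr_ge0// ?ltW// /g divr_gt0.
  split=> //; apply: (le_trans h); apply: ler_wpM2r; first exact: powR_ge0.
  rewrite -/P -[leRHS]mulrA; apply: ler_wpM2l; first by rewrite mulr_ge0 ?ltW.
  apply: le_trans Q2; set Q := 1 + It _.
  have Q1 : 1 <= Q by rewrite lerDl; exact: It_sqr_ge0.
  rewrite -[leRHS]powRr1; last exact: le_trans ler01 Q1.
  by apply: ler_powR; [exact: Q1|exact: dle].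
split.
- by have [] := main A mA.
- by move=> x; rewrite !mulr_ge0 ?powR_ge0// indicE.
move=> E mE.
have -> : (fun x => `|c x| * (1 + `|v x|) `^ d * \1_A x * \1_E x) = (fun x => `|c x| * w x `^ d * \1_(A `&` E) x).
  by apply/funext => x; rewrite indicI /w /=; ring.
have mAE : measurable (A `&` E) by exact: measurableI.
have [_ h] := main _ mAE; apply: (le_trans h).
rewrite -[leRHS]mulrA; apply: ler_wpM2l.
  rewrite !mulr_ge0 ?(ltW P0) ?(ltW V10)// addr_ge0//; exact: It_sqr_ge0.
(* The power [th + g] of the volume is shared: [th] goes to [E] as the Morrey bound, [g] to [A] as
   the gain on small sets used by De Giorgi iteration. *)
have [v0|v0] := eqVneq (vol (A `&` E)) 0.
  rewrite v0 powR0; first by rewrite mulr_ge0 ?powR_ge0.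
  by rewrite gt_eqF// addr_gt0// /g divr_gt0.
rewrite powRD ?v0 ?implybT// mulrC; apply: ler_pM; rewrite ?powR_ge0//.
  apply: ge0_ler_powR; rewrite ?nnegrE ?vol_ge0 ?le_vol//.
  by rewrite /g divr_ge0// ltW.
apply: ge0_ler_powR; rewrite ?nnegrE ?vol_ge0 ?le_vol// ltW//.
Qed.

End weights.

(** * Semilinear functionals *)

Lemma abs_le_sqr {R : realType} (x y : R) : 0 <= y -> x ^+ 2 <= y ^+ 2 -> `|x| <= y.
Proof.
by move=> y0 h; rewrite -(@ler_pXn2r _ 2)// ?nnegrE// real_normK ?num_real.
Qed.

(** The ratio [r] solves [r^g = 1/4]: under [m j <= m 0 r^j] the factor [4^j] is compensated by
    [(m j)^g], and the smallness of [m 0] makes the remaining factor at most [r]. *)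
Lemma geometric_decay {R : realType} (g B : R) (m : nat -> R) : 0 < g -> 0 <= B -> (forall j, 0 <= m j) ->
  (forall j, m j.+1 <= B * 4 ^+ j * (m j `^ g * m j)) -> B * m 0%N `^ g <= 4 `^ (- g^-1) ->
  m @ \oo --> 0.
Proof.
move=> g0 B0 m0 hm hB; set r := 4 `^ (- g^-1) in hB.
have r0 : 0 < r by rewrite powR_gt0.
have r1 : r < 1.
  by rewrite /r /powR pnatr_eq0/= expR_lt1 mulNr oppr_lt0 mulr_gt0 ?invr_gt0// ln_gt0// ltr1n.
have rg : r `^ g = 4^-1 by rewrite /r -powRrM mulNr mulVf ?gt_eqF// powRN powRr1.
have key j : m j <= m 0%N * r ^+ j.
  elim: j => [|j ih]; first by rewrite expr0 mulr1.
  have h1 : m j `^ g <= m 0%N `^ g * 4 ^- j.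
    have -> : 4 ^- j = (r ^+ j) `^ g by rewrite -(powR_mulrn j (ltW r0)) -powRrM mulrC powRrM rg powR_mulrn ?invr_ge0// exprVn.
    rewrite -powRM ?exprn_ge0 ?(ltW r0)//; apply: ge0_ler_powR; rewrite ?nnegrE ?(ltW g0)//.
    by rewrite mulr_ge0// exprn_ge0// ltW.
  apply: (le_trans (hm j)); rewrite mulrA; apply: (@le_trans _ _ (r * m j)).
    apply: ler_wpM2r => //; apply: le_trans hB.
    rewrite -mulrA; apply: ler_wpM2l => //; rewrite mulrC -ler_pdivlMr ?exprn_gt0//.
  rewrite exprS mulrCA; apply: ler_wpM2l => //; exact: ltW.
apply/cvgrPdist_lt => e e0; have e1 : 0 < e / (m 0%N + 1) by rewrite divr_gt0// ltr_wpDl.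
have r01 : 0 < r < 1 by rewrite r0.
have [k hk] := pow_small r01 e1.
exists k => // j /= kj; rewrite sub0r normrN ger0_norm//; apply: (le_lt_trans (key j)).
apply: (@le_lt_trans _ _ ((m 0%N + 1) * r ^+ k)).
  apply: ler_pM => //; first by rewrite exprn_ge0// ltW.
    by rewrite lerDl.
  by rewrite ler_wiXn2l// ltW.
by rewrite mulrC -ltr_pdivlMr// ltr_wpDl.
Qed.

(** * Functionals on H^1_0 as a Hilbert space *)

Section Hspace.
Context {R : realType} {n : nat}.
Local Notation X := 'rV[R]_n.
Variable Om : set X.
(** Pairs of a function and a gradient. Openness and boundedness are premises inside the predicate,
    so that it is a submodule for every [Om] and the module structure depends on [Om] alone. *)
Definition Hpred : {pred ((X -> R^o) * (X -> X))%type} :=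
  fun p => `[< open Om -> bounded_set Om -> Hs Om p.1 p.2 >].

Lemma Hpred_closed : submod_closed Hpred.
Proof.
split.
  apply/asboolP => oO bO; have := Hs_test oO bO (test0 Om); congr Hs.
  by apply/funext => x; apply/rowP => i; rewrite !mxE partial_cst.
move=> a u v /asboolP hu /asboolP hv; apply/asboolP => oO bO.
exact: (Hs_lin oO bO a (hu oO bO) (hv oO bO)).
Qed.
HB.instance Definition _ := GRing.isSubmodClosed.Build R ((X -> R^o) * (X -> X))%type Hpred Hpred_closed.
Record Hsp := HspOf { hval :> ((X -> R^o) * (X -> X))%type ; _ : hval \in Hpred }.
HB.instance Definition _ := [isSub for hval].
HB.instance Definition _ := [Choice of Hsp by <:].
HB.instance Definition _ := [SubChoice_isSubLmodule of Hsp by <:].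

Definition fn (v : Hsp) : X -> R := (hval v).1.
Definition gr (v : Hsp) : X -> X := (hval v).2.

Lemma fn_lin a v w x : fn (a *: v + w) x = a * fn v x + fn w x.
Proof. by rewrite /fn linearP. Qed.
Lemma gr_lin a v w x : gr (a *: v + w) x = a *: gr v x + gr w x.
Proof. by rewrite /gr linearP. Qed.
Lemma fnD v w x : fn (v + w) x = fn v x + fn w x.
Proof. by have := fn_lin 1 v w x; rewrite scale1r mul1r. Qed.
Lemma fnB v w x : fn (v - w) x = fn v x - fn w x.
Proof. by rewrite /fn raddfB. Qed.
Lemma grB v w x : gr (v - w) x = gr v x - gr w x.
Proof. by rewrite /gr raddfB. Qed.
Lemma fnZ a v x : fn (a *: v) x = a * fn v x.
Proof. by rewrite /fn linearZ. Qed.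
Lemma fn0 x : fn 0 x = 0.
Proof. by rewrite /fn raddf0. Qed.

Local Notation leb := (@lebesgue_rV R n).
Hypotheses (oOm : open Om) (bOm : bounded_set Om).
Let mO : measurable Om := mOm oOm.
Local Notation It f := (Rintegral leb Om f).
Local Notation L2 := (L2 leb Om).
Local Notation ig := (ig leb Om).
Local Notation aeD := (aeD leb Om).
Local Notation Hs := (Hs Om).
Local Notation vL2 := (vL2 Om).
Local Notation nq := (nq Om).

Lemma HspP (v : Hsp) : Hs (fn v) (gr v).
Proof. by have /asboolP := valP v; exact. Qed.

Lemma Hsp_ex u Du : Hs u Du -> exists v : Hsp, fn v = u /\ gr v = Du.
Proof.
move=> hu; have h : ((u : X -> R^o), Du) \in Hpred by apply/asboolP.
by exists (HspOf h).
Qed.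

Lemma fn_L2 v : L2 (fn v). Proof. exact: Hs_L2 (HspP v). Qed.
Lemma fn_meas v : measurable_fun Om (fn v). Proof. exact: L2_meas (fn_L2 v). Qed.
Lemma gr_vL2 v : vL2 (gr v). Proof. exact: Hs_vL2 (HspP v). Qed.

Variables (a : X -> R) (a0 a1 : R).
Hypotheses (ma : measurable_fun Om a) (a00 : 0 < a0) (ha : forall x, a0 <= a x <= a1).

Definition form (v w : Hsp) : R := It (fun x => a x * dot (gr v x) (gr w x)).

Let a_gt0 x : 0 < a x. Proof. by have /andP[h _] := ha x; exact: lt_le_trans h. Qed.
Let a1_ge0 : 0 < a1. Proof. by have /andP[_ h] := ha 0; exact: lt_le_trans (a_gt0 0) h. Qed.

Lemma ig_aZ f : ig f -> ig (fun x => a x * f x).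
Proof.
move=> i; apply: (@ig_le _ _ _ leb Om mO _ (fun x => a1 * `|f x|)).
- by apply: measurable_funM => //; exact: ig_meas i.
- by apply: igZ => //; exact: ig_norm.
apply: aeDW => x _; rewrite normrM (gtr0_norm (a_gt0 x)) ler_wpM2r//.
by have /andP[] := ha x.
Qed.

Lemma ig_form v w : ig (fun x => a x * dot (gr v x) (gr w x)).
Proof. by apply: ig_aZ; apply: ig_dot => //; exact: gr_vL2. Qed.

Lemma form_sym v w : form v w = form w v.
Proof. by apply: eq_It => x _; rewrite dotC. Qed.

Lemma form_lin k u v w : form (k *: u + v) w = k * form u w + form v w.
Proof.
rewrite -(ItZ mO _ (ig_form u w)) -(ItD mO (igZ mO k (ig_form u w)) (ig_form v w)).
by apply: eq_It => x _; rewrite gr_lin dotDl dotZl; ring.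
Qed.

Lemma form_ge0 v : 0 <= form v v.
Proof. by apply: Rintegral_ge0 => x _; rewrite mulr_ge0 ?dot_ge0 ?(ltW (a_gt0 x)). Qed.

Lemma nq_form v : a0 * nq (gr v) <= form v v.
Proof.
have i := ig_dot oOm (gr_vL2 v) (gr_vL2 v).
rewrite -(ItZ mO _ i); apply: (It_le mO); [exact: igZ|exact: ig_form|].
by apply: aeDW => x _; rewrite ler_wpM2r ?dot_ge0//; have /andP[] := ha x.
Qed.

Lemma form_nq v : form v v <= a1 * nq (gr v).
Proof.
have i := ig_dot oOm (gr_vL2 v) (gr_vL2 v).
rewrite -(ItZ mO _ i); apply: (It_le mO); [exact: ig_form|exact: igZ|].
by apply: aeDW => x _; rewrite ler_wpM2r ?dot_ge0//; have /andP[] := ha x.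
Qed.

Local Notation N := (nrm form).
Let sqN v : N v ^+ 2 = form v v := sqr_nrm form_ge0 v.

Hypothesis n0 : (0 < n)%N.

Lemma poincare_form : exists2 P : R, 0 < P & forall v, It (fun x => fn v x ^+ 2) <= P * N v ^+ 2.
Proof.
have [P P0 hP] := poincare oOm bOm n0; exists (P / a0) => [|v]; first exact: divr_gt0.
rewrite sqN; apply: (le_trans (hP _ _ (HspP v))); rewrite -mulrA ler_pM2l//.
by rewrite mulrC ler_pdivlMr// mulrC; exact: nq_form.
Qed.

Lemma form_complete : ncomplete form.
Proof.
move=> x hx; have [P P0 hP] := poincare_form.
have aeq (v w : Hsp) : nq (fun y => gr v y - gr w y) = nq (gr (v - w)).
  by apply: eq_It => y _; rewrite grB.
have aeu (v w : Hsp) : It (fun y => (fn v y - fn w y) ^+ 2) = It (fun y => fn (v - w) y ^+ 2).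
  by apply: eq_It => y _; rewrite fnB.
have [|e e0|u [Du [hu _ c]]] := @Hs_complete R n Om oOm bOm (fun k => fn (x k)) (fun k => gr (x k)).
- by move=> k; exact: HspP.
- pose K := Num.max P a0^-1; have K0 : 0 < K by rewrite lt_max P0.
  have [|M hM] := hx (Num.sqrt (e / K)); first by rewrite sqrtr_gt0 divr_gt0.
  exists M => k l Mk Ml; have h := hM k l Mk Ml.
  have h2 : N (x k - x l) ^+ 2 <= e / K.
    rewrite -[leRHS]sqr_sqrtr ?divr_ge0 ?(ltW e0) ?(ltW K0)//.
    by rewrite ler_pXn2r ?nnegrE ?nrm_ge0 ?sqrtr_ge0.
  have h3 : K * N (x k - x l) ^+ 2 <= e by rewrite mulrC -ler_pdivlMr.
  rewrite aeu aeq; split; apply: le_trans h3.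
    by apply: le_trans (hP _) _; rewrite ler_wpM2r ?sqr_ge0// le_max lexx.
  apply: (@le_trans _ _ (a0^-1 * N (x k - x l) ^+ 2)); last by rewrite ler_wpM2r ?sqr_ge0// le_max lexx orbT.
  by rewrite mulrC ler_pdivlMr// mulrC sqN; exact: nq_form.
have [l [lu lD]] := Hsp_ex hu; exists l.
have c2 : (fun k => a1 * nq (gr (x k - l))) @ \oo --> 0.
  have h : (fun k => a1 * nq (gr (x k - l))) @ \oo --> a1 * 0.
    by apply: cvgMr; move: c; rewrite -lD; under eq_fun do rewrite aeq.
  by rewrite mulr0 in h.
apply/cvgrPdist_lt => e e0; have e2 : 0 < e ^+ 2 by rewrite exprn_gt0.
move/cvgrPdist_lt : c2 => /(_ _ e2); apply: filterS => k.
rewrite !sub0r !normrN => h; apply: ltr_sqr_norm => //.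
rewrite real_normK ?num_real// sqN; apply: le_lt_trans h.
by apply: le_trans (ler_norm _); exact: form_nq.
Qed.

Variables (c : X -> R) (d g th C : R).
Hypotheses (c1 : forall x, 1 <= c x) (d01 : 0 < d <= 1) (g0 : 0 < g) (th0 : 0 < th)
  (nth2 : n%:R * (1 - th) < 2) (C0 : 0 < C)
  (cM : forall v A, L2 v -> measurable A -> morrey Om th (C * (1 + It (fun x => v x ^+ 2)) * vol Om A `^ g)
     (fun x => c x * (1 + `|v x|) `^ d * \1_A x)).

(** It dominates the difference quotients of [psi] in its second argument; the small power [d]
    stands for a logarithm. *)
Definition wt (v : X -> R) (x : X) : R := c x * (1 + `|v x|) `^ d.

Lemma wt_ge1 v x : 1 <= wt v x.
Proof.
have h : 1 <= (1 + `|v x|) `^ d.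
  rewrite -[leLHS](powRr0 (1 + `|v x|)).
  by apply: ler_powR; [rewrite lerDl|have /andP[/ltW] := d01].
by apply: le_trans (c1 x) _; rewrite /wt ler_peMr// (le_trans ler01).
Qed.

Lemma wt_ge0 v x : 0 <= wt v x. Proof. exact: le_trans (wt_ge1 v x). Qed.
Hint Resolve wt_ge0 : core.

Lemma wt_morrey v : L2 v -> exists2 K, 0 <= K & morrey Om th K (wt v).
Proof.
move=> Lv; exists (C * (1 + It (fun x => v x ^+ 2)) * vol Om setT `^ g).
  rewrite !mulr_ge0 ?powR_ge0 ?(ltW C0)// addr_ge0//; exact: It_sqr_ge0.
have := cM Lv measurableT; congr morrey; apply/funext => x.
by rewrite /wt indicE mem_set// mulr1.
Qed.

Lemma ig_wt v : L2 v -> ig (wt v).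
Proof. by move=> /wt_morrey[K _ []]. Qed.

(** The Morrey constant of [wt v] depends on [v] only through its L2 norm, so [Ce] is uniform in
    [v]; compactness arguments use this with a weight that varies along the sequence. *)
Lemma wt_est (e : R) : 0 < e -> exists2 Ce : R, 0 <= Ce & forall v eta, L2 v ->
  ig (fun x => wt v x * fn eta x ^+ 2) /\
  It (fun x => wt v x * fn eta x ^+ 2) <=
    (1 + It (fun x => v x ^+ 2)) * (e * N eta ^+ 2 + Ce * It (fun x => fn eta x ^+ 2)).
Proof.
move=> e0; pose K := C * vol Om setT `^ g + 1.
have K0 : 0 <= C * vol Om setT `^ g by rewrite mulr_ge0 ?powR_ge0// ltW.
have K1 : 0 < K by rewrite ltr_wpDl.
have [Ce Ce0 h] := @morrey_ineq R n Om oOm bOm th (e * a0 / K) th0 nth2 (divr_gt0 (mulr_gt0 e0 a00) K1).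
exists (K * Ce) => [|v eta Lv]; first by rewrite mulr_ge0// ltW.
have A0 : 0 <= 1 + It (fun x => v x ^+ 2).
  by rewrite addr_ge0//; exact: It_sqr_ge0.
have mw : morrey Om th (C * (1 + It (fun x => v x ^+ 2)) * vol Om setT `^ g) (wt v).
  have := cM Lv measurableT; congr morrey; apply/funext => x.
  by rewrite /wt indicE mem_set// mulr1.
have [|i1 i2] := h _ _ _ _ _ mw (HspP eta).
  by rewrite mulrAC mulr_ge0.
split=> //; apply: (le_trans i2).
have -> : C * (1 + It (fun x => v x ^+ 2)) * vol Om setT `^ g = (1 + It (fun x => v x ^+ 2)) * (C * vol Om setT `^ g).
  by rewrite mulrAC mulrC.
rewrite -[leLHS]mulrA; apply: ler_wpM2l => //.
have E0 : 0 <= It (fun x => fn eta x ^+ 2) by exact: It_sqr_ge0.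
have nqf := nq_form eta; rewrite -sqN in nqf.
have nq00 := nq_ge0 oOm (gr_vL2 eta).
apply: (@le_trans _ _ (K * (e * a0 / K * nq (gr eta) + Ce * It (fun x => fn eta x ^+ 2)))).
  apply: ler_wpM2r; last by rewrite /K lerDl.
  by rewrite addr_ge0 ?mulr_ge0 ?invr_ge0 ?(ltW e0) ?(ltW a00) ?(ltW K1).
have -> : K * (e * a0 / K * nq (gr eta) + Ce * It (fun x => fn eta x ^+ 2)) =
  e * (a0 * nq (gr eta)) + K * Ce * It (fun x => fn eta x ^+ 2) by field; rewrite gt_eqF.
by rewrite lerD2r ler_wpM2l// ltW.
Qed.

Lemma wt_bound : exists2 C1 : R, 1 <= C1 & forall v eta,
  ig (fun x => wt (fn v) x * fn eta x ^+ 2) /\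
  It (fun x => wt (fn v) x * fn eta x ^+ 2) <= C1 * (1 + N v) ^+ 2 * N eta ^+ 2.
Proof.
have [P P0 hP] := poincare_form; have [Ce Ce0 h] := wt_est ltr01.
exists ((1 + P) * (1 + Ce * P)) => [|v eta].
  have h1 : 0 <= Ce * P by rewrite mulr_ge0// ltW.
  by have := mulr_ge0 (ltW P0) h1; move: P0; lra.
have [i1 i2] := h _ eta (fn_L2 v); split=> //; apply: (le_trans i2).
have N0 : 0 <= N v := nrm_ge0 _ _.
rewrite [leRHS](_ : _ = ((1 + P) * (1 + N v) ^+ 2) * ((1 + Ce * P) * N eta ^+ 2)); last by ring.
apply: ler_pM.
- by rewrite addr_ge0//; exact: It_sqr_ge0.
- apply: addr_ge0; first by rewrite mul1r sqr_ge0.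
  by apply: mulr_ge0 => //; exact: It_sqr_ge0.
- by have := hP v; have := mulr_ge0 (ltW P0) N0; nra.
- by rewrite mul1r mulrDl mul1r lerD2l -mulrA; apply: ler_wpM2l.
Qed.

Variables (psi Psi : X -> R -> R) (L : R).
Hypotheses (L0 : 0 <= L)
  (mpsi : forall v, measurable_fun Om v -> measurable_fun Om (fun x => psi x (v x)))
  (mPsi : forall v, measurable_fun Om v -> measurable_fun Om (fun x => Psi x (v x)))
  (psi_lip : forall x s t, `|psi x s - psi x t| <=
     L * (c x * (1 + `|s|) `^ d + c x * (1 + `|t|) `^ d) * `|s - t|)
  (Psi_tay : forall x s t, `|Psi x t - Psi x s - psi x s * (t - s)| <=
     L * (c x * (1 + `|s|) `^ d + c x * (1 + `|t|) `^ d) * (t - s) ^+ 2)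
  (psi0 : forall x, `|psi x 0| <= L * c x) (Psi0 : forall x, Psi x 0 = 0).

Let w_ge x (s : R) : c x <= c x * (1 + `|s|) `^ d.
Proof.
have h : 1 <= (1 + `|s|) `^ d.
  rewrite -[leLHS](powRr0 (1 + `|s|)).
  by apply: ler_powR; [rewrite lerDl|have /andP[/ltW] := d01].
by rewrite ler_peMr// (le_trans ler01).
Qed.

Let w0 x : c x * (1 + `|0 : R|) `^ d = c x.
Proof. by rewrite normr0 addr0 powR1 mulr1. Qed.

Lemma psi_bound x s : `|psi x s| <= 2 * L * (c x * (1 + `|s|) `^ d) * (1 + `|s|).
Proof.
have := psi_lip x s 0; have := psi0 x; rewrite subr0 w0 => h1 h2.
have h3 := w_ge x s; move: h2 h3; move: (c x * _) => w h2 h3.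
have h4 : `|psi x s| <= `|psi x 0| + `|psi x s - psi x 0|.
  by rewrite -{1}(subrK (psi x 0) (psi x s)) addrC; exact: ler_normD.
have c0 : 0 <= c x := le_trans ler01 (c1 x).
have h5 : L * c x <= L * w by exact: ler_wpM2l.
have h6 : L * (w + c x) * `|s| <= L * (w + w) * `|s|.
  by apply: ler_wpM2r => //; apply: ler_wpM2l => //; rewrite lerD2l.
have h7 : 0 <= L * w by rewrite mulr_ge0// (le_trans c0).
lra.
Qed.

Lemma Psi_bound x s : `|Psi x s| <= 3 * L * (c x * (1 + `|s|) `^ d) * (1 + s ^+ 2).
Proof.
have := Psi_tay x 0 s; have := psi0 x; rewrite subr0 Psi0 subr0 w0 => h1 h2.
have h3 := w_ge x s; move: h2 h3; move: (c x * _) => w h2 h3.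
have h4 : `|Psi x s| <= `|psi x 0| * `|s| + `|Psi x s - psi x 0 * s|.
  by rewrite -normrM -{1}(subrK (psi x 0 * s) (Psi x s)) addrC; exact: ler_normD.
have c0 : 0 <= c x := le_trans ler01 (c1 x).
have h5 : `|psi x 0| * `|s| <= L * w * `|s|.
  by apply: ler_wpM2r => //; apply: (le_trans h1); exact: ler_wpM2l.
have h6 : L * (c x + w) * s ^+ 2 <= L * (w + w) * s ^+ 2.
  by apply: ler_wpM2r; [exact: sqr_ge0|apply: ler_wpM2l => //; rewrite lerD2r].
have h7 : 0 <= L * w by rewrite mulr_ge0// (le_trans c0).
have h8 : `|s| <= 1 + s ^+ 2.
  by rewrite -[s ^+ 2]real_normK ?num_real//; have := sqr_ge0 (`|s| - 2^-1); have := sqr_ge0 `|s|; nra.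
have h9 : L * w * `|s| <= L * w * (1 + s ^+ 2) by exact: ler_wpM2l.
have h10 : 0 <= L * w * s ^+ 2 by rewrite mulr_ge0 ?sqr_ge0.
lra.
Qed.

Let igw v : ig (wt (fn v)). Proof. exact: ig_wt (fn_L2 v). Qed.
Let igw2 v eta : ig (fun x => wt (fn v) x * fn eta x ^+ 2).
Proof. by have [C1 _ h] := wt_bound; have [] := h v eta. Qed.

Lemma ig_psi v z : ig (fun x => psi x (fn v x) * fn z x).
Proof.
have iF : ig (fun x => 2 * L * (wt (fn v) x + (2 * (wt (fn v) x * fn z x ^+ 2) + wt (fn v) x * fn v x ^+ 2))).
  by apply: (igZ mO); apply: (igD mO (igw v)); apply: (igD mO) => //; exact: igZ.
apply: (ig_le mO _ iF).
  by apply: measurable_funM; [exact: mpsi (fn_meas v)|exact: fn_meas].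
apply: aeDW => x _; rewrite normrM.
have h := psi_bound x (fn v x); rewrite -/(wt (fn v) x) in h.
apply: (le_trans (ler_wpM2r (normr_ge0 _) h)).
have W0 := wt_ge0 (fn v) x; move: W0; move: (wt (fn v) x) (fn v x) (fn z x) => w s t W0.
have t2 : t ^+ 2 = `|t| ^+ 2 by rewrite real_normK ?num_real.
have s2 : s ^+ 2 = `|s| ^+ 2 by rewrite real_normK ?num_real.
have h1 : (1 + `|s|) * `|t| <= 1 + (2 * t ^+ 2 + s ^+ 2).
  rewrite t2 s2; move: (`|s|) (`|t|) (normr_ge0 s) (normr_ge0 t) => y z' y0 z0.
  by have := sqr_ge0 (y - z'); have := sqr_ge0 (z' - 1); nra.
have h2 : 0 <= 2 * L * w by rewrite !mulr_ge0.
have := ler_wpM2l h2 h1; lra.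
Qed.

Lemma ig_Psi v : ig (fun x => Psi x (fn v x)).
Proof.
have iF : ig (fun x => 3 * L * (wt (fn v) x + wt (fn v) x * fn v x ^+ 2)).
  by apply: (igZ mO); exact: (igD mO (igw v)).
apply: (ig_le mO (mPsi (fn_meas v)) iF); apply: aeDW => x _.
by apply: (le_trans (Psi_bound x (fn v x))); rewrite -/(wt (fn v) x); lra.
Qed.

(** Cauchy-Schwarz with the weight [wt (fn v)] bounds the nonlinear term by a multiple of [N z], so
    [riesz] applies. *)
Lemma gradient_ex v : exists G, forall z, form v z - It (fun x => psi x (fn v x) * fn z x) = form G z.
Proof.
have [C1 C11 hb] := wt_bound; have C10 : 0 <= C1 := le_trans ler01 C11.
pose f x := 1 + `|fn v x|.
have mf : measurable_fun Om f.
  by apply: measurable_funD; [exact: measurable_cst|exact: measurableT_comp (fn_meas v)].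
have if2 : ig (fun x => wt (fn v) x * f x ^+ 2).
  apply: (ig_le mO _ (igD mO (igZ mO 2 (igw v)) (igZ mO 2 (igw2 v v)))).
    by apply: measurable_funM; [exact: ig_meas (igw v)|exact: measurable_funX].
  apply: aeDW => x _; rewrite ger0_norm; last by apply: mulr_ge0; [exact: wt_ge0|exact: sqr_ge0].
  have : f x ^+ 2 <= 2 + 2 * fn v x ^+ 2.
    by rewrite /f -[fn v x ^+ 2]real_normK ?num_real//; have := sqr_ge0 (`|fn v x| - 1); nra.
  by move/(ler_wpM2l (wt_ge0 (fn v) x)); lra.
pose F := It (fun x => wt (fn v) x * f x ^+ 2).
have F0 : 0 <= F by apply: Rintegral_ge0 => y _; apply: mulr_ge0; [exact: wt_ge0|exact: sqr_ge0].
pose D := Num.sqrt (F * (C1 * (1 + N v) ^+ 2)).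
have bnd z : `|It (fun x => psi x (fn v x) * fn z x)| <= 2 * L * D * N z.
  pose az x := `|fn z x|.
  have maz : measurable_fun Om az by apply: measurableT_comp (fn_meas z).
  have iz : ig (fun x => wt (fn v) x * az x ^+ 2).
    by move: (igw2 v z); congr ig; apply/funext => y; rewrite /az real_normK ?num_real.
  have [i3 b3] := CSw mO (ig_meas (igw v)) mf maz (@aeDW _ _ _ leb Om _ (fun x _ => wt_ge0 (fn v) x)) if2 iz.
  apply: (@le_trans _ _ (2 * L * It (fun x => wt (fn v) x * (f x * az x)))).
    rewrite -(ItZ mO _ i3); apply: (It_abs_le mO (ig_psi v z) (igZ mO _ i3)).
    apply: aeDW => x _; rewrite normrM; apply: (le_trans (ler_wpM2r (normr_ge0 _) (psi_bound x (fn v x)))).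
    by rewrite -/(wt (fn v) x) -/(f x) -/(az x) !mulrA.
  rewrite -[leRHS]mulrA; apply: ler_wpM2l; first by rewrite mulr_ge0.
  apply: le_trans (ler_norm _) _; apply: abs_le_sqr; first by rewrite mulr_ge0 ?sqrtr_ge0 ?nrm_ge0.
  apply: (le_trans b3); rewrite exprMn /D sqr_sqrtr; last by apply: mulr_ge0 => //; apply: mulr_ge0 => //; exact: sqr_ge0.
  rewrite -[leRHS]mulrA; apply: ler_wpM2l => //.
  have [_] := hb v z; apply: le_trans.
  by apply/le_of_eq/eq_It => x _; rewrite /az real_normK ?num_real.
apply: (riesz (B := form) form_sym form_lin form_ge0 (C := N v + 2 * L * D) form_complete).
  move=> k u w; rewrite form_sym form_lin !(form_sym _ v).
  have -> : It (fun x => psi x (fn v x) * fn (k *: u + w) x) =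
      k * It (fun x => psi x (fn v x) * fn u x) + It (fun x => psi x (fn v x) * fn w x).
    rewrite -(ItZ mO _ (ig_psi v u)) -(ItD mO (igZ mO k (ig_psi v u)) (ig_psi v w)).
    by apply: eq_It => x _; rewrite fn_lin; ring.
  by ring.
move=> z; apply: le_trans (ler_normB _ _) _; rewrite mulrDl; apply: lerD (bnd z).
exact: (B_CS form_sym form_lin form_ge0).
Qed.

Definition energy (v : Hsp) : R := 2^-1 * form v v - It (fun x => Psi x (fn v x)).

Lemma wt_diff_est : exists2 K : R, 1 <= K & forall v w y z,
  ig (fun x => L * (wt (fn v) x + wt (fn w) x) * (`|fn y x| * `|fn z x|)) /\
  It (fun x => L * (wt (fn v) x + wt (fn w) x) * (`|fn y x| * `|fn z x|)) <=
    K * ((1 + N v) + (1 + N w)) ^+ 2 * N y * N z.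
Proof.
have [C1 C11 hb] := wt_bound; have C10 : 0 <= C1 := le_trans ler01 C11.
have one v y z : ig (fun x => wt (fn v) x * (`|fn y x| * `|fn z x|)) /\
    It (fun x => wt (fn v) x * (`|fn y x| * `|fn z x|)) <= C1 * (1 + N v) ^+ 2 * N y * N z.
  have mab u : measurable_fun Om (fun x => `|fn u x|) by apply: measurableT_comp (fn_meas u).
  have e u : (fun x => wt (fn v) x * `|fn u x| ^+ 2) = (fun x => wt (fn v) x * fn u x ^+ 2).
    by apply/funext => x; rewrite real_normK ?num_real.
  have [i1 b1] := hb v y; have [i2 b2] := hb v z.
  have := CSw mO (ig_meas (igw v)) (mab y) (mab z) (@aeDW _ _ _ leb Om _ (fun x _ => wt_ge0 (fn v) x)).
  rewrite !e => /(_ i1 i2)[i3 b3]; split=> //.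
  set K := C1 * (1 + N v) ^+ 2 in b1 b2 *.
  have K0 : 0 <= K by rewrite mulr_ge0// sqr_ge0.
  apply: le_trans (ler_norm _) _.
  apply: abs_le_sqr; first by apply: mulr_ge0; [apply: mulr_ge0 => //|]; exact: nrm_ge0.
  apply: (le_trans b3).
  have -> : (K * N y * N z) ^+ 2 = (K * N y ^+ 2) * (K * N z ^+ 2) by ring.
  by apply: ler_pM => //; apply: Rintegral_ge0 => x _; rewrite mulr_ge0 ?sqr_ge0.
exists (1 + L * C1); first by rewrite lerDl mulr_ge0.
move=> v w y z; have [i1 b1] := one v y z; have [i2 b2] := one w y z.
have e : (fun x => L * (wt (fn v) x + wt (fn w) x) * (`|fn y x| * `|fn z x|)) =
    (fun x => L * (wt (fn v) x * (`|fn y x| * `|fn z x|) + wt (fn w) x * (`|fn y x| * `|fn z x|))).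
  by apply/funext => x; ring.
rewrite e; have i := igD mO i1 i2; split; first exact: igZ.
rewrite (ItZ mO _ i) (ItD mO i1 i2).
have Nv := nrm_ge0 form v; have Nw := nrm_ge0 form w; have Ny := nrm_ge0 form y; have Nz := nrm_ge0 form z.
have Q0 : 0 <= N y * N z by rewrite mulr_ge0.
apply: (@le_trans _ _ (L * C1 * ((1 + N v) ^+ 2 + (1 + N w) ^+ 2) * (N y * N z))).
  have -> : L * C1 * ((1 + N v) ^+ 2 + (1 + N w) ^+ 2) * (N y * N z) =
    L * (C1 * (1 + N v) ^+ 2 * N y * N z + C1 * (1 + N w) ^+ 2 * N y * N z) by ring.
  by apply: ler_wpM2l => //; exact: lerD.
rewrite -[leRHS]mulrA; apply: ler_wpM2r => //; apply: ler_pM.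
- by rewrite mulr_ge0.
- by rewrite addr_ge0 ?sqr_ge0.
- by rewrite lerDr.
- by have := mulr_ge0 (addr_ge0 ler01 Nv) (addr_ge0 ler01 Nw); move: (N v) (N w) => p q; lra.
Qed.

(** [G] is the gradient of [energy] for [form], and the last two bounds are the hypotheses [gL] and
    [JT] of the descent map. Their exponent 2 comes from the factor [(1 + N v)^2] of [wt_bound]. *)
Lemma functional : exists (G : Hsp -> Hsp) (K : R), [/\ 1 <= K,
  forall v z, form (G v) z = form v z - It (fun x => psi x (fn v x) * fn z x),
  forall v w, N (G v - G w) <= K * ((1 + N v) + (1 + N w)) ^+ 2 * N (v - w) &
  forall v w, `|energy (v + w) - energy v - form (G v) w| <= K * ((1 + N v) + (1 + N w)) ^+ 2 * N w ^+ 2].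
Proof.
have /choice[G hG] := gradient_ex.
have [K K1 hK] := wt_diff_est; have K0 : 0 <= K := le_trans ler01 K1.
exists G, (1 + 4 * K); split.
- by lra.
- by move=> v z; rewrite hG.
- move=> v w; set D := G v - G w.
  have Nv := nrm_ge0 form v; have Nw := nrm_ge0 form w; have ND := nrm_ge0 form D.
  have Nvw := nrm_ge0 form (v - w).
  set rr := (1 + N v) + (1 + N w); have rr1 : 1 <= rr by rewrite /rr; lra.
  have main : N D ^+ 2 <= (1 + K) * rr ^+ 2 * N (v - w) * N D.
    have [i b] := hK v w (v - w) D.
    have -> : N D ^+ 2 = form (v - w) D - It (fun x => (psi x (fn v x) - psi x (fn w x)) * fn D x).
      rewrite sqN {1}/D (BBl form_lin) -!hG (BBl form_lin).
      have -> : It (fun x => (psi x (fn v x) - psi x (fn w x)) * fn D x) =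
         It (fun x => psi x (fn v x) * fn D x) - It (fun x => psi x (fn w x) * fn D x).
        by rewrite -(ItB mO (ig_psi v D) (ig_psi w D)); apply: eq_It => x _; rewrite mulrBl.
      by ring.
    have b1 : `|It (fun x => (psi x (fn v x) - psi x (fn w x)) * fn D x)| <= K * rr ^+ 2 * N (v - w) * N D.
      apply: le_trans b; apply: (It_abs_le mO _ i).
        have := igB mO (ig_psi v D) (ig_psi w D); congr ig; apply/funext => x; by rewrite mulrBl.
      apply: aeDW => x _; rewrite normrM fnB mulrA; apply: ler_wpM2r => //; exact: psi_lip.
    have b2 := B_le form_sym form_lin form_ge0 (v - w) D.
    have b3 : N (v - w) * N D <= rr ^+ 2 * (N (v - w) * N D).
      by rewrite ler_peMl ?mulr_ge0// exprn_ege1.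
    move: b1; rewrite ler_norml => /andP[b4 _]; move: b2 b3 b4.
    by move: (rr ^+ 2) (N (v - w)) (N D) (form _ _) (It _) => z1 z2 z3 z4 z5; lra.
  have main2 : N D <= (1 + K) * rr ^+ 2 * N (v - w).
    have [D0|D0] := eqVneq (N D) 0.
      by rewrite D0; apply: mulr_ge0 => //; apply: mulr_ge0; [rewrite addr_ge0|exact: sqr_ge0].
    by rewrite -(ler_pM2r (_ : 0 < N D)) ?lt_neqAle ?ND ?andbT 1?eq_sym// -expr2.
  apply: (le_trans main2); rewrite -[leLHS]mulrA -[leRHS]mulrA; apply: ler_wpM2r.
    by apply: mulr_ge0 => //; exact: sqr_ge0.
  by rewrite lerD2l ler_peMl// ler1n.
- move=> v w; have Nv := nrm_ge0 form v; have Nw := nrm_ge0 form w; have Nvw := nrm_ge0 form (v + w).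
  have [i b] := hK v (v + w) w w.
  have e : energy (v + w) - energy v - form (G v) w =
      2^-1 * N w ^+ 2 - It (fun x => Psi x (fn (v + w) x) - Psi x (fn v x) - psi x (fn v x) * fn w x).
    rewrite (ItB mO (igB mO (ig_Psi (v + w)) (ig_Psi v)) (ig_psi v w)) (ItB mO (ig_Psi (v + w)) (ig_Psi v)).
    rewrite sqN -hG /energy (BDl form_lin) !(BDr form_sym form_lin) (form_sym w v).
    by field.
  have b1 : `|It (fun x => Psi x (fn (v + w) x) - Psi x (fn v x) - psi x (fn v x) * fn w x)| <=
      K * ((1 + N v) + (1 + N (v + w))) ^+ 2 * N w * N w.
    apply: le_trans b; apply: (It_abs_le mO _ i).
      exact: (igB mO (igB mO (ig_Psi (v + w)) (ig_Psi v)) (ig_psi v w)).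
    apply: aeDW => x _; have := Psi_tay x (fn v x) (fn (v + w) x).
    have -> : fn (v + w) x - fn v x = fn w x by rewrite fnD addrAC subrr add0r.
    by rewrite -expr2 real_normK ?num_real.
  rewrite e; apply: le_trans (ler_normB _ _) _.
  set rr := (1 + N v) + (1 + N w); have rr1 : 1 <= rr by rewrite /rr; lra.
  have b2 : K * ((1 + N v) + (1 + N (v + w))) ^+ 2 * N w * N w <= 4 * K * rr ^+ 2 * N w ^+ 2.
    rewrite -[leLHS]mulrA -expr2; apply: ler_wpM2r; first exact: sqr_ge0.
    have -> : 4 * K * rr ^+ 2 = K * (2 * rr) ^+ 2 by ring.
    apply: ler_wpM2l => //; rewrite ler_pXn2r// ?nnegrE; last 2 first.
    - by rewrite !addr_ge0.
    - by rewrite mulr_ge0// (le_trans ler01).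
    by have := nrmD form_sym form_lin form_ge0 v w; rewrite /rr; lra.
  have b3 : N w ^+ 2 <= rr ^+ 2 * N w ^+ 2 by rewrite ler_peMl ?sqr_ge0// exprn_ege1.
  rewrite [`|2^-1 * _|]ger0_norm; last by rewrite mulr_ge0 ?sqr_ge0 ?invr_ge0.
  have := sqr_ge0 (N w); move: b1 b2 b3; lra.
Qed.

Lemma ultra_cvg (U : set_system nat) (b : nat -> R) (M : R) : UltraFilter U -> (forall k, `|b k| <= M) ->
  exists l : R, b @ U --> l.
Proof.
move=> ult hb; have cK : compact `[- M, M]%classic := @segment_compact R (- M) M.
have ub : UltraFilter (b @ U).
  split=> [|G pG /= UG]; first exact: fmap_proper_filter.
  apply/seteqP; split => A; last exact: UG.
  move=> GA; have [//|UnA] := @in_ultra_setVsetC _ U (b @^-1` A) ult.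
  have GnA : G (~` A) by apply: UG.
  by have [x []] := @filter_ex _ G pG _ (@filterI _ G _ _ _ GA GnA).
rewrite compact_ultra in cK; have [] := cK (b @ U) ub.
  have : U (b @^-1` `[- M, M]%classic) by apply: filterE => k /=; rewrite in_itv/= -ler_norml.
  by [].
by move=> l [_ hl]; exists l.
Qed.

(** Along an ultrafilter finer than the tails every bounded real sequence converges, hence all the
    functionals of [rellich], for every precision at once. This replaces a diagonal extraction. *)
Lemma ultra_cauchy (v_ : nat -> Hsp) (M : R) : (forall k, N (v_ k) <= M) ->
  exists U : set_system nat, [/\ UltraFilter U, \oo `<=` U &
    forall e, 0 < e -> exists2 A, U A & forall k l, A k -> A l ->
      It (fun x => fn (v_ k - v_ l) x ^+ 2) <= e].
Proof.
move=> hM; have M0 : 0 <= M := le_trans (nrm_ge0 _ _) (hM 0%N).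
have [P P0 hP] := poincare_form.
have [U [ult sU]] := ultraFilterLemma (eventually_filter).
exists U; split=> // e e0.
pose D := (2 * M) ^+ 2 / a0 + 1.
have D0 : 0 <= (2 * M) ^+ 2 / a0 by rewrite divr_ge0 ?sqr_ge0// ltW.
have D1 : 0 < D by rewrite ltr_wpDl.
have [I [w [K [K0 [Lw hw]]]]] := rellich oOm bOm (divr_gt0 (divr_gt0 e0 (ltr0n R 2)) D1).
pose b f k := It (fun x => fn (v_ k) x * w f x).
have ib f k : ig (fun x => fn (v_ k) x * w f x) := L2M mO (fn_L2 (v_ k)) (Lw f).
have bb f k : `|b f k| <= Num.sqrt (P * M ^+ 2 * It (fun x => w f x ^+ 2)).
  have W0 : 0 <= It (fun x => w f x ^+ 2) by exact: It_sqr_ge0.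
  apply: abs_le_sqr; first exact: sqrtr_ge0.
  rewrite sqr_sqrtr; last by rewrite !mulr_ge0 ?sqr_ge0// ltW.
  apply: (le_trans (L2CS mO (fn_L2 (v_ k)) (Lw f))); apply: ler_wpM2r => //.
  apply: (le_trans (hP _)); apply: ler_wpM2l; first exact: ltW.
  by rewrite ler_pXn2r ?nnegrE ?nrm_ge0.
have /choice[l hl] f : exists l : R, b f @ U --> l by exact: ultra_cvg ult (bb f).
pose m := #|I|%:R + 1 : R; have m0 : 0 < m by rewrite ltr_wpDl.
pose de := Num.sqrt (e / 2 / ((K + 1) * m)).
have K1 : 0 < K + 1 by rewrite ltr_wpDl.
have de2 : de ^+ 2 = e / 2 / ((K + 1) * m) by rewrite sqr_sqrtr//; apply/ltW; rewrite !divr_gt0// mulr_gt0.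
have de0 : 0 < de by rewrite sqrtr_gt0 !divr_gt0// mulr_gt0.
have hA : U [set k | forall f, `|l f - b f k| < de / 2].
  apply: filter_forall => f; have /cvgrPdist_lt/(_ (de / 2)) := hl f.
  by apply; rewrite divr_gt0.
exists [set k | forall f, `|l f - b f k| < de / 2] => // k j /= hk hj.
have hd f : (It (fun x => fn (v_ k - v_ j) x * w f x)) ^+ 2 <= de ^+ 2.
  have -> : It (fun x => fn (v_ k - v_ j) x * w f x) = b f k - b f j.
    by rewrite -(ItB mO (ib f k) (ib f j)); apply: eq_It => x _; rewrite fnB mulrBl.
  rewrite -[leLHS]real_normK ?num_real// ler_pXn2r ?nnegrE ?(ltW de0)//.
  have := hk f; have := hj f; have := ler_distD (l f) (b f k) (b f j).
  by rewrite (distrC (b f k) (l f)); lra.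
apply: (le_trans (hw _ _ (HspP (v_ k - v_ j)))).
have nqD : nq (gr (v_ k - v_ j)) <= D.
  have : a0 * nq (gr (v_ k - v_ j)) <= (2 * M) ^+ 2.
    apply: (le_trans (nq_form _)); rewrite -sqN ler_pXn2r ?nnegrE ?nrm_ge0//; last by rewrite mulr_ge0.
    apply: (le_trans (nrmB form_sym form_lin form_ge0 _ _)).
    by have := hM k; have := hM j; lra.
  by rewrite mulrC -ler_pdivlMr// => h; apply: (le_trans h); rewrite /D lerDl.
have sD : \sum_(f : I) (It (fun x => fn (v_ k - v_ j) x * w f x)) ^+ 2 <= #|I|%:R * de ^+ 2.
  apply: le_trans (ler_sum _ (fun f _ => hd f)) _.
  by rewrite sumr_const mulr_natl.
have t1 : e / 2 / D * nq (gr (v_ k - v_ j)) <= e / 2.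
  by rewrite mulrAC ler_pdivrMr// ler_wpM2l// divr_ge0// ltW.
have t2 : K * \sum_(f : I) (It (fun x => fn (v_ k - v_ j) x * w f x)) ^+ 2 <= e / 2.
  apply: (@le_trans _ _ ((K + 1) * (m * de ^+ 2))).
    apply: ler_pM => //; first by apply: sumr_ge0 => f _; exact: sqr_ge0.
      by rewrite lerDl.
    by apply: (le_trans sD); rewrite ler_wpM2r ?sqr_ge0// lerDl.
  by rewrite de2; apply: le_of_eq; field; rewrite !gt_eqF.
lra.
Qed.

(** Subtracting the equations at two indices bounds [N (v_k - v_l)^2] by the gradients plus a
    weighted quadratic form of [v_k - v_l]. By [wt_est] the latter is small once the L2 distance is
    small, which [ultra_cauchy] provides. *)
Lemma palais_smale (G : Hsp -> Hsp) (v_ : nat -> Hsp) (M : R) :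
  (forall v z, form (G v) z = form v z - It (fun x => psi x (fn v x) * fn z x)) ->
  (forall k, N (v_ k) <= M) -> (fun k => N (G (v_ k))) @ \oo --> 0 ->
  exists (s : nat -> nat) (v : Hsp), (fun j => N (v_ (s j) - v)) @ \oo --> 0 /\
    (fun j => N (G (v_ (s j)))) @ \oo --> 0.
Proof.
move=> hG hM cG; have M0 : 0 <= M := le_trans (nrm_ge0 _ _) (hM 0%N).
have [P P0 hP] := poincare_form.
have [U [ult sU hU]] := ultra_cauchy hM.
have PM0 : 0 <= P * M ^+ 2 by rewrite mulr_ge0 ?sqr_ge0// ltW.
have v2 k : It (fun x => fn (v_ k) x ^+ 2) <= P * M ^+ 2.
  by apply: (le_trans (hP _)); apply: ler_wpM2l; [exact: ltW|rewrite ler_pXn2r ?nnegrE ?nrm_ge0].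
have cau e : 0 < e -> exists2 A, U A & forall k l, A k -> A l -> N (v_ k - v_ l) <= e.
  move=> e0; pose E := e ^+ 2 / 2; have E0 : 0 < E by rewrite divr_gt0// exprn_gt0.
  pose Q := 2 * L * (1 + P * M ^+ 2) + 1.
  have Q0 : 0 <= 2 * L * (1 + P * M ^+ 2) by rewrite !mulr_ge0// addr_ge0.
  have Q1 : 0 < Q by rewrite ltr_wpDl.
  pose e1 := E / 2 / (Q * ((2 * M) ^+ 2 + 1)).
  have m20 : 0 <= (2 * M) ^+ 2 := sqr_ge0 _.
  have m21 : 0 < (2 * M) ^+ 2 + 1 by rewrite ltr_wpDl.
  have e10 : 0 < e1 by rewrite !divr_gt0// mulr_gt0.
  have [Ce Ce0 hCe] := wt_est e10.
  pose e2 := E / 2 / (Q * (Ce + 1)).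
  have Ce1 : 0 < Ce + 1 by rewrite ltr_wpDl.
  have e20 : 0 < e2 by rewrite !divr_gt0// mulr_gt0.
  have [A UA hA] := hU _ e20.
  have e30 : 0 < E / (4 * M + 1) by rewrite divr_gt0// ltr_wpDl// mulr_ge0.
  have UB : U [set k | N (G (v_ k)) < E / (4 * M + 1)].
    apply: sU; have /cvgrPdist_lt/(_ _ e30) := cG; apply: filterS => k.
    by rewrite sub0r normrN ger0_norm ?nrm_ge0.
  exists (A `&` [set k | N (G (v_ k)) < E / (4 * M + 1)]); first exact: filterI.
  move=> k l [Ak /= gk] [Al /= gl]; set z := v_ k - v_ l.
  have zM : N z <= 2 * M.
    apply: (le_trans (nrmB form_sym form_lin form_ge0 _ _)).
    by have := hM k; have := hM l; lra.
  have Nz := nrm_ge0 form z.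
  have i1 := ig_psi (v_ k) z; have i2 := ig_psi (v_ l) z.
  have eq : N z ^+ 2 = form (G (v_ k) - G (v_ l)) z + It (fun x => (psi x (fn (v_ k) x) - psi x (fn (v_ l) x)) * fn z x).
    have -> : It (fun x => (psi x (fn (v_ k) x) - psi x (fn (v_ l) x)) * fn z x) =
       It (fun x => psi x (fn (v_ k) x) * fn z x) - It (fun x => psi x (fn (v_ l) x) * fn z x).
      by rewrite -(ItB mO i1 i2); apply: eq_It => x _; rewrite mulrBl.
    rewrite (BBl form_lin) !hG sqN {1}/z (BBl form_lin); ring.
  have b1 : form (G (v_ k) - G (v_ l)) z <= E.
    apply: (le_trans (B_le form_sym form_lin form_ge0 _ _)).
    have h1 : N (G (v_ k) - G (v_ l)) <= 2 * (E / (4 * M + 1)).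
      by apply: (le_trans (nrmB form_sym form_lin form_ge0 _ _)); lra.
    apply: (@le_trans _ _ (2 * (E / (4 * M + 1)) * (2 * M))).
      by apply: ler_pM; rewrite ?nrm_ge0.
    have -> : 2 * (E / (4 * M + 1)) * (2 * M) = E * (4 * M) / (4 * M + 1) by ring.
    by rewrite ler_pdivrMr ?ltr_wpDl ?mulr_ge0// ler_wpM2l ?(ltW E0)// lerDl.
  have [j1 c1'] := hCe (fn (v_ k)) z (fn_L2 _); have [j2 c2] := hCe (fn (v_ l)) z (fn_L2 _).
  have z2 := hA _ _ Ak Al; rewrite -/z in z2.
  have one w : It (fun x => wt (fn w) x * fn z x ^+ 2) <=
      (1 + It (fun x => fn w x ^+ 2)) * (e1 * N z ^+ 2 + Ce * It (fun x => fn z x ^+ 2)) ->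
      It (fun x => fn w x ^+ 2) <= P * M ^+ 2 ->
      It (fun x => wt (fn w) x * fn z x ^+ 2) <= (1 + P * M ^+ 2) * (e1 * (2 * M) ^+ 2 + Ce * e2).
    move=> h1 h2; apply: (le_trans h1); apply: ler_pM.
    - by rewrite addr_ge0//; exact: It_sqr_ge0.
    - rewrite addr_ge0// mulr_ge0 ?sqr_ge0 ?(ltW e10)//; exact: It_sqr_ge0.
    - by rewrite lerD2l.
    - apply: lerD; first by rewrite ler_wpM2l ?(ltW e10)// ler_pXn2r ?nnegrE ?mulr_ge0.
      by rewrite ler_wpM2l.
  have d1 := one _ c1' (v2 k); have d2 := one _ c2 (v2 l).
  have b2 : It (fun x => (psi x (fn (v_ k) x) - psi x (fn (v_ l) x)) * fn z x) <=
      L * (It (fun x => wt (fn (v_ k)) x * fn z x ^+ 2) + It (fun x => wt (fn (v_ l)) x * fn z x ^+ 2)).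
    rewrite -(ItD mO j1 j2) -(ItZ mO _ (igD mO j1 j2)).
    apply: (It_le mO) => //; last 2 first.
    - exact: (igZ mO _ (igD mO j1 j2)).
    - apply: aeDW => x _; apply: (le_trans (ler_norm _)); rewrite normrM.
      apply: (le_trans (ler_wpM2r (normr_ge0 _) (psi_lip x _ _))).
      rewrite -fnB -/z -[leLHS]mulrA -expr2 real_normK ?num_real// /wt.
      by apply: le_of_eq; ring.
    - have := igB mO i1 i2; congr ig; apply/funext => x; by rewrite mulrBl.
  have b3 : L * (It (fun x => wt (fn (v_ k)) x * fn z x ^+ 2) + It (fun x => wt (fn (v_ l)) x * fn z x ^+ 2)) <=
      Q * (e1 * (2 * M) ^+ 2 + Ce * e2).
    apply: (@le_trans _ _ (2 * L * (1 + P * M ^+ 2) * (e1 * (2 * M) ^+ 2 + Ce * e2))).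
      have -> : 2 * L * (1 + P * M ^+ 2) * (e1 * (2 * M) ^+ 2 + Ce * e2) =
        L * ((1 + P * M ^+ 2) * (e1 * (2 * M) ^+ 2 + Ce * e2) + (1 + P * M ^+ 2) * (e1 * (2 * M) ^+ 2 + Ce * e2)) by ring.
      by apply: (ler_wpM2l L0); exact: (lerD d1 d2).
    apply: ler_wpM2r; last by rewrite /Q lerDl.
    by rewrite addr_ge0// mulr_ge0// ltW.
  have b4 : Q * (e1 * (2 * M) ^+ 2 + Ce * e2) <= E.
    have h1 : Q * (e1 * ((2 * M) ^+ 2 + 1)) = E / 2 by rewrite /e1; field; rewrite !gt_eqF.
    have h2 : Q * ((Ce + 1) * e2) = E / 2 by rewrite /e2; field; rewrite !gt_eqF.
    have h3 : 0 <= Q * e1 by apply/ltW/mulr_gt0.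
    have h4 : 0 <= Q * e2 by apply/ltW/mulr_gt0.
    have h5 : Q * (e1 * (2 * M) ^+ 2) <= E / 2.
      by rewrite -h1 ler_pM2l// ler_pM2l// lerDl.
    have h6 : Q * (Ce * e2) <= E / 2.
      by rewrite -h2 ler_pM2l// ler_pM2r// lerDl.
    by rewrite mulrDr [leRHS]splitr; exact: lerD.
  rewrite -(@ler_pXn2r _ 2) ?nnegrE ?(ltW e0)//.
  have -> : e ^+ 2 = E + E by rewrite /E -splitr.
  by rewrite eq; apply: lerD b1 (le_trans b2 (le_trans b3 b4)).
have /choice[A hA] : forall j : nat, exists A, U A /\ forall k l, A k -> A l -> N (v_ k - v_ l) <= 2 ^- j.
  move=> j; have [|A UA hA] := cau (2 ^- j); first by rewrite invr_gt0 exprn_gt0.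
  by exists A.
(* An index lying in the sets [A 0], ..., [A j] together gives a sequence that is Cauchy in the
   ordinary sense; taking it at least [j] preserves the convergence of the gradients. *)
have /choice[s hs] : forall j : nat, exists k, (forall i, (i <= j)%N -> A i k) /\ (j <= k)%N.
  move=> j; have UI : U [set k | (forall i, (i <= j)%N -> A i k) /\ (j <= k)%N].
    apply: filterI; last by apply: sU; exists j.
    have h : U [set k | forall i : 'I_j.+1, A i k] by apply: filter_forall => i; have [] := hA i.
    by apply: filterS h => k /= hk i ij; exact: (hk (Ordinal (ij : (i < j.+1)%N))).
  by have [k hk] := filter_ex UI; exists k.
have [v hv] : exists v, (fun j => N (v_ (s j) - v)) @ \oo --> 0.
  apply: form_complete => e e0; have [j hj] := pow2_small e0.
  exists j => k l jk jl; apply: le_trans (ltW hj).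
  have [_ h] := hA j; apply: h; first by have [h _] := hs k; exact: h.
  by have [h _] := hs l; exact: h.
exists s, v; split=> //.
apply/cvgrPdist_lt => e e0; have /cvgrPdist_lt/(_ e e0)[m _ hm] := cG.
by exists m => // j /= mj; apply: hm => /=; apply: (leq_trans mj); have [] := hs j.
Qed.

(** Restricting the weight to [A] brings in the factor [vol Om A ^ g], the gain that makes De Giorgi
    iteration superlinear. *)
Lemma wt_level v0 : L2 v0 -> exists2 S : R, 0 <= S & forall A eta, measurable A ->
  ig (fun x => wt v0 x * \1_A x * fn eta x ^+ 2) /\
  It (fun x => wt v0 x * \1_A x * fn eta x ^+ 2) <= S * vol Om A `^ g * N eta ^+ 2.
Proof.
move=> Lv; have [P P0 hP] := poincare_form.
have [Ce Ce0 h] := @morrey_ineq R n Om oOm bOm th 1 th0 nth2 ltr01.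
have A0 : 0 <= 1 + It (fun x => v0 x ^+ 2).
  by rewrite addr_ge0//; exact: It_sqr_ge0.
have K0 : 0 <= C * (1 + It (fun x => v0 x ^+ 2)) by rewrite mulr_ge0// ltW.
have K1 : 0 <= a0^-1 + Ce * P by rewrite addr_ge0 ?invr_ge0 ?(ltW a00)// mulr_ge0// ltW.
exists (C * (1 + It (fun x => v0 x ^+ 2)) * (a0^-1 + Ce * P)); first by rewrite mulr_ge0.
move=> A eta mA; have [|i1 i2] := h _ _ _ _ _ (cM Lv mA) (HspP eta).
  by rewrite mulr_ge0 ?powR_ge0.
split; first exact: i1.
apply: (le_trans i2); set K := C * _ in K0 *; set V := vol Om A `^ g.
have -> : K * (a0^-1 + Ce * P) * V * N eta ^+ 2 = K * V * ((a0^-1 + Ce * P) * N eta ^+ 2) by ring.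
apply: ler_wpM2l; first by rewrite mulr_ge0 ?powR_ge0.
rewrite mul1r mulrDl; apply: lerD.
  by rewrite mulrC ler_pdivlMr// mulrC sqN; exact: nq_form.
by rewrite -mulrA; apply: ler_wpM2l.
Qed.

Definition above (u : X -> R) (k : R) : set X := Om `&` [set x | k < u x].

Lemma measurable_above u k : measurable_fun Om u -> measurable (above u k).
Proof.
move=> mu_; have := mu_ mO `]k, +oo[%classic (measurable_itv _); congr measurable.
by apply/seteqP; split => x [Ox /=]; rewrite in_itv/= andbT => h; split.
Qed.

(** Superlevel sets are measured with the weight, which is at least 1: the mass dominates the
    volume, and the right side of the energy inequality is again a mass. *)
Definition mass v0 u k : R := It (fun x => wt v0 x * \1_(above u k) x).

Lemma mass_ge0 v0 u k : 0 <= mass v0 u k.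
Proof. by apply: Rintegral_ge0 => x _; rewrite mulr_ge0 ?wt_ge0// indicE. Qed.

Lemma vol_mass v0 u k : L2 v0 -> measurable_fun Om u -> vol Om (above u k) <= mass v0 u k.
Proof.
move=> Lv mu_; have mA := measurable_above k mu_; have [i1 <-] := It_ind oOm bOm mA.
apply: (It_le mO i1 (ig_ind oOm mA (ig_wt Lv))); apply: aeDW => x _.
by rewrite ler_peMl// ?wt_ge1// indicE.
Qed.

(** Chebyshev's inequality between the levels [kap + H (1 - 2^-j)] and the form bound give
    [m_(j+1) <= 4 S T 4^j m_j^(1 + g)], the height [H] cancelling. By [geometric_decay] the masses
    tend to 0 and the set above [kap + H] is null. The equation enters only through the energy
    bounds on the truncations. *)
Lemma level_iteration (u v0 : X -> R) (S T kap H : R) (w_ : nat -> Hsp) :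
  measurable_fun Om u -> L2 v0 -> 0 <= S -> 0 <= T -> 0 < H ->
  (forall A eta, measurable A ->
    ig (fun x => wt v0 x * \1_A x * fn eta x ^+ 2) /\
    It (fun x => wt v0 x * \1_A x * fn eta x ^+ 2) <= S * vol Om A `^ g * N eta ^+ 2) ->
  (forall j x, fn (w_ j) x = Num.max (u x - (kap + H * (1 - 2 ^- j))) 0) ->
  (forall j, N (w_ j) ^+ 2 <= T * H ^+ 2 * mass v0 u (kap + H * (1 - 2 ^- j))) ->
  4 * S * T * mass v0 u kap `^ g <= 4 `^ (- g^-1) ->
  aeD (fun x => u x <= kap + H).
Proof.
move=> mu_ Lv S0 T0 H0 hS hw hN small.
pose k j := kap + H * (1 - 2 ^- j); pose m j := mass v0 u (k j).
have p0 j : 0 < 2 ^- j :> R by rewrite invr_gt0 exprn_gt0.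
have kS j : k j.+1 - k j = H * 2 ^- j.+1.
  rewrite /k exprS invfM; move: (p0 j); move: (2 ^- j) => z z0; by field.
have mA j := measurable_above (k j) mu_.
have iA j := ig_ind oOm (mA j) (ig_wt Lv).
have kle j : k j <= k j.+1 by rewrite -subr_ge0 kS mulr_ge0 ?ltW.
have m0 j : 0 <= m j := mass_ge0 _ _ _.
have step j : m j.+1 <= 4 * S * T * 4 ^+ j * (m j `^ g * m j).
  have [i1 b1] := hS _ (w_ j) (mA j).
  have b2 : (H * 2 ^- j.+1) ^+ 2 * m j.+1 <= It (fun x => wt v0 x * \1_(above u (k j)) x * fn (w_ j) x ^+ 2).
    rewrite -(ItZ mO _ (iA j.+1)); apply: (It_le mO (igZ mO _ (iA j.+1)) i1); apply: aeDW => x Ox.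
    rewrite mulrCA -[leRHS]mulrA; apply: ler_wpM2l; first exact: wt_ge0.
    rewrite !indicE; have [xA|xA] := boolP (x \in above u (k j.+1)); last first.
      by rewrite mulr0 mulr_ge0 ?sqr_ge0.
    have [_ /= hx] := set_mem xA.
    have xj : x \in above u (k j) by apply/mem_set; split=> //=; exact: le_lt_trans hx.
    have t0 : 0 <= H * 2 ^- j.+1 by apply: mulr_ge0; exact: ltW.
    have t1 : H * 2 ^- j.+1 <= Num.max (u x - k j) 0 by rewrite le_max -kS lerD2r (ltW hx).
    by rewrite xj mulr1 mul1r hw -/(k j) ler_pXn2r// ?nnegrE// (le_trans t0).
  have b3 : S * vol Om (above u (k j)) `^ g * N (w_ j) ^+ 2 <= S * m j `^ g * (T * H ^+ 2 * m j).
    apply: ler_pM; [by rewrite mulr_ge0 ?powR_ge0|exact: sqr_ge0| |exact: hN].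
    apply: ler_wpM2l => //; apply: ge0_ler_powR; rewrite ?nnegrE ?vol_ge0 ?(ltW g0) ?m0//.
    exact: vol_mass.
  have b4 := le_trans b2 (le_trans b1 b3).
  have e1 : (H * 2 ^- j.+1) ^+ 2 = H ^+ 2 * (4 * 4 ^+ j)^-1.
    rewrite exprMn exprVn -exprM mulnC exprM -exprS; congr (_ * (_ ^+ _)^-1).
    by rewrite expr2; ring.
  have H2 : 0 < H ^+ 2 by rewrite exprn_gt0.
  have q0 : 0 < 4 * 4 ^+ j :> R by rewrite mulr_gt0// exprn_gt0.
  rewrite -(ler_pM2l H2).
  have -> : H ^+ 2 * (4 * S * T * 4 ^+ j * (m j `^ g * m j)) = (4 * 4 ^+ j) * (S * m j `^ g * (T * H ^+ 2 * m j)) by ring.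
  have -> : H ^+ 2 * m j.+1 = (4 * 4 ^+ j) * ((H * 2 ^- j.+1) ^+ 2 * m j.+1).
    by rewrite e1; move: q0; move: (4 * 4 ^+ j) => z z0; field; rewrite gt_eqF.
  by rewrite ler_pM2l.
have B0 : 0 <= 4 * S * T by rewrite !mulr_ge0.
have k0 : k 0%N = kap by rewrite /k expr0 invr1 subrr mulr0 addr0.
have cm : m @ \oo --> 0 by apply: (geometric_decay g0 B0 m0 step); rewrite /m k0.
have mI := measurable_above (kap + H) mu_.
have iI := ig_ind oOm mI (ig_wt Lv).
have le_m j : mass v0 u (kap + H) <= m j.
  apply: (It_le mO iI (iA j)); apply: aeDW => x Ox; apply: ler_wpM2l; first exact: wt_ge0.
  rewrite !indicE; have [xA|//] := boolP (x \in above u (kap + H)).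
  have [_ /= hx] := set_mem xA; rewrite mem_set//; split=> //=; apply: le_lt_trans hx.
  by rewrite /k lerD2l ler_piMr ?(ltW H0)// gerBl ltW.
have z0 : mass v0 u (kap + H) = 0.
  apply/eqP; rewrite eq_le mass_ge0 andbT; apply/ler_addgt0Pr => e e0.
  by have [j hj] := cvg_near cm e0; rewrite add0r (le_trans (le_m j))// ltW.
have pos : aeD (fun x => 0 <= wt v0 x * \1_(above u (kap + H)) x).
  by apply: aeDW => x _; rewrite mulr_ge0 ?wt_ge0// indicE.
have := It_eq0 mO iI pos z0; apply: aeD1 => x Ox /eqP.
rewrite mulf_eq0 gt_eqF/=; last exact: lt_le_trans ltr01 (wt_ge1 _ _).
rewrite indicE; have [//|xA _] := boolP (x \in above u (kap + H)).
  by rewrite oner_eq0.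
by rewrite leNgt; apply/negP => hx; move/negP : xA; apply; apply/mem_set.
Qed.

Lemma level_ex (v : Hsp) k : 0 <= k -> exists (w : Hsp) (chi : X -> R),
  [/\ forall x, fn w x = Num.max (fn v x - k) 0, forall x, gr w x = chi x *: gr v x,
      measurable_fun Om chi & forall x, 0 <= chi x <= 1].
Proof.
move=> k0; have [chi [mc c01 _ _ h]] := Hs_pos oOm bOm k0 (HspP v).
have [w [ew ed]] := Hsp_ex h; exists w, chi; split=> // x; [by rewrite ew|by rewrite ed].
Qed.

(** This is [chi^2 <= chi] under the integral. *)
Lemma level_test (v w : Hsp) (chi : X -> R) : (forall x, gr w x = chi x *: gr v x) ->
  (forall x, 0 <= chi x <= 1) -> N w ^+ 2 <= form v w.
Proof.
move=> hg hc; rewrite sqN; apply: (It_le mO (ig_form w w) (ig_form v w)); apply: aeDW => x _.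
apply: ler_wpM2l; first exact: ltW (a_gt0 x).
rewrite hg !dotE mulrA; apply: ler_wpM2r; first exact: dot_ge0.
by have /andP[h1 h2] := hc x; rewrite ler_piMr.
Qed.

Lemma mass_small v0 (v : Hsp) (e : R) : L2 v0 -> ig (fun x => wt v0 x * fn v x ^+ 2) -> 0 < e ->
  exists2 K : R, 1 <= K & mass v0 (fn v) K < e.
Proof.
move=> Lv i e0; pose Q := It (fun x => wt v0 x * fn v x ^+ 2).
have Q0 : 0 <= Q by apply: Rintegral_ge0 => x _; rewrite mulr_ge0 ?wt_ge0 ?sqr_ge0.
pose K := 1 + Q / e; have K1 : 1 <= K by rewrite lerDl divr_ge0// ltW.
have K0 : 0 < K := lt_le_trans ltr01 K1.
exists K => //; have mA := measurable_above K (fn_meas v).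
have iA := ig_ind oOm mA (ig_wt Lv).
have h : K ^+ 2 * mass v0 (fn v) K <= Q.
  rewrite -(ItZ mO _ iA); apply: (It_le mO (igZ mO _ iA) i); apply: aeDW => x Ox.
  rewrite mulrCA; apply: ler_wpM2l; first exact: wt_ge0.
  rewrite indicE; have [xA|_] := boolP (x \in _); last by rewrite mulr0 sqr_ge0.
  have [_ /= hx] := set_mem xA; rewrite mulr1 ler_pXn2r ?nnegrE ?(ltW K0) ?(ltW hx)//.
  by apply: ltW; exact: lt_trans hx.
rewrite -(ltr_pM2l (_ : 0 < K ^+ 2)) ?exprn_gt0//; apply: (le_lt_trans h).
have : Q < K * e by rewrite /K mulrDl mul1r divfK ?gt_eqF// ltrDr.
move=> /lt_le_trans; apply; apply: ler_wpM2r; first exact: ltW.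
by rewrite expr2 ler_peMl// ltW.
Qed.

(** The truncation [w = (v - k)+] is tested. For [k >= 1] the nonlinear term is at most [2 L] times
    the weight times [2 w^2 + k^2]; the set where [v > k] is small, so the quadratic part is
    absorbed by the form. What remains is the energy bound of [level_iteration], run from level [K]
    to [2 K]. *)
Lemma critical_bounded_above (v : Hsp) :
  (forall z, form v z = It (fun x => psi x (fn v x) * fn z x)) ->
  exists M : R, aeD (fun x => fn v x <= M).
Proof.
move=> hv; have Lv := fn_L2 v; have [S S0 hS] := wt_level Lv.
have mv := fn_meas v.
(* After absorbing half of [N w^2], the term [2 L k^2 mass] with [k <= 2 K] leaves [16 L K^2 mass].
   The threshold [e1] below secures the absorption, and [e2] the smallness that starts the
   iteration. *)
pose T := 16 * L.
have T0 : 0 <= T by rewrite mulr_ge0.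
pose e1 := (8 * L * S + 1)^-1 `^ (g^-1).
have D1 : 0 < 8 * L * S + 1 by rewrite ltr_wpDl// !mulr_ge0.
pose D2 := 4 * S * T + 1; have D20 : 0 < D2 by rewrite ltr_wpDl// !mulr_ge0.
pose e2 := (4 `^ (- g^-1) / D2) `^ (g^-1).
have r0 : 0 < 4 `^ (- g^-1) :> R by rewrite powR_gt0.
have e10 : 0 < e1 by rewrite powR_gt0// invr_gt0.
have e20 : 0 < e2 by rewrite powR_gt0// divr_gt0.
have e12 : 0 < Num.min e1 e2 by rewrite lt_min e10.
have [K K1 hK] := mass_small Lv (igw2 v v) e12.
have K0 : 0 < K := lt_le_trans ltr01 K1.
have pg (m e : R) : 0 <= m -> m <= e `^ (g^-1) -> 0 < e -> m `^ g <= e.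
  move=> m0 h e0; rewrite -[leRHS](powRr1 (ltW e0)) -(mulVf (lt0r_neq0 g0)) powRrM.
  by apply: ge0_ler_powR; rewrite ?nnegrE ?powR_ge0 ?(ltW g0).
have mono k : K <= k -> mass (fn v) (fn v) k <= mass (fn v) (fn v) K.
  move=> Kk; have i1 := ig_ind oOm (measurable_above k mv) (ig_wt Lv).
  have i2 := ig_ind oOm (measurable_above K mv) (ig_wt Lv).
  apply: (It_le mO i1 i2); apply: aeDW => x Ox; apply: ler_wpM2l; first exact: wt_ge0.
  rewrite !indicE; have [xA|//] := boolP (x \in above (fn v) k).
  by have [_ /= hx] := set_mem xA; rewrite mem_set//; split=> //=; exact: le_lt_trans hx.
have energy_est k w chi : K <= k -> k <= 2 * K -> (forall x, fn w x = Num.max (fn v x - k) 0) ->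
    (forall x, gr w x = chi x *: gr v x) -> (forall x, 0 <= chi x <= 1) ->
    N w ^+ 2 <= T * K ^+ 2 * mass (fn v) (fn v) k.
  move=> Kk k2 ew ed hc; have mA := measurable_above k mv.
  have [i1 b1] := hS _ w mA; have iA := ig_ind oOm mA (ig_wt Lv).
  have k0 : 0 <= k := le_trans (ltW K0) Kk.
  have t1 := level_test ed hc; rewrite hv in t1.
  have t2 : It (fun x => psi x (fn v x) * fn w x) <=
      2 * L * (2 * It (fun x => wt (fn v) x * \1_(above (fn v) k) x * fn w x ^+ 2) + k ^+ 2 * mass (fn v) (fn v) k).
    rewrite -(ItZ mO _ i1) -(ItZ mO _ iA) -(ItD mO (igZ mO _ i1) (igZ mO _ iA)) -(ItZ mO _ (igD mO (igZ mO _ i1) (igZ mO _ iA))).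
    apply: (It_le mO (ig_psi v w) (igZ mO _ (igD mO (igZ mO _ i1) (igZ mO _ iA)))); apply: aeDW => x Ox.
    rewrite indicE ew; have [xA|xA] := boolP (x \in above (fn v) k); last first.
      have hx : fn v x - k <= 0.
        by rewrite subr_le0 leNgt; apply/negP => h; move/negP : xA; apply; apply/mem_set.
      by rewrite (max_idPr hx) !mulr0 mul0r !mulr0 addr0 mulr0.
    have [_ /= hx] := set_mem xA.
    have hx0 : 0 <= fn v x - k by rewrite subr_ge0 ltW.
    rewrite (max_idPl hx0) !mulr1; set t := fn v x - k in hx0 *.
    apply: le_trans (ler_wpM2r hx0 (le_trans (ler_norm _) (psi_bound x (fn v x)))) _.
    rewrite -/(wt (fn v) x); have W0 := wt_ge0 (fn v) x; move: W0; move: (wt (fn v) x) => W W0.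
    have v0 : 0 <= fn v x by apply: le_trans (ltW hx).
    rewrite (ger0_norm v0).
    have e : fn v x = t + k by rewrite /t subrK.
    have h1 : (1 + fn v x) * t <= 2 * t ^+ 2 + k ^+ 2.
      have h2 : (1 + fn v x) * t <= (t + 2 * k) * t.
        by apply: ler_wpM2r => //; rewrite e; have := le_trans K1 Kk; lra.
      by apply: (le_trans h2); have := sqr_ge0 (t - k); nra.
    have h2 : 0 <= 2 * L * W by rewrite !mulr_ge0.
    by have := ler_wpM2l h2 h1; lra.
  have v1 : vol Om (above (fn v) k) `^ g <= (8 * L * S + 1)^-1.
    apply: pg; rewrite ?vol_ge0 ?invr_gt0//.
    apply: le_trans (vol_mass k Lv mv) (le_trans (mono k Kk) (le_trans (ltW hK) _)).
    by rewrite ge_min lexx.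
  have b2 : It (fun x => wt (fn v) x * \1_(above (fn v) k) x * fn w x ^+ 2) <= S * (8 * L * S + 1)^-1 * N w ^+ 2.
    by apply: (le_trans b1); apply: ler_wpM2r; [exact: sqr_ge0|apply: ler_wpM2l].
  have b3 : 4 * L * (S * (8 * L * S + 1)^-1) <= 2^-1.
    by rewrite mulrA ler_pdivrMr//; lra.
  have N2 := sqr_ge0 (N w).
  have b4 : 4 * L * It (fun x => wt (fn v) x * \1_(above (fn v) k) x * fn w x ^+ 2) <= 2^-1 * N w ^+ 2.
    apply: (@le_trans _ _ (4 * L * (S * (8 * L * S + 1)^-1) * N w ^+ 2)).
      by rewrite -[leRHS]mulrA; apply: ler_wpM2l => //; rewrite mulr_ge0.
    exact: ler_wpM2r.
  have ms := mass_ge0 (fn v) (fn v) k.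
  have b5 : k ^+ 2 * mass (fn v) (fn v) k <= 4 * K ^+ 2 * mass (fn v) (fn v) k.
    apply: ler_wpM2r => //; have -> : 4 * K ^+ 2 = (2 * K) ^+ 2 by ring.
    by rewrite ler_pXn2r ?nnegrE// mulr_ge0// ltW.
  have b6 := ler_wpM2l L0 b5.
  rewrite /T; move: t1 t2 b4 b6; move: (N w ^+ 2) (mass _ _ _) (It _) (It _) (K ^+ 2) (k ^+ 2) => z1 z2 z3 z4 z5 z6.
  by move=> t1 t2 b4 b6; lra.
have /choice[w_ hw_] : forall j : nat, exists w : Hsp, exists chi : X -> R,
    [/\ forall x, fn w x = Num.max (fn v x - (K + K * (1 - 2 ^- j))) 0, forall x, gr w x = chi x *: gr v x,
      measurable_fun Om chi & forall x, 0 <= chi x <= 1].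
  move=> j; apply: level_ex; rewrite addr_ge0 ?(ltW K0)// mulr_ge0 ?(ltW K0)// subr_ge0.
  by rewrite invf_le1 ?exprn_gt0// exprn_ege1// ler1n.
exists (K + K); apply: (@level_iteration (fn v) (fn v) S T K K w_ mv Lv S0 T0 K0 hS).
- by move=> j x; have [chi [h _ _ _]] := hw_ j; rewrite h.
- move=> j; have [chi [h1 h2 _ h3]] := hw_ j.
  have p0 : 0 < 2 ^- j :> R by rewrite invr_gt0 exprn_gt0.
  have p1 : 2 ^- j <= 1 :> R by rewrite invf_le1 ?exprn_gt0// exprn_ege1// ler1n.
  apply: (energy_est _ _ chi _ _ h1 h2 h3).
    by rewrite lerDl mulr_ge0 ?(ltW K0)// subr_ge0.
  by rewrite mulrDl mul1r lerD2l ler_piMr ?(ltW K0)// gerBl ltW.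
- apply: (@le_trans _ _ (D2 * (4 `^ (- g^-1) / D2))); last by rewrite mulrC divfK// gt_eqF.
  apply: ler_pM; rewrite ?powR_ge0//; first by rewrite !mulr_ge0.
    by rewrite /D2 lerDl.
  apply: pg; rewrite ?mass_ge0 ?divr_gt0//.
  by apply: (le_trans (ltW hK)); rewrite ge_min lexx orbT.
Qed.

(** The weight follows the sequence and the limit is taken in L2 only. Since [wt_est] is uniform in
    the weight, it bounds the distance to all later terms, and Fatou's lemma passes to the limit in
    the later index. *)
Lemma weighted_limit (w_ : nat -> Hsp) (M : R) : (forall k, N (w_ k) <= M) ->
  exists (s : nat -> nat) (w : X -> R), [/\ forall j, (j <= s j)%N, L2 w &
    forall e, 0 < e -> exists m, forall j, (m <= j)%N ->
      ig (fun x => wt (fn (w_ (s j))) x * (fn (w_ (s j)) x - w x) ^+ 2) /\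
      It (fun x => wt (fn (w_ (s j))) x * (fn (w_ (s j)) x - w x) ^+ 2) <= e].
Proof.
move=> hM; have M0 : 0 <= M := le_trans (nrm_ge0 _ _) (hM 0%N).
have [P P0 hP] := poincare_form.
have [U [ult sU hU]] := ultra_cauchy hM.
have PM0 : 0 <= P * M ^+ 2 by rewrite mulr_ge0 ?sqr_ge0// ltW.
have v2 k : It (fun x => fn (w_ k) x ^+ 2) <= P * M ^+ 2.
  by apply: (le_trans (hP _)); apply: ler_wpM2l; [exact: ltW|rewrite ler_pXn2r ?nnegrE ?nrm_ge0].
have /choice[A hA] : forall j : nat, exists A, U A /\ forall k l, A k -> A l ->
    It (fun x => fn (w_ k - w_ l) x ^+ 2) <= 2 ^- j.
  move=> j; have [|A UA hA] := hU (2 ^- j); first by rewrite invr_gt0 exprn_gt0.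
  by exists A.
have /choice[s hs] : forall j : nat, exists k, (forall i, (i <= j)%N -> A i k) /\ (j <= k)%N.
  move=> j; have UI : U [set k | (forall i, (i <= j)%N -> A i k) /\ (j <= k)%N].
    apply: filterI; last by apply: sU; exists j.
    have h : U [set k | forall i : 'I_j.+1, A i k] by apply: filter_forall => i; have [] := hA i.
    by apply: filterS h => k /= hk i ij; exact: (hk (Ordinal (ij : (i < j.+1)%N))).
  by have [k hk] := filter_ex UI; exists k.
have cau j k l : (j <= k)%N -> (j <= l)%N -> It (fun x => fn (w_ (s k) - w_ (s l)) x ^+ 2) <= 2 ^- j.
  move=> jk jl; have [_ h] := hA j; apply: h; first by have [h _] := hs k; exact: h.
  by have [h _] := hs l; exact: h.
have [w Lw cw] : exists2 w, L2 w & (fun k => It (fun x => (fn (w_ (s k)) x - w x) ^+ 2)) @ \oo --> 0.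
  apply: (L2_complete mO) => [k|e /pow2_small[j hj]]; first exact: fn_L2.
  exists j => k l jk jl; apply: le_trans (ltW hj); apply: le_trans (cau j k l jk jl).
  by apply/le_of_eq/eq_It => x _; rewrite fnB.
(* A further subsequence, converging almost everywhere as Fatou's lemma requires. *)
have /choice[q hq] : forall j : nat, exists k, (j <= k)%N /\ It (fun x => (fn (w_ (s k)) x - w x) ^+ 2) <= 2 ^- j.
  move=> j; have e0 : 0 < 2 ^- j :> R by rewrite invr_gt0 exprn_gt0.
  have /cvgrPdist_lt/(_ _ e0)[k _ hk] := cw; exists (maxn j k); split; first exact: leq_maxl.
  have := hk (maxn j k) (leq_maxr j k); rewrite sub0r normrN => h.
  by apply: ltW; apply: le_lt_trans h; exact: ler_norm.
have aew : aeD (fun x => (fun k => fn (w_ (s (q k))) x) @ \oo --> w x).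
  by apply: (L2_fast_ae mO) => // k; [exact: fn_L2|have [] := hq k].
exists s, w; split=> [j| //|e e0]; first by have [] := hs j.
pose Q := 1 + P * M ^+ 2; have Q1 : 0 < Q by rewrite ltr_pwDl.
pose e1 := e / 2 / (Q * ((2 * M) ^+ 2 + 1)).
have m20 : 0 <= (2 * M) ^+ 2 := sqr_ge0 _.
have m21 : 0 < (2 * M) ^+ 2 + 1 by rewrite ltr_wpDl.
have e10 : 0 < e1 by rewrite !divr_gt0// mulr_gt0.
have [Ce Ce0 hCe] := wt_est e10.
have Ce1 : 0 < Ce + 1 by rewrite ltr_wpDl.
have e20 : 0 < e / 2 / (Q * (Ce + 1)) by rewrite !divr_gt0// mulr_gt0.
have [m hm] := pow2_small e20.
exists m => j mj.
have est k : (m <= k)%N -> ig (fun x => wt (fn (w_ (s j))) x * (fn (w_ (s j)) x - fn (w_ (s k)) x) ^+ 2) /\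
    It (fun x => wt (fn (w_ (s j))) x * (fn (w_ (s j)) x - fn (w_ (s k)) x) ^+ 2) <= e.
  move=> mk; have [i b] := hCe (fn (w_ (s j))) (w_ (s j) - w_ (s k)) (fn_L2 _).
  have eqf : (fun x => wt (fn (w_ (s j))) x * (fn (w_ (s j)) x - fn (w_ (s k)) x) ^+ 2) =
      (fun x => wt (fn (w_ (s j))) x * fn (w_ (s j) - w_ (s k)) x ^+ 2).
    by apply/funext => x; rewrite fnB.
  rewrite eqf; split=> //; apply: (le_trans b).
  have b2 := cau m j k mj mk.
  have zM : N (w_ (s j) - w_ (s k)) <= 2 * M.
    apply: (le_trans (nrmB form_sym form_lin form_ge0 _ _)).
    by have := hM (s j); have := hM (s k); lra.
  apply: (@le_trans _ _ (Q * (e1 * (2 * M) ^+ 2 + Ce * (e / 2 / (Q * (Ce + 1)))))).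
    apply: ler_pM.
    - by rewrite addr_ge0//; exact: It_sqr_ge0.
    - rewrite addr_ge0// mulr_ge0 ?sqr_ge0 ?(ltW e10)//; exact: It_sqr_ge0.
    - by rewrite /Q lerD2l.
    - apply: lerD; first by rewrite ler_wpM2l ?(ltW e10)// ler_pXn2r ?nnegrE ?mulr_ge0 ?nrm_ge0.
      by rewrite ler_wpM2l// (le_trans b2)// ltW.
  have h1 : Q * (e1 * ((2 * M) ^+ 2 + 1)) = e / 2 by rewrite /e1; field; rewrite !gt_eqF.
  have h2 : Q * ((Ce + 1) * (e / 2 / (Q * (Ce + 1)))) = e / 2 by field; rewrite !gt_eqF.
  have h5 : Q * (e1 * (2 * M) ^+ 2) <= e / 2 by rewrite -h1 ler_pM2l// ler_pM2l// lerDl.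
  have h6 : Q * (Ce * (e / 2 / (Q * (Ce + 1)))) <= e / 2.
    by rewrite -[leRHS]h2 ler_pM2l// ler_pM2r// lerDl.
  by rewrite mulrDr [leRHS]splitr; exact: lerD.
apply: (@It_fatou _ _ _ leb Om mO (fun k x => wt (fn (w_ (s j))) x * (fn (w_ (s j)) x - fn (w_ (s (q (maxn m k)))) x) ^+ 2)).
- by move=> k; have [qk _] := hq (maxn m k); have [] := est _ (leq_trans (leq_maxl m k) qk).
- by move=> k; apply: aeDW => x _; rewrite mulr_ge0 ?wt_ge0 ?sqr_ge0.
- apply: measurable_funM; first exact: ig_meas (igw _).
  by apply: measurable_funX; apply: measurable_funB; [exact: fn_meas|exact: L2_meas Lw].
- apply: aeD1 aew => x _ h; apply: cvgMr; apply: cvg_expn; apply: cvgB; first exact: cvg_cst.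
  apply/cvgrPdist_lt => d0 d00; have /cvgrPdist_lt/(_ _ d00)[k _ hk] := h.
  by exists k => // l /= kl; apply: hk => /=; exact: leq_trans (leq_maxr m l).
- by apply: nearW => k; have [qk _] := hq (maxn m k); have [] := est _ (leq_trans (leq_maxl m k) qk).
Qed.

End Hspace.

(** * Truncated logarithmic nonlinearities *)

Section truncated_logarithm.
Context {R : realType}.
Implicit Types s t x y d : R.

Lemma ln_le1 x : 0 < x -> ln x <= x - 1.
Proof. by move=> x0; have := expR_ge1Dx (ln x); rewrite lnK// lerBrDl. Qed.

Lemma xln_ge x : 0 < x -> x - 1 <= x * ln x.
Proof.
move=> x0; have := ln_le1 (_ : 0 < x^-1); rewrite invr_gt0 => /(_ x0).
rewrite lnV// => h; have := ler_wpM2l (ltW x0) h.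
by rewrite mulrBr mulfV ?gt_eqF// mulr1 mulrN; lra.
Qed.

(** This is [ln y <= y - 1] at [y = x^d]. *)
Lemma ln_powR_le d x : 0 < d -> 1 <= x -> ln x <= d^-1 * x `^ d.
Proof.
move=> d0 x1; have x0 : 0 < x := lt_le_trans ltr01 x1.
have := ln_le1 (powR_gt0 d x0); rewrite ln_powR => h.
by rewrite mulrC ler_pdivlMr// mulrC (le_trans h)// gerBl.
Qed.

(* Cutting [1 + s] off at the minimum point [expR (-1)] of [y ln y] makes [Gf]
   nondecreasing on the whole line; [Ff] and [Kf] are the primitives of [Gf] and
   [ybar] vanishing at [0]. *)
Definition ybar s : R := Num.max (1 + s) (expR (-1)).
Definition Gf s : R := ybar s * ln (ybar s).
Definition Phi1 y : R := 2^-1 * y ^+ 2 * ln y - 4^-1 * y ^+ 2 + 4^-1.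
(** The second term is 0 above the cut; below it, it continues the primitive affinely, with the
    constant value of [Gf] as slope. [Kf] has the same structure. *)
Definition Ff s : R := Phi1 (ybar s) + Gf s * (1 + s - ybar s).
Definition Kf s : R := 2^-1 * ybar s ^+ 2 - 2^-1 + ybar s * (1 + s - ybar s).

Let ep : R := expR (-1).
Let ep0 : 0 < ep. Proof. exact: expR_gt0. Qed.
Let ep1 : ep <= 1. Proof. by rewrite expR_le1; lra. Qed.

Lemma ybar_ge s : ep <= ybar s. Proof. by rewrite le_max lexx orbT. Qed.
Lemma ybar_gt0 s : 0 < ybar s. Proof. exact: lt_le_trans ep0 (ybar_ge s). Qed.
Lemma ybar_ge1 s : 1 + s <= ybar s. Proof. by rewrite le_max lexx. Qed.
Lemma ybar_id s : ep <= 1 + s -> ybar s = 1 + s. Proof. by move=> h; apply/max_idPl. Qed.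
Lemma ybar_pos s : 0 <= s -> ybar s = 1 + s.
Proof. by move=> h; apply: ybar_id; rewrite (le_trans ep1)// lerDl. Qed.
Lemma ybar_le s : ybar s <= 1 + `|s|.
Proof. by rewrite ge_max lerD2l ler_norm (le_trans ep1)// lerDl. Qed.
Lemma ybar_mono s t : s <= t -> ybar s <= ybar t.
Proof. by move=> h; rewrite ge_max !le_max lerD2l h lexx orbT. Qed.
Lemma ybar_lip s t : `|ybar s - ybar t| <= `|s - t|.
Proof.
have main a b : a <= b -> `|ybar b - ybar a| <= `|b - a|.
  move=> ab; rewrite !ger0_norm ?subr_ge0 ?ybar_mono//.
  rewrite lerBlDr {1}/ybar ge_max; apply/andP; split.
    by have := ybar_ge1 a; lra.
  by have := ybar_ge a; rewrite -/ep; lra.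
have [st|ts] := leP s t; last exact/main/ltW.
by rewrite distrC (distrC s); exact: main.
Qed.
Lemma ln_ybar_ge s : -1 <= ln (ybar s).
Proof.
rewrite -[leLHS](@expRK R); rewrite ler_ln ?posrE ?expR_gt0 ?ybar_gt0//.
exact: ybar_ge.
Qed.
Lemma ln_ybar_le d s : 0 < d -> ln (ybar s) <= d^-1 * (1 + `|s|) `^ d.
Proof.
move=> d0; apply: le_trans (ln_powR_le d0 _); last by rewrite lerDl.
by rewrite ler_ln ?posrE ?ybar_gt0 ?ybar_le// ltr_pwDl.
Qed.

(** For the truncated values [x <= y] one has [x (ln y - ln x) <= y - x <= y (ln y - ln x)], and
    [1 + ln x >= 0] thanks to the cut. *)
Lemma Gf_diff s t : s <= t ->
  0 <= Gf t - Gf s <= (1 + ln (ybar t)) * (ybar t - ybar s).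
Proof.
move=> st; have xy := ybar_mono st; have x0 := ybar_gt0 s; have y0 := ybar_gt0 t.
have h1 := ln_ybar_ge s; rewrite /Gf; move: xy x0 y0 h1; move: (ybar s) (ybar t) => x y xy x0 y0 h1.
have e : ln (y / x) = ln y - ln x by rewrite ln_div.
have q0 : 0 < y / x by rewrite divr_gt0.
have a1 := ln_le1 q0; have a2 := xln_ge q0; rewrite e in a1 a2.
have b1 : x * (ln y - ln x) <= y - x.
  have := ler_wpM2l (ltW x0) a1; have -> : x * (y / x - 1) = y - x by field; rewrite gt_eqF.
  by [].
have b2 : y - x <= y * (ln y - ln x).
  have := ler_wpM2l (ltW x0) a2.
  have -> : x * (y / x - 1) = y - x by field; rewrite gt_eqF.
  by have -> : x * (y / x * (ln y - ln x)) = y * (ln y - ln x) by field; rewrite gt_eqF.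
have h2 : 0 <= (y - x) * (1 + ln x) by apply: mulr_ge0; lra.
by apply/andP; split; lra.
Qed.

Lemma Gf_mono s t : s <= t -> Gf s <= Gf t.
Proof. by move=> /Gf_diff/andP[h _]; rewrite -subr_ge0. Qed.

Lemma pow_ge1 d s : 0 <= d -> 1 <= (1 + `|s|) `^ d.
Proof. by move=> d0; rewrite -[leLHS](powRr0 (1 + `|s|)); apply: ler_powR; rewrite ?lerDl. Qed.

Lemma Gf_lip d s t : 0 < d ->
  `|Gf s - Gf t| <= (1 + d^-1) * ((1 + `|s|) `^ d + (1 + `|t|) `^ d) * `|s - t|.
Proof.
move=> d0; have dV : 0 < d^-1 by rewrite invr_gt0.
have main a b : a <= b -> `|Gf b - Gf a| <= (1 + d^-1) * ((1 + `|a|) `^ d + (1 + `|b|) `^ d) * `|b - a|.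
  move=> ab; have /andP[h1 h2] := Gf_diff ab.
  rewrite ger0_norm//; apply: (le_trans h2).
  have p1 := pow_ge1 a (ltW d0); have p2 := pow_ge1 b (ltW d0).
  have l1 := ln_ybar_le b d0; have l2 := ln_ybar_ge b.
  have y1 := ybar_lip b a; rewrite (ger0_norm (_ : 0 <= ybar b - ybar a)) ?subr_ge0 ?ybar_mono// in y1.
  apply: ler_pM => //; first by lra.
    by rewrite subr_ge0 ybar_mono.
  have := mulr_ge0 (ltW dV) (le_trans ler01 p1); lra.
have [st|ts] := leP s t; last by rewrite [_ `^ d + _]addrC; exact/main/ltW.
by rewrite distrC (distrC s); exact: main.
Qed.

Lemma is_derive_Phi1 y : 0 < y -> is_derive y (1:R) Phi1 (y * ln y).
Proof.
move=> y0; have dl := is_derive1_ln y0.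
have d3 : is_derive y (1:R) (fun z : R => 2^-1 * z ^+ 2 * ln z - 4^-1 * z ^+ 2 + 4^-1) (y * ln y).
  apply: is_derive_eq; rewrite /GRing.scale/=; field; by rewrite gt_eqF.
exact: d3.
Qed.

(** Convexity of [Phi1] on the half-line from [1/e], where its derivative [y ln y] is
    nondecreasing. *)
Lemma Phi1_sub s t : 0 <= Phi1 (ybar t) - Phi1 (ybar s) - Gf s * (ybar t - ybar s).
Proof.
have gm a b : ep <= a -> a <= b -> a * ln a <= b * ln b.
  move=> ea ab; have y1 : ybar (a - 1) = a by rewrite ybar_id; rewrite addrC subrK.
  have y2 : ybar (b - 1) = b by rewrite ybar_id; rewrite addrC subrK// (le_trans ea).
  by have := @Gf_mono (a - 1) (b - 1); rewrite /Gf y1 y2 lerD2r; exact.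
have mvt a b : ep <= a -> a <= b -> exists2 z, a <= z <= b & Phi1 b - Phi1 a = z * ln z * (b - a).
  move=> ea ab.
  have dz z : a <= z -> is_derive z (1:R) Phi1 (z * ln z).
    by move=> az; apply: is_derive_Phi1; exact: lt_le_trans ep0 (le_trans ea az).
  have wc : {within `[a, b], continuous Phi1}.
    apply: derivable_within_continuous => z; rewrite in_itv/= => /andP[az _].
    by have [] := dz z az.
  have d1 z : z \in `]a, b[%R -> is_derive z (1:R) Phi1 (z * ln z).
    by rewrite in_itv/= => /andP[/ltW az _]; exact: dz.
  have [z zab ->] := MVT_segment ab d1 wc.
  by exists z => //; move: zab; rewrite in_itv.
have x1 := ybar_ge s; have y1 := ybar_ge t; rewrite /Gf; move: x1 y1.
move: (ybar s) (ybar t) => x y x1 y1; have [xy|yx] := leP x y.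
  have [z /andP[z1 z2] ->] := mvt x y x1 xy.
  by rewrite -mulrBl mulr_ge0 ?subr_ge0// gm.
have [z /andP[z1 z2] e] := mvt y x y1 (ltW yx).
have -> : Phi1 y - Phi1 x - x * ln x * (y - x) = (x * ln x - z * ln z) * (x - y) by lra.
by rewrite mulr_ge0 ?subr_ge0 ?(ltW yx)// gm// (le_trans y1).
Qed.

Lemma Ff_sub s t : 0 <= Ff t - Ff s - Gf s * (t - s).
Proof.
have h := Phi1_sub s t.
have h2 : 0 <= (Gf t - Gf s) * (1 + t - ybar t).
  have [y1|y1] := leP ep (1 + t); first by rewrite (ybar_id y1) subrr mulr0.
  have yt : ybar t = ep by apply/max_idPr/ltW.
  have : Gf t <= Gf s.
    have := ybar_ge s; have l1 := ln_ybar_ge s; rewrite /Gf yt => es.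
    have := @Gf_mono (ep - 1) (ybar s - 1); rewrite lerD2r => /(_ es).
    have y1' : ybar (ep - 1) = ep by rewrite ybar_id; rewrite addrC subrK.
    have y2 : ybar (ybar s - 1) = ybar s by rewrite ybar_id; rewrite addrC subrK.
    by rewrite /Gf y1' y2.
  move=> g1; rewrite yt mulrC nmulr_rge0; last by rewrite subr_lt0.
  by rewrite subr_le0.
by rewrite /Ff; lra.
Qed.

Lemma Kf_sub s t : 0 <= Kf t - Kf s - ybar s * (t - s).
Proof.
have h2 : 0 <= (ybar t - ybar s) * (1 + t - ybar t).
  have [y1|y1] := leP ep (1 + t); first by rewrite (ybar_id y1) subrr mulr0.
  have yt : ybar t = ep by apply/max_idPr/ltW.
  rewrite yt mulrC nmulr_rge0; last by rewrite subr_lt0.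
  by rewrite subr_le0; exact: ybar_ge.
have := sqr_ge0 (ybar t - ybar s); rewrite /Kf; move: h2; move: (ybar t) (ybar s) => y x; lra.
Qed.

(** The remainders based at [s] and at [t] are both nonnegative by convexity, and their sum is
    [(Gf t - Gf s) (t - s)]. *)
Lemma Ff_tay s t : `|Ff t - Ff s - Gf s * (t - s)| <= `|Gf t - Gf s| * `|t - s|.
Proof.
have h1 := Ff_sub s t; have h2 := Ff_sub t s.
rewrite (ger0_norm h1) -normrM; apply: le_trans (ler_norm _); lra.
Qed.

Lemma Kf_tay s t : `|Kf t - Kf s - ybar s * (t - s)| <= (t - s) ^+ 2.
Proof.
have h1 := Kf_sub s t; have h2 := Kf_sub t s.
rewrite (ger0_norm h1) -[leRHS]real_normK ?num_real// expr2.
apply: (@le_trans _ _ (`|ybar t - ybar s| * `|t - s|)).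
  by rewrite -normrM; apply: le_trans (ler_norm _); lra.
by rewrite ler_wpM2r// ybar_lip.
Qed.

Lemma ybar0 : ybar 0 = 1. Proof. by rewrite ybar_pos// addr0. Qed.
Lemma Gf0 : Gf 0 = 0. Proof. by rewrite /Gf ybar0 ln1 mulr0. Qed.
Lemma Ff0 : Ff 0 = 0. Proof. by rewrite /Ff Gf0 mul0r addr0 /Phi1 ybar0 ln1; ring. Qed.
Lemma Kf0 : Kf 0 = 0. Proof. by rewrite /Kf ybar0; ring. Qed.
Lemma Ff_ge0 s : 0 <= Ff s.
Proof. by have := Ff_sub 0 s; rewrite Ff0 Gf0 mul0r !subr0. Qed.

Lemma ybar_neg s : s <= 0 -> ybar s <= 1.
Proof. by move=> s0; rewrite ge_max ep1 andbT; lra. Qed.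

Lemma Gf_neg s : s <= 0 -> -1 <= Gf s <= 0.
Proof.
move=> s0; have := Gf_mono s0; rewrite Gf0 => h; rewrite h andbT.
have := ln_ybar_ge s; have := ybar_neg s0; have := ybar_gt0 s; rewrite /Gf.
move: (ybar s) (ln _) => y l y0 y1 l1; nra.
Qed.

Lemma Ff_neg s : s <= 0 -> Ff s <= `|s|.
Proof.
move=> s0; have := Ff_sub s 0; rewrite Ff0 !sub0r ler0_norm// => h.
by have /andP[g1 g2] := Gf_neg s0; nra.
Qed.

Lemma Kf_neg s : s <= 0 -> `|Kf s| <= `|s|.
Proof.
move=> s0; have h1 := Kf_sub s 0; have h2 := Kf_sub 0 s; move: h1 h2.
rewrite Kf0 ybar0 (ler0_norm s0) ler_norml => h1 h2.
have y0 := ybar_gt0 s; have y1 := ybar_neg s0; move: h1 h2 y0 y1; move: (ybar s) (Kf s) => y k h1 h2 y0 y1.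
by apply/andP; split; nra.
Qed.

Lemma Ff_pos s : 0 <= s -> Ff s = Phi1 (1 + s).
Proof. by move=> s0; rewrite /Ff (ybar_pos s0) subrr mulr0 addr0. Qed.
Lemma Kf_pos s : 0 <= s -> Kf s = s + 2^-1 * s ^+ 2.
Proof. by move=> s0; rewrite /Kf (ybar_pos s0) subrr mulr0; field. Qed.
Lemma Gf_pos s : 0 <= s -> Gf s = (1 + s) * ln (1 + s).
Proof. by move=> s0; rewrite /Gf (ybar_pos s0). Qed.

Definition pos s : R := Num.max s 0.
Lemma pos_id s : 0 <= s -> pos s = s. Proof. by move=> h; apply/max_idPl. Qed.
Lemma pos_0 s : s <= 0 -> pos s = 0. Proof. by move=> h; apply/max_idPr. Qed.
Lemma pos_ge0 s : 0 <= pos s. Proof. by rewrite le_max lexx orbT. Qed.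
Lemma pos_le s : pos s <= `|s|. Proof. by rewrite ge_max ler_norm normr_ge0. Qed.

(** * Growth and asymptotics of the truncated logarithm *)

Section growth.
Variable d : R.
Hypothesis d0 : 0 < d.
Let dV : 0 < d^-1. Proof. by rewrite invr_gt0. Qed.
Local Notation p s := ((1 + `|s|) `^ d).
Local Notation D := (1 + d^-1).

(** For [s >= 0] the terms [s^2 ln (1 + s)] cancel and the difference inside is exactly
    [s - (1 + s) ln (1 + s)]. This does the work of a superlinearity condition in bounding Cerami
    sequences. *)
Lemma energy_gap s : `|Gf s * s - 2 * Ff s - 2^-1 * pos s ^+ 2| <= 4 * D * p s * (1 + `|s|).
Proof.
have p1 := pow_ge1 s (ltW d0); have s1 := normr_ge0 s.
have q1 : 1 <= D * p s by have := mulr_ge0 (ltW dV) (le_trans ler01 p1); lra.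
have [s0|s0] := leP 0 s.
  rewrite (Gf_pos s0) (Ff_pos s0) (pos_id s0) /Phi1.
  have l1 : ln (1 + s) <= d^-1 * p s by have := ln_ybar_le s d0; rewrite (ybar_pos s0).
  have l0 : 0 <= ln (1 + s) by rewrite ln_ge0// lerDl.
  have -> : (1 + s) * ln (1 + s) * s - 2 * (2^-1 * (1 + s) ^+ 2 * ln (1 + s) - 4^-1 * (1 + s) ^+ 2 + 4^-1) - 2^-1 * s ^+ 2 =
     s - (1 + s) * ln (1 + s) by field.
  have h1 : (1 + s) * ln (1 + s) <= (1 + s) * (D * p s).
    by rewrite ler_wpM2l ?addr_ge0//; have := le_trans ler01 p1; lra.
  have h2 : 0 <= (1 + s) * ln (1 + s) by rewrite mulr_ge0 ?addr_ge0.
  have h3 : (1 + s) <= (1 + s) * (D * p s) by rewrite ler_peMr ?addr_ge0.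
  have -> : 4 * D * p s * (1 + `|s|) = 4 * ((1 + s) * (D * p s)) by rewrite (ger0_norm s0); ring.
  move: h1 h2 h3; move: ((1 + s) * ln (1 + s)) ((1 + s) * (D * p s)) => m1 m2 h1 h2 h3.
  by rewrite ler_norml; apply/andP; split; lra.
have sl := ltW s0; rewrite (pos_0 sl) expr0n mulr0 subr0.
have /andP[g1 g2] := Gf_neg sl; have f1 := Ff_neg sl; have f0 := Ff_ge0 s.
have h : `|Gf s * s - 2 * Ff s| <= 3 * (1 + `|s|).
  move: f1 s1; rewrite ler_norml (ltr0_norm s0) => f1 s1.
  by apply/andP; split; nra.
apply: (le_trans h); have : (1 + `|s|) <= D * p s * (1 + `|s|) by rewrite ler_peMl ?addr_ge0.
have -> : 4 * D * p s * (1 + `|s|) = 4 * (D * p s * (1 + `|s|)) by ring.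
by move: (D * p s * (1 + `|s|)) => q; lra.
Qed.

Lemma Kf_gap s : `|ybar s * s - 2 * Kf s| <= 3 * (1 + `|s|).
Proof.
have [s0|s0] := leP 0 s.
  rewrite (ybar_pos s0) (Kf_pos s0) (ger0_norm s0).
  have -> : (1 + s) * s - 2 * (s + 2^-1 * s ^+ 2) = - s by field.
  by rewrite normrN ger0_norm//; lra.
have sl := ltW s0; have k1 := Kf_neg sl; have y1 := ybar_neg sl; have y0 := ybar_gt0 s.
move: k1; rewrite (ltr0_norm s0) !ler_norml => /andP[k1 k2].
by apply/andP; split; nra.
Qed.

Section large.
Variable t : R.
Hypothesis t1 : 1 <= ln t.
Let tp : 0 < t.
Proof. by rewrite ltNge; apply/negP => /ln0 h; move: t1; rewrite h ler10. Qed.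
Let tau := ln t.
Let taut : tau <= t. Proof. by apply: ltW; exact: ln_sublinear. Qed.
Let tge1 : 1 <= t. Proof. exact: le_trans t1 taut. Qed.

(** Writing [1 + t s = t z] splits the logarithm into [ln t + ln z]. The first part gives the main
    term, and [z ln z] is bounded uniformly in [t], since [z <= 1 + s]. *)
Lemma Gf_large s : `|Gf (t * s) - t * tau * pos s| <= 3 * D * t * (p s * (1 + `|s|)).
Proof.
have p1 := pow_ge1 s (ltW d0); have s1 := normr_ge0 s; have t0 := tp.
have q1 : 1 <= D * p s by have := mulr_ge0 (ltW dV) (le_trans ler01 p1); lra.
have [s0|s0] := leP 0 s; last first.
  have h : t * s <= 0 by rewrite pmulr_rle0// ltW.
  rewrite (pos_0 (ltW s0)) mulr0 subr0.
  have /andP[g1 g2] := Gf_neg h; rewrite ler0_norm//.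
  have h2 : 1 <= D * p s * (1 + `|s|) by apply: (le_trans q1); rewrite ler_peMr ?(le_trans ler01 q1)// lerDl.
  have -> : 3 * D * t * (p s * (1 + `|s|)) = 3 * (t * (D * p s * (1 + `|s|))) by ring.
  have : 1 <= t * (D * p s * (1 + `|s|)) by apply: (le_trans h2); rewrite ler_peMl ?(le_trans ler01 h2).
  by lra.
have ts0 : 0 <= t * s by rewrite mulr_ge0// ltW.
rewrite (Gf_pos ts0) (pos_id s0) (ger0_norm s0).
set z := (1 + t * s) / t; have z0 : 0 < z by rewrite divr_gt0// ltr_pwDl.
have yz : 1 + t * s = t * z by rewrite /z [RHS]mulrC divfK ?gt_eqF.
have zs : z <= 1 + s.
  by rewrite /z ler_pdivrMr// mulrDl mul1r [s * t]mulrC lerD2r.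
have -> : (1 + t * s) * ln (1 + t * s) - t * tau * s = tau + t * (z * ln z).
  rewrite {1}yz {1}yz lnM ?posrE// -/tau.
  have -> : t * z * (tau + ln z) - t * tau * s = tau * (t * z - t * s) + t * (z * ln z) by ring.
  by rewrite -yz addrK mulr1.
have zl : `|z * ln z| <= (1 + s) * (D * p s).
  have [zge|zlt] := leP 1 z.
    have l0 : 0 <= ln z := ln_ge0 zge; rewrite ger0_norm; last exact: mulr_ge0 (ltW z0) l0.
    apply: ler_pM => //; first exact: ltW.
    apply: le_trans (ln_powR_le d0 zge) _; apply: (@le_trans _ _ (d^-1 * p s)); last first.
      by rewrite ler_wpM2r ?(le_trans ler01 p1)// lerDr.
    rewrite ler_pM2l//; apply: ge0_ler_powR; rewrite ?nnegrE ?(ltW d0) ?(ltW z0)//.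
    by rewrite (ger0_norm s0).
  have := xln_ge z0; have := ln_le0 (ltW zlt) => l0 l1.
  have l2 : z * ln z <= 0 by rewrite pmulr_rle0.
  rewrite ler0_norm//; have : 1 <= (1 + s) * (D * p s) by apply: (le_trans q1); rewrite ler_peMl ?(le_trans ler01 q1)// lerDl.
  by lra.
apply: le_trans (ler_normD _ _) _; rewrite normrM (gtr0_norm t0) (ger0_norm (_ : 0 <= tau)); last first.
  exact: le_trans ler01 t1.
have h1 : t <= t * ((1 + s) * (D * p s)).
  rewrite ler_peMr ?(ltW t0)//; apply: (le_trans q1).
  by rewrite ler_peMl ?(le_trans ler01 q1)// lerDl.
have h2 := ler_wpM2l (ltW t0) zl.
rewrite (ger0_norm s0) in h1 h2 *.
have -> : 3 * D * t * ((1 + s) `^ d * (1 + s)) = 3 * (t * ((1 + s) * (D * (1 + s) `^ d))) by ring.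
have h3 : 0 <= t * ((1 + s) * (D * (1 + s) `^ d)) by apply: le_trans h1; exact: ltW.
by have := taut; lra.
Qed.

(** The first two terms vanish for [s <= 0] and the last one tends to 0 as [t] grows. This suits
    rescaled sequences, whose limits will be nonpositive wherever the coefficients are nonzero. *)
Definition rem s : R := pos s + pos s ^+ 2 + tau / t * (1 + `|s|).

Let tt0 : 0 < tau / t. Proof. by rewrite divr_gt0// (lt_le_trans ltr01 t1). Qed.
Let tt1 : t^-1 <= tau / t. Proof. by rewrite ler_peMl// invr_ge0 ltW. Qed.

Lemma rem_neg s : s <= 0 -> t * `|s| <= t ^+ 2 * rem s.
Proof.
move=> s0; rewrite /rem (pos_0 s0) expr0n add0r add0r.
have -> : t ^+ 2 * (tau / t * (1 + `|s|)) = t * (tau * (1 + `|s|)) by field; rewrite gt_eqF.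
rewrite ler_pM2l//; apply: (@le_trans _ _ (1 + `|s|)); first by rewrite lerDr.
by rewrite ler_peMl ?addr_ge0.
Qed.

Lemma rem_ge0 s : 0 <= rem s.
Proof.
by rewrite /rem !addr_ge0 ?pos_ge0 ?sqr_ge0// mulr_ge0 ?addr_ge0// ltW.
Qed.

Lemma Kf_large s : `|Kf (t * s)| <= D * t ^+ 2 * (p s * rem s).
Proof.
have p1 := pow_ge1 s (ltW d0).
have q1 : 1 <= D * p s by have := mulr_ge0 (ltW dV) (le_trans ler01 p1); lra.
have r0 : 0 <= t ^+ 2 * rem s by rewrite mulr_ge0 ?sqr_ge0 ?rem_ge0.
suff h : `|Kf (t * s)| <= t ^+ 2 * rem s.
  apply: (le_trans h); have -> : D * t ^+ 2 * (p s * rem s) = D * p s * (t ^+ 2 * rem s) by ring.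
  by rewrite ler_peMl.
have [s0|s0] := leP 0 s; last first.
  have h : t * s <= 0 by rewrite pmulr_rle0// ltW.
  apply: le_trans (Kf_neg h) _; rewrite normrM (gtr0_norm tp); exact: rem_neg (ltW s0).
have ts0 : 0 <= t * s by rewrite mulr_ge0// ltW.
rewrite (Kf_pos ts0) ger0_norm; last first.
  by apply: addr_ge0 => //; apply: mulr_ge0; rewrite ?sqr_ge0.
rewrite /rem (pos_id s0).
have a1 : 0 <= t ^+ 2 * (tau / t * (1 + `|s|)) by rewrite mulr_ge0 ?sqr_ge0// mulr_ge0 ?addr_ge0// ltW.
have a2 : t * s <= t ^+ 2 * s.
  by rewrite ler_wpM2r// expr2 ler_peMr// ltW.
have a3 : 0 <= t ^+ 2 * s ^+ 2 by rewrite mulr_ge0 ?sqr_ge0.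
rewrite exprMn; lra.
Qed.

(** The same splitting [1 + t s = t z]. The main term takes up [t^2 ln t]; in the error [ln t]
    survives only divided by [t]. *)
Lemma Ff_large s : `|Ff (t * s) - 2^-1 * t ^+ 2 * tau * pos s ^+ 2| <= 4 * D * t ^+ 2 * (p s * rem s).
Proof.
have p1 := pow_ge1 s (ltW d0); have t0 := tp.
have q1 : 1 <= D * p s by have := mulr_ge0 (ltW dV) (le_trans ler01 p1); lra.
have r0 : 0 <= t ^+ 2 * rem s by rewrite mulr_ge0 ?sqr_ge0 ?rem_ge0.
have [s0|s0] := leP 0 s; last first.
  have h : t * s <= 0 by rewrite pmulr_rle0// ltW.
  rewrite (pos_0 (ltW s0)) expr0n mulr0 subr0 ger0_norm ?Ff_ge0//.
  apply: le_trans (Ff_neg h) _; rewrite normrM (gtr0_norm tp).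
  apply: le_trans (rem_neg (ltW s0)) _.
  have -> : 4 * D * t ^+ 2 * (p s * rem s) = 4 * (D * p s) * (t ^+ 2 * rem s) by ring.
  by rewrite ler_peMl//; lra.
have ts0 : 0 <= t * s by rewrite mulr_ge0// ltW.
rewrite (Ff_pos ts0) (pos_id s0) /Phi1.
set z := (1 + t * s) / t; have z0 : 0 < z by rewrite divr_gt0// ltr_pwDl.
have yz : 1 + t * s = t * z by rewrite /z [RHS]mulrC divfK ?gt_eqF.
have zs : z = s + t^-1 by rewrite /z mulrDl mul1r mulrAC mulfV ?gt_eqF// mul1r addrC.
have tV : 0 < t^-1 by rewrite invr_gt0.
have tV1 : t^-1 <= 1 by rewrite invf_le1.
have lz : z ^+ 2 * `|ln z| <= D * p s * (z + z ^+ 2).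
  have [zge|zlt] := leP 1 z.
    rewrite ger0_norm ?ln_ge0//.
    have h1 : ln z <= D * p s.
      apply: le_trans (ln_powR_le d0 zge) _; apply: (@le_trans _ _ (d^-1 * p s)); last first.
        by rewrite ler_wpM2r ?(le_trans ler01 p1)// lerDr.
      rewrite ler_pM2l//; apply: ge0_ler_powR; rewrite ?nnegrE ?(ltW d0) ?(ltW z0)//.
      by rewrite (ger0_norm s0) zs; lra.
    have := ler_wpM2l (sqr_ge0 z) h1; have := mulr_ge0 (le_trans ler01 q1) (ltW z0).
    by move: (D * p s) => q; lra.
  have l1 := xln_ge z0; have l0 := ln_le0 (ltW zlt).
  rewrite ler0_norm//.
  have h1 : z ^+ 2 * - ln z <= z.
    have : z * (- (z * ln z)) <= z * 1 by rewrite ler_pM2l//; lra.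
    by rewrite expr2; lra.
  apply: (le_trans h1); have : 0 <= z ^+ 2 := sqr_ge0 z.
  by move=> z2; apply: (@le_trans _ _ (1 * (z + z ^+ 2))); [lra|apply: ler_wpM2r => //; lra].
have -> : 2^-1 * (1 + t * s) ^+ 2 * ln (1 + t * s) - 4^-1 * (1 + t * s) ^+ 2 + 4^-1 - 2^-1 * t ^+ 2 * tau * s ^+ 2 =
    2^-1 * (tau * (1 + 2 * (t * s))) + 2^-1 * (t ^+ 2 * (z ^+ 2 * ln z)) - 4^-1 * (2 * (t * s) + t ^+ 2 * s ^+ 2).
  have -> : ln (1 + t * s) = tau + ln z by rewrite yz lnM ?posrE.
  have e2 : t ^+ 2 * z ^+ 2 = (1 + t * s) ^+ 2 by rewrite -exprMn -yz.
  by rewrite (mulrA (t ^+ 2)) e2; field.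
have tau0 : 0 <= tau := le_trans ler01 t1.
have T0 : 0 <= t ^+ 2 := sqr_ge0 t.
have s2 := sqr_ge0 s.
have b1 : tau * (1 + 2 * (t * s)) <= t ^+ 2 * (tau / t * (1 + 2 * s)).
  have -> : t ^+ 2 * (tau / t * (1 + 2 * s)) = tau * (t * (1 + 2 * s)) by field; rewrite gt_eqF.
  by apply: ler_wpM2l => //; rewrite [t * (_ + _)]mulrDr mulr1 [t * (2 * s)]mulrCA lerD2r.
have b2 : z + z ^+ 2 <= s + 2 * s ^+ 2 + 3 * (tau / t).
  have tV2 : t^-1 ^+ 2 <= t^-1 by rewrite expr2 ler_piMr// ltW.
  have := sqr_ge0 (s - t^-1); have := tt1; rewrite zs; nra.
have b3 : t * s <= t ^+ 2 * s by rewrite ler_wpM2r// expr2 ler_peMr// ltW.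
have rE : rem s = s + s ^+ 2 + tau / t * (1 + s) by rewrite /rem (pos_id s0) (ger0_norm s0).
have c0 : 0 <= tau / t * s by rewrite mulr_ge0// ltW.
have b4 : z + z ^+ 2 <= 3 * rem s by rewrite rE; have := tt0; lra.
have b5 : t ^+ 2 * (z ^+ 2 * `|ln z|) <= 3 * (D * p s * (t ^+ 2 * rem s)).
  apply: (le_trans (ler_wpM2l T0 lz)).
  have := ler_wpM2l (le_trans ler01 q1) b4; move/(ler_wpM2l T0).
  by move: (D * p s) => q; lra.
have b6 : t ^+ 2 * rem s <= D * p s * (t ^+ 2 * rem s) by rewrite ler_peMl.
have b7 : t ^+ 2 * (tau / t * (1 + 2 * s)) <= 2 * (t ^+ 2 * rem s).
  have : tau / t * (1 + 2 * s) <= 2 * rem s by rewrite rE; have := tt0; lra.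
  by move/(ler_wpM2l T0); lra.
have b8 : 2 * (t * s) + t ^+ 2 * s ^+ 2 <= 2 * (t ^+ 2 * rem s).
  have : 2 * s + s ^+ 2 <= 2 * rem s by rewrite rE; have := tt0; lra.
  by move/(ler_wpM2l T0); lra.
have c1 : 0 <= tau * (1 + 2 * (t * s)) by rewrite mulr_ge0// addr_ge0// mulr_ge0.
have c2 : 0 <= 2 * (t * s) + t ^+ 2 * s ^+ 2 by apply: addr_ge0; [apply: mulr_ge0|exact: mulr_ge0 T0 s2].
have c3 : `|t ^+ 2 * (z ^+ 2 * ln z)| <= 3 * (D * p s * (t ^+ 2 * rem s)).
  by rewrite normrM (ger0_norm T0) normrM (ger0_norm (sqr_ge0 z)).
have -> : 4 * D * t ^+ 2 * (p s * rem s) = 4 * (D * p s * (t ^+ 2 * rem s)) by ring.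
move: c3 b6 b7 b8 c1 c2 b1; rewrite !ler_norml => /andP[c3 c4].
move: (t ^+ 2 * (z ^+ 2 * ln z)) (D * p s * (t ^+ 2 * rem s)) (t ^+ 2 * rem s) c3 c4 => u1 u2 u3 c3 c4.
move: (tau * (1 + 2 * (t * s))) (t ^+ 2 * (tau / t * (1 + 2 * s))) (2 * (t * s) + t ^+ 2 * s ^+ 2).
move=> u4 u5 u6 b6 b7 b8 c1 c2 b1.
by apply/andP; split; lra.
Qed.

End large.
End growth.
End truncated_logarithm.

(** * Density of test functions *)

Section density.
Context {R : realType} {n : nat}.
Local Notation X := 'rV[R]_n.
Local Notation leb := (@lebesgue_rV R n).
Variable Om : set X.
Hypothesis oOm : open Om.
Let mO : measurable Om := mOm oOm.
Local Notation "'It' f" := (Rintegral leb Om f) (at level 10, f at level 8).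
Local Notation ig := (ig leb Om).

Definition chf (A : set X) (x : X) : R := \1_A x.
Local Notation "1_ A" := (chf A) (at level 8, A at level 2, format "1_ A").

Lemma chfE (A : set X) x : 1_A x = (x \in A)%:R. Proof. by rewrite /chf indicE. Qed.

Definition cutoff (phi : X -> R) := test_function Om phi /\ forall x, 0 <= phi x <= 1.

Lemma cutoff0 : cutoff (fun=> 0).
Proof. by split => [|x]; [exact: test0|rewrite lexx ler01]. Qed.

Lemma cutoffM (phi u : X -> R) : cutoff phi -> smooth u -> (forall x, 0 <= u x <= 1) ->
  cutoff (fun x => phi x * u x).
Proof.
move=> [tp p01] su u01; split => [|x]; first exact: testM.
have /andP[a b] := p01 x; have /andP[c d] := u01 x.
by rewrite mulr_ge0//= mulr_ile1.
Qed.

(** The function is [1 - (1 - phi) (1 - psi)], the smooth counterpart of a union. *)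
Lemma cutoffU (phi psi : X -> R) : cutoff phi -> cutoff psi ->
  cutoff (fun x => phi x + psi x - phi x * psi x).
Proof.
move=> [tp p01] [tq q01]; split => [|x].
  have h := testZ (-1) (testM tp (test_smooth tq)).
  rewrite (_ : (fun _ => _) = (fun x => phi x + psi x + -1 * (phi x * psi x))).
    exact: testD (testD tp tq) h.
  by apply/funext => x; ring.
have /andP[a b] := p01 x; have /andP[c d] := q01 x.
by apply/andP; split; nra.
Qed.

(** As [N] grows these increase to the indicator of the set where [phi] is positive, and they are
    polynomials in [phi] without constant term. *)
Lemma cutoff_pow (phi : X -> R) N : cutoff phi -> cutoff (fun x => 1 - (1 - phi x) ^+ N).
Proof.
move=> [tp p01]; split => [|x]; last first.
  have /andP[a b] := p01 x; have c : 0 <= 1 - phi x by rewrite subr_ge0.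
  by rewrite subr_ge0 exprn_ile1//= ?gerBl ?exprn_ge0// lerBlDr lerDl.
have := @test_horner _ _ Om (1 - (1 - 'X) ^+ N)%R phi.
rewrite !hornerE subr0 expr1n subrr => /(_ erefl tp).
by under eq_fun do rewrite !hornerE.
Qed.

Lemma smooth_bump (a c : R) (i : 'I_n) : smooth (fun x : X => bump (a * x 0 i + c)).
Proof. by have [F [<- hF]] := @bump_family R; exact: smooth_coord hF. Qed.

Lemma cutoff_cube (c : 'I_n -> R) (r : R) : 0 < r ->
  [set x : X | forall i, `|x 0 i - c i| <= r] `<=` Om ->
  exists2 phi, cutoff phi & forall x, 0 < phi x <-> forall i, `|x 0 i - c i| < r.
Proof.
move=> r0 cOm.
pose b (i : 'I_n) (x : X) : R := bump (1 * x 0 i + (r - c i)) * bump ((-1) * x 0 i + (r + c i)).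
have b01 i x : 0 <= b i x <= 1.
  by rewrite mulr_ge0 ?bump_ge0//= mulr_ile1 ?bump_ge0 ?bump_le1.
have bgt i x : (0 < b i x) = (`|x 0 i - c i| < r).
  rewrite ltr_norml /b; have h1 := bump_ge0 (1 * x 0 i + (r - c i)).
  have h2 := bump_ge0 ((-1) * x 0 i + (r + c i)).
  have [e1|e1] := eqVneq (bump (1 * x 0 i + (r - c i))) 0.
    rewrite e1 mul0r ltxx; apply/esym/negbTE; apply/negP => /andP[l1 _].
    have : 0 < bump (1 * x 0 i + (r - c i)) by rewrite bump_gt0; lra.
    by rewrite e1 ltxx.
  have b1 : 0 < bump (1 * x 0 i + (r - c i)) by rewrite lt_def e1.
  rewrite pmulr_rgt0// bump_gt0; apply/idP/andP => [l2|[_ l2]]; last by lra.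
  by split; last lra; move: b1; rewrite bump_gt0; lra.
have bs i : smooth (b i) by apply: smoothM; exact: smooth_bump.
pose phi x := \prod_(i < n) b i x.
have p01 x : 0 <= phi x <= 1 by apply/andP; split; [apply: prodr_ge0 => i _; case/andP: (b01 i x)|exact: prodr_ile1].
have pgt x : 0 < phi x <-> forall i, `|x 0 i - c i| < r.
  split => [h i|h]; last by apply: prodr_gt0 => i _; rewrite bgt.
  rewrite -bgt lt_def; have /andP[-> _] := b01 i x; rewrite andbT.
  apply: contraTneq h => bi; rewrite /phi (bigD1 i)//= bi mul0r ltxx//.
have ck : compact [set x : X | forall i, `|x 0 i - c i| <= r].
  have := @rV_compact R n (fun i => `[c i - r, c i + r]%classic) (fun=> @segment_compact _ _ _).
  congr compact; apply/seteqP; split => x /= h i; have := h i.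
    by rewrite in_itv/= ler_distl.
  by rewrite in_itv/= ler_distl.
have sub : closure [set x | phi x != 0] `<=` [set x : X | forall i, `|x 0 i - c i| <= r].
  have cl : closed [set x : X | forall i, `|x 0 i - c i| <= r].
    by apply: compact_closed => //; exact: norm_hausdorff.
  rewrite [Y in _ `<=` Y]((closure_id _).1 cl); apply: closure_subset => x /= px i.
  by have /andP[p0 _] := p01 x; apply/ltW; apply: (pgt x).1; rewrite lt_def px.
exists phi => //; split => //; split.
- exact: smooth_prod.
- exact: subclosed_compact (@closed_closure _ _) ck sub.
- exact: subset_trans sub cOm.
Qed.

(** * Sets whose indicators are limits of cutoffs *)

Section approximation.
Variable f : X -> R.
Hypotheses (fi : ig f) (f0 : forall x, 0 <= f x).

(** The distance is that of L1 with density [f]. Such sets turn out to be a sigma-algebra containing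
    the half-spaces, which takes the place of a regularity argument for the measure. *)
Definition approx (A : set X) := measurable A /\
  forall e : R, 0 < e -> exists2 phi, cutoff phi & It (fun x => f x * `|phi x - 1_A x|) < e.

Lemma chf0 x : 1_set0 x = 0. Proof. by rewrite chfE in_set0. Qed.

Lemma meas_ind (A : set X) : measurable A -> measurable_fun Om (1_A).
Proof. by move=> mA; apply: measurable_funTS; exact: measurable_indic. Qed.

Lemma ind01 (A : set X) x : 0 <= (1_A x) <= 1.
Proof. by rewrite chfE; case: (x \in A); rewrite ?lexx ?ler01. Qed.

Lemma ig_weight (u : X -> R) : measurable_fun Om u -> (forall x, `|u x| <= 1) ->
  ig (fun x => f x * u x).
Proof.
move=> mu u1; apply: (@ig_le _ _ _ leb Om mO _ f) => //.
  by apply: measurable_funM => //; exact: ig_meas fi.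
apply: aeDW => x _; rewrite normrM (ger0_norm (f0 x)).
by rewrite -[leRHS]mulr1; exact: ler_wpM2l.
Qed.

Lemma dist01 (a b : R) : 0 <= a <= 1 -> 0 <= b <= 1 -> `|a - b| <= 1.
Proof. by move=> /andP[? ?] /andP[? ?]; rewrite ler_norml; apply/andP; split; lra. Qed.

Lemma ig_dist (phi : X -> R) (A : set X) : cutoff phi -> measurable A ->
  ig (fun x => f x * `|phi x - 1_A x|).
Proof.
move=> [tp p01] mA; apply: ig_weight => [|x].
  apply: measurableT_comp => //; apply: measurable_funB; [exact: test_meas tp|exact: meas_ind].
by rewrite normr_id; apply: dist01 => //; exact: ind01.
Qed.

Lemma ig_lim (v_ : nat -> X -> R) (v : X -> R) :
  (forall j, measurable_fun Om (v_ j)) -> (forall j x, 0 <= v_ j x <= 1) ->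
  measurable_fun Om v -> (forall x, 0 <= v x <= 1) ->
  (forall x, Om x -> v_ ^~ x @ \oo --> v x) ->
  forall e : R, 0 < e -> exists j, It (fun x => f x * `|v_ j x - v x|) < e.
Proof.
move=> mv_ v_01 mv v01 lim e e0.
have b j x : `|(`|v_ j x - v x|)| <= 1 by rewrite normr_id; exact: dist01.
have iv j : ig (fun x => f x * `|v_ j x - v x|).
  by apply: ig_weight (b j); apply: measurableT_comp => //; exact: measurable_funB.
have h1 : aeD leb Om (fun x => (fun j => f x * `|v_ j x - v x|) @ \oo --> (0:R)).
  apply: aeDW => x Ox; rewrite -[0](mulr0 (f x)); apply: cvgM; first exact: cvg_cst.
  rewrite -[0](@normr0 _ R) -(subrr (v x)); apply: cvg_norm; apply: cvgB; [exact: lim|exact: cvg_cst].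
have h2 j : aeD leb Om (fun x => `|f x * `|v_ j x - v x| | <= f x).
  by apply: aeDW => x Ox; rewrite normrM (ger0_norm (f0 x)) -[leRHS]mulr1 ler_wpM2l.
have [_] := It_DCT mO (fun j => ig_meas (iv j)) (measurable_cst _) h1 fi h2.
rewrite It0 => /cvgrPdist_lt/(_ e e0)[j _ /(_ j (leqnn j))] hj; exists j.
by move: hj; rewrite sub0r normrN; exact: le_lt_trans (ler_norm _).
Qed.

Lemma approx_lim (phi_ : nat -> X -> R) (A : set X) : measurable A -> (forall j, cutoff (phi_ j)) ->
  (forall x, Om x -> phi_ ^~ x @ \oo --> (1_A x)) -> approx A.
Proof.
move=> mA cp lim; split => // e e0.
have [j hj] := ig_lim (fun j => test_meas (D:=Om) (cp j).1) (fun j => (cp j).2) (meas_ind mA) (ind01 A) lim e0.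
by exists (phi_ j).
Qed.

Lemma approx2 (A B C : set X) : (measurable A -> measurable B -> measurable C) ->
  (forall phi psi, cutoff phi -> cutoff psi -> exists2 eta, cutoff eta &
     forall x, Om x -> `|eta x - 1_C x| <= `|phi x - 1_A x| + `|psi x - 1_B x|) ->
  approx A -> approx B -> approx C.
Proof.
move=> mABC comb [mA hA] [mB hB]; have mC := mABC mA mB; split => // e e0; have e2 : 0 < e / 2 by rewrite divr_gt0.
have [phi cp ap] := hA _ e2; have [psi cq aq] := hB _ e2.
have [eta ce le] := comb _ _ cp cq; exists eta => //.
rewrite [e]splitr; apply: le_lt_trans (ltrD ap aq).
rewrite -(ItD mO (ig_dist cp mA) (ig_dist cq mB)).
apply: (It_le mO (ig_dist ce mC) (igD mO (ig_dist cp mA) (ig_dist cq mB))).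
by apply: aeDW => x Ox; rewrite -mulrDr ler_wpM2l//; exact: le.
Qed.

Lemma approxU (A B : set X) : approx A -> approx B -> approx (A `|` B).
Proof.
move=> hA hB; apply: approx2 hA hB => [mA mB|phi psi cp cq]; first exact: measurableU.
exists (fun x => phi x + psi x - phi x * psi x) => [|x _]; first exact: cutoffU.
have [_ /(_ x) /andP[a b]] := cp; have [_ /(_ x) /andP[c d]] := cq.
rewrite !chfE in_setU; move: (phi x) (psi x) a b c d => y z a b c d.
have -> : y + z - y * z - (((x \in A) || (x \in B))%:R : R) =
   (y - (x \in A)%:R) * (1 - z) + (z - (x \in B)%:R) * (1 - (x \in A)%:R).
  by case: (x \in A); case: (x \in B) => /=; ring.
apply: le_trans (ler_normD _ _) _; rewrite !normrM; apply: lerD; rewrite ler_piMr//.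
  by rewrite ler_norml; apply/andP; split; lra.
by case: (x \in A); rewrite ?subr0 ?subrr ?normr0 ?normr1.
Qed.

Lemma approxU_seq (A_ : nat -> set X) : (forall j, approx (A_ j)) -> approx (\bigcup_j A_ j).
Proof.
move=> hA; have mA j : measurable (A_ j) by case: (hA j).
have mU : measurable (\bigcup_j A_ j) by exact: bigcupT_measurable.
pose B j := \bigcup_(k < j) A_ k.
have hB j : approx (B j).
  elim: j => [|j ih].
    rewrite /B bigcup_mkord big_ord0; split => // e e0; exists (fun=> 0); first exact: cutoff0.
    under eq_Rintegral do rewrite chf0 subr0 normr0 mulr0.
    by rewrite It0.
  have -> : B j.+1 = B j `|` A_ j by rewrite /B !bigcup_mkord big_ord_recr.
  exact: approxU.
have mB j : measurable (B j) by case: (hB j).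
split => // e e0; have e2 : 0 < e / 2 by rewrite divr_gt0.
have lim x : 1_(B j) x @[j --> \oo] --> (1_(\bigcup_j A_ j) x).
  have [[k _ Ak]|nU] := pselect ((\bigcup_j A_ j) x).
    apply/cvgrPdist_lt => d d0; exists k.+1 => // j /= kj.
    by rewrite !chfE !mem_set ?subrr ?normr0//; [exists k => //|exists k].
  rewrite (_ : (fun j => _) = (fun=> 1_(\bigcup_j A_ j) x)); first exact: cvg_cst.
  apply/funext => j; rewrite !chfE !memNset// => -[k _ Ak]; apply: nU; by exists k.
have [j hj] := ig_lim (fun j => meas_ind (mB j)) (fun j => ind01 (B j)) (meas_ind mU) (ind01 _) (fun x _ => lim x) e2.
have igB' : ig (fun x => f x * `|1_(B j) x - 1_(\bigcup_j A_ j) x|).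
  apply: ig_weight => [|x]; last by rewrite normr_id; apply: dist01; exact: ind01.
  by apply: measurableT_comp => //; apply: measurable_funB; exact: meas_ind.
have [_ /(_ _ e2)[phi cp hp]] := hB j; exists phi => //.
rewrite [e]splitr; apply: le_lt_trans (ltrD hp hj).
rewrite -(ItD mO (ig_dist cp (mB j)) igB').
apply: (It_le mO (ig_dist cp mU) (igD mO (ig_dist cp (mB j)) igB')).
by apply: aeDW => x Ox; rewrite -mulrDr ler_wpM2l// ler_distD.
Qed.

Lemma pow_ind (A : set X) (b : X -> R) x : 0 <= b x <= 1 -> (0 < b x <-> A x) ->
  1 - (1 - b x) ^+ N @[N --> \oo] --> (1_A x).
Proof.
move=> /andP[b0 b1] bA; have [Ax|nA] := pselect (A x).
  have bx := (bA.2 Ax); rewrite chfE mem_set// -[1%:R in X in _ --> X](subr0 1).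
  apply: cvgB; first exact: cvg_cst.
  by apply: cvg_expr; rewrite ger0_norm ?subr_ge0// gtrBl.
have bx : b x = 0 by apply/eqP; rewrite eq_le b0 andbT leNgt; apply/negP => /bA.1.
rewrite chfE memNset// bx subr0; under eq_fun do rewrite expr1n subrr.
exact: cvg_cst.
Qed.

Lemma approx_cube (c : 'I_n -> R) (r : R) : 0 < r ->
  [set x : X | forall i, `|x 0 i - c i| <= r] `<=` Om ->
  approx [set x : X | forall i, `|x 0 i - c i| < r].
Proof.
move=> r0 /(cutoff_cube r0)[b cb bP].
apply: (@approx_lim (fun N x => 1 - (1 - b x) ^+ N)) => [|N|x _].
- rewrite (_ : mkset _ = [set x | 0 < b x]); last by apply/seteqP; split => x /bP.
  have mb : measurable_fun setT b by exact: test_meas cb.1.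
  have := mb measurableT `]0, +oo[%classic (measurable_itv _); rewrite setTI.
  by congr measurable; apply/seteqP; split => x /=; rewrite in_itv/= andbT.
- exact: cutoff_pow.
- by apply: pow_ind; [case: cb|exact: bP].
Qed.

(** An open set is a countable union of cubes with rational data whose closed versions it contains,
    and each such cube is the positivity set of a cutoff. *)
Lemma approx_Om : approx Om.
Proof.
pose box (c : 'rV[rat]_n * rat) : set X := [set x | forall i, `|x 0 i - ratr (c.1 0 i)| < ratr c.2].
pose cbox (c : 'rV[rat]_n * rat) : set X := [set x | forall i, `|x 0 i - ratr (c.1 0 i)| <= ratr c.2].
pose good c := 0 < (ratr c.2 : R) /\ cbox c `<=` Om.
pose Q (j : nat) : set X := if unpickle j is Some c then
  (if `[< good c >] then box c else set0) else set0.
have appr0 : approx set0.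
  split => // e e0; exists (fun=> 0); first exact: cutoff0.
  under eq_Rintegral do rewrite chf0 subr0 normr0 mulr0.
  by rewrite It0.
have -> : Om = \bigcup_j Q j.
  apply/seteqP; split => [x Ox|x [j _]]; last first.
    rewrite /Q; case: unpickle => [c|//]; case: asboolP => // -[r0 cO] bx.
    by apply: cO => i; exact/ltW/bx.
  have /nbhs_ballP[e /= e0 xeA] : nbhs x Om by exact: open_nbhs_nbhs.
  have [r0] := @rat_in_itvoo R 0 (e / 2) (divr_gt0 e0 (ltr0Sn _ 1)).
  rewrite in_itv => /andP[r0_gt0 r0e].
  have /choice[q qP] : forall i, exists q : rat, `|x 0 i - ratr q| < ratr r0.
    move=> i; have [|q] := @rat_in_itvoo R (x 0 i - ratr r0) (x 0 i + ratr r0).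
      by rewrite ltrBlDr -addrA ltrDl addr_gt0.
    by rewrite in_itv/= => qx; exists q; rewrite distrC ltr_distl.
  exists (pickle (\row_i q i, r0)) => //; rewrite /Q pickleK.
  case: asboolP => [_|]; first by move=> i; rewrite /= mxE.
  case; split => // y yb; apply: xeA; split=> // i j; rewrite ord1 /ball /= [e]splitr.
  apply: le_lt_trans (ler_distD (ratr (q j)) _ _) _; apply: ltrD.
    exact: lt_trans r0e.
  by have := yb j; rewrite /= mxE distrC => /le_lt_trans; exact.
apply: approxU_seq => j; rewrite /Q; case: unpickle => [c|//]; case: asboolP => // -[r0 cO].
exact: (@approx_cube (fun i => ratr (c.1 0 i)) (ratr c.2) r0 cO).
Qed.

(** The function [1 - phi] need not have support in [Om]; multiplying it by a cutoff close to the
    indicator of [Om] repairs this. *)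
Lemma approxC (A : set X) : approx A -> approx (~` A).
Proof.
move=> hA; apply: approx2 hA approx_Om => [mA _|phi psi cp cq]; first exact: measurableC.
have cv x : 0 <= 1 - phi x <= 1 by have [_ /(_ x)/andP[a b]] := cp; apply/andP; split; lra.
exists (fun x => psi x * (1 - phi x)) => [|x Ox].
  apply: cutoffM => //; under eq_fun do rewrite -mulN1r.
  by apply: smoothD; [exact: smooth_cst|apply: smoothZ; case: cp => /test_smooth].
have [_ /(_ x) /andP[a b]] := cp; have [_ /(_ x) /andP[c d]] := cq.
rewrite !chfE in_setC (mem_set Ox); move: (phi x) (psi x) a b c d => y z a b c d.
have -> : z * (1 - y) - ((~~ (x \in A))%:R : R) = (z - 1) * (1 - y) - (y - (x \in A)%:R).
  by case: (x \in A) => /=; ring.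
apply: le_trans (ler_normB _ _) _; rewrite addrC lerD2l normrM ler_piMr//.
by rewrite ler_norml; apply/andP; split; lra.
Qed.

Lemma approx_half (c : R) i : approx [set x | c < x 0 i].
Proof.
have mH : measurable [set x : X | c < x 0 i].
  have := @measurable_coord R n i measurableT `]c, +oo[%classic (measurable_itv _); rewrite setTI.
  by congr measurable; apply/seteqP; split => x /=; rewrite in_itv/= andbT.
pose b (x : X) : R := bump (1 * x 0 i + (- c)).
have sb : smooth b by exact: smooth_bump.
have b01 x : 0 <= b x <= 1 by rewrite bump_ge0 bump_le1.
pose v N x := 1 - (1 - b x) ^+ N.
have sv N : smooth (v N).
  have := @smooth_horner _ _ (1 - (1 - 'X) ^+ N) b sb.
  by under eq_fun do rewrite !hornerE.
have v01 N x : 0 <= v N x <= 1.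
  have /andP[c0 c1] := b01 x; have d0 : 0 <= 1 - b x by rewrite subr_ge0.
  by rewrite subr_ge0 exprn_ile1//= ?gerBl ?exprn_ge0// lerBlDr lerDl.
have mv N : measurable_fun Om (v N) by apply: measurable_funTS; exact: cont_measurable (smooth_cont (sv N)).
split => // e e0; have e2 : 0 < e / 2 by rewrite divr_gt0.
have lim x : Om x -> v ^~ x @ \oo --> 1_[set x | c < x 0 i] x.
  move=> _; apply: pow_ind => //; rewrite bump_gt0 /=; split => h; lra.
have [N hN] := ig_lim mv v01 (meas_ind mH) (ind01 _) lim e2.
have [_ /(_ _ e2)[psi cq hq]] := approx_Om.
exists (fun x => psi x * v N x); first exact: cutoffM.
have iN : ig (fun x => f x * `|v N x - 1_[set x | c < x 0 i] x|).
  apply: ig_weight => [|x]; last by rewrite normr_id; apply: dist01 => //; exact: ind01.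
  by apply: measurableT_comp => //; apply: measurable_funB => //; exact: meas_ind.
rewrite [e]splitr; apply: le_lt_trans (ltrD hq hN).
rewrite -(ItD mO (ig_dist cq mO) iN).
apply: (It_le mO _ (igD mO (ig_dist cq mO) iN)).
  exact: ig_dist (cutoffM cq (sv N) (v01 N)) mH.
apply: aeDW => x Ox; rewrite -mulrDr ler_wpM2l//.
have [_ /(_ x) /andP[a1 b1]] := cq; have /andP[a2 b2] := v01 N x; have /andP[a3 b3] := ind01 [set x | c < x 0 i] x.
rewrite [1_Om x]chfE (mem_set Ox); move: (psi x) (v N x) (1_ _ x) a1 b1 a2 b2 a3 b3 => y z k a1 b1 a2 b2 a3 b3.
have -> : y * z - k = (y - 1) * z + (z - k) by ring.
apply: le_trans (ler_normD _ _) _; rewrite lerD2r normrM ler_piMr//.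
by rewrite ler_norml; apply/andP; split; lra.
Qed.

(** Stated for preimages, to serve both for the identity and for each coordinate function. *)
Lemma approx_sigma (T : Type) (g : X -> T) :
  sigma_algebra setT [set B | approx (g @^-1` B)].
Proof.
split => [|B hB|F hF] /=.
- rewrite preimage_set0; split => // e e0; exists (fun=> 0); first exact: cutoff0.
  under eq_Rintegral do rewrite chf0 subr0 normr0 mulr0.
  by rewrite It0.
- by rewrite setTD preimage_setC; exact: approxC.
- by rewrite preimage_bigcup; exact: approxU_seq.
Qed.

Lemma approx_measurable (A : set X) : measurable A -> approx A.
Proof.
apply: smallest_sub; first exact: (@approx_sigma _ id).
rewrite -bigcup_seq/=; apply: bigcup_sub => i _ _ [B mB <-]; rewrite setTI.
move: B mB; rewrite [measurable]RGenOInfty.measurableE.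
apply: smallest_sub; first exact: approx_sigma.
move=> _ [c ->] /=; have := approx_half c i; congr approx.
by apply/seteqP; split => x /=; rewrite in_itv/= andbT.
Qed.

End approximation.

(** Vanishing against cutoffs passes to indicators of measurable sets; the set where [f] is positive
    and its complement then give [f = 0]. *)
Lemma test_fundamental (f : X -> R) : ig f ->
  (forall phi, cutoff phi -> It (fun x => f x * phi x) = 0) -> aeD leb Om (fun x => f x = 0).
Proof.
move=> fi fphi; have fni := ig_norm fi.
have [F [mF Feq]] : exists F : X -> R, measurable_fun setT F /\ forall x, Om x -> F x = f x.
  exists (fun x => if x \in Om then f x else 0); split => [|x Ox]; last by rewrite mem_set.
  have := (measurable_restrictT f mO).1 (ig_meas fi).
  by rewrite /patch.
have key (A : set X) : measurable A -> It (fun x => f x * 1_A x) = 0.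
  move=> mA; apply/eqP; rewrite -normr_eq0 eq_le normr_ge0 andbT; apply/ler_addgt0Pr => e e0; rewrite add0r.
  have [_ /(_ _ e0)[phi cp hphi]] := approx_measurable fni (fun x => normr_ge0 (f x)) mA.
  have i1 : ig (fun x => f x * 1_A x).
    apply: (@ig_le _ _ _ leb Om mO _ _ _ fni).
      by apply: measurable_funM; [exact: ig_meas fi|exact: meas_ind].
    apply: aeDW => x _; rewrite normrM ler_piMr//.
    by have /andP[a b] := ind01 A x; rewrite ger0_norm.
  have i2 : ig (fun x => f x * phi x).
    apply: (@ig_le _ _ _ leb Om mO _ _ _ fni).
      by apply: measurable_funM; [exact: ig_meas fi|exact: test_meas cp.1].
    apply: aeDW => x _; rewrite normrM ler_piMr//.
    by have /andP[a b] := cp.2 x; rewrite ger0_norm.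
  rewrite -[It _]subr0 -(fphi _ cp) -(ItB mO i1 i2); apply: le_trans (ltW hphi).
  apply: (It_abs_le mO (igB mO i1 i2)); first exact: ig_dist.
  by apply: aeDW => x _; rewrite -mulrBr normrM distrC.
have half (g : X -> R) : ig g -> (forall x, Om x -> 0 <= g x) -> It g = 0 -> aeD leb Om (fun x => g x = 0).
  by move=> gi g0; apply: (It_eq0 mO gi); exact: aeDW.
have mpos : measurable [set x | 0 < F x].
  have := mF measurableT `]0, +oo[%classic (measurable_itv _); rewrite setTI.
  by congr measurable; apply/seteqP; split => x /=; rewrite in_itv/= andbT.
have mneg : measurable (~` [set x | 0 < F x]) by exact: measurableC.
have sg (A : set X) : measurable A -> ig (fun x => f x * 1_A x).
  move=> mA; apply: (@ig_le _ _ _ leb Om mO _ _ _ fni).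
    by apply: measurable_funM; [exact: ig_meas fi|exact: meas_ind].
  apply: aeDW => x _; rewrite normrM ler_piMr//.
  by have /andP[a b] := ind01 A x; rewrite ger0_norm.
have h1 := half _ (sg _ mpos) _ (key _ mpos).
have h2 := half _ (igN (sg _ mneg)) _ _.
apply: aeD2 (h1 _) (h2 _ _) => [x Ox|x Ox|x Ox|]; rewrite ?chfE.
- rewrite in_setC; case: (x \in _) => /=; rewrite ?mulr1 ?mulr0 ?oppr0// => _ /eqP.
  by rewrite oppr_eq0 => /eqP.
- have [h|h] := boolP (x \in _); last by rewrite mulr0.
  by rewrite mulr1 -Feq// ltW//; move: h; rewrite inE.
- have [h|h] := boolP (x \in _); last by rewrite mulr0 oppr0.
  by rewrite mulr1 oppr_ge0 -Feq// leNgt; move: h; rewrite inE => /= h; apply/negP.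
- by rewrite (ItN mO (sg _ mneg)) key// oppr0.
Qed.

(** An indicator equals its square, so replacing it by [phi^2] costs at most twice the L1 distance
    with density [|w|]; hence the precision [e / 2]. *)
Lemma test_positive (w : X -> R) (A : set X) : ig w -> measurable A ->
  0 < It (fun x => w x * 1_A x) -> exists2 phi, cutoff phi & 0 < It (fun x => w x * phi x ^+ 2).
Proof.
move=> wi mA w0; have wni := ig_norm wi.
set e := It _ in w0; have e2 : 0 < e / 2 by rewrite divr_gt0.
have [_ /(_ _ e2)[phi cp hphi]] := approx_measurable wni (fun x => normr_ge0 (w x)) mA.
exists phi => //.
have i1 : ig (fun x => w x * 1_A x).
  apply: (@ig_le _ _ _ leb Om mO _ _ _ wni).
    by apply: measurable_funM; [exact: ig_meas wi|exact: meas_ind].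
  apply: aeDW => x _; rewrite normrM ler_piMr//.
  by have /andP[a b] := ind01 A x; rewrite ger0_norm.
have i2 : ig (fun x => w x * phi x ^+ 2).
  apply: (@ig_le _ _ _ leb Om mO _ _ _ wni).
    by apply: measurable_funM; [exact: ig_meas wi|apply: measurable_funX; exact: test_meas cp.1].
  apply: aeDW => x _; rewrite normrM ler_piMr//.
  by have /andP[a b] := cp.2 x; rewrite ger0_norm ?sqr_ge0// expr_le1.
have i3 := ig_dist wni (fun x => normr_ge0 (w x)) cp mA.
suff : e - It (fun x => w x * phi x ^+ 2) < e by rewrite ltrBlDr ltrDl.
rewrite -(ItB mO i1 i2).
apply: (@le_lt_trans _ _ (2 * It (fun x => `|w x| * `|phi x - 1_A x|))); last first.
  by rewrite -ltr_pdivlMl// mulrC.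
rewrite -(ItZ mO)//; apply: (It_le mO (igB mO i1 i2) (igZ mO 2 i3)); apply: aeDW => x _.
have /andP[a1 b1] := cp.2 x; have /andP[a3 b3] := ind01 A x.
have -> : w x * 1_A x - w x * phi x ^+ 2 = w x * ((1_A x - phi x) * (1_A x + phi x)).
  have e1 : 1_A x ^+ 2 = 1_A x by rewrite chfE; case: (x \in A); rewrite ?expr1n ?expr0n.
  by rewrite -{1}e1; ring.
apply: le_trans (ler_norm _) _; rewrite 2!normrM [leRHS]mulrCA ler_wpM2l// distrC mulrC ler_wpM2r//.
by rewrite ger0_norm ?addr_ge0//; lra.
Qed.
End density.

(** * The transformed problem *)

Lemma cvg_upper {R : realType} (u : nat -> R) (l c : R) : u @ \oo --> l -> (forall j, u j <= c) -> l <= c.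
Proof.
move=> h hu; rewrite -(cvg_lim (@Rhausdorff R) h); apply: limr_le; last exact: nearW.
by apply/cvg_ex; exists l.
Qed.

Lemma abs_sqr1 {R : realType} (s : R) : `|s| <= 1 + s ^+ 2.
Proof.
have := sqr_ge0 (`|s| - 1); have := normr_ge0 s; rewrite -(real_normK (num_real s)).
by move: (`|s|) => r r0 r1; lra.
Qed.

Lemma abs_1sqr {R : realType} (s : R) : 1 + `|s| <= 2 * (1 + s ^+ 2).
Proof. by have := abs_sqr1 s; have := sqr_ge0 s; lra. Qed.

(** With [de = (1 - d) / 2] one has [ln t <= t^de / de], and [t^de >= 1 / (de e)] for large [t]; the
    exponents [de], [de] and [d] add up to 1. *)
Lemma log_growth {R : realType} (d e : R) : d < 1 -> 0 < e ->
  exists T : R, forall t, T <= t -> 1 <= ln t /\ ln t * t `^ d <= e * t.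
Proof.
move=> d1 e0; pose de := (1 - d) / 2; have de0 : 0 < de by rewrite divr_gt0// subr_gt0.
have q0 : 0 < (de * e)^-1 by rewrite invr_gt0 mulr_gt0.
exists (Num.max (expR 1) ((de * e)^-1 `^ de^-1)) => t; rewrite ge_max => /andP[t1 t2].
have t0 : 0 < t := lt_le_trans (expR_gt0 1) t1.
have tl : 1 <= ln t by rewrite -(expRK 1) ler_ln ?posrE ?expR_gt0.
have tg : 1 <= t by apply: (le_trans tl); apply: ltW; exact: ln_sublinear.
split=> //; have h1 : (de * e)^-1 <= t `^ de.
  have := ge0_ler_powR (ltW de0) _ _ t2; rewrite !nnegrE powR_ge0 (ltW t0) => /(_ isT isT).
  by rewrite -powRrM mulVf ?gt_eqF// powRr1// ltW.
have h2 := ln_powR_le de0 tg.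
have h3 : de^-1 <= e * t `^ de.
  have -> : de^-1 = e * (de * e)^-1 by field; rewrite !gt_eqF.
  by rewrite ler_pM2l.
have -> : e * t = e * t `^ de * (t `^ de * t `^ d).
  have -> : e * t `^ de * (t `^ de * t `^ d) = e * (t `^ de * t `^ de * t `^ d) by ring.
  rewrite -!powRD ?(gt_eqF t0) ?implybT//.
  have -> : de + de + d = 1 by rewrite /de; field.
  by rewrite powRr1// ltW.
rewrite mulrA; apply: ler_wpM2r; first exact: powR_ge0.
by apply: (le_trans h2); apply: ler_wpM2r; first exact: powR_ge0.
Qed.

Section two_solutions.
Context {R : realType} {n : nat}.
Local Notation X := 'rV[R]_n.
Local Notation leb := (@lebesgue_rV R n).
Variable Om : set X.
Hypotheses (oOm : open Om) (bOm : bounded_set Om) (n0 : (0 < n)%N).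
Let mO : measurable Om := mOm oOm.
Local Notation It f := (Rintegral leb Om f).
Local Notation L2 := (L2 leb Om).
Local Notation ig := (ig leb Om).
Local Notation aeD := (aeD leb Om).
Local Notation Hsp := (Hsp Om).

Variables (cp cm U0 : X -> R) (M0 : R).
Hypotheses (mcp : measurable_fun Om cp) (mcm : measurable_fun Om cm) (mU0 : measurable_fun Om U0)
  (cp0 : forall x, 0 <= cp x) (cm0 : forall x, 0 <= cm x) (cpm : forall x, cp x * cm x = 0)
  (U0M : forall x, `|U0 x| <= M0)
  (cp_pos : (0 < leb [set x | Om x /\ (0 < cp x)%R])%E).

Definition coef x : R := expR (2 * U0 x).
(** The added 1 makes the weights at least 1, so that masses dominate volumes. *)
Definition cw x : R := 1 + cp x + cm x.

Variables (d g th C : R).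
Hypotheses (d01 : 0 < d < 1) (g0 : 0 < g) (th0 : 0 < th)
  (nth2 : n%:R * (1 - th) < 2) (C0 : 0 < C)
  (cM : forall v A, L2 v -> measurable A -> morrey Om th (C * (1 + It (fun x => v x ^+ 2)) * vol Om A `^ g)
     (fun x => cw x * (1 + `|v x|) `^ d * \1_A x)).

Let a0 : R := expR (- (2 * M0)).
Let a1 : R := expR (2 * M0).
Let ma : measurable_fun Om coef.
Proof. by apply: measurableT_comp => //; apply: measurable_funM. Qed.
Let a00 : 0 < a0. Proof. exact: expR_gt0. Qed.
Let a10 : 0 < a1. Proof. exact: expR_gt0. Qed.
Let ha x : a0 <= coef x <= a1.
Proof. by have := U0M x; rewrite !ler_expR ler_norml => /andP[h1 h2]; apply/andP; split; lra. Qed.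
Let M00 : 0 <= M0. Proof. exact: le_trans (normr_ge0 _) (U0M 0). Qed.
Let a_ge0 x : 0 <= coef x. Proof. exact: expR_ge0. Qed.
Let cw1 x : 1 <= cw x. Proof. by have := cp0 x; have := cm0 x; rewrite /cw; lra. Qed.
Let c_le x : cp x + cm x <= cw x. Proof. by rewrite /cw; lra. Qed.
Let d0 : 0 < d. Proof. by case/andP: d01. Qed.
Let d01' : 0 < d <= 1. Proof. by case/andP: d01 => -> /ltW. Qed.

Local Notation form := (form coef).
Local Notation N := (nrm form).
Local Notation p s := ((1 + `|s|) `^ d).
Local Notation D := (1 + d^-1).
Local Notation wt := (wt cw d).

Let D1 : 1 <= D. Proof. by rewrite lerDl invr_ge0 ltW. Qed.
(** One constant for all growth bounds: [4 D] majorizes the constants of the truncated logarithm,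
    [a1] the coefficient [coef], and [1 + M0] the combination with [U0]. *)
Let L : R := 4 * a1 * D * (1 + M0).
Let L0 : 0 <= L.
Proof. by rewrite /L !mulr_ge0 ?addr_ge0 ?(ltW a10) ?invr_ge0 ?(ltW d0). Qed.

Let Fsym := @form_sym R n Om coef.
Let Flin := form_lin oOm bOm ma a00 ha.
Let Fpos := form_ge0 a00 ha : forall v : Hsp, 0 <= form v v.
Let wtb := wt_bound oOm bOm ma a00 ha n0 th0 nth2 C0 cM.
Let igw v := @ig_wt R n Om cw d g th C C0 cM v.
Let wt1 := wt_ge1 cw1 d01'.
Let wt0 := wt_ge0 cw1 d01'.
Let sqN (v : Hsp) : N v ^+ 2 = form v v := sqr_nrm Fpos v.

Lemma unit_bound : exists2 B : R, 0 <= B & forall w : Hsp, N w <= 2 ->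
  It (wt (fn w)) <= B /\ It (fun x => wt (fn w) x * fn w x ^+ 2) <= B.
Proof.
have [C1 C11 hC1] := wtb; have [P P0 hP] := poincare_form oOm bOm ma a00 ha n0.
have vT : 0 <= vol Om setT by rewrite fine_ge0.
pose B1 := C * (1 + P * 4) * vol Om setT `^ g * vol Om setT `^ th.
pose B2 := C1 * (1 + 2) ^+ 2 * 2 ^+ 2.
have B20 : 0 <= B2 by rewrite !mulr_ge0 ?sqr_ge0// (le_trans ler01).
exists (Num.max B1 B2) => [|w w2]; first by rewrite le_max B20 orbT.
have w0 : 0 <= N w := nrm_ge0 _ _.
have w22 : N w ^+ 2 <= 2 ^+ 2 by rewrite ler_pXn2r ?nnegrE.
split; rewrite le_max; apply/orP; [left|right].
  have [_ _ /(_ setT measurableT)] := cM (fn_L2 oOm bOm w) measurableT.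
  have -> : It (fun x => cw x * (1 + `|fn w x|) `^ d * \1_[set: X] x * \1_[set: X] x) = It (wt (fn w)).
    by apply: eq_It => x _; rewrite !indicT !mulr1.
  move=> h; apply: (le_trans h); rewrite ler_wpM2r ?powR_ge0// ler_wpM2r ?powR_ge0//.
  rewrite ler_pM2l// lerD2l; apply: (le_trans (hP w)); rewrite ler_pM2l//.
  by apply: (le_trans w22); rewrite expr2; lra.
have [_ h] := hC1 w w; apply: (le_trans h); apply: ler_pM => //; rewrite ?sqr_ge0//.
  by rewrite mulr_ge0 ?sqr_ge0// (le_trans ler01).
rewrite ler_pM2l ?(lt_le_trans ltr01)// ler_pXn2r ?nnegrE//; first lra.
by rewrite addr_ge0.
Qed.

(** * The functional for a fixed parameter *)

Section parameter.
Variable lam : R.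
Hypotheses (lam0 : 0 < lam) (lam1 : lam <= 1).

(** The nonlinearity, its primitive and the limit profiles all have this shape, linear in [(A, B)];
    estimates on [Gf], [ybar], [Ff] and [Kf] are thus transferred by the single bound [lin_le]. *)
Definition lin x (A B : R) : R := coef x * (lam * cp x * (A + U0 x * B) - cm x * A).
Definition psi x s := lin x (Gf s) (ybar s).
Definition Psi x s := lin x (Ff s) (Kf s).

Lemma linB x A B A' B' : lin x A B - lin x A' B' = lin x (A - A') (B - B').
Proof. by rewrite /lin; ring. Qed.

Lemma linZ k x A B : k * lin x A B = lin x (k * A) (k * B).
Proof. by rewrite /lin; ring. Qed.

Lemma lin_le x A B y : 0 <= y -> `|A| <= 4 * D * y -> `|B| <= 4 * D * y ->
  `|lin x A B| <= L * (cp x + cm x) * y.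
Proof.
move=> y0 hA hB; set z := 4 * D * y in hA hB.
have z0 : 0 <= z := le_trans (normr_ge0 _) hA.
have -> : L * (cp x + cm x) * y = a1 * ((cp x + cm x) * ((1 + M0) * z)) by rewrite /L /z; ring.
rewrite normrM (ger0_norm (a_ge0 x)); apply: ler_pM => //; first by case/andP: (ha x).
have h1 : `|A + U0 x * B| <= (1 + M0) * z.
  apply: (le_trans (ler_normD _ _)); rewrite mulrDl mul1r; apply: lerD => //.
  by rewrite normrM; apply: ler_pM.
have h2 : `|A| <= (1 + M0) * z.
  by apply: (le_trans hA); rewrite ler_peMl// lerDl.
rewrite mulrDl; apply: (le_trans (ler_normB _ _)); rewrite !normrM (gtr0_norm lam0) (ger0_norm (cp0 x)) (ger0_norm (cm0 x)).
apply: lerD; last exact: ler_wpM2l.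
by apply: ler_pM => //; [apply: mulr_ge0 => //; exact: ltW|rewrite ler_piMl].
Qed.

Lemma lin_le_c x A B y : 0 <= y -> `|A| <= 4 * D * y -> `|B| <= 4 * D * y ->
  `|lin x A B| <= L * (cw x * y).
Proof.
move=> y0 hA hB; apply: (le_trans (lin_le x y0 hA hB)).
by rewrite -mulrA; apply: ler_wpM2l => //; apply: ler_wpM2r.
Qed.

Let p1 (s : R) : 1 <= p s. Proof. exact: pow_ge1 (ltW d0). Qed.
Let k1 y : 0 <= y -> D * y <= 4 * D * y.
Proof. by move=> y0; rewrite -mulrA; have := mulr_ge0 (le_trans ler01 D1) y0; move: (D * y) => z; lra. Qed.
Let k2 y : 0 <= y -> 3 * D * y <= 4 * D * y.
Proof. by move=> y0; rewrite -!mulrA; have := mulr_ge0 (le_trans ler01 D1) y0; move: (D * y) => z; lra. Qed.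
Let k3 y : 0 <= y -> 4 * y <= 4 * D * y.
Proof. by move=> y0; rewrite -[leRHS]mulrA ler_pM2l// ler_peMl. Qed.
Let py (s y : R) : 0 <= y -> y <= p s * y.
Proof. by move=> y0; rewrite ler_peMl. Qed.

Lemma psi_lip x (s t : R) : `|psi x s - psi x t| <= L * (cw x * p s + cw x * p t) * `|s - t|.
Proof.
rewrite linB -mulrDr -mulrA -[cw x * _ * _]mulrA; have ps := p1 s; have pt := p1 t.
have y0 : 0 <= (p s + p t) * `|s - t| by rewrite mulr_ge0// addr_ge0// (le_trans ler01).
apply: lin_le_c => //.
  by apply: (le_trans (Gf_lip s t d0)); rewrite -mulrA; exact: k1.
apply: (le_trans (ybar_lip s t)); apply: le_trans (k3 y0).
by rewrite mulrA ler_peMl//; lra.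
Qed.

Lemma Psi_tay x (s t : R) :
  `|Psi x t - Psi x s - psi x s * (t - s)| <= L * (cw x * p s + cw x * p t) * (t - s) ^+ 2.
Proof.
rewrite linB [psi x s * _]mulrC linZ linB -mulrDr -mulrA -[cw x * _ * _]mulrA; have ps := p1 s; have pt := p1 t.
have y0 : 0 <= (p s + p t) * (t - s) ^+ 2 by rewrite mulr_ge0 ?sqr_ge0// addr_ge0// (le_trans ler01).
apply: lin_le_c => //.
  rewrite [(t - s) * Gf s]mulrC; apply: (le_trans (Ff_tay s t)).
  apply: le_trans (k1 y0).
  rewrite -(real_normK (num_real (t - s))) expr2 !mulrA; apply: ler_wpM2r => //.
  by rewrite [p s + p t]addrC; exact: Gf_lip.
rewrite [(t - s) * ybar s]mulrC; apply: (le_trans (Kf_tay s t)).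
by apply: le_trans (k3 y0); rewrite mulrA ler_peMl ?sqr_ge0//; lra.
Qed.

Lemma psi0_le x : `|psi x 0| <= L * cw x.
Proof.
rewrite -[cw x]mulr1; apply: lin_le_c => //; rewrite ?Gf0 ?ybar0 ?normr0 ?normr1; by have := D1; lra.
Qed.

Lemma Psi0 x : Psi x 0 = 0. Proof. by rewrite /Psi /lin Ff0 Kf0; ring. Qed.

Lemma Psi_gap x s : `|psi x s * s - 2 * Psi x s - 2^-1 * lin x (pos s ^+ 2) 0| <=
  L * (cw x * (p s * (1 + `|s|))).
Proof.
rewrite [psi x s * _]mulrC !linZ !linB; have ps := p1 s; have s0 := normr_ge0 s.
have y0 : 0 <= p s * (1 + `|s|) by rewrite mulr_ge0 ?addr_ge0// (le_trans ler01).
apply: lin_le_c => //; first by rewrite [s * _]mulrC [leRHS]mulrA; exact: energy_gap.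
rewrite mulr0 subr0 [s * _]mulrC; apply: (le_trans (Kf_gap s)).
have h : 1 + `|s| <= p s * (1 + `|s|) by rewrite ler_peMl ?addr_ge0.
by apply: le_trans (k3 y0); move: (p s * _) h y0 => q h y0; lra.
Qed.

Lemma psi_large x s t : 1 <= ln t ->
  `|psi x (t * s) - t * ln t * lin x (pos s) 0| <= L * (cw x * (t * (p s * (1 + `|s|)))).
Proof.
move=> t1; have t0 : 0 < t by rewrite ltNge; apply/negP => /ln0 h; move: t1; rewrite h ler10.
rewrite linZ linB mulr0 subr0; have ps := p1 s; have s0 := normr_ge0 s.
have y0 : 0 <= p s * (1 + `|s|) by rewrite mulr_ge0 ?addr_ge0// (le_trans ler01).
have z0 : 0 <= t * (p s * (1 + `|s|)) by rewrite mulr_ge0// ltW.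
have tg : 1 <= t by apply: (le_trans t1); apply: ltW; exact: ln_sublinear.
apply: lin_le_c => //.
  by apply: (le_trans (Gf_large d0 t1 s)); rewrite -[leLHS]mulrA; exact: k2.
rewrite ger0_norm ?(ltW (ybar_gt0 _))//; apply: (le_trans (ybar_le _)).
rewrite normrM (gtr0_norm t0); apply: (@le_trans _ _ (t * (1 + `|s|))); first by lra.
apply: le_trans (k3 z0); apply: (@le_trans _ _ (t * (p s * (1 + `|s|)))).
  by rewrite ler_pM2l// ler_peMl ?addr_ge0.
by rewrite ler_peMl//; lra.
Qed.

Lemma Psi_large x s t : 1 <= ln t ->
  `|Psi x (t * s) - 2^-1 * (t ^+ 2 * ln t) * lin x (pos s ^+ 2) 0| <= L * (cp x + cm x) * (t ^+ 2 * (p s * rem t s)).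
Proof.
move=> t1; rewrite linZ linB mulr0 subr0; have ps := p1 s.
have y0 : 0 <= t ^+ 2 * (p s * rem t s).
  by apply: mulr_ge0; [exact: sqr_ge0|apply: mulr_ge0; [exact: le_trans ps|exact: rem_ge0]].
apply: lin_le => //.
  by rewrite [2^-1 * _]mulrA [leRHS]mulrA; exact: Ff_large.
by apply: (le_trans (Kf_large d0 t1 s)); rewrite -[leLHS]mulrA; exact: k1.
Qed.

(** The term with [cm] has the favourable sign because [Ff] is nonnegative; what is left carries the
    factor [lam]. *)
Lemma Psi_le x (s : R) : Psi x s <= lam * L * (cw x * (p s * (1 + s ^+ 2))).
Proof.
have ps := p1 s; have y0 : 0 <= p s * (1 + s ^+ 2) by rewrite mulr_ge0 ?addr_ge0 ?sqr_ge0// (le_trans ler01).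
have f0 := Ff_ge0 s; have s20 := sqr_ge0 s.
have hF : `|Ff s| <= 4 * D * (p s * (1 + s ^+ 2)).
  have := Ff_tay 0 s; rewrite Ff0 Gf0 mul0r !subr0 => h; apply: (le_trans h).
  have := Gf_lip s 0 d0; rewrite Gf0 !subr0 normr0 addr0 powR1 => h2.
  apply: (le_trans (ler_wpM2r (normr_ge0 s) h2)).
  rewrite -!mulrA -expr2 real_normK ?num_real//.
  have h3 : (p s + 1) * s ^+ 2 <= 4 * (p s * (1 + s ^+ 2)).
    have := ler_wpM2r s20 ps; have := ps; rewrite mul1r; have := mulr_ge0 (le_trans ler01 ps) s20; move: (p s) (s ^+ 2) s20 => q r; lra.
  have Dp : 0 <= D by exact: le_trans D1.
  have := ler_wpM2l Dp h3; move: (p s * (1 + s ^+ 2)) ((p s + 1) * _) => q r; lra.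
have hK : `|Kf s| <= 4 * D * (p s * (1 + s ^+ 2)).
  have := Kf_tay 0 s; rewrite Kf0 ybar0 mul1r !subr0 => h.
  have h1 : `|Kf s| <= `|s| + s ^+ 2.
    by rewrite -{1}(subrK s (Kf s)) addrC; apply: (le_trans (ler_normD _ _)); rewrite lerD2l.
  apply: (le_trans h1); apply: (@le_trans _ _ (2 * (p s * (1 + s ^+ 2)))).
    have h2 := abs_sqr1 s.
    have h3 : 1 + s ^+ 2 <= p s * (1 + s ^+ 2) by rewrite ler_peMl// addr_ge0.
    by move: (p s * _) h3 => q h3; lra.
  by apply: le_trans (k3 y0); move: (p s * _) y0 => q y0; lra.
set y := p s * _ in y0 hF hK *.
rewrite /Psi /lin; apply: (@le_trans _ _ (coef x * (lam * cp x * (Ff s + U0 x * Kf s)))).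
  by apply: ler_wpM2l => //; rewrite gerBl mulr_ge0.
have -> : lam * L * (cw x * y) = a1 * (lam * (cw x * ((1 + M0) * (4 * D * y)))) by rewrite /L; ring.
apply: (@le_trans _ _ (coef x * (lam * (cw x * ((1 + M0) * (4 * D * y)))))); last first.
  apply: ler_wpM2r; last by case/andP: (ha x).
  have z0 : 0 <= 4 * D * y := le_trans (normr_ge0 _) hF.
  apply: mulr_ge0; first exact: ltW.
  apply: mulr_ge0; first exact: le_trans ler01 (cw1 x).
  by apply: mulr_ge0 => //; exact: addr_ge0.
apply: ler_wpM2l => //; rewrite -[leLHS]mulrA; apply: ler_wpM2l; first exact: ltW.
have h : `|Ff s + U0 x * Kf s| <= (1 + M0) * (4 * D * y).
  apply: (le_trans (ler_normD _ _)); rewrite mulrDl mul1r; apply: lerD => //.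
  by rewrite normrM; apply: ler_pM.
apply: (@le_trans _ _ (cp x * `|Ff s + U0 x * Kf s|)); first by apply: ler_wpM2l => //; exact: ler_norm.
by apply: ler_pM => //; have := cm0 x; rewrite /cw; lra.
Qed.

Let cpt_meas (h : R -> R) (v : X -> R) : measurable_fun setT h -> measurable_fun Om v ->
  measurable_fun Om (fun x => h (v x)).
Proof. by move=> mh mv; exact: measurableT_comp. Qed.

Let m_ybar : measurable_fun setT (@ybar R).
Proof. by apply: measurable_maxr => //; apply: measurable_funD. Qed.
Let m_ln : measurable_fun setT (fun s : R => ln (ybar s)).
Proof. by apply: measurableT_comp => //; exact: measurable_ln. Qed.
Let m_Gf : measurable_fun setT (@Gf R). Proof. exact: measurable_funM. Qed.
Let m_Kf : measurable_fun setT (@Kf R).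
Proof.
apply: measurable_funD; first by apply: measurable_funB => //; apply: measurable_funM => //; exact: measurable_funX.
apply: measurable_funM => //; apply: measurable_funB => //; exact: measurable_funD.
Qed.
Let m_Ff : measurable_fun setT (@Ff R).
Proof.
apply: measurable_funD; last first.
  by apply: measurable_funM => //; apply: measurable_funB => //; exact: measurable_funD.
apply: measurable_funD => //; apply: measurable_funB; last by apply: measurable_funM => //; exact: measurable_funX.
by apply: measurable_funM => //; apply: measurable_funM => //; exact: measurable_funX.
Qed.

Lemma m_lin (A B : X -> R) : measurable_fun Om A -> measurable_fun Om B ->
  measurable_fun Om (fun x => lin x (A x) (B x)).
Proof.
move=> mA mB; apply: measurable_funM => //; apply: measurable_funB; last exact: measurable_funM.
apply: measurable_funM; first exact: measurable_funM.
by apply: measurable_funD => //; exact: measurable_funM.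
Qed.

Lemma mpsi v : measurable_fun Om v -> measurable_fun Om (fun x => psi x (v x)).
Proof. by move=> mv; apply: m_lin; exact: cpt_meas. Qed.
Lemma mPsi v : measurable_fun Om v -> measurable_fun Om (fun x => Psi x (v x)).
Proof. by move=> mv; apply: m_lin; exact: cpt_meas. Qed.

Let igpsi := ig_psi oOm bOm ma a00 ha n0 cw1 d01' th0 nth2 C0 cM L0 mpsi psi_lip psi0_le.
Let igPsi := ig_Psi oOm bOm ma a00 ha n0 cw1 d01' th0 nth2 C0 cM L0 mPsi Psi_tay psi0_le Psi0.

Definition critical (v : Hsp) := forall z : Hsp, form v z = It (fun x => psi x (fn v x) * fn z x).
Local Notation J := (energy coef Psi).
Let wts (w : Hsp) : ig (fun x => wt (fn w) x * fn w x ^+ 2).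
Proof. by have [C1 _ h] := wtb; have [] := h w w. Qed.
Let ig1 (w : Hsp) : ig (fun x => wt (fn w) x * (1 + fn w x ^+ 2)).
Proof.
have := igD mO (igw (fn_L2 oOm bOm w)) (wts w); congr ig; apply/funext => x.
by rewrite mulrDr mulr1.
Qed.
Let It1 (w : Hsp) : It (fun x => wt (fn w) x * (1 + fn w x ^+ 2)) =
  It (wt (fn w)) + It (fun x => wt (fn w) x * fn w x ^+ 2).
Proof.
rewrite -(ItD mO (igw (fn_L2 oOm bOm w)) (wts w)); apply: eq_It => x _.
by rewrite mulrDr mulr1.
Qed.

Let m_pos : measurable_fun setT (@pos R).
Proof. exact: measurable_maxr. Qed.

Lemma ig_linpos (w : Hsp) : ig (fun x => lin x (pos (fn w x) ^+ 2) 0).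
Proof.
apply: (@ig_le _ _ _ leb Om mO _ (fun x => L * (wt (fn w) x * (1 + fn w x ^+ 2)))).
- apply: m_lin => //; apply: measurable_funX; apply: cpt_meas => //; exact: fn_meas.
- exact: igZ.
apply: aeDW => x _; set s := fn w x; have s2 := sqr_ge0 s.
have y0 : 0 <= p s * (1 + s ^+ 2) by rewrite mulr_ge0 ?addr_ge0 ?powR_ge0.
have -> : wt (fn w) x * (1 + s ^+ 2) = cw x * (p s * (1 + s ^+ 2)) by rewrite mulrA.
apply: lin_le_c => //; last by rewrite normr0 mulr_ge0// mulr_ge0// (le_trans ler01).
apply: le_trans (k3 y0); rewrite ger0_norm ?sqr_ge0//.
have h1 : pos s ^+ 2 <= s ^+ 2.
  by rewrite -(real_normK (num_real s)) ler_pXn2r ?nnegrE ?pos_ge0 ?pos_le.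
have h2 := @py s (1 + s ^+ 2) (addr_ge0 ler01 s2); lra.
Qed.

Let scale_wt (w : Hsp) (t : R) x : 1 <= t -> cw x * (p (t * fn w x) * (1 + `|t * fn w x|)) <=
  2 * (t `^ d * t) * (wt (fn w) x * (1 + fn w x ^+ 2)).
Proof.
move=> t1; have t0 : 0 <= t := le_trans ler01 t1; set s := fn w x.
have e1 : 1 + `|t * s| <= t * (1 + `|s|) by rewrite normrM (ger0_norm t0) mulrDr mulr1 lerD2r.
have e2 : p (t * s) <= t `^ d * p s.
  by rewrite -powRM ?addr_ge0//; apply: ge0_ler_powR; rewrite ?nnegrE ?mulr_ge0 ?addr_ge0// ltW.
have e3 := abs_1sqr s.
have wE : wt (fn w) x = cw x * p s by [].
have -> : 2 * (t `^ d * t) * (wt (fn w) x * (1 + s ^+ 2)) =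
  cw x * ((t `^ d * p s) * (t * (2 * (1 + s ^+ 2)))) by rewrite wE; ring.
apply: ler_wpM2l; first exact: le_trans ler01 (cw1 x).
apply: ler_pM; rewrite ?powR_ge0 ?addr_ge0//.
by apply: (le_trans e1); apply: ler_wpM2l.
Qed.

Let Nge0 (v : Hsp) : 0 <= N v := nrm_ge0 _ v.

(** * Estimates along a direction at large norm *)

Section large_norm.
Variables (G : Hsp -> Hsp) (B : R) (w : Hsp) (t : R).
Hypotheses (hG : forall v z, form (G v) z = form v z - It (fun x => psi x (fn v x) * fn z x))
  (B0 : 0 <= B) (w1 : N w = 1) (t1 : 1 <= ln t)
  (hB1 : It (wt (fn w)) <= B) (hB2 : It (fun x => wt (fn w) x * fn w x ^+ 2) <= B).
Local Notation v := (t *: w).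
Let t0 : 0 < t. Proof. by rewrite ltNge; apply/negP => /ln0 h; move: t1; rewrite h ler10. Qed.
Let tg : 1 <= t. Proof. by apply: (le_trans t1); apply: ltW; exact: ln_sublinear. Qed.
Let fv x : fn v x = t * fn w x := fnZ t w x.
Let B1 : It (fun x => wt (fn w) x * (1 + fn w x ^+ 2)) <= 2 * B.
Proof. by rewrite It1 mulr_natl mulr2n lerD. Qed.

(** In [2 J v - form (G v) v] the quadratic form cancels, and by [Psi_gap] half of the integral of
    [lin x (pos v ^+ 2) 0] remains. The error is of order [t^(1 + d)], smaller than the [t^2] of the
    main term. *)
Lemma large_gap : t ^+ 2 * `|It (fun x => lin x (pos (fn w x) ^+ 2) 0)| <=
  2 * (2 * `|J v| + N (G v) * N v) + 8 * L * B * (t `^ d * t).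
Proof.
have i1 : ig (fun x => psi x (fn v x) * fn v x) := igpsi v v.
have i2 : ig (fun x => Psi x (fn v x)) := igPsi v.
have i3 := igB mO i1 (igZ mO 2 i2).
have e1 : 2 * J v - form (G v) v = It (fun x => psi x (fn v x) * fn v x - 2 * Psi x (fn v x)).
  by rewrite (ItB mO i1 (igZ mO 2 i2)) (ItZ mO _ i2) hG /energy; field.
have i4 := igZ mO 2^-1 (ig_linpos v).
have e2 : `|2 * J v - form (G v) v - 2^-1 * It (fun x => lin x (pos (fn v x) ^+ 2) 0)| <=
    It (fun x => L * (2 * (t `^ d * t) * (wt (fn w) x * (1 + fn w x ^+ 2)))).
  rewrite e1 -(ItZ mO _ (ig_linpos v)) -(ItB mO i3 i4).
  apply: (It_abs_le mO (igB mO i3 i4)); first by apply: igZ => //; exact: igZ.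
  apply: aeDW => x _; apply: (le_trans (Psi_gap x (fn v x))).
  by apply: ler_wpM2l => //; rewrite fv; exact: scale_wt.
rewrite (ItZ mO _ (igZ mO _ (ig1 w))) (ItZ mO _ (ig1 w)) in e2.
have e3 : It (fun x => lin x (pos (fn v x) ^+ 2) 0) = t ^+ 2 * It (fun x => lin x (pos (fn w x) ^+ 2) 0).
  rewrite -(ItZ mO _ (ig_linpos w)); apply: eq_It => x _; rewrite linZ mulr0 fv; congr lin.
  rewrite -exprMn; congr (_ ^+ _).
  have [s0|s0] := leP 0 (fn w x).
    by rewrite !pos_id// mulr_ge0// ltW.
  by rewrite !pos_0 ?mulr0// ?ltW// pmulr_rlt0.
rewrite e3 in e2.
have e4 : `|form (G v) v| <= N (G v) * N v by exact: B_CS Fsym Flin Fpos _ _.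
have td : 0 <= t `^ d * t by rewrite mulr_ge0 ?powR_ge0// ltW.
have e5 : L * (2 * (t `^ d * t) * It (fun x => wt (fn w) x * (1 + fn w x ^+ 2))) <= L * (2 * (t `^ d * t) * (2 * B)).
  by apply: ler_wpM2l => //; apply: ler_wpM2l => //; rewrite mulr_ge0.
have -> : t ^+ 2 * `|It (fun x => lin x (pos (fn w x) ^+ 2) 0)| = `|t ^+ 2 * It (fun x => lin x (pos (fn w x) ^+ 2) 0)|.
  by rewrite [RHS]normrM [in RHS](ger0_norm (sqr_ge0 t)).
have -> : 8 * L * B * (t `^ d * t) = 2 * (L * (2 * (t `^ d * t) * (2 * B))) by ring.
have e6 := le_trans e2 e5; move: e6 e4; clear e2 e5.
have h1 := ler_norm (J v); have h2 := lerNnormlW (lexx `|J v|); move: h1 h2.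
move: (L * (2 * _ * (2 * B))) (form (G v) v) (t ^+ 2 * It _) (N (G v) * N v) (`|J v|) => z2 z3 z4 z6 z7.
by rewrite !ler_norml => h1 h2 /andP[h3 h4] /andP[h5 h6]; apply/andP; split; lra.
Qed.

(** The gradient is paired with a fixed bounded [phi] and divided by [t]: the main term keeps the
    factor [ln t], and the other terms stay bounded. *)
Lemma large_test (phi : Hsp) : (forall x, `|fn phi x| <= 1) ->
  `|It (fun x => lin x (pos (fn w x)) 0 * fn phi x)| * ln t <= (N (G v) + 1) * N phi + 4 * L * B.
Proof.
move=> phi1; have i1 := igpsi v phi.
have i2 : ig (fun x => lin x (pos (fn w x)) 0 * fn phi x).
  apply: (@ig_le _ _ _ leb Om mO _ (fun x => L * (wt (fn w) x * (1 + fn w x ^+ 2)))).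
  - apply: measurable_funM; last exact: fn_meas.
    by apply: m_lin => //; apply: cpt_meas => //; exact: fn_meas.
  - exact: igZ.
  apply: aeDW => x _; set s := fn w x; have s2 := sqr_ge0 s.
  have y0 : 0 <= p s * (1 + s ^+ 2) by rewrite mulr_ge0 ?addr_ge0 ?powR_ge0.
  have -> : wt (fn w) x * (1 + s ^+ 2) = cw x * (p s * (1 + s ^+ 2)) by rewrite mulrA.
  rewrite normrM -[leRHS]mulr1; apply: ler_pM => //.
  apply: lin_le_c => //; last by rewrite normr0 mulr_ge0// mulr_ge0// (le_trans ler01).
  apply: le_trans (k3 y0); rewrite ger0_norm ?pos_ge0//; apply: (le_trans (pos_le s)).
  have h2 := @py s (1 + s ^+ 2) (addr_ge0 ler01 s2).
  by have := abs_sqr1 s; move: (p s * _) h2 => q h2; lra.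
have i3 := igZ mO (t * ln t) i2.
have e1 : form (G v) phi = t * form w phi - It (fun x => psi x (fn v x) * fn phi x).
  by rewrite hG (BZl Flin).
have e2 : `|It (fun x => psi x (fn v x) * fn phi x) - t * ln t * It (fun x => lin x (pos (fn w x)) 0 * fn phi x)| <=
    L * (t * (2 * (2 * B))).
  rewrite -(ItZ mO _ i2) -(ItB mO i1 i3).
  apply: (@le_trans _ _ (L * (t * (2 * It (fun x => wt (fn w) x * (1 + fn w x ^+ 2)))))); last first.
    by apply: ler_wpM2l => //; rewrite ler_pM2l// ler_pM2l.
  rewrite -(ItZ mO 2 (ig1 w)) -(ItZ mO t (igZ mO 2 (ig1 w))) -(ItZ mO L (igZ mO t (igZ mO 2 (ig1 w)))).
  apply: (It_abs_le mO (igB mO i1 i3)); first by apply: igZ => //; apply: igZ => //; exact: igZ.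
  apply: aeDW => x _; rewrite mulrA -mulrBl normrM -[leRHS]mulr1; apply: ler_pM => //.
  rewrite fv; apply: (le_trans (psi_large x (fn w x) t1)); apply: ler_wpM2l => //.
  set s := fn w x.
  have wE : wt (fn w) x = cw x * p s by [].
  have e3 := abs_1sqr s.
  have -> : t * (2 * (wt (fn w) x * (1 + s ^+ 2))) = cw x * (t * (p s * (2 * (1 + s ^+ 2)))) by rewrite wE; ring.
  apply: ler_wpM2l; first exact: le_trans ler01 (cw1 x).
  by rewrite ler_pM2l//; apply: ler_wpM2l => //; exact: powR_ge0.
have e4 : `|form (G v) phi| <= N (G v) * N phi by exact: B_CS Fsym Flin Fpos _ _.
have e5 : `|form w phi| <= N phi.
  by have := B_CS Fsym Flin Fpos w phi; rewrite w1 mul1r.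
have tau0 : 0 <= ln t := le_trans ler01 t1.
rewrite -(@ler_pM2l _ t)//.
have -> : t * (`|It (fun x => lin x (pos (fn w x)) 0 * fn phi x)| * ln t) =
  `|t * ln t * It (fun x => lin x (pos (fn w x)) 0 * fn phi x)|.
  by rewrite normrM (ger0_norm (mulr_ge0 (ltW t0) tau0)); ring.
have e6 : `|t * form w phi| <= t * N phi by rewrite normrM (gtr0_norm t0) ler_pM2l.
have e7 : N (G v) * N phi <= t * (N (G v) * N phi) by rewrite ler_peMl// mulr_ge0.
have -> : t * ((N (G v) + 1) * N phi + 4 * L * B) = t * (N (G v) * N phi) + t * N phi + L * (t * (2 * (2 * B))) by ring.
move: e1 e2 e4 e6 e7; move: (It _) (t * ln t * It _) (t * form w phi) (form (G v) phi) (t * (N (G v) * N phi))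
  (N (G v) * N phi) (t * N phi) (L * (t * (2 * (2 * B)))) => z1 z2 z3 z4 z5 z6 z7 z8.
by rewrite !ler_norml => e1 /andP[h1 h2] /andP[h3 h4] /andP[h5 h6] h7; apply/andP; split; lra.
Qed.

(** [Psi_large] is integrated. Where [cp + cm > 0] the profile [wl] is nonpositive, so
    [pos w <= |w - wl|]; with [|y| <= e + y^2 / e] the remainder is controlled by the weighted
    distance to [wl]. *)
Lemma large_energy (wl : X -> R) (e E : R) : measurable_fun Om wl -> 0 < e ->
  aeD (fun x => 0 < cp x + cm x -> wl x <= 0) ->
  ig (fun x => wt (fn w) x * (fn w x - wl x) ^+ 2) ->
  It (fun x => wt (fn w) x * (fn w x - wl x) ^+ 2) <= E ->
  `|J v / t ^+ 2 - 2^-1 + 2^-1 * (ln t * It (fun x => lin x (pos (fn w x) ^+ 2) 0))| <=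
  L * (e * B + (1 + e^-1) * E + ln t / t * (4 * B)).
Proof.
move=> mwl e0 aewl iE hE; have eV : 0 < e^-1 by rewrite invr_gt0.
have i1 := igPsi v; have i2 := ig_linpos w; have i3 := igZ mO (2^-1 * (t ^+ 2 * ln t)) i2.
have tt : 0 < t ^+ 2 by rewrite exprn_gt0.
have tau0 : 0 <= ln t := le_trans ler01 t1.
have eJ : t ^+ 2 * (J v / t ^+ 2 - 2^-1 + 2^-1 * (ln t * It (fun x => lin x (pos (fn w x) ^+ 2) 0))) =
    - It (fun x => Psi x (fn v x) - 2^-1 * (t ^+ 2 * ln t) * lin x (pos (fn w x) ^+ 2) 0).
  have e1 : form v v = t ^+ 2 by rewrite -sqN (nrmZ Fsym Flin) w1 mulr1 real_normK ?num_real.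
  rewrite (ItB mO i1 i3) (ItZ mO _ i2) /energy e1; field; by rewrite gt_eqF.
rewrite -(@ler_pM2l _ (t ^+ 2))// -{1}(ger0_norm (ltW tt)) -normrM eJ normrN.
pose W x := wt (fn w) x * (e + (1 + e^-1) * (fn w x - wl x) ^+ 2 + ln t / t * (2 * (1 + fn w x ^+ 2))).
have iW0 := igw (fn_L2 oOm bOm w).
have j1 := igZ mO e iW0; have j2 := igZ mO (1 + e^-1) iE; have j3 := igZ mO (ln t / t) (igZ mO 2 (ig1 w)).
have WE : W = fun x => e * wt (fn w) x + (1 + e^-1) * (wt (fn w) x * (fn w x - wl x) ^+ 2) +
   ln t / t * (2 * (wt (fn w) x * (1 + fn w x ^+ 2))).
  by apply/funext => x; rewrite /W; move: (ln t / t) => k; ring.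
have iW : ig W by rewrite WE; have := igD mO (igD mO j1 j2) j3.
apply: (@le_trans _ _ (L * (t ^+ 2 * It W))); last first.
  rewrite mulrCA; apply: ler_wpM2l; first exact: ltW.
  apply: ler_wpM2l => //; rewrite WE (ItD mO (igD mO j1 j2) j3) (ItD mO j1 j2) (ItZ mO _ iW0) (ItZ mO _ iE) (ItZ mO _ (igZ mO 2 (ig1 w))) (ItZ mO _ (ig1 w)).
  apply: lerD; first apply: lerD.
  - by rewrite ler_pM2l.
  - by rewrite ler_pM2l// addr_gt0.
  - have -> : 4 * B = 2 * (2 * B) by ring.
    by apply: ler_wpM2l; [rewrite divr_ge0// ltW|rewrite ler_pM2l].
rewrite -(ItZ mO _ iW) -(ItZ mO _ (igZ mO _ iW)).
apply: (It_abs_le mO (igB mO i1 i3)); first by apply: igZ => //; exact: igZ.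
apply: aeD1 aewl => x Ox hwl; rewrite fv; apply: (le_trans (Psi_large x (fn w x) t1)).
rewrite -mulrA; apply: ler_wpM2l => //; rewrite mulrCA; apply: ler_wpM2l; first exact: ltW.
have c0 : 0 <= cp x + cm x by rewrite addr_ge0.
have [c00|cn] := eqVneq (cp x + cm x) 0.
  have s2 := sqr_ge0 (fn w x); rewrite c00 mul0r /W; apply: mulr_ge0; first exact: wt0.
  apply: addr_ge0; last first.
    by apply: mulr_ge0; [apply: divr_ge0 => //; exact: ltW|apply: mulr_ge0 => //; exact: addr_ge0].
  apply: addr_ge0; first exact: ltW.
  by apply: mulr_ge0; [apply/ltW; exact: addr_gt0|exact: sqr_ge0].
have cpos : 0 < cp x + cm x by rewrite lt_def cn.
have wl0 := hwl cpos.
have wE : wt (fn w) x = cw x * p (fn w x) by [].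
rewrite /W wE [leLHS]mulrA; apply: ler_pM.
- by rewrite mulr_ge0 ?powR_ge0.
- exact: rem_ge0.
- by apply: ler_wpM2r; rewrite ?powR_ge0.
set s := fn w x; set y := s - wl x.
have py1 : pos s <= `|y|.
  rewrite ge_max normr_ge0 andbT; apply: le_trans (ler_norm _); rewrite /y; lra.
have py2 : pos s ^+ 2 <= y ^+ 2.
  by rewrite -(real_normK (num_real y)) ler_pXn2r ?nnegrE ?pos_ge0.
have py3 : `|y| <= e + e^-1 * y ^+ 2.
  rewrite -(real_normK (num_real y)); move: (`|y|) (normr_ge0 y) => r r0.
  have h : 0 <= e^-1 * (e - r) ^+ 2 by rewrite mulr_ge0 ?sqr_ge0// ltW.
  have h2 : e^-1 * (e - r) ^+ 2 = e - 2 * r + e^-1 * r ^+ 2 by field; rewrite gt_eqF.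
  by rewrite h2 in h; lra.
have e3 := abs_1sqr s.
rewrite /rem; apply: lerD; last by apply: ler_wpM2l => //; rewrite divr_ge0// ltW.
by move: (pos s) (pos s ^+ 2) (e^-1 * y ^+ 2) (y ^+ 2) py1 py2 py3 (mulrDl 1 e^-1 (y ^+ 2)) => z1 z2 z3 z4 h1 h2 h3 h4; lra.
Qed.

End large_norm.

Lemma pos_lip (s t : R) : `|pos s - pos t| <= `|s - t|.
Proof.
rewrite /pos; have [a|a] := leP s 0; have [b|b] := leP t 0.
- by rewrite subrr normr0.
- by rewrite sub0r normrN (gtr0_norm b) distrC ger0_norm; lra.
- by rewrite subr0 (gtr0_norm a) ger0_norm; lra.
- by [].
Qed.

Let abs_sqr (y e : R) : 0 < e -> `|y| <= e + e^-1 * y ^+ 2.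
Proof.
move=> e0; rewrite -(real_normK (num_real y)); move: (`|y|) (normr_ge0 y) => r r0.
have h : 0 <= e^-1 * (e - r) ^+ 2 by rewrite mulr_ge0 ?sqr_ge0// invr_ge0 ltW.
have h2 : e^-1 * (e - r) ^+ 2 = e - 2 * r + e^-1 * r ^+ 2 by field; rewrite gt_eqF.
by rewrite h2 in h; lra.
Qed.

Let cw_wt (v : X -> R) x : cw x <= wt v x.
Proof. by rewrite -[leLHS]mulr1; apply: ler_wpM2l; [exact: le_trans ler01 (cw1 x)|exact: p1]. Qed.

Lemma linpos_lip x (s t : R) : `|lin x (pos s) 0 - lin x (pos t) 0| <= L * (cw x * `|s - t|).
Proof.
rewrite linB subrr; apply: lin_le_c => //; last by rewrite normr0 mulr_ge0// mulr_ge0// (le_trans ler01).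
apply: (le_trans (pos_lip s t)); apply: le_trans (k3 (normr_ge0 _)).
by rewrite ler_peMl//; lra.
Qed.

Section limit.
Variables (w : Hsp) (wl : X -> R).
Hypotheses (mwl : measurable_fun Om wl)
  (iE : ig (fun x => wt (fn w) x * (fn w x - wl x) ^+ 2)).

Lemma ig_linpos1 (u : Hsp) : ig (fun x => lin x (pos (fn u x)) 0).
Proof.
apply: (@ig_le _ _ _ leb Om mO _ (fun x => L * (wt (fn u) x * (1 + fn u x ^+ 2)))).
- by apply: m_lin => //; apply: cpt_meas => //; exact: fn_meas.
- exact: igZ.
apply: aeDW => x _; have := linpos_lip x (fn u x) 0.
have -> : lin x (pos 0) 0 = 0 by rewrite /lin pos_id//; ring.
rewrite !subr0 => h; apply: (le_trans h); apply: ler_wpM2l => //; apply: ler_pM => //.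
  exact: le_trans ler01 (cw1 x).
exact: abs_sqr1.
Qed.

Lemma ig_linpos_lim : ig (fun x => lin x (pos (wl x)) 0).
Proof.
have j1 := ig1 w; have j2 := igw (fn_L2 oOm bOm w).
apply: (@ig_le _ _ _ leb Om mO _ (fun x => L * (wt (fn w) x * (1 + fn w x ^+ 2) + (wt (fn w) x + wt (fn w) x * (fn w x - wl x) ^+ 2)))).
- by apply: m_lin => //; apply: cpt_meas.
- by apply: igZ => //; exact: (igD mO j1 (igD mO j2 iE)).
apply: aeDW => x _; have := linpos_lip x (wl x) 0.
have -> : lin x (pos 0) 0 = 0 by rewrite /lin pos_id//; ring.
rewrite !subr0 => h; apply: (le_trans h); apply: ler_wpM2l => //.
have h2 := abs_sqr1 (fn w x); have h1 := abs_sqr1 (fn w x - wl x).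
have h3 : `|wl x| <= `|fn w x| + `|fn w x - wl x|.
  have := ler_normB (fn w x) (fn w x - wl x).
  by have -> : fn w x - (fn w x - wl x) = wl x by ring.
have -> : wt (fn w) x * (1 + fn w x ^+ 2) + (wt (fn w) x + wt (fn w) x * (fn w x - wl x) ^+ 2) =
  wt (fn w) x * (1 + fn w x ^+ 2 + (1 + (fn w x - wl x) ^+ 2)) by ring.
apply: ler_pM => //; first exact: le_trans ler01 (cw1 x).
lra.
Qed.

Lemma linpos_cvg (phi : Hsp) (e B E : R) : 0 < e -> (forall x, `|fn phi x| <= 1) ->
  It (wt (fn w)) <= B -> It (fun x => wt (fn w) x * (fn w x - wl x) ^+ 2) <= E ->
  `|It (fun x => lin x (pos (fn w x)) 0 * fn phi x) - It (fun x => lin x (pos (wl x)) 0 * fn phi x)| <=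
  L * (e * B + e^-1 * E).
Proof.
move=> e0 phi1 hB hE; have j2 := igw (fn_L2 oOm bOm w).
have mul1 f : ig f -> ig (fun x => f x * fn phi x).
  move=> fi; apply: (@ig_le _ _ _ leb Om mO _ _ _ (ig_norm fi)).
    by apply: measurable_funM; [exact: ig_meas fi|exact: fn_meas].
  by apply: aeDW => x _; rewrite normrM ler_piMr.
have i1 := mul1 _ (ig_linpos1 w); have i2 := mul1 _ ig_linpos_lim.
rewrite -(ItB mO i1 i2); have j3 := igD mO (igZ mO e j2) (igZ mO e^-1 iE).
apply: (@le_trans _ _ (L * It (fun x => e * wt (fn w) x + e^-1 * (wt (fn w) x * (fn w x - wl x) ^+ 2)))); last first.
  apply: ler_wpM2l => //; rewrite (ItD mO (igZ mO e j2) (igZ mO e^-1 iE)) (ItZ mO _ j2) (ItZ mO _ iE).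
  by apply: lerD; rewrite ler_pM2l// invr_gt0.
rewrite -(ItZ mO _ j3); apply: (It_abs_le mO (igB mO i1 i2) (igZ mO L j3)); apply: aeDW => x _.
rewrite -mulrBl normrM; apply: (@le_trans _ _ (L * (cw x * `|fn w x - wl x|) * 1)).
  by apply: ler_pM => //; exact: linpos_lip.
rewrite mulr1; apply: ler_wpM2l => //.
have -> : e * wt (fn w) x + e^-1 * (wt (fn w) x * (fn w x - wl x) ^+ 2) =
  wt (fn w) x * (e + e^-1 * (fn w x - wl x) ^+ 2) by ring.
by apply: ler_pM => //; [exact: le_trans ler01 (cw1 x)|exact: abs_sqr].
Qed.

End limit.

(* Let [w] be the weak limit of [w_k = v_k / t_k] with [t_k = N (v_k)] unbounded.
   Testing and dividing by [t_k ln t_k] gives [(lam cp - cm) w+ = 0], while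
   [2 J - J' v] gives [int a (lam cp - cm) w_k+^2 = O(t_k^(d-1))], which beats the
   factor [ln t_k] in [J(v_k) / t_k^2]; hence [J(v_k) / t_k^2] tends to [1/2]. *)
Lemma cerami_bounded (G : Hsp -> Hsp) (Jm : R) :
  (forall v z, form (G v) z = form v z - It (fun x => psi x (fn v x) * fn z x)) ->
  exists M dd : R, 0 < dd /\ forall v, `|J v| <= Jm -> (1 + N v) * N (G v) < dd -> N v <= M.
Proof.
move=> hG; apply: contrapT => hn.
have /choice[v_ hv] : forall k : nat, exists v : Hsp, [/\ `|J v| <= Jm, (1 + N v) * N (G v) < 1 & k%:R < N v].
  move=> k; apply: contrapT => h; apply: hn; exists k%:R, 1; split=> // v h1 h2.
  by rewrite leNgt; apply/negP => h3; apply: h; exists v.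
pose t_ k := N (v_ k); have t0 k : 0 < t_ k by have [_ _ h] := hv k; apply: le_lt_trans h.
pose w_ k := (t_ k)^-1 *: v_ k.
have w1 k : N (w_ k) = 1.
  by rewrite (nrmZ Fsym Flin) ger0_norm ?invr_ge0 ?(ltW (t0 k))// mulVf// gt_eqF.
have vE k : t_ k *: w_ k = v_ k by rewrite scalerA mulfV ?scale1r// gt_eqF.
have [|s [wl [js Lwl hlim]]] := @weighted_limit _ _ _ oOm bOm _ _ _ ma a00 ha n0 _ _ _ _ _ cw1 d01' th0 nth2 C0 cM w_ 1.
  by move=> k; rewrite w1.
have mwl := L2_meas Lwl.
have [B B0 hB] := unit_bound.
have hB1 k : It (wt (fn (w_ k))) <= B by have [|h _] := hB (w_ k); [rewrite w1; lra|].
have hB2 k : It (fun x => wt (fn (w_ k)) x * fn (w_ k) x ^+ 2) <= B by have [|_ h] := hB (w_ k); [rewrite w1; lra|].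
have tlarge T : exists m, forall j, (m <= j)%N -> T <= t_ (s j).
  have [m hm] : exists m : nat, T <= m%:R.
    exists (Num.bound `|T|); apply: (le_trans (ler_norm T)); apply: ltW; exact: archi_boundP.
  exists m => j mj; have [_ _ h] := hv (s j); apply: (le_trans hm); apply: le_trans (ltW h).
  by rewrite ler_nat (leq_trans mj).
have LB0 : 0 <= L * B by rewrite mulr_ge0.
have d1 : d < 1 by case/andP: d01.
have NG k : N (G (v_ k)) <= 1.
  have [_ h _] := hv k; apply: le_trans (ltW h); by rewrite ler_peMl// lerDl.
have NGN k : N (G (v_ k)) * N (v_ k) <= 1.
  have [_ h _] := hv k; apply: le_trans (ltW h); by rewrite mulrC ler_wpM2r// lerDr.
have [m0 hm0] := hlim 1 ltr01; have [iE0 _] := hm0 m0 (leqnn m0).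
(* Against any cutoff the integral is a limit of quantities that [large_test] bounds by a constant
   over [ln t]; the total error is split into three parts [e / 3]. *)
have lin0 : aeD (fun x => lin x (pos (wl x)) 0 = 0).
  apply: (test_fundamental oOm (ig_linpos_lim mwl iE0)) => phi [tphi phi01].
  have [z [zE _]] := Hsp_ex (Hs_test oOm bOm tphi).
  have z1 x : `|fn z x| <= 1 by rewrite zE; have /andP[a b] := phi01 x; rewrite ger0_norm.
  apply/eqP; rewrite -normr_eq0 eq_le normr_ge0 andbT; apply/ler_addgt0Pr => e e0; rewrite add0r -zE.
  pose e1 := e / 3 / (L * B + 1); have LB1 : 0 < L * B + 1 by rewrite ltr_wpDl.
  have e10 : 0 < e1 by rewrite !divr_gt0.
  have L1 : 0 < L + 1 by rewrite ltr_wpDl.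
  pose E := e1 * (e / 3 / (L + 1)); have E0 : 0 < E by rewrite mulr_gt0// !divr_gt0.
  have [m1 hm1] := hlim _ E0.
  pose Q := (1 + 1) * N z + 4 * L * B; have Q0 : 0 <= Q.
    by apply: addr_ge0; [apply: mulr_ge0 => //; exact: addr_ge0|rewrite -mulrA mulr_ge0].
  have [m2 hm2] := tlarge (expR (3 * Q / e + 1)).
  pose j := maxn m1 m2; have [iE hE] := hm1 j (leq_maxl _ _); have hT := hm2 j (leq_maxr _ _).
  have tau : 3 * Q / e + 1 <= ln (t_ (s j)).
    by rewrite -(expRK (3 * Q / e + 1)) ler_ln ?posrE ?expR_gt0.
  have q0 : 0 <= 3 * Q / e by rewrite divr_ge0 ?mulr_ge0// ltW.
  have tau1 : 1 <= ln (t_ (s j)) by lra.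
  have f1 := linpos_cvg mwl iE e10 z1 (hB1 (s j)) hE.
  have f2 := large_test hG (w1 (s j)) tau1 (hB1 _) (hB2 _) z1; rewrite vE in f2.
  have f3 : L * (e1 * B + e1^-1 * E) <= e / 3 + e / 3.
    rewrite mulrDr; apply: lerD.
      rewrite mulrCA -ler_pdivlMl// /e1 invf_div mulrC mulrA divfK ?gt_eqF ?divr_gt0//.
      by rewrite lerDl.
    rewrite /E mulKf ?gt_eqF// mulrA ler_pdivrMr// mulrC ler_wpM2l ?divr_ge0 ?(ltW e0)//.
    by rewrite lerDl.
  have f4 : `|It (fun x => lin x (pos (fn (w_ (s j)) x)) 0 * fn z x)| <= e / 3.
    have tp : 0 < ln (t_ (s j)) := lt_le_trans ltr01 tau1.
    rewrite -(ler_pM2r tp); apply: (le_trans f2); apply: (@le_trans _ _ Q).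
      by rewrite lerD2r ler_wpM2r// lerD2r.
    apply: (@le_trans _ _ (e / 3 * (3 * Q / e))); last first.
      by rewrite ler_wpM2l ?divr_ge0 ?(ltW e0)//; lra.
    by apply: le_of_eq; field; rewrite gt_eqF.
  have := le_trans f1 f3; rewrite distrC => f5; have := lerD f5 f4.
  have -> : e / 3 + e / 3 + e / 3 = e by field.
  apply: le_trans; rewrite -[Y in `|Y| <= _](subrK (It (fun x => lin x (pos (fn (w_ (s j)) x)) 0 * fn z x))).
  exact: ler_normD.
(* As [cp] and [cm] have disjoint supports and [lam > 0], the coefficient [lam cp - cm] vanishes
   only where both do. *)
have aewl : aeD (fun x => 0 < cp x + cm x -> wl x <= 0).
  apply: aeD1 lin0 => x _ /eqP; rewrite /lin mulr0 addr0 mulf_eq0 expR_eq0/= -mulrBl mulf_eq0 => h hc.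
  rewrite leNgt; apply/negP => wp; move: h; rewrite (pos_id (ltW wp)) (gt_eqF wp) orbF.
  have /eqP := cpm x; rewrite mulf_eq0 => /orP[]/eqP h0; rewrite h0 in hc *.
    by rewrite mulr0 sub0r oppr_eq0 => /eqP h1; move: hc; rewrite h1 addr0 ltxx.
  by rewrite subr0 mulf_eq0 (gt_eqF lam0)/= => /eqP h1; move: hc; rewrite h1 addr0 ltxx.
have Jm0 : 0 <= Jm by have [h _ _] := hv 0%N; exact: le_trans h.
(* [Q] collects the terms proportional to [e1]: [Jm] from the energy, [2 Jm + 1 + 4 L B] from half
   of the gap, [4 L B] from the remainder. With [e1 Q = 1/32] and two further errors of [1/32], the
   term 1/2 of the energy would be at most 3/32. *)
pose Q := 3 * Jm + 1 + 8 * (L * B).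
have Q0 : 0 < Q by rewrite /Q; lra.
pose e1 := (32 * Q)^-1; have e10 : 0 < e1 by rewrite invr_gt0 mulr_gt0.
have [T hT] := log_growth d1 e10.
pose e2 := (32 * (L * B + 1))^-1; have LB1 : 0 < L * B + 1 by rewrite ltr_wpDl.
have e20 : 0 < e2 by rewrite invr_gt0 mulr_gt0.
have e2V : 0 < 1 + e2^-1 by rewrite addr_gt0// invr_gt0.
have L1 : 0 < L + 1 by rewrite ltr_wpDl.
pose E := (32 * (L + 1))^-1 / (1 + e2^-1); have E0 : 0 < E by rewrite divr_gt0// invr_gt0 mulr_gt0.
have [m1 hm1] := hlim _ E0; have [m2 hm2] := tlarge T.
pose j := maxn m1 m2; have [iE hE] := hm1 j (leq_maxl _ _).
have [tau1 tau2] := hT _ (hm2 j (leq_maxr _ _)).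
have := large_energy (w1 (s j)) tau1 (hB1 _) (hB2 _) mwl e20 aewl iE hE; rewrite vE.
have := large_gap hG tau1 (hB1 (s j)) (hB2 (s j)); rewrite vE.
have [hJ _ _] := hv (s j); have hN := NGN (s j); have := t0 (s j); move: tau1 tau2.
set A := It _; set t := t_ (s j) in hN *; set Jv := J _ in hJ * => tau1 tau2 tp.
have tg : 1 <= t by apply: (le_trans tau1); apply: ltW; exact: ln_sublinear.
have td : 1 <= t `^ d by rewrite -[leLHS](powRr0 t); apply: ler_powR => //; exact: ltW.
have tau0 : 0 <= ln t := le_trans ler01 tau1.
have ttau : ln t <= e1 * t by apply: le_trans tau2; rewrite ler_peMr.
have r1 : ln t / t <= e1 by rewrite ler_pdivrMr.
have tt : 0 < t ^+ 2 by rewrite exprn_gt0.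
have tV : (t ^+ 2)^-1 <= e1.
  apply: le_trans r1; rewrite expr2 invfM; apply: ler_pM => //; rewrite ?invr_ge0 ?(ltW tp)//.
  by rewrite (le_trans _ tau1)// invf_le1.
move=> hA hE'; have b1 : `|Jv / t ^+ 2| <= e1 * Jm.
  rewrite normrM (ger0_norm (_ : 0 <= (t ^+ 2)^-1)) ?invr_ge0 ?(ltW tt)// mulrC.
  by apply: ler_pM => //; rewrite invr_ge0 ltW.
have b2 : ln t * `|A| <= e1 * (4 * Jm + 2 + 8 * (L * B)).
  rewrite -(ler_pM2l tt) mulrCA; apply: (le_trans (ler_wpM2l tau0 hA)).
  have c1 : ln t * (2 * (2 * `|Jv| + N (G (v_ (s j))) * N (v_ (s j)))) <= e1 * t * (4 * Jm + 2).
    by apply: ler_pM => //; [rewrite mulr_ge0// addr_ge0 ?mulr_ge0|lra].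
  have c2 : e1 * t * (4 * Jm + 2) <= t ^+ 2 * (e1 * (4 * Jm + 2)).
    have -> : t ^+ 2 * (e1 * (4 * Jm + 2)) = t * (e1 * t * (4 * Jm + 2)) by ring.
    by rewrite ler_peMl// mulr_ge0 ?mulr_ge0 ?(ltW e10) ?(ltW tp)//; lra.
  have c3 : ln t * (8 * L * B * (t `^ d * t)) <= t ^+ 2 * (e1 * (8 * (L * B))).
    have -> : ln t * (8 * L * B * (t `^ d * t)) = (8 * (L * B) * t) * (ln t * t `^ d) by ring.
    have -> : t ^+ 2 * (e1 * (8 * (L * B))) = (8 * (L * B) * t) * (e1 * t) by ring.
    by apply: ler_wpM2l => //; rewrite mulr_ge0 ?(ltW tp)// mulr_ge0.
  rewrite mulrDr; apply: (le_trans (lerD (le_trans c1 c2) c3)).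
  by rewrite -mulrDr -mulrDr.
have b3 : L * (e2 * B + (1 + e2^-1) * E + ln t / t * (4 * B)) <= 32^-1 + 32^-1 + e1 * (4 * (L * B)).
  have c1 : L * (e2 * B) <= 32^-1.
    rewrite mulrCA /e2 invfM -mulrA ger_pMr ?invr_gt0//.
    by rewrite mulrC ler_pdivrMr// mul1r lerDl.
  have c2 : L * ((1 + e2^-1) * E) <= 32^-1.
    rewrite /E [(1 + _) * _]mulrC divfK ?gt_eqF// invfM mulrCA ger_pMr ?invr_gt0//.
    by rewrite ler_pdivrMr// mul1r lerDl.
  have c3 : L * (ln t / t * (4 * B)) <= e1 * (4 * (L * B)).
    have -> : L * (ln t / t * (4 * B)) = ln t / t * (4 * (L * B)) by ring.
    by apply: ler_wpM2r => //; rewrite mulr_ge0.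
  by rewrite !mulrDr; apply: lerD => //; exact: lerD.
have b4 : `|ln t * A| = ln t * `|A| by rewrite normrM (ger0_norm tau0).
have := le_trans hE' b3; rewrite -b4 in b2.
have e1Q : e1 * (3 * Jm + 1 + 8 * (L * B)) = 32^-1.
  by rewrite -/Q /e1 invfM -mulrA mulVf ?mulr1// gt_eqF.
move: b1 b2 e1Q; rewrite ![e1 * (_ + _)]mulrDr.
rewrite !mulr1; rewrite [e1 * (4 * Jm)]mulrCA [e1 * (8 * _)]mulrCA [e1 * (3 * _)]mulrCA [e1 * (4 * _)]mulrCA.
move: (Jv / _) (ln t * A) (e1 * Jm) (e1 * (L * B)) => y1 y2 y3 y4; rewrite !ler_norml.
by move=> /andP[h1 h2] /andP[h3 h4] h5 /andP[h6 h7]; lra.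
Qed.

Lemma energy_lower (B : R) (v : Hsp) : It (wt (fn v)) <= B ->
  It (fun x => wt (fn v) x * fn v x ^+ 2) <= B -> 2^-1 * N v ^+ 2 - lam * (L * (2 * B)) <= J v.
Proof.
move=> h1 h2; rewrite /energy -sqN lerD2l lerN2.
have i := igZ mO (lam * L) (ig1 v).
apply: (@le_trans _ _ (lam * L * It (fun x => wt (fn v) x * (1 + fn v x ^+ 2)))); last first.
  rewrite -mulrA ler_pM2l//; apply: ler_wpM2l => //; rewrite It1; lra.
rewrite -(ItZ mO _ (ig1 v)); apply: (It_le mO (igPsi v) i); apply: aeDW => x _.
by rewrite -[wt _ x * _]mulrA; exact: Psi_le.
Qed.

Let ig_cw : ig cw.
Proof.
have := igw (fn_L2 oOm bOm (0 : Hsp)); congr ig; apply/funext => x.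
by have -> : wt (fn (0 : Hsp)) x = cw x * p (fn (0 : Hsp) x) by []; rewrite fn0 normr0 addr0 powR1 mulr1.
Qed.

(** Where [cp > 0] the coefficient [cm] vanishes, so some cutoff [z] has a positive integral of
    [lin x 1 0 * z^2]. On its ray the energy is a positive multiple of [- t^2 ln t] up to terms of
    order [t^2]. *)
Lemma energy_negative : exists e : Hsp, J e < - 4^-1.
Proof.
pose A := Om `&` [set x | 0 < cp x].
have mA : measurable A.
  have := mcp mO (measurable_itv `]0, +oo[); congr measurable; apply/seteqP.
  by split => x /= []; rewrite in_itv/= andbT.
have iw : ig (fun x => lin x 1 0).
  apply: (@ig_le _ _ _ leb Om mO _ (fun x => L * cw x)); [exact: m_lin|exact: igZ|].
  apply: aeDW => x _; rewrite -[cw x]mulr1; apply: lin_le_c => //; rewrite ?normr0 ?normr1; by have := D1; lra.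
have iwA : ig (fun x => lin x 1 0 * chf A x).
  apply: (@ig_le _ _ _ leb Om mO _ _ _ (ig_norm iw)).
    by apply: measurable_funM; [exact: ig_meas iw|exact: meas_ind].
  apply: aeDW => x _; rewrite normrM ler_piMr//.
  by have /andP[h1 h2] := ind01 A x; rewrite ger0_norm.
have wAE x : lin x 1 0 * chf A x = coef x * (lam * cp x) * chf A x.
  rewrite chfE; have [|_] := boolP (x \in A); last by rewrite !mulr0.
  rewrite inE => -[_ /= cpx]; have /eqP := cpm x; rewrite mulf_eq0 (gt_eqF cpx)/= => /eqP cm00.
  by rewrite /lin cm00; ring.
have wA0 x : 0 <= lin x 1 0 * chf A x.
  rewrite wAE; apply: mulr_ge0; last by case/andP: (ind01 A x).
  by apply: mulr_ge0 => //; apply: mulr_ge0 => //; exact: ltW.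
have IA : 0 < It (fun x => lin x 1 0 * chf A x).
  rewrite lt_def; apply/andP; split; last first.
    by apply: (It_ge0 mO); [exact: ig_meas iwA|exact: aeDW].
  apply/negP => /eqP I0; have := It_eq0 mO iwA (aeDW _ (fun x _ => wA0 x)) I0.
  move=> [S [mS S0 hS]]; have : (leb A <= leb S)%E.
    apply: le_measure; rewrite ?inE//; move=> x [Ox cpx]; apply: hS => /= /(_ Ox).
    rewrite wAE chfE mem_set//= mulr1 => /eqP; rewrite !mulf_eq0 expR_eq0 (gt_eqF lam0)/= => h.
    by move: cpx; rewrite /= (eqP h) ltxx.
  rewrite S0; apply/negP; rewrite -ltNge; move: cp_pos; congr (_ < leb _)%E.
have [phi [tphi phi01] hphi] := test_positive oOm iw mA IA.
have [z [zE _]] := Hsp_ex (Hs_test oOm bOm tphi).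
set kap := It _ in hphi; set B := It (wt (fn z)).
have B0 : 0 <= B by apply: Rintegral_ge0 => x _; exact: wt0.
(* With [ln t = tau] the bracket in the bound [t^2 / 2 (N z^2 + 8 L B - ln t kap)] equals
   [- (kap + 1)]. *)
pose tau := 1 + (N z ^+ 2 + 8 * (L * B) + 1) / kap.
have num0 : 0 <= N z ^+ 2 + 8 * (L * B) + 1.
  have LB : 0 <= L * B by exact: mulr_ge0.
  by have := sqr_ge0 (N z); move: LB; move: (L * B) (N z ^+ 2) => y1 y2 h1 h2; lra.
have q0 : 0 <= (N z ^+ 2 + 8 * (L * B) + 1) / kap by rewrite divr_ge0// ltW.
pose t := expR tau; have tE : ln t = tau by rewrite expRK.
have t0 : 0 < t by exact: expR_gt0.
have t1 : 1 <= ln t by rewrite tE /tau lerDl.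
have taut : ln t <= t by apply: ltW; exact: ln_sublinear.
have tg : 1 <= t := le_trans t1 taut.
have tt : 1 <= t ^+ 2 by rewrite expr2 -[leLHS]mulr1; apply: ler_pM.
exists (t *: z).
have iphi : ig (fun x => lin x 1 0 * phi x ^+ 2).
  apply: (@ig_le _ _ _ leb Om mO _ _ _ (ig_norm iw)).
    by apply: measurable_funM; [exact: ig_meas iw|apply: measurable_funX; exact: test_meas tphi].
  apply: aeDW => x _; rewrite normrM ler_piMr//.
  by have /andP[h1 h2] := phi01 x; rewrite ger0_norm ?sqr_ge0// expr_le1.
have iz := igw (fn_L2 oOm bOm z).
have j1 := igZ mO (2^-1 * (t ^+ 2 * ln t)) iphi; have j2 := igZ mO (4 * L * t ^+ 2) iz.
have lower : 2^-1 * (t ^+ 2 * ln t) * kap - 4 * L * t ^+ 2 * B <= It (fun x => Psi x (fn (t *: z) x)).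
  rewrite -(ItZ mO _ iphi) -(ItZ mO _ iz) -(ItB mO j1 j2).
  apply: (It_le mO (igB mO j1 j2) (igPsi _)); apply: aeDW => x _.
  rewrite fnZ; have := Psi_large x (fn z x) t1; rewrite zE; have /andP[s0 s1] := phi01 x.
  rewrite (pos_id s0); have -> : lin x (phi x ^+ 2) 0 = lin x 1 0 * phi x ^+ 2 by rewrite /lin; ring.
  have r4 : rem t (phi x) <= 4.
    rewrite /rem (pos_id s0) (ger0_norm s0).
    have c1 : phi x ^+ 2 <= 1 by rewrite expr_le1.
    have c2 : ln t / t <= 1 by rewrite ler_pdivrMr// mul1r.
    have c3 : ln t / t * (1 + phi x) <= 1 * 2.
      by apply: ler_pM => //; [rewrite divr_ge0 ?(ltW t0)// (le_trans ler01)|rewrite addr_ge0|lra].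
    by move: (ln t / t * _) (phi x ^+ 2) c1 c3 => y1 y2 c1 c3; lra.
  have wE : wt phi x = cw x * p (phi x) by [].
  have c4 : L * (cp x + cm x) * (t ^+ 2 * (p (phi x) * rem t (phi x))) <= 4 * L * t ^+ 2 * wt phi x.
    have -> : 4 * L * t ^+ 2 * wt phi x = L * cw x * (t ^+ 2 * (p (phi x) * 4)) by rewrite wE; ring.
    have e0 : 0 <= rem t (phi x) by exact: rem_ge0.
    apply: ler_pM => //; first by rewrite mulr_ge0// addr_ge0.
    - by rewrite mulr_ge0 ?sqr_ge0// mulr_ge0 ?powR_ge0.
    - exact: ler_wpM2l.
    - by apply: ler_wpM2l; [exact: sqr_ge0|apply: ler_wpM2l => //; exact: powR_ge0].
  move: c4; move: (L * _ * _) (4 * L * t ^+ 2 * _) (2^-1 * _ * _) (Psi _ _) => y1 y2 y3 y4 c4.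
  by rewrite ler_norml => /andP[c5 c6]; lra.
rewrite /energy; have -> : form (t *: z) (t *: z) = t ^+ 2 * N z ^+ 2.
  by rewrite -sqN (nrmZ Fsym Flin) exprMn real_normK ?num_real.
apply: (@le_lt_trans _ _ (2^-1 * (t ^+ 2 * N z ^+ 2) - (2^-1 * (t ^+ 2 * ln t) * kap - 4 * L * t ^+ 2 * B))).
  by rewrite lerD2l lerN2.
have -> : 2^-1 * (t ^+ 2 * N z ^+ 2) - (2^-1 * (t ^+ 2 * ln t) * kap - 4 * L * t ^+ 2 * B) =
   t ^+ 2 * (2^-1 * (N z ^+ 2 + 8 * (L * B) - ln t * kap)) by field.
have -> : ln t * kap = kap + (N z ^+ 2 + 8 * (L * B) + 1).
  by rewrite tE /tau mulrDl mul1r divfK ?gt_eqF.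
have -> : 2^-1 * (N z ^+ 2 + 8 * (L * B) - (kap + (N z ^+ 2 + 8 * (L * B) + 1))) = - (2^-1 * (kap + 1)).
  by move: (N z ^+ 2) (L * B) => y1 y2; field.
rewrite mulrN ltrN2; apply: (@lt_le_trans _ _ (2^-1 * (kap + 1))); first lra.
by rewrite ler_peMl// mulr_ge0// addr_ge0// ltW.
Qed.

(** * Existence of two critical points *)

Section critical_points.
Variables (G : Hsp -> Hsp) (K : R).
Hypotheses (K1 : 1 <= K)
  (hG : forall v z, form (G v) z = form v z - It (fun x => psi x (fn v x) * fn z x))
  (gL : forall v w, N (G v - G w) <= K * ((1 + N v) + (1 + N w)) ^+ 2 * N (v - w))
  (JT : forall v w, `|J (v + w) - J v - form (G v) w| <= K * ((1 + N v) + (1 + N w)) ^+ 2 * N w ^+ 2).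

Lemma limit_point (v_ : nat -> Hsp) (M : R) : (forall k, N (v_ k) <= M) ->
  (forall k, N (G (v_ k)) < k.+1%:R^-1) -> exists (s : nat -> nat) (v : Hsp),
  [/\ critical v, (fun j => N (v_ (s j))) @ \oo --> N v & (fun j => J (v_ (s j))) @ \oo --> J v].
Proof.
move=> hM hk; have c0 : (fun k => N (G (v_ k))) @ \oo --> 0.
  apply: (squeeze_cvgr _ (cvg_cst 0) (@cvg_harmonic R)).
  by apply: nearW => k; rewrite Nge0 ltW.
have [s [v [c1 c2]]] := palais_smale oOm bOm ma a00 ha n0 cw1 d01' th0 nth2 C0 cM L0 mpsi psi_lip psi0_le hG hM c0.
exists s, v; split.
- have c3 : (fun j => N (G (v_ (s j)) - G v)) @ \oo --> 0 := cvgN_g Fsym Flin Fpos gL c1.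
  have {}c3 := c3 eventually_filter.
  have NG0 : N (G v) = 0.
    apply/eqP; rewrite eq_le Nge0 andbT.
    have h : (fun j => N (G (v_ (s j)) - G v) + N (G (v_ (s j)))) @ \oo --> (0 + 0 : R) by exact: cvgD c3 c2.
    rewrite addr0 in h; apply: (ler_cvg_to (cvg_cst (N (G v))) h).
    apply: nearW => j; rewrite (nrmBC Fsym Flin).
    have := nrmD Fsym Flin Fpos (G v - G (v_ (s j))) (G (v_ (s j))); by rewrite subrK.
  move=> z; apply/eqP; rewrite -subr_eq0 -hG -normr_eq0 eq_le normr_ge0 andbT.
  by apply: (le_trans (B_CS Fsym Flin Fpos _ _)); rewrite NG0 mul0r.
- by have h := cvgN_nrm Fsym Flin Fpos c1; exact: (h eventually_filter).
- by have h := cvgN_J Fsym Flin Fpos JT c1; exact: (h eventually_filter).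
Qed.

(** The smallness of [lam] gives [J >= 1/2 - 1/4] on the ring and [J >= - 1/4] in the ball. The
    inner limit has [J <= 0], hence lies in the open well; the outer limit lies outside it. Equality
    almost everywhere would, by the two equations, give [N (v2 - v1) = 0], hence equal norms and
    energies. *)
Lemma two_critical (B : R) : (forall w : Hsp, N w <= 2 -> It (wt (fn w)) <= B /\
    It (fun x => wt (fn w) x * fn w x ^+ 2) <= B) ->
  lam * (L * (2 * B)) <= 4^-1 ->
  exists v1 v2, [/\ critical v1, critical v2 & ~ aeD (fun x => fn v1 x = fn v2 x)].
Proof.
move=> hB lamB; have b0 : 0 < 4^-1 :> R by rewrite invr_gt0.
have J00 : J (0 : Hsp) = 0.
  rewrite /energy (B0l Flin) mulr0 sub0r; apply/eqP; rewrite oppr_eq0; apply/eqP.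
  by rewrite -[RHS](@It0 _ _ R leb Om); apply: eq_It => x _; rewrite fn0 Psi0.
have Jring (v : Hsp) : 1 <= N v <= 2 -> 4^-1 <= J v.
  move=> /andP[h1 h2]; have [e1 e2] := hB v h2; have := energy_lower e1 e2.
  have : 1 <= N v ^+ 2 by rewrite expr2 -[leLHS]mulr1; apply: ler_pM.
  by move: (lam * _) lamB (N v ^+ 2) => y1 h3 y2; lra.
have Jball (v : Hsp) : N v < 1 -> - 4^-1 <= J v.
  move=> h1; have h2 : N v <= 2 by rewrite (le_trans (ltW h1))// ler1n.
  have [e1 e2] := hB v h2; have := energy_lower e1 e2; have := sqr_ge0 (N v).
  by move: (lam * _) lamB (N v ^+ 2) => y1 h3 y2; lra.
have [e Je] := energy_negative.
have pk k : 0 < k.+1%:R^-1 :> R by rewrite invr_gt0.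
have lek (v : Hsp) (c : R) : (1 + N v) * N (G v) < c -> N (G v) < c.
  by apply: le_lt_trans; rewrite ler_peMl// lerDl.
have /choice[v_ hv] : forall k : nat, exists v : Hsp, [/\ N v < 1 /\ J v < 4^-1, J v <= 0 & (1 + N v) * N (G v) < k.+1%:R^-1].
  by move=> k; have [v hv] := inner_cerami Fsym Flin Fpos K1 gL JT b0 J00 Jring Jball (pk k); exists v.
have [k|k|s1 [v1 [cv1 cN1 cJ1]]] := @limit_point v_ 1.
- by have [[h _] _ _] := hv k; exact: ltW.
- by have [_ _ h] := hv k; exact: lek.
have N1 : N v1 <= 1.
  apply: (cvg_upper cN1) => j.
  by have [[h _] _ _] := hv (s1 j); exact: ltW.
have J1 : J v1 <= 0.
  by apply: (cvg_upper cJ1) => j; have [_ h _] := hv (s1 j).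
have [Jm hJm] := outer_cerami Fsym Flin Fpos K1 gL JT b0 J00 Jring Jball Je.
have [M [dd [dd0 hM]]] := cerami_bounded (Num.max `|Jm| 4^-1) hG.
have /choice[u_ hu] : forall k : nat, exists v : Hsp, [/\ ~ (N v < 1 /\ J v < 4^-1), N v <= M & N (G v) < k.+1%:R^-1].
  move=> k; have m0 : 0 < Num.min dd k.+1%:R^-1 by rewrite lt_min dd0 pk.
  have [v [h1 /andP[h2 h3] h4]] := hJm _ m0; exists v; split => //; last first.
    by apply: lek; apply: (lt_le_trans h4); rewrite ge_min lexx orbT.
  apply: hM; last by apply: (lt_le_trans h4); rewrite ge_min lexx.
  rewrite ler_norml; apply/andP; split.
    by apply: le_trans h2; rewrite lerN2 le_max lexx orbT.
  by apply: (le_trans h3); rewrite le_max ler_norm.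
have [k|k|s2 [v2 [cv2 cN2 cJ2]]] := @limit_point u_ M.
- by have [_ h _] := hu k.
- by have [_ _ h] := hu k.
have out2 : ~ (N v2 < 1 /\ J v2 < 4^-1).
  move=> [h1 h2]; have e1 : \forall j \near \oo, N (u_ (s2 j)) < 1 by exact: (cvgr_lt _ cN2 _ h1).
  have e2 : \forall j \near \oo, J (u_ (s2 j)) < 4^-1 by exact: (cvgr_lt _ cJ2 _ h2).
  have [j [h3 h4]] : exists j, N (u_ (s2 j)) < 1 /\ J (u_ (s2 j)) < 4^-1.
    have [j _ hj] := filterI e1 e2; exists j; exact: hj (leqnn j).
  by have [h _ _] := hu (s2 j); apply: h.
exists v1, v2; split => // eqv; apply: out2.
have D0 : N (v2 - v1) = 0.
  apply/eqP; rewrite -sqrf_eq0 sqN (BBl Flin) cv1 cv2.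
  rewrite -(ItB mO (igpsi v2 _) (igpsi v1 _)); apply/eqP.
  rewrite -[RHS](@It0 _ _ R leb Om); apply/esym/(It_eq mO (ig0 _ _)).
    by apply: measurable_funB; exact: ig_meas (igpsi _ _).
  by apply: aeD1 eqv => x Ox ->; rewrite subrr.
have Neq : N v2 = N v1.
  apply/eqP; rewrite -subr_eq0 -normr_eq0 eq_le normr_ge0 andbT -D0.
  exact: nrm_absB Fsym Flin Fpos _ _.
have Jeq : J v2 = J v1.
  have vE : v1 + (v2 - v1) = v2 by rewrite addrC subrK.
  have := JT v1 (v2 - v1); rewrite vE D0 expr0n mulr0 normr_le0 => /eqP.
  have -> : form (G v1) (v2 - v1) = 0.
    apply/eqP; rewrite -normr_eq0 eq_le normr_ge0 andbT.
    by apply: (le_trans (B_CS Fsym Flin Fpos _ _)); rewrite D0 mulr0.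
  by rewrite subr0 => /eqP; rewrite subr_eq0 => /eqP.
rewrite Neq Jeq; split; last exact: le_lt_trans J1 b0.
rewrite lt_neqAle N1 andbT; apply/eqP => e1.
have := Jring v1; rewrite e1 lexx ler1n => /(_ isT) h.
by have := le_trans h J1; rewrite leNgt b0.
Qed.

End critical_points.

Lemma critical_above (v : Hsp) : critical v -> exists M : R, aeD (fun x => fn v x <= M).
Proof.
by move=> hv; have := critical_bounded_above oOm bOm ma a00 ha n0 cw1 d01' g0 th0 nth2 C0 cM L0 mpsi psi_lip psi0_le hv.
Qed.

(** For [s <= 0] one has [-1 <= Gf s <= 0] and [ybar s <= 1]: in [- psi] the term with [cm] is
    nonpositive and the others carry the factor [lam]. *)
Let psi_neg x (s k : R) : 0 <= k ->
  - psi x s * Num.max (- s - k) 0 <= lam * L * (cw x * Num.max (- s - k) 0).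
Proof.
move=> k0; have [h|h] := leP (- s - k) 0; first by rewrite !mulr0.
have s0 : s <= 0 by lra.
have /andP[g1 g2] := Gf_neg s0; have y1 := ybar_neg s0; have y0 := ltW (ybar_gt0 s).
rewrite [leRHS]mulrA; apply: ler_wpM2r; first exact: ltW.
have -> : - psi x s = coef x * (cm x * Gf s + lam * (cp x * - (Gf s + U0 x * ybar s))) by rewrite /psi /lin; ring.
have h1 : - (Gf s + U0 x * ybar s) <= 1 + M0.
  rewrite opprD; apply: lerD; first by rewrite lerNl.
  apply: (le_trans (ler_norm _)); rewrite normrN normrM (ger0_norm y0) -[leRHS]mulr1.
  by apply: ler_pM.
have h2 : cm x * Gf s <= 0 by rewrite mulr_ge0_le0.
have m1 : 0 <= 1 + M0 by exact: addr_ge0.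
apply: (@le_trans _ _ (coef x * (lam * (cw x * (1 + M0))))).
  apply: ler_wpM2l => //; rewrite -[leRHS]add0r; apply: lerD => //.
  rewrite ler_pM2l//; apply: (le_trans (ler_wpM2l (cp0 x) h1)); apply: ler_wpM2r => //.
  by have := cm0 x; rewrite /cw; lra.
apply: (@le_trans _ _ (a1 * (lam * (cw x * (1 + M0))))).
  apply: ler_wpM2r; last by case/andP: (ha x).
  by apply: mulr_ge0; [exact: ltW|apply: mulr_ge0 => //; exact: le_trans ler01 (cw1 x)].
have -> : lam * L * cw x = a1 * (lam * (cw x * (1 + M0))) * (4 * D) by rewrite /L; ring.
rewrite ler_peMr//; last by have := D1; lra.
apply: mulr_ge0; first exact: ltW.
by apply: mulr_ge0; [exact: ltW|apply: mulr_ge0 => //; exact: le_trans ler01 (cw1 x)].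
Qed.

Local Notation zero := (fun _ : X => 0 : R).

Let L2_zero : L2 zero.
Proof. by have := fn_L2 oOm bOm (0 : Hsp); congr L2; apply/funext => x; rewrite fn0. Qed.

Let wt_zero x : wt zero x = cw x.
Proof. by have -> : wt zero x = cw x * p (0 : R) by []; rewrite normr0 addr0 powR1 mulr1. Qed.

(** De Giorgi iteration for [- v] from level 0 to level 1/2. The start is small because the energy
    bound has the factor [lam^2], and not because the level is high. The reference function of the
    weight is 0, so all constants are independent of [v]. *)
Lemma critical_below (S C1 : R) (v : Hsp) : 0 <= S -> 0 < C1 ->
  (forall (A : set X) (eta : Hsp), measurable A ->
    ig (fun x => wt zero x * \1_A x * fn eta x ^+ 2) /\
    It (fun x => wt zero x * \1_A x * fn eta x ^+ 2) <= S * vol Om A `^ g * N eta ^+ 2) ->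
  (forall eta : Hsp, ig (fun x => cw x * fn eta x ^+ 2) /\ It (fun x => cw x * fn eta x ^+ 2) <= C1 * N eta ^+ 2) ->
  4 * S * (4 * (C1 * (lam * L) ^+ 2)) * It cw `^ g <= 4 `^ (- g^-1) ->
  critical v -> aeD (fun x => - 2^-1 <= fn v x).
Proof.
move=> S0 C10 hS hC small cv; have fvN x : fn (- v) x = - fn v x by rewrite -scaleN1r fnZ mulN1r.
have h2 : 0 < 2^-1 :> R by rewrite invr_gt0.
have pj (j : nat) : 0 <= 2^-1 * (1 - 2 ^- j) :> R.
  by rewrite mulr_ge0 ?(ltW h2)// subr_ge0 invf_le1 ?exprn_gt0// exprn_ege1// ler1n.
have /choice[w_ hw] : forall j : nat, exists w : Hsp, exists chi : X -> R,
  [/\ forall x, fn w x = Num.max (fn (- v) x - 2^-1 * (1 - 2 ^- j)) 0, forall x, gr w x = chi x *: gr (- v) x,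
      measurable_fun Om chi & forall x, 0 <= chi x <= 1].
  by move=> j; exact: level_ex.
have mu : measurable_fun Om (fn (- v)) by exact: fn_meas.
have mA k : measurable (above Om (fn (- v)) k) by exact: measurable_above.
have c1 x : 0 <= cw x := le_trans ler01 (cw1 x).
have igA (k : R) : ig (fun x => wt zero x * \1_(above Om (fn (- v)) k) x).
  apply: (@ig_le _ _ _ leb Om mO _ cw) => //.
    apply: measurable_funM; first by exact: ig_meas (igw L2_zero).
    by apply: measurable_funTS; exact: measurable_indic.
  apply: aeDW => x _; rewrite wt_zero normrM ger0_norm// ler_piMr//.
  by rewrite indicE; case: (x \in _); rewrite ?normr1 ?normr0.
have massle : mass Om cw d zero (fn (- v)) 0 <= It cw.
  apply: (It_le mO (igA 0) ig_cw); by apply: aeDW => x _; rewrite wt_zero ler_piMr.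
have T0 : 0 <= 4 * (C1 * (lam * L) ^+ 2) by rewrite mulr_ge0// mulr_ge0 ?sqr_ge0// ltW.
have key : aeD (fun x => fn (- v) x <= 0 + 2^-1).
  apply: (level_iteration oOm bOm cw1 d01' g0 C0 cM mu L2_zero S0 T0 h2 hS (w_ := w_)).
  - by move=> j x; have [chi [e _ _ _]] := hw j; rewrite e add0r.
  - move=> j; have [chi [e1 e2 mchi e3]] := hw j; rewrite add0r; set k := 2^-1 * (1 - 2 ^- j) in e1 *.
    have k0 : 0 <= k by exact: pj.
    have t1 := level_test oOm bOm ma a00 ha e2 e3.
    have t2 : form (- v) (w_ j) = - It (fun x => psi x (fn v x) * fn (w_ j) x) by rewrite (BNl Flin) cv.
    have [i1 b1] := hC (w_ j); have i2 := igA k.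
    (* Young's inequality [y s <= s^2 / (2 C1) + C1 y^2 / 2] with [y = lam L]. Absorbing half of
       [N^2] leaves [2 q mass], which is [T H^2 mass] for [T = 4 C1 (lam L)^2] and [H = 1/2]. *)
    pose q := C1 / 2 * (lam * L) ^+ 2.
    have j1 := igD mO (igZ mO (2 * C1)^-1 i1) (igZ mO q i2).
    have t3 : - It (fun x => psi x (fn v x) * fn (w_ j) x) <=
      It (fun x => (2 * C1)^-1 * (cw x * fn (w_ j) x ^+ 2) + q * (wt zero x * \1_(above Om (fn (- v)) k) x)).
      rewrite -(ItN mO (igpsi v (w_ j))); have i0 := igN (igpsi v (w_ j)).
      apply: (It_le mO i0 j1); apply: aeDW => x Ox.
      have := @psi_neg x (fn v x) k k0; rewrite -fvN -e1 mulNr => h; apply: (le_trans h).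
      rewrite wt_zero; have [ax|nax] := boolP (x \in above Om (fn (- v)) k); last first.
        have -> : fn (w_ j) x = 0.
          rewrite e1; apply/max_idPr; rewrite subr_le0 leNgt; apply/negP => hk.
          by move/negP : nax; apply; rewrite inE; split.
        rewrite indicE (negbTE nax) expr0n !mulr0 addr0//.
      rewrite indicE ax mulr1; move: (fn (w_ j) x) => s.
      have -> : lam * L * (cw x * s) = cw x * (lam * L * s) by ring.
      have -> : (2 * C1)^-1 * (cw x * s ^+ 2) + q * cw x = cw x * ((2 * C1)^-1 * s ^+ 2 + q) by ring.
      apply: ler_wpM2l => //; rewrite /q; move: (lam * L) => y.
      have : 0 <= (2 * C1)^-1 * (s - C1 * y) ^+ 2.
        by rewrite mulr_ge0 ?sqr_ge0// invr_ge0 mulr_ge0// ltW.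
      have -> : (2 * C1)^-1 * (s - C1 * y) ^+ 2 = (2 * C1)^-1 * s ^+ 2 + C1 / 2 * y ^+ 2 - y * s.
        by field; rewrite gt_eqF.
      by rewrite subr_ge0.
    rewrite (ItD mO (igZ mO _ i1) (igZ mO q i2)) (ItZ mO _ i1) (ItZ mO q i2) in t3.
    have t4 : (2 * C1)^-1 * It (fun x => cw x * fn (w_ j) x ^+ 2) <= 2^-1 * N (w_ j) ^+ 2.
      rewrite invfM -mulrA ler_pM2l// mulrC ler_pdivrMr// mulrC; exact: b1.
    have -> : 4 * (C1 * (lam * L) ^+ 2) * 2^-1 ^+ 2 * mass Om cw d zero (fn (- v)) k =
      2 * (q * mass Om cw d zero (fn (- v)) k) by rewrite /q; field.
    rewrite t2 in t1; have t5 := le_trans t1 t3; move: t4 t5; rewrite -/(mass Om cw d zero (fn (- v)) k).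
    move: (_^-1 * It _) (q * _) (N (w_ j) ^+ 2) => y1 y2 y3; lra.
  - apply: le_trans small; apply: ler_wpM2l; first by rewrite mulr_ge0// mulr_ge0.
    apply: ge0_ler_powR; rewrite ?nnegrE ?(ltW g0)//.
      exact: mass_ge0 cw1 d01' _ _ _.
    exact: le_trans (mass_ge0 Om cw1 d01' _ _ _) massle.
by apply: aeD1 key => x _; rewrite fvN add0r lerNl.
Qed.

End parameter.

Theorem two_critical_points : exists2 Lam : R, 0 < Lam & forall lam, 0 < lam -> lam < Lam ->
  exists v1 v2, [/\ critical lam v1, critical lam v2, ~ aeD (fun x => fn v1 x = fn v2 x) &
    exists M : R, aeD (fun x => - 2^-1 <= fn v1 x <= M) /\ aeD (fun x => - 2^-1 <= fn v2 x <= M)].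
Proof.
have [B B0 hB] := unit_bound.
have z2 : L2 (fun _ : X => 0 : R).
  by have := fn_L2 oOm bOm (0 : Hsp); congr L2; apply/funext => x; rewrite fn0.
have [S S0 hS] := wt_level oOm bOm ma a00 ha n0 th0 nth2 C0 cM z2.
have [C1 C11 hC1] := wtb; have C10 : 0 < C1 := lt_le_trans ltr01 C11.
have hC (eta : Hsp) : ig (fun x => cw x * fn eta x ^+ 2) /\ It (fun x => cw x * fn eta x ^+ 2) <= C1 * N eta ^+ 2.
  have := hC1 0 eta; have -> : N (0 : Hsp) = 0 by rewrite (nrm0 Flin).
  rewrite addr0 expr1n mulr1.
  have -> : (fun x => wt (fn (0 : Hsp)) x * fn eta x ^+ 2) = (fun x => cw x * fn eta x ^+ 2) => //.
  apply/funext => x; congr (_ * _).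
  by have -> : wt (fn (0 : Hsp)) x = cw x * p (fn (0 : Hsp) x) by []; rewrite fn0 normr0 addr0 powR1 mulr1.
pose Q := 4 * S * (4 * (C1 * L ^+ 2)) * It cw `^ g.
have Q0 : 0 <= Q.
  apply: mulr_ge0; last exact: powR_ge0.
  by apply: mulr_ge0; [exact: mulr_ge0|apply: mulr_ge0 => //; apply: mulr_ge0; [exact: ltW|exact: sqr_ge0]].
have LB0 : 0 <= L * (2 * B) by rewrite mulr_ge0// mulr_ge0.
(* The bound 1 serves the growth estimates and gives [lam^2 Q <= lam Q]; the second bound gives the
   energy barrier, the third the start of the iteration in [critical_below]. *)
pose Lam := Num.min 1 (Num.min (4^-1 / (L * (2 * B) + 1)) (4 `^ (- g^-1) / (Q + 1))).
exists Lam => [|lam lam0]; first by rewrite !lt_min ltr01 !divr_gt0 ?ltr_wpDl ?powR_gt0.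
rewrite !lt_min => /and3P[/ltW lam1 l2 l3].
have [G [K [K1 hG gL JT]]] := functional oOm bOm ma a00 ha n0 cw1 d01' th0 nth2 C0 cM L0 (mpsi lam) (mPsi lam)
  (psi_lip lam0 lam1) (Psi_tay lam0 lam1) (psi0_le lam0 lam1) (Psi0 lam).
have [|v1 [v2 [c1 c2 ne]]] := two_critical lam0 lam1 K1 hG gL JT hB.
  apply: (@le_trans _ _ (4^-1 / (L * (2 * B) + 1) * (L * (2 * B)))).
    by apply: ler_wpM2r => //; exact: ltW.
  by rewrite mulrAC ler_pdivrMr ?ltr_wpDl// ler_pM2l ?invr_gt0// lerDl.
have small : 4 * S * (4 * (C1 * (lam * L) ^+ 2)) * It cw `^ g <= 4 `^ (- g^-1).
  have -> : 4 * S * (4 * (C1 * (lam * L) ^+ 2)) * It cw `^ g = lam * (lam * Q) by rewrite /Q; ring.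
  apply: (@le_trans _ _ (1 * (lam * Q))).
    by apply: ler_wpM2r => //; rewrite mulr_ge0// ltW.
  rewrite mul1r; apply: (@le_trans _ _ (4 `^ (- g^-1) / (Q + 1) * Q)).
    by apply: ler_wpM2r => //; exact: ltW.
  by rewrite mulrAC ler_pdivrMr ?ltr_wpDl// ler_pM2l ?powR_gt0// lerDl.
have [M1 hM1] := critical_above lam0 lam1 c1; have [M2 hM2] := critical_above lam0 lam1 c2.
have b1 := critical_below lam0 lam1 S0 C10 hS hC small c1.
have b2 := critical_below lam0 lam1 S0 C10 hS hC small c2.
exists v1, v2; split=> //; exists (Num.max M1 M2); split.
- by apply: aeD2 b1 hM1 => x _ -> /= h; rewrite le_max h.
- by apply: aeD2 b2 hM2 => x _ -> /= h; rewrite le_max h orbT.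
Qed.
End two_solutions.

(** * Back to the original problem *)

Section back_transformation.
Context {R : realType} {n : nat}.
Local Notation X := 'rV[R]_n.
Local Notation leb := (@lebesgue_rV R n).
Variable Om : set X.
Hypotheses (oOm : open Om) (bOm : bounded_set Om).
Let mO : measurable Om := mOm oOm.
Local Notation It f := (Rintegral leb Om f).
Local Notation ig := (ig leb Om).
Local Notation aeD := (aeD leb Om).
Local Notation Hs := (Hs Om).

Definition bdd (u : X -> R) := exists K : R, aeD (fun x => `|u x| <= K).

Lemma ig_bd (f b : X -> R) : ig f -> measurable_fun Om b -> bdd b -> ig (fun x => f x * b x).
Proof.
move=> fi mb [K bK]; apply: (@ig_le _ _ _ leb Om mO _ _ _ (igZ mO K (ig_norm fi))).
  by apply: measurable_funM => //; exact: ig_meas fi.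
by apply: aeD1 bK => x _ h; rewrite normrM mulrC; apply: ler_wpM2r.
Qed.

Lemma bddD (u v : X -> R) : bdd u -> bdd v -> bdd (fun x => u x + v x).
Proof.
move=> [K hu] [K' hv]; exists (K + K'); apply: aeD2 hu hv => x _ h h'.
by apply: (le_trans (ler_normD _ _)); exact: lerD.
Qed.

Lemma bddM (u v : X -> R) : bdd u -> bdd v -> bdd (fun x => u x * v x).
Proof.
move=> [K hu] [K' hv]; exists (K * K'); apply: aeD2 hu hv => x _ h h'.
by rewrite normrM; apply: ler_pM.
Qed.

Lemma bdd_pos (u : X -> R) : bdd u -> exists2 K : R, 0 < K & aeD (fun x => `|u x| <= K).
Proof.
move=> [K hu]; exists (Num.max K 0 + 1); first by rewrite ltr_wpDl// le_max lexx orbT.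
by apply: aeD1 hu => x _ h; apply: (le_trans h); rewrite ler_wpDr// le_max lexx.
Qed.

Lemma HsM_bdd v Dv w Dw : Hs v Dv -> Hs w Dw -> bdd v -> bdd w ->
  Hs (fun x => v x * w x) (fun x => v x *: Dw x + w x *: Dv x).
Proof.
move=> hv hw [K bv] [K' bw]; apply: (@HsM _ _ _ oOm bOm _ _ _ _ (Num.max K K')) => //.
  by apply: aeD1 bv => x _ h; rewrite le_max h.
by apply: aeD1 bw => x _ h; rewrite le_max h orbT.
Qed.

(** The exponential is shifted by 1 so as to vanish at 0, as composition within H^1_0 requires. *)
Lemma Hs_exp y Dy : Hs y Dy -> bdd y ->
  Hs (fun x => expR (- y x) - 1) (fun x => - expR (- y x) *: Dy x).
Proof.
move=> hy /bdd_pos[K K0 hK].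
have cg : continuous (fun s : R => - expR (- s)).
  have ce : continuous (fun s : R => expR (- s)).
    by move=> s; apply: continuous_comp; [exact: opp_continuous|exact: continuous_expR].
  by move=> s; apply: (continuous_comp (ce s)); exact: opp_continuous.
have my := L2_meas (Hs_L2 hy).
apply: (@Hs_comp_bounded _ _ _ oOm bOm y Dy (- K) K (fun s => expR (- s) - 1) (fun s => - expR (- s)) hy).
- by rewrite oppr_le0 (ltW K0).
- by rewrite gtrN.
- by apply: aeD1 hK => x _; rewrite ler_norml.
- move=> s _; have d1 : is_derive s 1 (expR \o (fun s : R => - s)) (expR (- s) * - (1 : R)).
    by apply: is_derive1_comp.
  by apply: (is_derive_eq (is_deriveB d1 (is_derive_cst (1:R) s 1))); rewrite mulrN1 subr0.
- exact: cg.
- by rewrite oppr0 expR0 subrr.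
- apply: measurable_funB => //; apply: measurableT_comp => //; exact: measurableT_comp.
Qed.

(** The factor [(2^-1 + |2^-1 + s|)^-1] is [(1 + s)^-1] for [s >= - 1/2], continued continuously to
    the whole line. *)
Lemma Hs_ln v Dv (M : R) : Hs v Dv -> aeD (fun x => - 2^-1 <= v x <= M) ->
  Hs (fun x => ln (1 + v x)) (fun x => (2^-1 + `|2^-1 + v x|)^-1 *: Dv x).
Proof.
move=> hv hM; have h2 : 0 < 2^-1 :> R by rewrite invr_gt0.
have den (s : R) : 0 < 2^-1 + `|2^-1 + s| by rewrite ltr_wpDr.
apply: (@Hs_comp_bounded _ _ _ oOm bOm v Dv (- 2^-1) (Num.max M 0) (fun s => ln (1 + s)) (fun s => (2^-1 + `|2^-1 + s|)^-1) hv).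
- by rewrite oppr_le0 (ltW h2) le_max lexx orbT.
- by rewrite lt_max oppr_lt0 h2 orbT.
- by apply: aeD1 hM => x _ /andP[h1 h3]; rewrite h1 le_max h3.
- move=> s /andP[h1 _]; have s1 : 0 < 1 + s by lra.
  have -> : (2^-1 + `|2^-1 + s|)^-1 = (1 + s)^-1 by congr (_^-1); rewrite ger0_norm; lra.
  have dl := is_derive1_ln s1.
  have ds : is_derive s (1 : R) (fun s : R => 1 + s) (1 : R)
    by apply: (is_derive_eq (is_deriveD (is_derive_cst (1 : R) s (1 : R)) (is_derive_id s (1 : R)))); rewrite add0r.
  have d1 : is_derive s (1 : R) (@ln R \o (fun s : R => 1 + s)) ((1 + s)^-1 * (1 : R)).
    exact: is_derive1_comp.
  by apply: (is_derive_eq d1); rewrite mulr1.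
- move=> s; apply: cvgV; first by rewrite gt_eqF.
  by apply: cvgD; [exact: cvg_cst|apply: cvg_norm; apply: cvgD; [exact: cvg_cst|exact: cvg_id]].
- by rewrite addr0 ln1.
- apply: measurableT_comp; first exact: measurable_ln.
  by apply: measurable_funD => //; exact: L2_meas (Hs_L2 hv).
Qed.

Lemma ig_source (c h u eta : X -> R) (Du : X -> X) (mu : R) : ig c -> ig h -> Hs u Du -> bdd u ->
  measurable_fun Om eta -> bdd eta ->
  ig (fun x => (c x * u x + mu * dot (Du x) (Du x) + h x) * eta x).
Proof.
move=> ic ih hu bu me be; have vD := Hs_vL2 hu.
apply: ig_bd => //; apply: (igD mO _ ih); apply: (igD mO).
  by apply: ig_bd => //; exact: L2_meas (Hs_L2 hu).
exact: (igZ mO mu (ig_dot oOm vD vD)).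
Qed.

Variables (cp cm h U0 : X -> R) (DU : X -> X) (mu lam M0 M : R) (v : Hsp Om).
Hypotheses (icp : ig cp) (icm : ig cm) (ih : ig h) (mu0 : 0 < mu)
  (HU : Hs U0 DU) (U0M : forall x, `|U0 x| <= M0)
  (eqU : forall psi Dpsi, Hs psi Dpsi -> bdd psi ->
    It (fun x => dot (DU x) (Dpsi x)) = It (fun x => (- (cm x * U0 x) + dot (DU x) (DU x) + mu * h x) * psi x))
  (cv : critical cp cm U0 lam v) (hv : aeD (fun x => - 2^-1 <= fn v x <= M)).

(* The critical point equation is tested with [eta exp (- ln (1 + v) - 2 U0)]. *)
Lemma back_transformation : exists Du,
  let u x := mu^-1 * (U0 x + ln (1 + fn v x)) in
  [/\ Hs u Du, bdd u & forall eta Deta, Hs eta Deta -> bdd eta ->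
    It (fun x => dot (Du x) (Deta x)) =
    It (fun x => ((lam * cp x - cm x) * u x + mu * dot (Du x) (Du x) + h x) * eta x)].
Proof.
have h2 : 0 < 2^-1 :> R by rewrite invr_gt0.
pose z x := ln (1 + fn v x); pose k x := (2^-1 + `|2^-1 + fn v x|)^-1.
have kE : aeD (fun x => 0 < 1 + fn v x /\ k x = (1 + fn v x)^-1).
  apply: aeD1 hv => x _ /andP[h1 _]; split; first lra.
  by rewrite /k; congr (_^-1); rewrite ger0_norm; lra.
pose Dz x := k x *: gr v x.
have Hz : Hs z Dz by exact: Hs_ln (HspP oOm bOm v) hv.
have bz : bdd z.
  exists (Num.max (ln 2) (ln (1 + Num.max M 0))); apply: aeD2 hv kE => x _ /andP[h1 h3] [s0 _].
  have m0 : 0 < 1 + Num.max M 0 by rewrite ltr_pwDl// le_max lexx orbT.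
  rewrite ler_norml lerNl; apply/andP; split; rewrite le_max.
    apply/orP; left; rewrite -lnV ?posrE// ler_ln ?posrE ?invr_gt0//.
    by rewrite -[leRHS]invrK lef_pV2 ?posrE//; lra.
  apply/orP; right; rewrite ler_ln ?posrE// lerD2l le_max h3//.
have bU : bdd U0 by exists M0; exact: aeDW.
have mz := L2_meas (Hs_L2 Hz); have mU := L2_meas (Hs_L2 HU).
exists (fun x => mu^-1 *: (DU x + Dz x)) => u.
have HU1 : Hs (fun x => U0 x + z x) (fun x => DU x + Dz x).
  have := Hs_lin oOm bOm 1 HU Hz; congr Hs; apply/funext => x; first by rewrite mul1r.
  by rewrite scale1r.
have Hu : Hs u (fun x => mu^-1 *: (DU x + Dz x)).
  have := Hs_lin oOm bOm mu^-1 HU1 (Hs_test oOm bOm (test0 Om)); congr Hs; apply/funext => x.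
    by rewrite addr0.
  rewrite (_ : grad (fun=> 0) x = 0) ?addr0//; apply/rowP => i.
  by rewrite !mxE partial_cst.
have bUz := bddD bU bz.
split=> //.
  have [K hK] := bUz; exists (mu^-1 * K); apply: aeD1 hK => x _ hx.
  by rewrite normrM gtr0_norm ?invr_gt0// ler_pM2l ?invr_gt0.
move=> eta De He be; have me := L2_meas (Hs_L2 He).
pose y x := 2 * U0 x + z x; pose Dy x := 2 *: DU x + Dz x.
have Hy : Hs y Dy := Hs_lin oOm bOm 2 HU Hz.
have b2 : bdd (fun=> 2 : R) by exists `|2 : R|; exact: aeDW.
have by' : bdd y by exact: bddD (bddM b2 bU) bz.
have Ht := Hs_exp Hy by'.
have bt : bdd (fun x => expR (- y x) - 1).
  have [K hK] := by'; exists (expR K + 1); apply: aeD1 hK => x _; rewrite ler_norml => /andP[h1 h3].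
  apply: (le_trans (ler_normB _ _)); rewrite normr1 lerD2r ger0_norm ?expR_ge0// ler_expR; lra.
(* The product [eta exp (- y)] is written [eta (exp (- y) - 1) + eta], because the exponential
   itself is not in H^1_0 while both summands are. *)
have [Z [ZE DZE]] := Hsp_ex (Hs_lin oOm bOm 1 (HsM_bdd He Ht be bt) He).
have vDz := Hs_vL2 Hz; have vDU := Hs_vL2 HU; have vDe := Hs_vL2 He.
have i1 : ig (fun x => dot (Dz x) (De x)) := ig_dot oOm vDz vDe.
have i2 : ig (fun x => dot (Dz x) (Dz x) * eta x) := ig_bd (ig_dot oOm vDz vDz) me be.
have i3 : ig (fun x => dot (Dz x) (DU x) * eta x) := ig_bd (ig_dot oOm vDz vDU) me be.
have i4 : ig (fun x => cp x * ((U0 x + z x) * eta x)).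
  by apply: ig_bd => //; [apply: measurable_funM => //; exact: measurable_funD|exact: bddM].
have i5 : ig (fun x => cm x * (z x * eta x)).
  by apply: ig_bd => //; [exact: measurable_funM|exact: bddM].
have i6 : ig (fun x => dot (DU x) (De x)) := ig_dot oOm vDU vDe.
have i7 : ig (fun x => cm x * (U0 x * eta x)).
  by apply: ig_bd => //; [exact: measurable_funM|exact: bddM].
have i8 : ig (fun x => dot (DU x) (DU x) * eta x) := ig_bd (ig_dot oOm vDU vDU) me be.
have i9 : ig (fun x => h x * eta x) := ig_bd ih me be.
(* [Bq] comes from differentiating the exponential; added to the quadratic term of the equation of
   [U0], it completes [|DU + Dz|^2]. *)
pose Bq x := dot (Dz x) (Dz x) * eta x + 2 * (dot (Dz x) (DU x) * eta x).
have iB : ig Bq := igD mO i2 (igZ mO 2 i3).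
pose F1 x := dot (Dz x) (De x) - Bq x; have iF1 : ig F1 := igB mO i1 iB.
pose F2 x := lam * (cp x * ((U0 x + z x) * eta x)) - cm x * (z x * eta x).
have iF2 : ig F2 := igB mO (igZ mO lam i4) i5.
pose F4 x := - (cm x * (U0 x * eta x)) + dot (DU x) (DU x) * eta x + mu * (h x * eta x).
have iF4 : ig F4 := igD mO (igD mO (igN i7) i8) (igZ mO mu i9).
have F34 : It (fun x => dot (DU x) (De x)) = It F4.
  by rewrite (eqU He be); apply: eq_It => x _; rewrite /F4; ring.
have coefE x : 0 < 1 + fn v x -> coef U0 x * expR (- y x) = (1 + fn v x)^-1.
  by move=> s0; rewrite /coef -expRD /y opprD addrA subrr add0r expRN /z lnK.
have F12 : It F1 = It F2.
  have mZ := fn_meas oOm bOm Z.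
  transitivity (form (coef U0) v Z).
    apply/esym/(It_eq mO _ (ig_meas iF1)).
      apply: (ig_form oOm bOm (a0 := expR (- (2 * M0))) (a1 := expR (2 * M0))).
      - by apply: measurableT_comp => //; exact: measurable_funM.
      - exact: expR_gt0.
      - by move=> x; have := U0M x; rewrite !ler_expR ler_norml => /andP[c1 c2]; apply/andP; split; lra.
    apply: aeD1 kE => x _ [s0 kx]; have := coefE x s0; rewrite -kx => ck.
    rewrite DZE /F1 /Bq /Dy /Dz !dotE.
    move: ck; move: (k x) (coef U0 x) (expR (- y x)) => k1 c1 e1 ck.
    move: (dot (gr v x) (De x)) (dot (gr v x) (DU x)) (dot (gr v x) (gr v x)) => q1 q2 q3.
    transitivity ((c1 * e1) * (q1 - eta x * (2 * q2 + k1 * q3))); first by ring.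
    by rewrite ck; ring.
  rewrite cv; apply/esym/(It_eq mO iF2).
    by apply: measurable_funM => //; apply: mpsi => //; [exact: ig_meas icp|exact: ig_meas icm|exact: fn_meas].
  apply: aeD2 hv kE => x _ /andP[v1 _] [s0 _]; have := coefE x s0.
  (* The cut is inactive: [1/e <= 1/2 <= 1 + v]. *)
  have eh : expR (-1) <= 1 + fn v x.
    apply: (@le_trans _ _ 2^-1); last lra.
    rewrite expRN lef_pV2 ?posrE ?expR_gt0//; have := expR_ge1Dx (1 : R); lra.
  rewrite ZE /psi /lin /Gf (ybar_id eh) /F2 /z -/(z x); move: s0.
  move: (1 + fn v x) (coef U0 x) (expR (- y x)) (z x) => s c1 e1 z1 s0 ck.
  transitivity ((c1 * e1 * s) * (lam * (cp x * ((U0 x + z1) * eta x)) - cm x * (z1 * eta x))).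
    by rewrite ck mulVf ?gt_eqF// mul1r.
  by ring.
have iu1 := igD mO (igD mO i6 iF1) iB; have iu2 := igD mO (igD mO iF4 iF2) iB.
transitivity (mu^-1 * (It (fun x => dot (DU x) (De x)) + It F1 + It Bq)).
  rewrite -(ItD mO i6 iF1) -(ItD mO (igD mO i6 iF1) iB) -(ItZ mO _ iu1); apply: eq_It => x _.
  by rewrite /F1 !dotE; ring.
rewrite F34 F12 -(ItD mO iF4 iF2) -(ItD mO (igD mO iF4 iF2) iB) -(ItZ mO _ iu2); apply: eq_It => x _.
rewrite /F4 /F2 /Bq /u -/(z x); move: (DU x) (Dz x) => v1 v2.
rewrite !dotE (dotC v1 v2); field; by rewrite gt_eqF.
Qed.

End back_transformation.

Lemma Lq_ig {R : realType} {n : nat} (Om : set 'rV[R]_n) (q : R) (u : 'rV[R]_n -> R) :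
  open Om -> bounded_set Om -> 1 <= q -> Lp Om q%:E u -> ig (lebesgue_rV n) Om u.
Proof.
move=> oO bO q1 /(Lp_ig (mOm oO) _ (lt_le_trans ltr01 q1))[mu iu].
have i1 : ig (lebesgue_rV n) Om (fun=> 1 : R).
  by apply: (ig_bounded oO bO (M := 1)) => // x _; rewrite normr1.
apply: (ig_le (mOm oO) mu (igD (mOm oO) i1 iu)); apply: aeDW => x _.
have [u1|u1] := leP (`|u x|) 1; first by rewrite (le_trans u1)// lerDl powR_ge0.
rewrite (le_trans _ (_ : `|u x| `^ q <= _)) ?lerDr//.
rewrite -[leLHS]powRr1//; apply: ler_powR => //; exact: ltW.
Qed.

Theorem theorem1p3 (R : realType) (N : nat) (N_ge2 : (2 <= N)%N)
    (Om : set 'rV[R]_N)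
    (Om_domain : bounded_domain Om) (Om_lip : lipschitz_boundary Om)
    (q : R) (q_gt : N%:R / 2 < q)
    (cp cm h : 'rV[R]_N -> R)
    (cp_Lq : Lp Om q%:E cp) (cm_Lq : Lp Om q%:E cm) (h_Lq : Lp Om q%:E h)
    (mu : R) (mu_gt0 : 0 < mu)
    (cp_ge0 : {ae lebesgue_rV N, forall x, Om x -> 0 <= cp x})
    (cp_neq0 : (0 < lebesgue_rV N [set x | Om x /\ (0 < cp x)%R])%E)
    (cm_ge0 : {ae lebesgue_rV N, forall x, Om x -> 0 <= cm x})
    (cp_cm : {ae lebesgue_rV N, forall x, Om x -> cp x * cm x = 0}) :
  let P (lambda : R) := solution Om (fun x => lambda * cp x - cm x) mu h in
  (exists u, P 0 u) ->
  exists2 Lambda : R, 0 < Lambda &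
    forall lambda : R, 0 < lambda -> lambda < Lambda ->
      exists u1 u2, [/\ P lambda u1, P lambda u2 &
        ~ {ae lebesgue_rV N, forall x, Om x -> u1 x = u2 x}].
Proof.
move=> P [u0 [Du0 [H0 u0oo eq0]]]; have [oO _ _ bO] := Om_domain.
have mO := mOm oO; have N0 : (0 < N)%N := ltn_trans (ltn0Sn 0) N_ge2.
have q1 : 1 <= q.
  apply: le_trans (ltW q_gt); rewrite ler_pdivlMr// mul1r (ler_nat R 2 N) //.
have q0 : 0 < q := lt_le_trans ltr01 q1.
have icp := Lq_ig oO bO q1 cp_Lq; have icm := Lq_ig oO bO q1 cm_Lq; have ih := Lq_ig oO bO q1 h_Lq.
have mcp := ig_meas icp; have mcm := ig_meas icm.
have Hu0 := (H10_Hs oO bO _ _).1 H0.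
have [mu0 [K hK]] := (Lpoo mO u0).1 u0oo.
(* Representatives for which the sign conditions and [bp bm = 0] hold at every point; they agree
   almost everywhere with [cp] and [cm]. *)
pose bp x := Num.max (cp x - cm x) 0; pose bm x := Num.max (cm x - cp x) 0.
have mbp : measurable_fun Om bp by apply: measurable_maxr => //; exact: measurable_funB.
have mbm : measurable_fun Om bm by apply: measurable_maxr => //; exact: measurable_funB.
have bp0 x : 0 <= bp x by rewrite le_max lexx orbT.
have bm0 x : 0 <= bm x by rewrite le_max lexx orbT.
have bpm x : bp x * bm x = 0.
  rewrite /bp /bm; have [c|c] := leP (cp x) (cm x).
    by rewrite [Num.max (cp x - cm x) 0](max_idPr _) ?mul0r// subr_le0.
  by rewrite [Num.max (cm x - cp x) 0](max_idPr _) ?mulr0// subr_le0 ltW.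
have bE : aeD (lebesgue_rV N) Om (fun x => bp x = cp x /\ bm x = cm x).
  have a1 : aeD (lebesgue_rV N) Om (fun x => 0 <= cp x /\ 0 <= cm x).
    by apply: aeD2 cp_ge0 cm_ge0 => x _.
  apply: aeD2 a1 cp_cm => x _ [c1 c2] /eqP; rewrite mulf_eq0 /bp /bm => /orP[]/eqP ->.
    by rewrite sub0r subr0 (max_idPr _) ?oppr_le0// (max_idPl _).
  by rewrite subr0 sub0r (max_idPl _)// (max_idPr _) ?oppr_le0.
pose M0 := mu * Num.max K 0; have M00 : 0 <= M0 by rewrite mulr_ge0 ?(ltW mu_gt0)// le_max lexx orbT.
(* [mu u0] is clamped to be bounded at every point, which changes it only on a null set. *)
pose U0 x := Num.max (- M0) (Num.min M0 (mu * u0 x)).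
have U0M x : `|U0 x| <= M0.
  rewrite ler_norml le_max lexx/= ge_max ge_min lexx/= andbT; lra.
have mU0 : measurable_fun Om U0.
  by apply: measurable_maxr => //; apply: measurable_minr => //; exact: measurable_funM.
have U0E : aeD (lebesgue_rV N) Om (fun x => U0 x = mu * u0 x).
  apply: aeD1 hK => x _ hx; have : `|mu * u0 x| <= M0.
    by rewrite normrM (gtr0_norm mu_gt0) ler_pM2l// le_max hx.
  by rewrite ler_norml /U0 => /andP[h1 h2]; rewrite (min_idPr h2) (max_idPr h1).
have HU : Hs Om U0 (fun x => mu *: Du0 x).
  have h1 := Hs_lin oO bO mu Hu0 (Hs_test oO bO (test0 Om)).
  have m1 := Hs_vL2 h1; apply: (Hs_ae oO bO h1 mU0).
  - by move=> i; have := L2_meas (Hs_vL2 Hu0 i) => mi; under eq_fun do rewrite mxE; exact: measurable_funM.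
  - by apply: aeD1 U0E => x _ ->; rewrite addr0.
  - apply: aeDW => x _; rewrite (_ : grad (fun=> 0) x = 0) ?addr0//; apply/rowP => i.
    by rewrite !mxE partial_cst.
(* The positivity set of [cp] lies in that of [bp] up to the null set where [bE] fails. *)
have pos' : (0 < lebesgue_rV N [set x | Om x /\ (0 < bp x)%R])%E.
  rewrite lt_def measure_ge0 andbT; apply/eqP => z0.
  have [S [mS S0 hS]] := bE.
  have mA : measurable (Om `&` [set x | (0 < bp x)%R]).
    have := mbp mO _ (measurable_itv `]0, +oo[); congr measurable; apply/seteqP.
    by split => x /= []; rewrite in_itv/= andbT.
  have mB : measurable (Om `&` [set x | (0 < cp x)%R]).
    have := mcp mO _ (measurable_itv `]0, +oo[); congr measurable; apply/seteqP.
    by split => x /= []; rewrite in_itv/= andbT.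
  have : (lebesgue_rV N (Om `&` [set x | (0 < cp x)%R]) <= lebesgue_rV N ((Om `&` [set x | (0 < bp x)%R]) `|` S))%E.
    apply: le_measure; rewrite ?inE//; first exact: measurableU.
    move=> x [Ox cx]; have [Sx|nS] := pselect (S x); [by right|left; split => //=].
    have [] : bp x = cp x /\ bm x = cm x by apply: contrapT => nb; apply: nS; apply: hS => /= /(_ Ox).
    by move=> -> _.
  move=> /le_trans/(_ (measureU2 _ mA mS)).
  have -> : (lebesgue_rV N (Om `&` [set x | (0 < bp x)%R]) + lebesgue_rV N S = 0)%E.
    by rewrite -[RHS]adde0; congr (_ + _)%E.
  by apply/negP; rewrite -ltNge.
have mcw : measurable_fun Om (cw bp bm).
  by apply: measurable_funD => //; exact: measurable_funD.
(* With [m] the maximum of 1, [|cp|] and [|cm|], the weight is at most [1 + 2 |cp| + 2 |cm| <= 5 m],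
   and [m^q] is at most the sum of the three powers. *)
have cwq : ig (lebesgue_rV N) Om (fun x => `|cw bp bm x| `^ q).
  have [_ ip] := (Lp_ig mO cp q0).1 cp_Lq; have [_ im] := (Lp_ig mO cm q0).1 cm_Lq.
  have i1 : ig (lebesgue_rV N) Om (fun=> 1 : R).
    by apply: (ig_bounded oO bO (M := 1)) => // x _; rewrite normr1.
  apply: (ig_le mO _ (igZ mO (5 `^ q) (igD mO (igD mO i1 ip) im))).
    by apply: (measurableT_comp (measurable_powR q)); exact: measurableT_comp.
  apply: aeDW => x _; rewrite ger0_norm ?powR_ge0//.
  pose m := Num.max 1 (Num.max `|cp x| `|cm x|).
  have m1 : 1 <= m by rewrite le_max lexx.
  have mp : `|cp x| <= m by rewrite !le_max lexx orbT.
  have mm : `|cm x| <= m by rewrite !le_max lexx !orbT.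
  have cw0 : 0 <= cw bp bm x by rewrite !addr_ge0.
  have cwm : cw bp bm x <= 5 * m.
    have c1 : bp x <= `|cp x| + `|cm x|.
      by rewrite ge_max (addr_ge0 (normr_ge0 _) (normr_ge0 _)) andbT (le_trans (ler_norm _))// ler_normB.
    have c2 : bm x <= `|cp x| + `|cm x|.
      by rewrite ge_max (addr_ge0 (normr_ge0 _) (normr_ge0 _)) andbT (le_trans (ler_norm _))// distrC ler_normB.
    by rewrite /cw; lra.
  rewrite (ger0_norm cw0); apply: (@le_trans _ _ ((5 * m) `^ q)).
    by apply: ge0_ler_powR; rewrite ?nnegrE ?(ltW q0)// mulr_ge0// (le_trans ler01).
  rewrite powRM ?(le_trans ler01 m1)//; apply: ler_wpM2l; first exact: powR_ge0.
  have e0 := powR_ge0 `|cp x| q; have e1 := powR_ge0 `|cm x| q.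
  rewrite /m; case: (leP 1 _) => _; last by rewrite powR1 -addrA lerDl addr_ge0.
  by case: (leP `|cp x| _) => _; lra.
have [d [g [th [C [d01 g0 [th0 nth2] C0 cM]]]]] := weight_morrey oO bO N_ge2 q_gt mcw cwq.
have cM' v A : L2 (lebesgue_rV N) Om v -> measurable A ->
    morrey Om th (C * (1 + Rintegral (lebesgue_rV N) Om (fun x => v x ^+ 2)) * vol Om A `^ g)
     (fun x => cw bp bm x * (1 + `|v x|) `^ d * \1_A x).
  move=> Lv mA; have := cM v A Lv mA; congr morrey; apply/funext => x.
  by rewrite ger0_norm// !addr_ge0.
have [Lam Lam0 hLam] := two_critical_points oO bO N0 mbp mbm mU0 bp0 bm0 bpm U0M pos' d01 g0 th0 nth2 C0 cM'.
exists Lam => // lam lam0 lamL; have [v1 [v2 [c1 c2 ne [M [b1 b2]]]]] := hLam lam lam0 lamL.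
have ibp : ig (lebesgue_rV N) Om bp by apply: (ig_ae mO mbp icp); apply: aeD1 bE => x _ [].
have ibm : ig (lebesgue_rV N) Om bm by apply: (ig_ae mO mbm icm); apply: aeD1 bE => x _ [].
(* The equation of [u0] multiplied by [mu]: since [U0 = mu u0], the gradient term becomes [|D U0|^2]
   with coefficient 1. *)
have eqU psi Dpsi : Hs Om psi Dpsi -> bdd Om psi ->
    Rintegral (lebesgue_rV N) Om (fun x => dot (mu *: Du0 x) (Dpsi x)) =
    Rintegral (lebesgue_rV N) Om (fun x => (- (bm x * U0 x) + dot (mu *: Du0 x) (mu *: Du0 x) + mu * h x) * psi x).
  move=> hpsi bpsi; have mpsi := L2_meas (Hs_L2 hpsi).
  have e0 := eq0 psi Dpsi ((H10_Hs oO bO _ _).2 hpsi) ((Lpoo mO psi).2 (conj mpsi bpsi)).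
  have i0 : ig (lebesgue_rV N) Om (fun x => 0 * cp x - cm x) := igB mO (igZ mO 0 icp) icm.
  have i1 := ig_source oO mu i0 ih Hu0 (ex_intro _ K hK) mpsi bpsi.
  have i2 := ig_source oO 1 (igN ibm) (igZ mO mu ih) HU (ex_intro _ M0 (aeDW _ (fun x _ => U0M x))) mpsi bpsi.
  have i3 := ig_dot oO (Hs_vL2 Hu0) (Hs_vL2 hpsi).
  transitivity (mu * Rintegral (lebesgue_rV N) Om (fun x => dot (Du0 x) (Dpsi x))).
    by rewrite -(ItZ mO _ i3); apply: eq_It => x _; rewrite dotZl.
  rewrite e0 -(ItZ mO _ i1); apply: (It_eq mO (igZ mO mu i1)).
    have := ig_meas i2; congr measurable_fun; apply/funext => x; rewrite /=; ring.
  by apply: aeD2 bE U0E => x _ [_ ->] ->; rewrite !dotE; ring.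
have sol (v : Hsp Om) : critical bp bm U0 lam v -> aeD (lebesgue_rV N) Om (fun x => - 2^-1 <= fn v x <= M) ->
    exists2 u, P lam u & aeD (lebesgue_rV N) Om (fun x => u x = mu^-1 * (U0 x + ln (1 + fn v x))).
  move=> cv bv; have [Du [Hu bu eqv]] := back_transformation oO bO ibp ibm ih mu_gt0 HU U0M eqU cv bv.
  exists (fun x => mu^-1 * (U0 x + ln (1 + fn v x))); last exact: aeDW.
  exists Du; split.
  - exact/H10_Hs.
  - apply/(Lpoo mO); split; [exact: L2_meas (Hs_L2 Hu)|exact: bu].
  move=> w Dw /(H10_Hs oO bO)hw /(Lpoo mO)[mw bw].
  rewrite (eqv w Dw hw bw).
  have i1 := ig_source oO mu (igB mO (igZ mO lam ibp) ibm) ih Hu bu mw bw.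
  have i2 := ig_source oO mu (igB mO (igZ mO lam icp) icm) ih Hu bu mw bw.
  by apply: (It_eq mO i1 (ig_meas i2)); apply: aeD1 bE => x _ [-> ->].
have [u1 P1 e1] := sol v1 c1 b1; have [u2 P2 e2] := sol v2 c2 b2.
(* The passage from v to u is injective, because [1 + v] is positive and the logarithm is injective
   there. *)
exists u1, u2; split => // e12; apply: ne.
have a1 : aeD (lebesgue_rV N) Om (fun x => ln (1 + fn v1 x) = ln (1 + fn v2 x)).
  have a2 : aeD (lebesgue_rV N) Om (fun x => u1 x = mu^-1 * (U0 x + ln (1 + fn v2 x))).
    by apply: aeD2 e12 e2 => x _ ->.
  apply: aeD2 e1 a2 => x _ -> /(mulfI _); rewrite invr_eq0 gt_eqF// => /(_ isT).
  by move/addrI.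
have a3 : aeD (lebesgue_rV N) Om (fun x => 0 < 1 + fn v1 x /\ 0 < 1 + fn v2 x).
  by apply: aeD2 b1 b2 => x _ /andP[h1 _] /andP[h2 _]; split; lra.
apply: aeD2 a3 a1 => x _ [p1 p2] /(ln_inj p1 p2); exact: addrI.
Qed.
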